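(* Let $(A,\mathfrak m)$ be a two-dimensional regular local ring with infinite residue class field and let $M\neq (0)$ be a finitely generated torsion-free $A$-module. Suppose that $\mathcal R(M)$ is a Buchsbaum ring and $\widetilde M=\overline M$. Then, for every integrally closed $\mathfrak m$-primary ideal $I$ of $A$, $\mathcal R(IM)$ is a Buchsbaum ring and $\widetilde{IM}=\overline{IM}$. In particular, $\mathcal R(\mathfrak m^{\ell}M)$ is a Buchsbaum ring for every $\ell\geq 0$.
   Context: For a nonzero finitely generated torsion-free $A$-module $N$, put $(-)^*=\operatorname{Hom}_A(-,A)$ and $F_N=N^{**}$, a finitely generated free $A$-module containing $N$ via the biduality map; let $S_N=\operatorname{Sym}_A(F_N)$ with its standard grading. (For $N=IM$ with $I$ an $\mathfrak m$-primary ideal, $F_N=M^{**}$.) The Rees algebra is $\mathcal R(N)=\operatorname{Im}(\operatorname{Sym}_A(N)\to S_N)$, $N^n=[\mathcal R(N)]_n$. The Ratliff–Rush closure is $\widetilde N=\bigcup_{\ell>0}[N^{\ell+1}:_{F_N}N^{\ell}]$, and the integral closure $\overline N\subseteq F_N$ is the degree $1$ component of the integral closure of $\mathcal R(N)$ in $S_N$. A Noetherian local ring $(R,\mathfrak n)$ is Buchsbaum if $\ell_R(R/Q)-e_Q(R)$ (length minus multiplicity) is independent of the choice of the parameter ideal $Q$ of $R$; $\mathcal R(N)$ is called Buchsbaum if its localization at the graded maximal ideal $\mathfrak m\mathcal R(N)+\bigoplus_{n>0}N^n$ is a Buchsbaum local ring. *)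

(* Defs.v *)
From HB Require Import structures.
From mathcomp Require Import all_boot all_order all_algebra generic_quotient.
From mathcomp Require Import all_classical.
From mathcomp Require Import ring.

Set Implicit Arguments.
Unset Strict Implicit.
Unset Printing Implicit Defensive.
Import Order.TTheory GRing.Theory Num.Theory.
Local Open Scope classical_set_scope.
Local Open Scope ring_scope.
Local Open Scope quotient_scope.

(* Submodules are Prop-valued sets; an ideal of R is a submodule of R^o.      *)

Section Submodules.
Context {R : pzRingType} {V : lmodType R}.

Definition is_submod (N : set V) : Prop :=
  [/\ N 0, forall x y, N x -> N y -> N (x + y) & forall a x, N x -> N (a *: x)].

Definition span (X : set V) : set V := smallest is_submod X.

Lemma span_submod (X : set V) : is_submod (span X).
Proof.
split=> [N [[]] // | x y Hx Hy N HN | a x Hx N HN].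
  by have [[_ addN _] _] := HN; apply: addN; [exact: Hx | exact: Hy].
by have [[_ _ scaleN] _] := HN; apply: scaleN; exact: Hx.
Qed.

(* The submodule I N; for N an ideal (V = R^o) this is the product of ideals. *)
Definition smul (I : set R) (N : set V) : set V :=
  span [set z | exists a x, [/\ I a, N x & z = a *: x]].

Definition finitely_generated (N : set V) : Prop :=
  exists s : seq V, N = span [set` s].

(* A chain L <= N 0 < N 1 < ... < N n of submodules, i.e. a chain of length n *)
(* of submodules of V / L.                                                    *)
Definition submod_chain (L : set V) (n : nat) : Prop :=
  exists N : nat -> set V,
    [/\ L `<=` N 0%N,
        forall i, (i <= n)%N -> is_submod (N i)
      & forall i, (i < n)%N -> N i `<` N i.+1].

(* The module V / L has finite length, equal to n.                            *)
Definition colength (L : set V) (n : nat) : Prop :=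
  submod_chain L n /\ ~ submod_chain L n.+1.

End Submodules.

Section Ideals.
Context {R : comPzRingType}.
Implicit Types (I J P Q m : set R).

Definition is_ideal I : Prop := is_submod (I : set R^o).

Definition ideal_mul I J : set R := smul I (J : set R^o).

Definition ideal_pow I (n : nat) : set R := iter n (ideal_mul I) setT.

Definition ideal_gen (X : set R) : set R := span (X : set R^o).

Definition radical I : set R := [set x | exists n : nat, I (x ^+ n)].

Definition prime_ideal P : Prop :=
  [/\ is_ideal P, ~ P 1 & forall x y, P (x * y) -> P x \/ P y].

Definition primary_ideal Q : Prop :=
  [/\ is_ideal Q, ~ Q 1 & forall x y, Q (x * y) -> Q x \/ radical Q y].

Definition primary_to m Q : Prop := primary_ideal Q /\ radical Q = m.

Definition maximal_ideal m : Prop :=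
  [/\ is_ideal m, ~ m 1
    & forall J, is_ideal J -> ~ J 1 -> m `<=` J -> J = m].

Definition integral_over_ideal I (x : R) : Prop :=
  exists (n : nat) (a : nat -> R),
    [/\ (0 < n)%N, forall i, (1 <= i <= n)%N -> ideal_pow I i (a i)
      & x ^+ n + \sum_(1 <= i < n.+1) a i * x ^+ (n - i) = 0].

Definition integrally_closed_ideal I : Prop :=
  is_ideal I /\ forall x, integral_over_ideal I x -> I x.

End Ideals.

Section LocalRings.
Variable R : comPzRingType.
Implicit Types (m Q : set R).

Definition local_ring m : Prop :=
  maximal_ideal m /\ forall m', maximal_ideal m' -> m' = m.

Definition noetherian : Prop :=
  forall I : set R, is_ideal I -> exists s : seq R, I = ideal_gen [set` s].

Definition prime_chain (n : nat) : Prop :=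
  exists P : nat -> set R,
    (forall i, (i <= n)%N -> prime_ideal (P i)) /\
    (forall i, (i < n)%N -> P i `<` P i.+1).

Definition krull_dim (d : nat) : Prop := prime_chain d /\ ~ prime_chain d.+1.

Definition noetherian_local (m : set R) (d : nat) : Prop :=
  [/\ noetherian, local_ring m & krull_dim d].

Definition regular_local (m : set R) (d : nat) : Prop :=
  noetherian_local m d /\
  exists s : seq R, size s = d /\ m = ideal_gen [set` s].

(* The set of cosets R / m is infinite.                                       *)
Definition infinite_residue_field (m : set R) : Prop :=
  infinite_set (range (fun x : R => [set y | m (y - x)])).

Definition parameter_ideal m (d : nat) Q : Prop :=
  primary_to m Q /\ exists s : seq R, size s = d /\ Q = ideal_gen [set` s].

(* e_Q(R), for R of dimension d: the Hilbert-Samuel function                  *)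
(* n |-> length (R / Q^(n+1)) agrees for large n with a polynomial whose      *)
(* term of degree d is (e / d!) X^d.                                          *)
Definition multiplicity (d : nat) Q (e : nat) : Prop :=
  exists p : {poly rat},
    [/\ (size p <= d.+1)%N, p`_d = e%:R / (d`!)%:R
      & exists n0 : nat, forall n : nat, (n0 <= n)%N ->
          exists2 l : nat, colength (ideal_pow Q n.+1 : set R^o) l
                         & p.[n%:R] = l%:R].

Definition buchsbaum_local : Prop :=
  exists (m : set R) (d : nat),
    noetherian_local m d /\
    exists c : int, forall Q, parameter_ideal m d Q ->
      exists l e : nat,
        [/\ colength (Q : set R^o) l, multiplicity d Q e & l%:Z - e%:Z = c].

End LocalRings.

(* Ring of fractions R[T^-1] for an arbitrary T : denominators range over the *)
(* multiplicative submonoid generated by T. When T is the complement of a     *)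
(* prime P this submonoid is T itself, and the result is the localization R_P.*)

Section Localization.
Variables (R : comPzRingType) (T : set R).

Definition submonoid (S : set R) : Prop :=
  S 1 /\ forall x y, S x -> S y -> S (x * y).

Definition denominator : set R := smallest submonoid T.

Lemma denominator_submonoid : submonoid denominator.
Proof.
split=> [S [[]] // | x y Hx Hy S HS].
by have [[_ mulS] _] := HS; apply: mulS; [exact: Hx | exact: Hy].
Qed.

Let den1 : denominator 1 := proj1 denominator_submonoid.
Let denM := proj2 denominator_submonoid.

Definition fraction : Type := (R * {s : R | denominator s})%type.

HB.instance Definition _ := gen_eqMixin fraction.
HB.instance Definition _ := gen_choiceMixin fraction.

Definition mk_fraction (a s : R) (Hs : denominator s) : fraction :=
  (a, exist _ s Hs).

Definition fraction_eq : rel fraction := fun x y =>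
  `[< exists2 u, denominator u &
      u * (x.1 * projT1 y.2) = u * (y.1 * projT1 x.2) >].

Lemma fraction_eq_refl : reflexive fraction_eq.
Proof. by move=> x; apply/asboolP; exists 1. Qed.

Lemma fraction_eq_sym : symmetric fraction_eq.
Proof.
by move=> x y; apply/asboolP/asboolP => -[u Hu E]; exists u.
Qed.

Lemma fraction_eq_trans : transitive fraction_eq.
Proof.
move=> [b [t Ht]] [a [s Hs]] [c [r Hr]] /asboolP[u Hu /= E1] /asboolP[v Hv /= E2].
apply/asboolP; exists (u * v * t) => /=; first by do 2?apply: denM.
transitivity (v * r * (u * (a * t))); first by ring.
rewrite E1; transitivity (u * s * (v * (b * r))); first by ring.
by rewrite E2; ring.
Qed.

Canonical fraction_equiv :=
  EquivRel fraction_eq fraction_eq_refl fraction_eq_sym fraction_eq_trans.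

Definition localization : Type := {eq_quot fraction_eq}.

HB.instance Definition _ := Choice.on localization.
HB.instance Definition _ : EqQuotient _ fraction_eq localization :=
  EqQuotient.on localization.

Lemma fraction_piP (x y : fraction) :
  reflect (exists2 u, denominator u &
             u * (x.1 * projT1 y.2) = u * (y.1 * projT1 x.2))
          (\pi_localization x == \pi_localization y).
Proof. by rewrite eqmodE; apply: (iffP (asboolP _)). Qed.

Definition fraction_add (x y : fraction) : fraction :=
  mk_fraction (x.1 * projT1 y.2 + y.1 * projT1 x.2)
              (denM (projT2 x.2) (projT2 y.2)).
Definition fraction_mul (x y : fraction) : fraction :=
  mk_fraction (x.1 * y.1) (denM (projT2 x.2) (projT2 y.2)).
Definition fraction_opp (x : fraction) : fraction :=
  mk_fraction (- x.1) (projT2 x.2).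

Definition loc_of := lift_embed localization (fun a => mk_fraction a den1).
Definition loc_add := lift_op2 localization fraction_add.
Definition loc_mul := lift_op2 localization fraction_mul.
Definition loc_opp := lift_op1 localization fraction_opp.

Canonical loc_of_morph := PiEmbed loc_of.

Lemma repr_fraction (x : fraction) : exists2 u, denominator u &
  u * ((repr (\pi_localization x)).1 * projT1 x.2) =
  u * (x.1 * projT1 (repr (\pi_localization x)).2).
Proof. by apply/fraction_piP; rewrite reprK. Qed.

Lemma loc_addE : {morph \pi : x y / fraction_add x y >-> loc_add x y}.
Proof.
move=> x y; unlock loc_add; apply/eqP; rewrite eq_sym; apply/fraction_piP => /=.
have [u Hu] := repr_fraction x; have [v Hv] := repr_fraction y.
move: (repr _) (repr _) => [a [s Hs]] [b [t Ht]].
case: x y => [a' [s' Hs']] [b' [t' Ht']] /= E2 E1.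
exists (u * v); first exact: denM.
transitivity (v * t * t' * (u * (a * s')) + u * s * s' * (v * (b * t'))).
  by ring.
by rewrite E1 E2; ring.
Qed.
Canonical loc_add_morph := PiMorph2 loc_addE.

Lemma loc_mulE : {morph \pi : x y / fraction_mul x y >-> loc_mul x y}.
Proof.
move=> x y; unlock loc_mul; apply/eqP; rewrite eq_sym; apply/fraction_piP => /=.
have [u Hu] := repr_fraction x; have [v Hv] := repr_fraction y.
move: (repr _) (repr _) => [a [s Hs]] [b [t Ht]].
case: x y => [a' [s' Hs']] [b' [t' Ht']] /= E2 E1.
exists (u * v); first exact: denM.
transitivity ((u * (a * s')) * (v * (b * t'))); first by ring.
by rewrite E1 E2; ring.
Qed.
Canonical loc_mul_morph := PiMorph2 loc_mulE.

Lemma loc_oppE : {morph \pi : x / fraction_opp x >-> loc_opp x}.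
Proof.
move=> x; unlock loc_opp; apply/eqP; rewrite eq_sym; apply/fraction_piP => /=.
have [u Hu E] := repr_fraction x.
by exists u; rewrite // !mulNr !mulrN E.
Qed.
Canonical loc_opp_morph := PiMorph1 loc_oppE.

Let pi_eq (x y : fraction) :
  x.1 * projT1 y.2 = y.1 * projT1 x.2 -> \pi_localization x = \pi_localization y.
Proof. by move=> E; apply/eqP/fraction_piP; exists 1; rewrite ?E. Qed.

Local Ltac loc_solve := rewrite !piE; apply: pi_eq => /=; ring.

Lemma loc_addA : associative loc_add.
Proof. by elim/quotW=> x; elim/quotW=> y; elim/quotW=> z; loc_solve. Qed.
Lemma loc_addC : commutative loc_add.
Proof. by elim/quotW=> x; elim/quotW=> y; loc_solve. Qed.
Lemma loc_add0 : left_id (loc_of 0) loc_add.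
Proof. by elim/quotW=> x; loc_solve. Qed.
Lemma loc_addN : left_inverse (loc_of 0) loc_opp loc_add.
Proof. by elim/quotW=> x; loc_solve. Qed.
Lemma loc_mulA : associative loc_mul.
Proof. by elim/quotW=> x; elim/quotW=> y; elim/quotW=> z; loc_solve. Qed.
Lemma loc_mulC : commutative loc_mul.
Proof. by elim/quotW=> x; elim/quotW=> y; loc_solve. Qed.
Lemma loc_mul1 : left_id (loc_of 1) loc_mul.
Proof. by elim/quotW=> x; loc_solve. Qed.
Lemma loc_mulD : left_distributive loc_mul loc_add.
Proof. by elim/quotW=> x; elim/quotW=> y; elim/quotW=> z; loc_solve. Qed.

HB.instance Definition _ := GRing.isZmodule.Build localization
  loc_addA loc_addC loc_add0 loc_addN.
HB.instance Definition _ := GRing.Zmodule_isComPzRing.Build localization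
  loc_mulA loc_mulC loc_mul1 loc_mulD.

End Localization.

Section SpanModule.
Variables (A : comNzRingType) (V : lmodType A) (X : set V).

Definition in_span : pred V := fun x => `[< span X x >].

Lemma in_span_closed : submod_closed in_span.
Proof.
have [s0 sD sZ] := span_submod X.
split=> [|a x y /asboolP Hx /asboolP Hy]; apply/asboolP; first exact: s0.
by apply: sD => //; apply: sZ.
Qed.
HB.instance Definition _ := GRing.isSubmodClosed.Build A V in_span in_span_closed.

Record span_module := SpanModule {
  span_val : V; span_valP : span_val \in in_span }.
HB.instance Definition _ := [isSub for span_val].
HB.instance Definition _ := [Choice of span_module by <:].
HB.instance Definition _ := [SubChoice_isSubLmodule of span_module by <:].

End SpanModule.

Section Dual.
Variables (A : comNzRingType) (V : lmodType A).

Definition linear_form : pred (V -> A^o) := fun f => `[< linear f >].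

Lemma linear_form_closed : submod_closed linear_form.
Proof.
split=> [|a f g /asboolP Hf /asboolP Hg]; apply/asboolP => b x y.
  by rewrite -[LHS]/(0 : A^o) -[RHS]/(b *: (0 : A^o) + 0) scaler0 addr0.
rewrite -[LHS]/(a *: f (b *: x + y) + g (b *: x + y)).
rewrite -[RHS]/(b *: (a *: f x + g x) + (a *: f y + g y)).
by rewrite Hf Hg !scalerDr !scalerA addrACA [a * b]mulrC.
Qed.
HB.instance Definition _ :=
  GRing.isSubmodClosed.Build A (V -> A^o) linear_form linear_form_closed.

(* Hom_A(V, A) *)
Record dual_module := DualModule {
  dual_val :> V -> A^o; dual_valP : dual_val \in linear_form }.
HB.instance Definition _ := [isSub for dual_val].
HB.instance Definition _ := [Choice of dual_module by <:].
HB.instance Definition _ := [SubChoice_isSubLmodule of dual_module by <:].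

End Dual.

Section Biduality.
Variables (A : comNzRingType) (V : lmodType A).

Lemma evaluation_linear (x : V) :
  (fun f : dual_module V => f x : A^o) \in @linear_form A (dual_module V).
Proof. by apply/asboolP. Qed.

Definition bidual_map (x : V) : dual_module (dual_module V) :=
  DualModule (evaluation_linear x).

(* V as a submodule of V^** (for V torsion-free over a domain). *)
Definition bidual_image : set (dual_module (dual_module V)) :=
  range bidual_map.

End Biduality.
Arguments bidual_image {A} V.

(* Sym_A(V), as the commutative A-algebra generated by the elements of V      *)
(* subject to the A-linear relations of V.                                    *)

Section SymmetricAlgebra.
Variables (A : comNzRingType) (V : lmodType A).

Inductive sym_term : Type :=
  | SymConst of A
  | SymGen of V
  | SymAdd of sym_term & sym_term
  | SymMul of sym_term & sym_term
  | SymOpp of sym_term.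

Inductive sym_cong : sym_term -> sym_term -> Prop :=
  | sym_refl t : sym_cong t t
  | sym_sym t u : sym_cong t u -> sym_cong u t
  | sym_trans t u v : sym_cong t u -> sym_cong u v -> sym_cong t v
  | sym_add_cong t t' u u' : sym_cong t t' -> sym_cong u u' ->
      sym_cong (SymAdd t u) (SymAdd t' u')
  | sym_mul_cong t t' u u' : sym_cong t t' -> sym_cong u u' ->
      sym_cong (SymMul t u) (SymMul t' u')
  | sym_opp_cong t t' : sym_cong t t' -> sym_cong (SymOpp t) (SymOpp t')
  | sym_addA t u v :
      sym_cong (SymAdd t (SymAdd u v)) (SymAdd (SymAdd t u) v)
  | sym_addC t u : sym_cong (SymAdd t u) (SymAdd u t)
  | sym_add0 t : sym_cong (SymAdd (SymConst 0) t) t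
  | sym_addN t : sym_cong (SymAdd (SymOpp t) t) (SymConst 0)
  | sym_mulA t u v :
      sym_cong (SymMul t (SymMul u v)) (SymMul (SymMul t u) v)
  | sym_mulC t u : sym_cong (SymMul t u) (SymMul u t)
  | sym_mul1 t : sym_cong (SymMul (SymConst 1) t) t
  | sym_mulD t u v :
      sym_cong (SymMul (SymAdd t u) v) (SymAdd (SymMul t v) (SymMul u v))
  | sym_constD a b :
      sym_cong (SymConst (a + b)) (SymAdd (SymConst a) (SymConst b))
  | sym_constM a b :
      sym_cong (SymConst (a * b)) (SymMul (SymConst a) (SymConst b))
  | sym_genD x y : sym_cong (SymGen (x + y)) (SymAdd (SymGen x) (SymGen y))
  | sym_genZ a x : sym_cong (SymGen (a *: x)) (SymMul (SymConst a) (SymGen x)).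

HB.instance Definition _ := gen_eqMixin sym_term.
HB.instance Definition _ := gen_choiceMixin sym_term.

Definition sym_congb : rel sym_term := fun t u => `[< sym_cong t u >].

Lemma sym_congb_refl : reflexive sym_congb.
Proof. by move=> t; apply/asboolP; apply: sym_refl. Qed.
Lemma sym_congb_sym : symmetric sym_congb.
Proof. by move=> t u; apply/asboolP/asboolP; apply: sym_sym. Qed.
Lemma sym_congb_trans : transitive sym_congb.
Proof.
by move=> u t v /asboolP E1 /asboolP E2; apply/asboolP; apply: sym_trans E1 E2.
Qed.

Canonical sym_equiv :=
  EquivRel sym_congb sym_congb_refl sym_congb_sym sym_congb_trans.

Definition sym_alg : Type := {eq_quot sym_congb}.

HB.instance Definition _ := Choice.on sym_alg.
HB.instance Definition _ : EqQuotient _ sym_congb sym_alg :=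
  EqQuotient.on sym_alg.

Lemma sym_piP t u : \pi_sym_alg t = \pi_sym_alg u <-> sym_cong t u.
Proof.
split=> [/eqP|E]; first by rewrite eqmodE => /asboolP.
by apply/eqP; rewrite eqmodE; apply/asboolP.
Qed.

Definition sym_const := lift_embed sym_alg SymConst.
Definition sym_gen := lift_embed sym_alg SymGen.
Definition sym_add := lift_op2 sym_alg SymAdd.
Definition sym_mul := lift_op2 sym_alg SymMul.
Definition sym_opp := lift_op1 sym_alg SymOpp.
Definition sym_scale (a : A) (x : sym_alg) : sym_alg :=
  sym_mul (sym_const a) x.

Canonical sym_const_morph := PiEmbed sym_const.
Canonical sym_gen_morph := PiEmbed sym_gen.

Let repr_cong t : sym_cong (repr (\pi_sym_alg t)) t.
Proof. by apply/sym_piP; rewrite reprK. Qed.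

Lemma sym_addE : {morph \pi : t u / SymAdd t u >-> sym_add t u}.
Proof.
move=> t u; unlock sym_add; apply/sym_piP/sym_sym.
by apply: sym_add_cong; apply: repr_cong.
Qed.
Canonical sym_add_morph := PiMorph2 sym_addE.
Lemma sym_mulE : {morph \pi : t u / SymMul t u >-> sym_mul t u}.
Proof.
move=> t u; unlock sym_mul; apply/sym_piP/sym_sym.
by apply: sym_mul_cong; apply: repr_cong.
Qed.
Canonical sym_mul_morph := PiMorph2 sym_mulE.
Lemma sym_oppE : {morph \pi : t / SymOpp t >-> sym_opp t}.
Proof.
move=> t; unlock sym_opp; apply/sym_piP/sym_sym.
by apply: sym_opp_cong; apply: repr_cong.
Qed.
Canonical sym_opp_morph := PiMorph1 sym_oppE.

Lemma sym_alg_addA : associative sym_add.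
Proof.
elim/quotW=> t; elim/quotW=> u; elim/quotW=> v; rewrite !piE.
by apply/sym_piP; apply: sym_addA.
Qed.
Lemma sym_alg_addC : commutative sym_add.
Proof.
by elim/quotW=> t; elim/quotW=> u; rewrite !piE; apply/sym_piP; apply: sym_addC.
Qed.
Lemma sym_alg_add0 : left_id (sym_const 0) sym_add.
Proof. by elim/quotW=> t; rewrite !piE; apply/sym_piP; apply: sym_add0. Qed.
Lemma sym_alg_addN : left_inverse (sym_const 0) sym_opp sym_add.
Proof. by elim/quotW=> t; rewrite !piE; apply/sym_piP; apply: sym_addN. Qed.
Lemma sym_alg_mulA : associative sym_mul.
Proof.
elim/quotW=> t; elim/quotW=> u; elim/quotW=> v; rewrite !piE.
by apply/sym_piP; apply: sym_mulA.
Qed.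
Lemma sym_alg_mulC : commutative sym_mul.
Proof.
by elim/quotW=> t; elim/quotW=> u; rewrite !piE; apply/sym_piP; apply: sym_mulC.
Qed.
Lemma sym_alg_mul1 : left_id (sym_const 1) sym_mul.
Proof. by elim/quotW=> t; rewrite !piE; apply/sym_piP; apply: sym_mul1. Qed.
Lemma sym_alg_mulD : left_distributive sym_mul sym_add.
Proof.
elim/quotW=> t; elim/quotW=> u; elim/quotW=> v; rewrite !piE.
by apply/sym_piP; apply: sym_mulD.
Qed.

(* The augmentation Sym_A(V) -> A; it shows that Sym_A(V) is not trivial.     *)
Fixpoint sym_augment (t : sym_term) : A :=
  match t with
  | SymConst a => a
  | SymGen _ => 0
  | SymAdd t u => sym_augment t + sym_augment u
  | SymMul t u => sym_augment t * sym_augment u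
  | SymOpp t => - sym_augment t
  end.

Lemma sym_augment_cong t u : sym_cong t u -> sym_augment t = sym_augment u.
Proof.
elim=> //= {t u}.
- by move=> t u v _ -> _ ->.
- by move=> t t' u u' _ -> _ ->.
- by move=> t t' u u' _ -> _ ->.
- by move=> t t' _ ->.
- by move=> t u v; rewrite addrA.
- by move=> t u; rewrite addrC.
- by move=> t; rewrite add0r.
- by move=> t; rewrite addNr.
- by move=> t u v; rewrite mulrA.
- by move=> t u; rewrite mulrC.
- by move=> t; rewrite mul1r.
- by move=> t u v; rewrite mulrDl.
- by rewrite addr0.
- by move=> a x; rewrite mulr0.
Qed.

HB.instance Definition _ := GRing.isZmodule.Build sym_alg
  sym_alg_addA sym_alg_addC sym_alg_add0 sym_alg_addN.

Lemma sym_alg_1neq0 : sym_const 1 != 0.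
Proof.
rewrite /GRing.zero /=; unlock sym_const.
apply/eqP => /sym_piP /sym_augment_cong /= /eqP.
by rewrite oner_eq0.
Qed.

HB.instance Definition _ := GRing.Zmodule_isComNzRing.Build sym_alg
  sym_alg_mulA sym_alg_mulC sym_alg_mul1 sym_alg_mulD sym_alg_1neq0.

Lemma sym_scaleA a b x : sym_scale a (sym_scale b x) = sym_scale (a * b) x.
Proof.
rewrite /sym_scale sym_alg_mulA; congr sym_mul.
rewrite !piE; apply/sym_piP; apply/sym_sym/sym_constM.
Qed.
Lemma sym_scale1 : left_id 1 sym_scale.
Proof. exact: sym_alg_mul1. Qed.
Lemma sym_scaleDr : right_distributive sym_scale +%R.
Proof. by move=> a x y; apply: (mulrDr (sym_const a)). Qed.
Lemma sym_scaleDl x : {morph sym_scale^~ x : a b / a + b}.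
Proof.
move=> a b; transitivity ((sym_const a + sym_const b) * x); last exact: mulrDl.
congr sym_mul; apply: esym; rewrite /GRing.add /= !piE.
by apply/sym_piP; apply/sym_sym/sym_constD.
Qed.

HB.instance Definition _ := GRing.Zmodule_isLmodule.Build A sym_alg
  sym_scaleA sym_scale1 sym_scaleDr sym_scaleDl.

Lemma sym_scaleAl a (x y : sym_alg) : a *: (x * y) = a *: x * y.
Proof. exact: sym_alg_mulA. Qed.

HB.instance Definition _ := GRing.Lmodule_isLalgebra.Build A sym_alg sym_scaleAl.
HB.instance Definition _ := GRing.Lalgebra_isComAlgebra.Build A sym_alg.

(* The homogeneous component of degree n of Sym_A(V).                         *)
Definition sym_degree (n : nat) : set sym_alg :=
  span (range (fun x : 'I_n -> V => \prod_(i < n) sym_gen (x i))).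

End SymmetricAlgebra.

Section SymmetricMap.
Variables (A : comNzRingType) (U V : lmodType A) (f : {linear U -> V}).

Fixpoint sym_term_map (t : sym_term U) : sym_term V :=
  match t with
  | SymConst a => SymConst V a
  | SymGen x => SymGen (f x)
  | SymAdd t u => SymAdd (sym_term_map t) (sym_term_map u)
  | SymMul t u => SymMul (sym_term_map t) (sym_term_map u)
  | SymOpp t => SymOpp (sym_term_map t)
  end.

Lemma sym_term_map_cong t u :
  sym_cong t u -> sym_cong (sym_term_map t) (sym_term_map u).
Proof.
elim=> /= {t u}; try by constructor.
- by move=> t u v _ E1 _ E2; apply: sym_trans E1 E2.
- by move=> x y; rewrite linearD; constructor.
- by move=> a x; rewrite linearZ; constructor.
Qed.

(* Sym_A(f) : Sym_A(U) -> Sym_A(V) *)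
Definition sym_map (x : sym_alg U) : sym_alg V := \pi_(sym_alg V) (sym_term_map (repr x)).

Lemma sym_mapE t :
  sym_map (\pi_(sym_alg U) t) = \pi_(sym_alg V) (sym_term_map t).
Proof. by apply/sym_piP/sym_term_map_cong/sym_piP; rewrite reprK. Qed.

Lemma sym_map_is_zmod_morphism : zmod_morphism sym_map.
Proof.
elim/quotW=> t; elim/quotW=> u.
transitivity (sym_map (sym_add (\pi t) (sym_opp (\pi u)))) => //.
by rewrite -sym_oppE -sym_addE !sym_mapE /= sym_addE sym_oppE.
Qed.
Lemma sym_map_is_monoid_morphism : monoid_morphism sym_map.
Proof.
split.
  transitivity (sym_map (sym_const U 1)) => //.
  by unlock sym_const; rewrite sym_mapE /GRing.one /=; unlock sym_const.
elim/quotW=> t; elim/quotW=> u.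
transitivity (sym_map (sym_mul (\pi t) (\pi u))) => //.
by rewrite -sym_mulE !sym_mapE /= sym_mulE.
Qed.
Lemma sym_map_is_scalable : scalable sym_map.
Proof.
move=> a; elim/quotW=> t.
transitivity (sym_map (sym_mul (sym_const U a) (\pi t))) => //.
transitivity (sym_mul (sym_const V a) (sym_map (\pi t))) => //.
by unlock sym_const; rewrite -sym_mulE !sym_mapE /= sym_mulE.
Qed.

HB.instance Definition _ :=
  GRing.isZmodMorphism.Build _ _ sym_map sym_map_is_zmod_morphism.
HB.instance Definition _ :=
  GRing.isMonoidMorphism.Build _ _ sym_map sym_map_is_monoid_morphism.
HB.instance Definition _ :=
  GRing.isScalable.Build A _ _ _ sym_map sym_map_is_scalable.

End SymmetricMap.

(* A submodule N of F is given here by a set X spanning it (N = span X, so X = N   *)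
(* when X is already a submodule). S = Sym_A(F).                              *)

Section ReesAlgebra.
Variables (A : comNzRingType) (F : lmodType A) (X : set F).

Definition rees_map : sym_alg (span_module X) -> sym_alg F :=
  sym_map (\val : {linear span_module X -> F}).

(* R(N) = Im (Sym_A(N) -> Sym_A(F)) *)
Definition rees : set (sym_alg F) := range rees_map.

Definition in_rees : pred (sym_alg F) := fun x => `[< rees x >].

Lemma in_rees_closed : subring_closed in_rees.
Proof.
split=> [|x y|x y].
- by apply/asboolP; exists 1 => //; apply: rmorph1.
- move=> /asboolP[u _ <-] /asboolP[v _ <-]; apply/asboolP.
  by exists (u - v) => //; apply: rmorphB.
- move=> /asboolP[u _ <-] /asboolP[v _ <-]; apply/asboolP.
  by exists (u * v) => //; apply: rmorphM.
Qed.
HB.instance Definition _ :=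
  GRing.isSubringClosed.Build (sym_alg F) in_rees in_rees_closed.

Record rees_ring := ReesRing {
  rees_val : sym_alg F; rees_valP : rees_val \in in_rees }.
HB.instance Definition _ := [isSub for rees_val].
HB.instance Definition _ := [Choice of rees_ring by <:].
HB.instance Definition _ := [SubChoice_isSubComNzRing of rees_ring by <:].

(* N^n *)
Definition rees_degree (n : nat) : set (sym_alg F) :=
  rees `&` sym_degree n.

(* m R(N) + (+)_(n > 0) N^n, as an ideal of R(N) *)
Definition rees_max_ideal (m : set A) : set rees_ring :=
  [set x | span (smul m rees `|` \bigcup_(n in [set n | (0 < n)%N]) rees_degree n)
             (rees_val x)].

Definition rees_buchsbaum (m : set A) : Prop :=
  buchsbaum_local (localization (~` rees_max_ideal m)).

Definition ratliff_rush : set F :=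
  [set x | exists2 l : nat, (0 < l)%N &
     forall y, rees_degree l y -> rees_degree l.+1 (sym_gen x * y)].

(* F is identified with the degree 1 component of Sym_A(F) through sym_gen.   *)
Definition module_integral_closure : set F :=
  [set x | integralOver (\val : rees_ring -> sym_alg F) (sym_gen x)].

End ReesAlgebra.

Definition torsion_free (A : comNzRingType) (V : lmodType A) : Prop :=
  forall (a : A) (x : V), a *: x = 0 -> a = 0 \/ x = 0.

(* Main.v *)
(* Inside K[X_0, ..., X_r], K = Frac A, a finitely generated torsion-free module
 is a module N of linear forms, contained in the free module F of all forms
 over A. Choose a reduction of N generated by r + 2 linear forms U, with its
 unique relation c. By induction on the colength of the ideal (c), which drops
 under blowing up, the Koszul complex of U over the integral closure B of the
 Rees algebra is exact in degrees at least 2. Two consequences follow.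
 First, the integral closure of IN is I times that of N for I integrally
 closed (apply exactness to N + IT, T a new variable). Second, the higher
 Koszul homology of every parameter ideal Q on B vanishes; comparing Hilbert
 functions, l(R/Q) - e(Q) is then (d - 1) l(B/(R + aB)) for a in Q annihilating
 B/R, so that, when the Ratliff-Rush closure is integrally closed, R(N) is
 Buchsbaum iff the closure L of N satisfies mL <= N and L^2 <= N^2. By the
 first consequence this condition passes from N to IN. *)
From HB Require Import structures.
Require Import Defs.
From mathcomp Require Import all_boot all_order all_algebra.
From mathcomp Require Import generic_quotient.
From mathcomp Require Import all_classical.
From mathcomp Require Import ring zify mpoly.
Set Implicit Arguments.
Unset Strict Implicit.
Unset Printing Implicit Defensive.
Import GRing.Theory.
Local Open Scope classical_set_scope.
Local Open Scope ring_scope.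

(** * Modules over a subring *)

(** Total degree 2 enters through the base case: where the ideal (c) is principal, one form of U
    depends on the others, which are the variables of a polynomial ring; their Koszul complex is
    exact in positive total degree, and the cone over it involves degrees n and n - 1. Descent from
    the blow-up rests on the vanishing of the first cohomology of the degree n part of B over the
    two charts; it holds because that part is the span of the monomials in U outside finitely many
    points of the exceptional line. With d the dimension of R, the d + 1 elements x, y, U have no
    Koszul homology on B from degree 2 on, which says that B has depth d; every parameter sequence
    inherits this by adjoining and removing elements. The closure condition on N says that the
    maximal ideal of R kills B/R, B being generated over R by 1 and L. That it is forced comes from
    comparing the invariants of parameter ideals containing a and a^N, whose other generators kill
    B/R. Charts and their localizations are subsets of one field K, so that they can be intersected
    and compared; abstract rings return for the parameter ideals. *)

Section Modules.
Variables (R : comPzRingType) (V : lmodType R).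
Implicit Types (D J : set R) (C N B X : set V).

Definition subring D : Prop :=
 [/\ D 1, forall a b, D a -> D b -> D (a - b)
  & forall a b, D a -> D b -> D (a * b)].

Definition smod D N : Prop :=
 [/\ N 0, forall u v, N u -> N v -> N (u + v)
  & forall a v, D a -> N v -> N (a *: v)].

(** The coefficient set [D] is arbitrary: with an ideal [J] in its place, [spn J N] is the product
    [J N], the form in which Nakayama's lemma is stated and applied. *)
Inductive spn D X : set V :=
| spn_zero : spn D X 0
| spn_cons d x v : D d -> X x -> spn D X v -> spn D X (d *: x + v).

Definition sadd C N : set V := [set v | exists u w, [/\ C u, N w & v = u + w]].
Lemma sr1 D : subring D -> D 1. by case. Qed.
Lemma sr0 D : subring D -> D 0.
by case=> d1 dB _; rewrite -(subrr 1); apply: dB. Qed.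
Lemma srN D a : subring D -> D a -> D (- a).
by move=> sD; have := sr0 sD; case: sD=> _ dB _; rewrite -sub0r; apply: dB. Qed.
Lemma srB D a b : subring D -> D a -> D b -> D (a - b).
by case=> _ + _; apply. Qed.
Lemma srD D a b : subring D -> D a -> D b -> D (a + b).
by move=> sD Da Db; rewrite -[b]opprK; apply: srB=> //; apply: srN.
Qed.
Lemma srM D a b : subring D -> D a -> D b -> D (a * b).
by case=> _ _; apply. Qed.
Lemma srX D a n : subring D -> D a -> D (a ^+ n).
by move=> sD Da; elim: n=> [|n]; rewrite ?exprS; [exact: sr1 | exact: srM].
Qed.
Lemma sr_sum D I (r : seq I) (P : pred I) (F : I -> R) :
 subring D -> (forall i, P i -> D (F i)) -> D (\sum_(i <- r | P i) F i).
move=> sD DF; apply: big_ind=> //; first exact: sr0.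
by move=> a b; apply: srD.
Qed.
Lemma srT : subring [set: R]. by []. Qed.
Lemma smod0 D N : smod D N -> N 0. by case. Qed.
Lemma smodD D N u v : smod D N -> N u -> N v -> N (u + v).
by case=> _ + _; apply. Qed.
Lemma smodZ D N a v : smod D N -> D a -> N v -> N (a *: v).
by case=> _ _; apply. Qed.
Lemma smodN D N v : subring D -> smod D N -> N v -> N (- v).
move=> sD sN Nv; rewrite -scaleN1r; apply: (smodZ sN)=> //.
by apply: srN=> //; apply: sr1.
Qed.
Lemma smodB D N u v : subring D -> smod D N -> N u -> N v -> N (u - v).
by move=> sD sN Nu Nv; apply: (smodD sN)=> //; apply: (smodN sD). Qed.
Lemma smod_sum D N I (r : seq I) (P : pred I) (F : I -> V) :
 smod D N -> (forall i, P i -> N (F i)) -> N (\sum_(i <- r | P i) F i).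
by case=> N0 ND _; apply: big_ind. Qed.
Lemma smod_sum_seq D N (I : eqType) (r : seq I) (P : pred I) (F : I -> V) :
 smod D N -> (forall i, i \in r -> P i -> N (F i)) -> N (\sum_(i <- r | P i) F i).
by move=> sN NF; rewrite big_seq_cond; apply: (smod_sum (D := D))=> // i /andP[]; exact: NF.
Qed.
Lemma smodDr D N u v : subring D -> smod D N -> N u -> N (u + v) -> N v.
by move=> sD sN Nu /(smodB sD sN) /(_ Nu); rewrite addrC addKr. Qed.
Lemma smodI D N B : smod D N -> smod D B -> smod D (N `&` B).
move=> sN sB; split=> [|u v [Nu Bu] [Nv]|a v Da [Nv]]; split;
[exact: smod0 sN|exact: smod0 sB|exact: (smodD sN)|exact: (smodD sB)
  |exact: (smodZ sN)|exact: (smodZ sB)].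
Qed.
Lemma smod_sub D D' N : D `<=` D' -> smod D' N -> smod D N.
by move=> DD [N0 ND NZ]; split=> // a v /DD; apply: NZ. Qed.
Lemma smod_one D : smod D [set 0 : V].
by split=> [|u v -> ->|a v _ ->]; rewrite ?addr0 ?scaler0. Qed.
Lemma smodT D : smod D [set: V]. by []. Qed.
Lemma sadd_smod D C N : smod D C -> smod D N -> smod D (sadd C N).
move=> sC sN; split.
- by exists 0, 0; rewrite addr0; split; [exact: smod0 sC|exact: smod0 sN|].
- move=> _ _ [u [w [Cu Nw ->]]] [u' [w' [Cu' Nw' ->]]].
 by exists (u + u'), (w + w'); rewrite addrACA; split; [exact: (smodD sC)|exact: (smodD sN)|].
- move=> a _ Da [u [w [Cu Nw ->]]]; exists (a *: u), (a *: w).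
 by rewrite scalerDr; split; [exact: (smodZ sC)|exact: (smodZ sN)|].
Qed.
Lemma saddl D C N : smod D N -> C `<=` sadd C N.
by move=> sN u; exists u, 0; rewrite addr0; split=> //; apply: smod0 sN. Qed.
Lemma saddr D C N : smod D C -> N `<=` sadd C N.
by move=> sC u; exists 0, u; rewrite add0r; split=> //; apply: smod0 sC. Qed.
Lemma sadd_min D C N B : smod D B -> C `<=` B -> N `<=` B -> sadd C N `<=` B.
by move=> sB CB NB _ [u [w [/CB Bu /NB Bw ->]]]; apply: (smodD sB). Qed.
Lemma spnD D X u v : spn D X u -> spn D X v -> spn D X (u + v).
elim=> [|d x w Dd Xx _ IH] Sv; first by rewrite add0r.
by rewrite -addrA; apply: spn_cons=> //; apply: IH.
Qed.
Lemma spnZ D X D' a v : (forall d, D d -> D' (a * d)) -> spn D X v -> spn D' X (a *: v).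
move=> aD; elim=> [|d x w Dd Xx _ IH]; first by rewrite scaler0; constructor.
by rewrite scalerDr scalerA; apply: spn_cons=> //; apply: aD.
Qed.
Lemma spn_smod D X : subring D -> smod D (spn D X).
move=> sD; split=> [||a v Da]; [by constructor|exact: spnD|].
by apply: spnZ=> d; apply: srM.
Qed.
Lemma spn_mem D X d x : D d -> X x -> spn D X (d *: x).
by move=> Xx; rewrite -[_ *: _]addr0; do 2?constructor. Qed.
Lemma spn_gen D X x : D 1 -> X x -> spn D X x.
by move=> D1 Xx; rewrite -[x]scale1r; apply: spn_mem. Qed.
Lemma spn_min D X N : smod D N -> X `<=` N -> spn D X `<=` N.
move=> sN XN v; elim=> [|d x w Dd /XN Nx _ IH]; first exact: smod0 sN.
by apply: (smodD sN)=> //; apply: (smodZ sN).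
Qed.
Lemma spn_mono D D' X X' : D `<=` D' -> X `<=` X' -> spn D X `<=` spn D' X'.
move=> DD XX v; elim=> [|d x w /DD Dd /XX]; by constructor.
Qed.
Lemma spn_trans D X Y : subring D -> X `<=` spn D Y -> spn D X `<=` spn D Y.
by move=> sD; apply: spn_min; apply: spn_smod. Qed.
Lemma spn_consP D (x : V) (s : seq V) v : subring D ->
 spn D [set` x :: s] v -> exists d w, [/\ D d, spn D [set` s] w & v = d *: x + w].
move=> sD; elim=> [|d y w Dd /= + _ [d' [w' [Dd' Sw' ->]]]].
 by exists 0, 0; split; [exact: sr0|constructor|rewrite scale0r addr0].
rewrite inE=> /orP[/eqP ->|ys].
 by exists (d + d'), w'; rewrite scalerDl addrA; split=> //; apply: srD.
exists d', (d *: y + w'); rewrite addrCA; split=> //.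
exact: spn_cons.
Qed.
Lemma spn_nilP D v : spn D [set` [::]] v -> v = 0.
by elim=> [|]. Qed.

(** * Noetherian modules and Nakayama's lemma *)

Definition fg D N : Prop := exists s : seq V,
 (forall x, x \in s -> N x) /\ N `<=` spn D [set` s].

Definition noethm D B : Prop := forall N, smod D N -> N `<=` B -> fg D N.
Lemma noethm_sub D B B' : B' `<=` B -> noethm D B -> noethm D B'.
by move=> BB nB N sN NB; apply: nB; apply: subset_trans NB BB. Qed.
Lemma spn_seq_smodP D N (s : seq V) : smod D N -> (forall x, x \in s -> N x) ->
 spn D [set` s] `<=` N.
by move=> sN; apply: spn_min. Qed.
Lemma fg_sub_chain (f : nat -> set V) D : subring D -> (forall n, smod D (f n)) ->
 (forall n, f n `<=` f n.+1) -> noethm D (fun v=> exists n, f n v) ->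
 exists n, f n.+1 `<=` f n.
move=> sD sf fS nB.
have fmono i j: (i <= j)%N -> f i `<=` f j.
 move=> /subnK <-; elim: (j - i)%N=> [//|k IH]; exact: subset_trans (fS _).
have [||s [sN Ns]] := nB (fun v=> exists n, f n v)=> //.
 split=> [|u v [i fu] [j fv]|a v Da [i fv]]; first by exists 0%N; apply: smod0.
  exists (maxn i j); apply: (smodD (sf _)).
   by apply: fmono fu; apply: leq_maxl.
  by apply: fmono fv; apply: leq_maxr.
 by exists i; apply: smodZ.
have [n ns]: exists n, forall x, x \in s -> f n x.
 elim: s sN {Ns} => [|x s IH] sN; first by exists 0%N.
 have [|n ns] := IH; first by move=> y ys; apply: sN; rewrite inE ys orbT.
 have [k fx] := sN x (mem_head _ _).
 exists (maxn n k)=> y; rewrite inE=> /orP[/eqP->|/ns fy].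
  by apply: fmono fx; apply: leq_maxr.
 by apply: fmono fy; apply: leq_maxl.
exists n=> v fv; apply: (spn_seq_smodP (sf n) ns); apply: Ns; by exists n.+1.
Qed.
Lemma noeth_max D B (Fam : set (set V)) : subring D -> noethm D B ->
 (forall N, Fam N -> smod D N /\ N `<=` B) -> (exists N, Fam N) ->
 exists2 N, Fam N & forall N', Fam N' -> N `<=` N' -> N' `<=` N.
move=> sD nB FamB [N0 F0]; apply: contrapT=> nomax.
have next (N: {N | Fam N}) : exists N' : {N | Fam N},
  sval N `<=` sval N' /\ ~ (sval N' `<=` sval N).
 case: N=> N FN /=; apply: contrapT=> H; apply: nomax; exists N=> // N' FN' NN'.
 by apply: contrapT=> N'N; apply: H; exists (exist _ N' FN').
have [g gP] := choice next.
pose f n := sval (iter n g (exist _ N0 F0)).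
have [n|n|N sN NB|n] := @fg_sub_chain f D sD.
- by have [] := FamB _ (svalP (iter n g (exist _ N0 F0))).
- by have [] := gP (iter n g (exist _ N0 F0)).
- apply: nB=> // v /NB[n].
 by have [_] := FamB _ (svalP (iter n g (exist _ N0 F0))); apply.
- by have [] := gP (iter n g (exist _ N0 F0)).
Qed.
(** Induction on the generators: in [(1 - j) x = u + w] the factor is inverted, which expresses [x]
    modulo [C] through the other generators with coefficients in [J], and [x] is substituted into
    their equations. Only the invertibility of the [1 - j] in [D] enters. *)
Lemma nakayama D J C (s : seq V) : subring D -> smod D C ->
 (forall a b, D a -> J b -> J (a * b)) -> (forall a b, J a -> J b -> J (a + b)) ->
 J `<=` D -> (forall j, J j -> exists2 c, D c & c * (1 - j) = 1) ->
 (forall x, x \in s -> sadd C (spn J [set` s]) x) -> forall x, x \in s -> C x.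
move=> sD sC JM JD JsD Junit.
have JspnP x t v: spn J [set` x :: t] v ->
  (exists d w, [/\ J d, spn J [set` t] w & v = d *: x + w]) \/ spn J [set` t] v.
 elim=> [|d y w Dd /= + _ IH]; first by right; constructor.
 rewrite inE=> /orP[/eqP->|ys].
  case: IH=> [[d' [w' [Dd' Sw' ->]]]|Sw]; left.
   by exists (d + d'), w'; rewrite scalerDl addrA; split=> //; apply: JD.
  by exists d, w.
 case: IH=> [[d' [w' [Dd' Sw' ->]]]|]; last by right; constructor.
 by left; exists d', (d *: y + w'); rewrite addrCA; split=> //; constructor.
elim: s=> [//|x s IH] Hs.
have xP: sadd C (spn J [set` s]) x.
 have [u [w [Cu /JspnP Sw xE]]] := Hs x (mem_head _ _).
 case: Sw=> [[j [w' [Jj Sw' wE]]]|]; last by exists u, w.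
 have [c Dc cj] := Junit j Jj.
 exists (c *: u), (c *: w'); split; first exact: (smodZ sC).
  by apply: spnZ Sw'=> d; apply: JM.
 rewrite -[LHS]scale1r -cj -scalerA scalerBl scale1r {1}xE wE addrA addrAC.
 by rewrite [u + _]addrC addrK -scalerDr addrC.
have Cs: forall y, y \in s -> C y.
 apply: IH=> y ys.
 have [u [w [Cu /JspnP Sw ->]]]: sadd C (spn J [set` x :: s]) y by apply: Hs; rewrite inE ys orbT.
 case: Sw=> [[j [w' [Jj Sw' ->]]]|]; last by exists u, w.
 have [u' [w2 [Cu' Sw2 ->]]] := xP.
 exists (u + j *: u'), (j *: w2 + w'); split.
 - by apply: (smodD sC)=> //; apply: (smodZ sC)=> //; apply: JsD.
 - apply: spnD=> //; apply: spnZ Sw2=> d; by apply: JM; apply: JsD.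
 - by rewrite scalerDr !addrA.
move=> y; rewrite inE=> /orP[/eqP->|]; last exact: Cs.
have [u [w [Cu Sw ->]]] := xP; apply: (smodD sC)=> //.
move: Sw; apply: spn_min=> //; exact: (smod_sub JsD).
Qed.
End Modules.
Create HintDb smods.
#[local] Hint Resolve srT spn_smod sadd_smod smodI : smods.
Ltac closure_more n := fail.
Ltac issub := solve [eauto 3 with smods nocore].
(* Membership in subrings and submodules given by arithmetic expressions. *)
Ltac closure n := first [assumption | exact: spn_zero | lazymatch n with S ?n=>
 match goal with
 | |- _ 0=> first [refine (sr0 _); issub | refine (smod0 _); issub]
 | |- _ 1=> refine (sr1 _); issub
 | |- _ (- _)=> first [refine (srN _ _); [issub|closure n] | refine (smodN _ _ _); [|issub|closure n]; issub]
 | |- _ (_ + _)=> first [refine (srD _ _ _); [issub|closure n..] | refine (smodD _ _ _); [issub|closure n..]]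
 | |- _ (_ * _)=> refine (srM _ _ _); [issub|closure n..]
 | |- _ (_ ^+ _)=> refine (@srX _ _ _ _ _ _); [issub|closure n]
 | |- _ (_ *: _)=> refine (smodZ _ _ _); [issub|closure n..]
 | H : ?A `<=` ?B |- ?B _=> simple apply H; closure n
 | |- _=> closure_more n
 | |- spn _ _ _=> first [refine (spnD _ _); closure n | refine (spn_gen _ _); closure n]
 end end].
Ltac mem := lazymatch goal with |- _ = _=> fail | |- is_true _=> fail
 | |- smod _ _=> first [exact: smodT | exact: smod_one | issub] | |- subring _=> issub | |- spn _ _ _=> closure 6%nat | |- _ ?u=>
 lazymatch u with 0=> idtac | 1=> idtac | _ + _=> idtac | - _=> idtac | _ * _=> idtac
 | _ *: _=> idtac | _ ^+ _=> idtac end; unshelve closure 6%nat; fail end.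
Ltac mem_seq := lazymatch goal with
 | |- is_true (_ \in _)=> first [exact: mem_head | exact: map_f | exact: allpairs_f | by rewrite !inE ?eqxx ?orbT]
 | |- subset ?A ?A=> exact: subset_refl end.
#[local] Hint Extern 0=> first [mem | mem_seq] : core.

Definition noeth (R : comPzRingType) (D : set R) : Prop := noethm (V := R^o) D D.

Section FinitelyGenerated.
Variables (R : comPzRingType) (V : lmodType R).
(** Induction on the generators of the ambient module: the coefficients of the head in members of
    [N] form an ideal of [D]; lifts [d *: x + h d] of its generators, together with generators of
    the part of [N] in the span of the tail, generate [N]. *)
Lemma fg_noeth (D : set R) (s : seq V) : subring D -> noeth D ->
 noethm D (spn D [set` s]).
move=> sD nD; elim: s=> [|x s IH] N sN NB.
 by exists [::].
pose I : set R^o := [set d | D d /\ exists2 w, spn D [set` s] w & N (d *: x + w)].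
have [||t [tI It]] := nD I.
- split=> [|a b [Da [u Su Nu]] [Db [w Sw Nw]]|a b Da [Db [w Sw Nw]]].
 + split=> //; exists 0=> //.
  by rewrite scale0r.
 + split=> //; exists (u + w)=> //.
  by rewrite scalerDl addrACA.
 + split; [exact: srM|exists (a *: w)=> //].
  by rewrite -scalerA -scalerDr.
- by move=> d [].
have [||s' [s'N Ns']] := IH (N `&` spn D [set` s])=> //.
have /choice[h hP]: forall d, exists w, d \in t -> spn D [set` s] w /\ N (d *: x + w).
 move=> d; have [/tI [_ [w]]|_] := boolP (d \in t); first by exists w.
 by exists 0.
exists ([seq d *: x + h d | d <- t] ++ s'); split.
 move=> v; rewrite mem_cat=> /orP[/mapP[d /hP[_ Nd] ->//]|/s'N[]//].
have sT := @spn_smod _ V D [set` [seq d *: x + h d | d <- t] ++ s'] sD.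
have key d: spn D ([set` t] : set R^o) d -> exists2 w, spn D [set` s] w &
  N (d *: x + w) /\ spn D [set` [seq d *: x + h d | d <- t] ++ s'] (d *: x + w).
 elim=> [|a b c Da bt _ [w Sw [Nw Tw]]].
  by exists 0; [|rewrite scale0r].
 have [Sh Nh] := hP _ bt.
 exists (a *: h b + w)=> //.
 rewrite scalerDl -scalerA addrACA -scalerDr; split=> //.
 apply: spnD=> //; apply: smodZ=> //; apply: spn_gen=> //.
 by rewrite /= mem_cat (map_f (fun d=> d *: x + h d)).
move=> v Nv; have [d [w [Dd Sw vE]]] := spn_consP sD (NB _ Nv).
have [|w' Sw' [Nw' Tw']] := key d; first by apply: It; split=> //; exists w; rewrite -?vE.
have ->: v = (d *: x + w') + (w - w') by rewrite -addrA [w' + _]addrC subrK.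
apply: spnD=> //.
have : spn D [set` s'] (w - w').
 apply: Ns'; split=> //.
 have ->: w - w' = v - (d *: x + w') by rewrite vE opprD addrACA subrr add0r.
 exact.
by apply: spn_mono=> // y /= ys; rewrite mem_cat ys orbT.
Qed.
Lemma nakayama_fg (D J : set R) (C N B : set V) : subring D ->
 noethm D B -> smod D C -> smod D N -> N `<=` B ->
 (forall a b, D a -> J b -> J (a * b)) -> (forall a b, J a -> J b -> J (a + b)) ->
 J `<=` D -> (forall j, J j -> exists2 c, D c & c * (1 - j) = 1) ->
 N `<=` sadd C (spn J N) -> N `<=` C.
move=> sD nB sC sN NB JM JD JsD Ju H.
have [s [sN' Ns]] := nB N sN NB.
have JS: spn J N `<=` spn J [set` s].
 move=> v; elim=> [|j x w Jj Nx _ IH] //.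
 apply: spnD=> //; apply: spnZ (Ns _ Nx)=> d Dd; by rewrite mulrC; apply: JM.
have Cs: forall x, x \in s -> C x.
 apply: (@nakayama _ _ D J)=> // x /sN' /H[u [w [Cu Sw ->]]].
 by exists u, w.
by move=> v /Ns; apply: spn_min.
Qed.
End FinitelyGenerated.

(** * Adjoining an element *)

Section Hilbert.
Variable R : comNzRingType.
Implicit Types (D : set R) (t : R) (p q : {poly R}).

Definition pcoef D : set {poly R} := [set p | forall i, D p`_i].

Definition adj D t : set R := [set v | exists2 p, pcoef D p & v = p.[t]].
Lemma pcoef_sub D : subring D -> subring (pcoef D).
move=> sD; split=> [i|p q Dp Dq i|p q Dp Dq i].
- by rewrite coef1; case: eqP=> _; [exact: sr1|exact: sr0].
- by rewrite coefB; apply: srB.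
- by rewrite coefM; apply: sr_sum=> // j _; apply: srM.
Qed.
Lemma pcoefC D a : subring D -> D a -> pcoef D a%:P.
by move=> sD Da i; rewrite coefC; case: eqP. Qed.
Lemma pcoefX D : subring D -> pcoef D 'X.
by move=> sD i; rewrite coefX; case: eqP=> _; [exact: sr1|exact: sr0]. Qed.
Lemma adj_subring D t : subring D -> subring (adj D t).
move=> sD; have sP := pcoef_sub sD; split.
- by exists 1; [|rewrite hornerC].
- by move=> _ _ [p Dp ->] [q Dq ->]; exists (p - q); [|rewrite hornerD hornerN].
- by move=> _ _ [p Dp ->] [q Dq ->]; exists (p * q); [|rewrite hornerM].
Qed.
Lemma adj_sub D t : subring D -> D `<=` adj D t.
by move=> sD a; exists a%:P; [exact: pcoefC|rewrite hornerC]. Qed.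
Lemma adj_gen D t : subring D -> adj D t t.
by move=> sD; exists 'X; [exact: pcoefX|rewrite hornerX]. Qed.
Lemma adj_min D D' t : subring D' -> D `<=` D' -> D' t -> adj D t `<=` D'.
move=> sD' DD' D't _ [p Dp ->]; rewrite horner_coef; apply: sr_sum=> // i _.
by apply: srM=> //; exact: DD'.
Qed.
Lemma pcoef_spn D n p : subring D -> pcoef D p -> (size p <= n)%N ->
 spn D [set` [seq 'X^i | i <- iota 0 n]] p.
move=> sD Dp sp; rewrite -[p]coefK poly_def.
apply: smod_sum=> [|i _] //.
apply: spn_mem=> //=.
apply/mapP; exists (val i)=> //; rewrite mem_iota /=.
exact: leq_trans.
Qed.
(** Hilbert's basis argument, run on polynomials that represent the elements of an ideal [I] of
    [D[t]], although [t] may be algebraic. [P n] collects those of size at most [n], [L n] their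
    coefficients of degree [n] one size up. Once [L n0] is maximal, a higher leading term is
    cancelled by a power of [t] times a member of [P n0.+1], a finite [D]-module. *)
Theorem noeth_adj D t : subring D -> noeth D -> noeth (adj D t).
move=> sD nD I sI IA; have sP := pcoef_sub sD.
pose P n : set {poly R} := [set p | [/\ pcoef D p, (size p <= n)%N & I p.[t]]].
have sPn n: smod D (P n).
 split=> [|p q [Dp sp Ip] [Dq sq Iq]|a p Da [Dp sp Ip]].
 - split; [exact: sr0|by rewrite size_poly0|by rewrite horner0].
 - split=> //.
   by apply: leq_trans (size_polyD _ _) _; rewrite geq_max sp.
  by rewrite hornerD.
 - split; first by move=> i; rewrite coefZ; apply: srM.
   exact: leq_trans (size_scale_leq _ _) sp.
  by rewrite hornerZ; apply: smodZ=> //; apply: adj_sub.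
pose L n : set R^o := [set a | exists2 p, P n.+1 p & a = p`_n].
have [||N [n0 ->] n0max] := @noeth_max _ R^o D D [set N | exists n, N = L n] sD nD.
- move=> _ [n ->]; split; last by move=> _ [p [Dp _ _] ->].
 split=> [|_ _ [p Pp ->] [q Pq ->]|a _ Da [p Pp ->]].
 + by exists 0; [|rewrite coef0].
 + by exists (p + q); [|rewrite coefD].
 + by exists (a *: p); [|rewrite coefZ].
- by exists (L 0%N), 0%N.
have LS n: L n `<=` L n.+1.
 move=> _ [p [Dp sp Ip] ->]; exists ('X * p); last by rewrite coefXM.
 split; first exact: (srM sP (pcoefX sD)).
  have [->|p0] := eqVneq p 0; first by rewrite mulr0 size_poly0.
  by rewrite mulrC size_mulX.
 by rewrite hornerM hornerX; apply: (smodZ sI (adj_gen t sD)).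
have Lmono n: (n0 <= n)%N -> L n `<=` L n0.
 move=> le; apply: n0max; first by exists n.
 move/subnK: le=> <-; elim: (n - n0)%N=> [//|k IH]; exact: subset_trans (LS _).
have [|p [Dp sp _]|s [sP0 Ps]] := @fg_noeth _ {poly R} D [seq 'X^i | i <- iota 0 n0.+1] sD nD (P n0.+1)=> //.
- exact: pcoef_spn.
exists [seq p.[t] | p <- s]; split.
 by move=> _ /mapP[p /sP0[_ _ Ip] ->].
have sA := adj_subring t sD.
have sS := @spn_smod _ R^o (adj D t) [set` [seq p.[t] | p <- s]] sA.
suff H n p: P n p -> spn (adj D t) ([set` [seq p.[t] | p <- s]] : set R^o) p.[t].
 by move=> v Iv; have [p Dp vE] := IA _ Iv; rewrite vE; apply: H; split; rewrite -?vE.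
have small r: P n0.+1 r -> spn (adj D t) ([set` [seq p.[t] | p <- s]] : set R^o) r.[t].
 move=> /Ps; elim=> [|d q r' Dd /= qs _ IH]; first by rewrite horner0.
 rewrite hornerD hornerZ; apply: spn_cons=> //; first exact: adj_sub.
 exact: map_f.
elim: n p=> [|n IH] p Pp.
 by apply: small; case: Pp=> Dp; rewrite leqn0=> /eqP s0; split; rewrite // s0.
have [le|lt] := leqP n.+1 n0.+1.
 by apply: small; case: Pp; split=> //; apply: leq_trans le.
have [q [Dq sq Iq] qE]: L n0 p`_n by apply: (Lmono n); [exact: ltnW|exists p].
have Xq: ('X^(n - n0) * q).[t] = t ^+ (n - n0) * q.[t] by rewrite hornerM hornerXn.
have At: adj D t (t ^+ (n - n0)) by apply: srX=> //; apply: adj_gen.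
have ->: p.[t] = (p - 'X^(n - n0) * q).[t] + t ^+ (n - n0) * q.[t] by rewrite hornerD hornerN Xq subrK.
apply: (smodD sS); last by apply: (smodZ sS At); apply: small.
apply: IH; case: Pp=> Dp sp Ip; split.
- exact: (srB sP Dp (srM sP (srX _ sP (pcoefX sD)) Dq)).
- apply/leq_sizeP=> j; rewrite leq_eqVlt=> /orP[/eqP<-|lj].
  by rewrite coefB coefXnM ltnNge leq_subr subKn 1?ltnW // -qE subrr.
 rewrite coefB [p`_j]nth_default ?(leq_trans sp) // coefXnM.
 case: ifP=> _; first by rewrite subr0.
 rewrite [q`_ _]nth_default ?subr0 //; apply: leq_trans sq _.
 by lia.
- rewrite hornerD hornerN Xq; apply: (smodB sA sI)=> //; exact: smodZ.
Qed.
End Hilbert.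

(** * Ideals of subrings of a field *)

Section Ideals.
Variable K : fieldType.
Implicit Types (D I P m : set K) (a b x : K).

Definition ideal D I : Prop := smod D (I : set K^o) /\ I `<=` D.
Definition primei D P : Prop :=
 [/\ ideal D P, ~ P 1 & forall a b, D a -> D b -> P (a * b) -> P a \/ P b].
Definition maxi D m : Prop :=
 [/\ ideal D m, ~ m 1 & forall a, D a -> ~ m a -> exists2 b, D b & m (1 - a * b)].
Lemma ideal0 D I : ideal D I -> I 0. by case=> sI. Qed.
Lemma idealD D I a b : ideal D I -> I a -> I b -> I (a + b).
by case=> sI. Qed.
Lemma idealMl D I a b : ideal D I -> D a -> I b -> I (a * b).
by case=> sI _; apply: (smodZ sI). Qed.
Lemma idealMr D I a b : ideal D I -> D a -> I b -> I (b * a).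
by rewrite mulrC; apply: idealMl. Qed.
Lemma idealN D I a : subring D -> ideal D I -> I a -> I (- a).
by move=> sD [sI]. Qed.
Lemma idealB D I a b : subring D -> ideal D I -> I a -> I b -> I (a - b).
by move=> sD iI Ia Ib; apply: (idealD iI)=> //; apply: idealN. Qed.
Lemma idealS D I a : ideal D I -> I a -> D a. by case=> _; apply. Qed.
Lemma primeX D P a n : subring D -> primei D P -> D a -> P (a ^+ n) -> P a.
move=> sD [iP P1 Pp] Da; elim: n=> [|n IH] //.
by rewrite exprS=> /Pp[|||].
Qed.

Definition idealadd D I a : set K := [set v | exists b c, [/\ I b, D c & v = b + a * c]].
Lemma idealadd_ideal D I a : subring D -> ideal D I -> D a -> ideal D (idealadd D I a).
move=> sD iI Da; split; last first.
 by move=> _ [b [c [/(idealS iI) Db Dc ->]]].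
split.
- by exists 0, 0; rewrite mulr0 addr0; split=> //; exact: ideal0 iI.
- move=> _ _ [b [c [Ib Dc ->]]] [b' [c' [Ib' Dc' ->]]].
 by exists (b + b'), (c + c'); rewrite mulrDr addrACA; split=> //; exact: (idealD iI).
- move=> d _ Dd [b [c [Ib Dc ->]]]; exists (d * b), (d * c).
 split; [exact: (idealMl iI)|exact: srM|by rewrite -[LHS]/(d * _); ring].
Qed.
Lemma idealadd_sub D I a : subring D -> I `<=` idealadd D I a.
by move=> sD b; exists b, 0; rewrite mulr0 addr0. Qed.
Lemma idealadd_mem D I a : subring D -> ideal D I -> idealadd D I a a.
by move=> sD iI; exists 0, 1; rewrite mulr1 add0r; split=> //; exact: ideal0 iI.
Qed.
Lemma ex_maximal D I : subring D -> noeth D -> ideal D I -> ~ I 1 ->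
 exists2 m, maxi D m & I `<=` m.
move=> sD nD iI I1.
have [||m [im Im m1] mmax] := @noeth_max _ K^o D D
 [set J | [/\ ideal D J, I `<=` J & ~ J 1]] sD nD.
- by move=> J [].
- by exists I.
exists m=> //; split=> // a Da ma.
have : idealadd D m a 1.
 apply: contrapT=> n1; apply: ma.
 apply: (mmax); [|exact: idealadd_sub|exact: idealadd_mem].
 split=> //; first exact: idealadd_ideal.
 exact: subset_trans (idealadd_sub _ sD).
by case=> b [c [mb Dc E]]; exists c=> //; rewrite E addrK.
Qed.
Lemma maxi_prime D m : subring D -> maxi D m -> primei D m.
move=> sD [im m1 mm]; split=> // a b Da Db mab.
have [|na] := pselect (m a); [by left|right].
have [c Dc mc] := mm a Da na.
have ->: b = b * (1 - a * c) + c * (a * b) by ring.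
by apply: (idealD im); apply: (idealMl im).
Qed.
Lemma ex_prime_avoiding D I x : subring D -> noeth D -> ideal D I -> D x ->
 (forall n, ~ I (x ^+ n)) -> exists P, [/\ primei D P, I `<=` P & ~ P x].
move=> sD nD iI Dx Ix.
have [||P [iP IP Px] Pmax] := @noeth_max _ K^o D D
 [set J | [/\ ideal D J, I `<=` J & forall n, ~ J (x ^+ n)]] sD nD.
- by move=> J [].
- by exists I.
have add a: D a -> ~ P a -> exists n, idealadd D P a (x ^+ n).
 move=> Da nPa; apply: contrapT=> H; apply: nPa.
 apply: (Pmax); [|exact: idealadd_sub|exact: idealadd_mem].
 split; [exact: idealadd_ideal|exact: subset_trans (idealadd_sub _ sD)|].
 by move=> n Hn; apply: H; exists n.
exists P; split=> //; last by have := Px 1%N.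
split=> //; first by have := Px 0%N.
move=> a b Da Db Pab; apply: contrapT=> /not_orP[/(add _ Da)[n [u [c [Pu Dc En]]]]].
move=> /(add _ Db)[k [u' [c' [Pu' Dc' Ek]]]]; apply: (Px (n + k)%N).
rewrite exprD En Ek.
have ->: (u + a * c) * (u' + b * c') = (u' + b * c') * u + (a * c) * u' + (c * c') * (a * b) by ring.
by apply: (idealD iP); [apply: (idealD iP)|];
 apply: (idealMl iP); do ?[apply: srD|]=> //; apply: (idealS iP).
Qed.

(** * Localization inside the field *)

Definition Loc D P : set K := [set v | exists a s, [/\ D a, D s, ~ P s & v = a / s]].

Section Loc.
Variables (D P : set K).
Hypotheses (sD : subring D) (pP : primei D P).
Let P0 : P 0. by case: pP=> iP _ _; apply: ideal0 iP. Qed.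
Lemma prime_neq0 s : ~ P s -> s != 0.
by move=> Ps; apply/eqP=> s0; apply: Ps; rewrite s0. Qed.
Lemma primeMn s t : D s -> D t -> ~ P s -> ~ P t -> ~ P (s * t).
by case: pP=> _ _ Pp Ds Dt Ps Pt /Pp[]. Qed.
Lemma Loc_sub : D `<=` Loc D P.
by move=> a; exists a, 1; rewrite divr1; case: pP. Qed.
Lemma Loc_inv s : D s -> ~ P s -> Loc D P s^-1.
by move=> Ds; exists 1, s; rewrite div1r. Qed.
Lemma Loc_subring : subring (Loc D P).
split; first exact: Loc_sub.
 move=> _ _ [a [s [Da Ds Ps ->]]] [b [t [Db Dt Pt ->]]].
 exists (a * t - b * s), (s * t); split=> //.
 - exact: primeMn.
 - have := prime_neq0 Ps; have := prime_neq0=> t0 s0; by field; rewrite t0.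
move=> _ _ [a [s [Da Ds Ps ->]]] [b [t [Db Dt Pt ->]]].
exists (a * b), (s * t); split=> //; first exact: primeMn.
by rewrite mulf_div.
Qed.
Lemma Loc_noeth : noeth D -> noeth (Loc D P).
move=> nD I sI IL.
have [||s [sI' Is]] := nD (I `&` D : set K^o)=> //.
- split=> [|a b [Ia Da] [Ib]|a b Da [Ib Db]] //.
 + by split; [apply: idealMl=> //; exact: Loc_sub|exact: srM].
exists s; split; first by move=> a /sI'[].
move=> v Iv; have [a [t [Da Dt Pt vE]]] := IL v Iv.
have aE: a = t * v by rewrite vE mulrCA divff ?mulr1 // prime_neq0.
have ->: v = t^-1 * a by rewrite mulrC.
apply: (@spnZ _ K^o D)=> [d Dd|].
 by apply: srM; [exact: Loc_subring|exact: Loc_inv|exact: Loc_sub].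
apply: Is; split=> //; rewrite aE; apply: idealMl=> //; exact: Loc_sub.
Qed.
Lemma Loc_unit v : Loc D P v -> (v != 0 /\ Loc D P v^-1) \/ (exists a s, [/\ P a, D s, ~ P s & v = a / s]).
case=> a [s [Da Ds Ps ->]]; have [|Pa] := pselect (P a); first by right; exists a, s.
left; rewrite mulf_neq0 ?invr_neq0 ?prime_neq0 //; split=> //.
by exists s, a; rewrite invf_div.
Qed.
End Loc.

End Ideals.
#[local] Hint Resolve pcoef_sub adj_subring Loc_subring : smods.
Ltac closure_more n ::= match goal with
 | |- _ 0=> refine (ideal0 _); eassumption
 | |- _ (- _)=> refine (idealN _ _ _); [|eassumption|closure n]; issub
 | |- _ (_ + _)=> refine (idealD _ _ _); [eassumption|closure n..]
 | |- _ (_ * _)=> first [refine (idealMl _ _ _); [eassumption|closure n..] | refine (idealMr _ _ _); [eassumption|closure n..]]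
 | H : ideal ?D _ |- ?D _=> refine (idealS H _); closure n
 end.

(** * Two-dimensional regular local rings *)

Section Regular.
Variable K : fieldType.
Implicit Types (A D P : set K) (a b x y : K).

Definition mi A x y : set K := [set v | exists b c, [/\ A b, A c & v = x * b + y * c]].

(* [A] is a two-dimensional regular local ring with regular parameters x, y. *)
Record rlr2 A x y : Prop := Rlr2 {
 rlr_sub : subring A;
 rlr_noeth : noeth A;
 rlr_x : A x;
 rlr_y : A y;
 rlr_x0 : x != 0;
 rlr_proper : ~ mi A x y 1;
 rlr_unit : forall a, A a -> ~ mi A x y a -> A a^-1;
 rlr_reg : forall a b, A a -> A b -> y * a = x * b -> exists2 c, A c & a = x * c }.

(* [pi] may be zero, so that fields are allowed. *)
Record dvr D (pi : K) : Prop := Dvr {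
 dvr_subring : subring D;
 dvr_noeth : noeth D;
 dvr_pi : D pi;
 dvr_proper : forall c, D c -> pi * c <> 1;
 dvr_unit : forall a, D a -> (exists2 c, D c & a = pi * c) \/ D a^-1 }.

(** A dichotomy in place of unique factorization: a prime is principal, or has [D :_K P = D], the
    form taken here by depth at least two. Regular local rings of dimension two, discrete valuation
    rings and fields have it, and it is enough for polynomial rings over [D] to be integrally
    closed. *)
Definition good D : Prop := forall P, primei D P ->
 (exists2 g, P g & forall a, P a -> exists2 c, D c & a = g * c) \/
 (forall f, (forall a, P a -> D (a * f)) -> D f).
Lemma mi_swap A x y : mi A x y = mi A y x.
by apply/seteqP; split=> v [b [c [Ab]]]; exists c, b; rewrite addrC.
Qed.
Lemma rlr2_sym A x y : rlr2 A x y -> rlr2 A y x.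
move=> [sA nA Ax Ay x0 pr un reg]; rewrite mi_swap in pr un; split=> //.
- apply/eqP=> y0; have [|c Ac E] := reg 1 0 (sr1 sA) (sr0 sA).
  by rewrite y0 mul0r mulr0.
 by apply: pr; exists 0, c; rewrite mulr0 add0r.
- move=> a b Aa Ab E; have [c Ac bE] := reg b a Ab Aa (esym E).
 by exists c=> //; apply: (mulfI x0); rewrite E bE; ring.
Qed.

Section Rlr2.
Variables (A : set K) (x y : K).
Hypothesis rA : rlr2 A x y.
Let sA := rlr_sub rA.
Let Ax := rlr_x rA.
Let Ay := rlr_y rA.
Lemma mi_ideal : ideal A (mi A x y).
split; last move=> _ [b [c [Ab Ac ->]]] //.
split.
- by exists 0, 0; rewrite !mulr0 addr0.
- move=> _ _ [b [c [Ab Ac ->]]] [b' [c' [Ab' Ac' ->]]].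
 by exists (b + b'), (c + c'); rewrite !mulrDr addrACA.
- move=> a _ Aa [b [c [Ab Ac ->]]]; exists (a * b), (a * c); split=> //.
 by rewrite -[LHS]/(a * _); ring.
Qed.
Lemma mi_x b : A b -> mi A x y (x * b).
by move=> Ab; exists b, 0; rewrite mulr0 addr0. Qed.
Lemma mi_y b : A b -> mi A x y (y * b).
by move=> Ab; exists 0, b; rewrite mulr0 add0r. Qed.
Lemma mi_gx : mi A x y x.
by rewrite -[X in _ X]mulr1; apply: mi_x. Qed.
Lemma mi_gy : mi A x y y.
by rewrite -[X in _ X]mulr1; apply: mi_y. Qed.
Lemma mi_maxi : maxi A (mi A x y).
split; [exact: mi_ideal|exact: rlr_proper|move=> a Aa ma].
exists a^-1; first exact: (rlr_unit rA).
rewrite divff ?subrr; first exact: ideal0 mi_ideal.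
by apply/eqP=> a0; apply: ma; rewrite a0; apply: ideal0 mi_ideal.
Qed.
Lemma mi_prime : primei A (mi A x y). exact: maxi_prime mi_maxi. Qed.
Lemma mi_neq0 a : ~ mi A x y a -> a != 0.
by move=> ma; apply/eqP=> a0; apply: ma; rewrite a0; apply: ideal0 mi_ideal. Qed.
Lemma proper_mi P : ideal A P -> ~ P 1 -> P `<=` mi A x y.
move=> iP P1 a Pa; apply: contrapT=> ma; apply: P1.
rewrite -(mulVf (mi_neq0 ma)); apply: (idealMl iP)=> //.
by apply: (rlr_unit rA)=> //; apply: idealS Pa.
Qed.
Lemma mi_1B j : mi A x y j -> exists2 c, A c & c * (1 - j) = 1.
move=> mj; have mn: ~ mi A x y (1 - j) by move=> H; apply: (rlr_proper rA); rewrite -[1](subrK j); apply: (idealD mi_ideal).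
exists (1 - j)^-1; last by rewrite mulVf // mi_neq0.
apply: (rlr_unit rA)=> //; apply: srB=> //; exact: (idealS mi_ideal).
Qed.
Lemma rlr_nakayama (C N : set K) : ideal A C -> ideal A N ->
 (forall v, N v -> exists u w, [/\ C u, N w & exists2 j, mi A x y j & v = u + j * w]) ->
 N `<=` C.
move=> [sC CA] [sN NA] H.
apply: (@nakayama_fg _ K^o A (mi A x y) C N A)=> //.
- exact: (rlr_noeth rA).
- by move=> a b; apply: (idealMl mi_ideal).
- by move=> a b; apply: (idealD mi_ideal).
- by case: mi_ideal.
- exact: mi_1B.
- move=> v /H[u [w [Cu Nw [j mj ->]]]]; exists u, (j * w); split=> //.
 exact: spn_mem.
Qed.
Lemma xmul_ideal (I : set K) a : A a -> ideal A I -> ideal A [set v | exists2 c, I c & v = a * c].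
move=> Aa iI; split; last by move=> _ [c Ic ->].
split.
- by exists 0; rewrite ?mulr0.
- by move=> _ _ [c Ic ->] [d Id ->]; exists (c + d); rewrite ?mulrDr.
- by move=> b _ Ab [c Ic ->]; exists (b * c); [|rewrite -[LHS]/(b * _); ring].
Qed.
Lemma ring_ideal : ideal A A.
by split=> //; split=> [||a b]=> //; exact: srM. Qed.
(** [A / x] is a valuation ring with parameter [y]: the elements lying in [x A + y^k A] for every
    [k] form an ideal [N] inside [x A + m N], because [y] is regular modulo [x], and Nakayama puts
    [N] into [x A]. *)
Lemma rlr_yadic a : A a -> ~ (exists2 c, A c & a = x * c) ->
 exists k u c, [/\ A u, ~ mi A x y u, A c & a = y ^+ k * u + x * c].
move=> Aa nxa; apply: contrapT=> H.
pose Y k := [set v | exists u c, [/\ A u, A c & v = y ^+ k * u + x * c]].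
have Yall k: Y k a.
 elim: k=> [|k [u [c [Au Ac E]]]].
  by exists a, 0; rewrite mul1r mulr0 addr0.
 have [[b [b' [Ab Ab' uE]]]|mu] := pselect (mi A x y u); last by case: H; exists k, u, c.
 exists b', (y ^+ k * b + c); split=> //.
 by rewrite E uE exprS; ring.
pose N := [set v | A v /\ forall k, Y k v].
have iN: ideal A N.
 split; last by move=> v [].
 split.
 - split=> [|k] //.
  by exists 0, 0; rewrite !mulr0 addr0.
 - move=> u v [Au Hu] [Av Hv]; split=> [|k] //.
  have [p [q [Ap Aq ->]]] := Hu k; have [p' [q' [Ap' Aq' ->]]] := Hv k.
  by exists (p + p'), (q + q'); rewrite !mulrDr addrACA.
 - move=> u v Au [Av Hv]; split=> [|k]; first exact: srM.
  have [p [q [Ap Aq ->]]] := Hv k; exists (u * p), (u * q); split=> //.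
  by rewrite -[LHS]/(u * _); ring.
have := rlr_nakayama (xmul_ideal Ax ring_ideal) iN; move=> /(_ _ a) HN.
apply: nxa; have [||c] := HN=> //; last by exists c.
move=> v [Av Yv]; have [u [c [Au Ac E]]] := Yv 1%N.
exists (x * c), u; split; [by exists c| |by exists y; [exact: mi_gy|rewrite addrC]].
split=> // k; have [u' [c' [Au' Ac' E']]] := Yv k.+1.
have [|||d Ad uE] := rlr_reg rA (a := u - y ^+ k * u') (b := c' - c)=> //.
- apply: (addIr (x * c)); transitivity (y ^+ 1 * u + x * c - y ^+ k.+1 * u').
  by rewrite [y ^+ k.+1]exprS; ring.
 by rewrite -E E'; ring.
by exists u', d; rewrite -uE addrC subrK.
Qed.
(** An element [h] of [P] of least [y]-adic order modulo [x] divides the others modulo [x]; the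
    remainder is [x] times an element of [P], as [x] is outside [P]. So [P] lies in [h A + x P], and
    Nakayama applies. *)
Lemma prime_principal_aux P : primei A P -> ~ P x ->
 exists2 g, P g & forall a, P a -> exists2 c, A c & a = g * c.
move=> pP nPx; have [iP P1 Pp] := pP.
have Pdiv c: A c -> P (x * c) -> P c by move=> Ac /Pp[].
have PA a: P a -> A a by apply: idealS.
suff [h Ph Hh]: exists2 h, P h & forall a, P a -> exists2 c, A c & exists2 d, P d & a = h * c + x * d.
 exists h=> //; apply: (rlr_nakayama (xmul_ideal (PA _ Ph) ring_ideal) iP).
 move=> a /Hh[c Ac [d Pd ->]].
 by exists (h * c), d; split=> //; [exists c|exists x=> //; apply: mi_gx].
have [allx|] := pselect (forall a, P a -> exists2 c, A c & a = x * c).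
 exists 0=> //.
 move=> a Pa; have [c Ac E] := allx a Pa; exists 0=> //.
 by exists c; [apply: Pdiv=> //; rewrite -E|rewrite mul0r add0r].
move=> /existsNP[a0 /not_implyP[Pa0 na0]].
pose Q k := `[< exists h u c, [/\ P h, A u, ~ mi A x y u, A c & h = y ^+ k * u + x * c] >].
have exQ: exists k, Q k.
 have [k [u [c [Au mu Ac E]]]] := rlr_yadic (PA _ Pa0) na0.
 by exists k; apply/asboolP; exists a0, u, c.
case: (ex_minnP exQ)=> k /asboolP[h [u [c [Ph Au mu Ac hE]]]] kmin.
exists h=> // a Pa.
have [[d Ad E]|na] := pselect (exists2 c, A c & a = x * c).
 exists 0=> //.
 by exists d; [apply: Pdiv=> //; rewrite -E|rewrite mulr0 add0r].
have [j [v [d [Av mv Ad aE]]]] := rlr_yadic (PA _ Pa) na.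
have kj: (k <= j)%N by apply: kmin; apply/asboolP; exists a, v, d.
have Au': A u^-1 by apply: (rlr_unit rA).
exists (y ^+ (j - k) * v * u^-1)=> //.
have E: a = h * (y ^+ (j - k) * v * u^-1) + x * (d - c * (y ^+ (j - k) * v * u^-1)).
 rewrite hE aE -{1}(subnK kj) exprD; have u0 := mi_neq0 mu; by field.
exists (d - c * (y ^+ (j - k) * v * u^-1))=> //.
apply: Pdiv=> //.
rewrite [X in P X](_ : _ = a - h * (y ^+ (j - k) * v * u^-1)) //.
by rewrite {1}E addrAC subrr add0r.
Qed.
End Rlr2.
Lemma prime_principal A x y P : rlr2 A x y -> primei A P -> ~ (P x /\ P y) ->
 exists2 g, P g & forall a, P a -> exists2 c, A c & a = g * c.
move=> rA pP H; have [Px|] := pselect (P x); last exact: (prime_principal_aux rA).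
by apply: (prime_principal_aux (rlr2_sym rA))=> // Py; apply: H.
Qed.
Lemma rlr2_good A x y : (forall k, exists a b, [/\ A a, A b & k = a / b]) -> rlr2 A x y -> good A.
move=> KA rA P pP.
have [[Px Py]|H] := pselect (P x /\ P y); last by left; apply: prime_principal H.
right=> f Hf.
have [c Ac E] := rlr_reg rA (Hf x Px) (Hf y Py) (mulrCA _ _ _).
by rewrite (mulfI (rlr_x0 rA) E).
Qed.
(** Powers of [pi] are removed from [a] and [b] until one cofactor is a unit or zero. This stops: if
    [(u, v)] is largest among the ideals of cofactors and [u = pi u'], [v = pi v'], then [(u', v')]
    lies in [pi (u', v')] and vanishes by Nakayama. *)
Lemma dvr_total D pi a b : dvr D pi -> D a -> D b ->
 (exists2 c, D c & b = a * c) \/ (exists2 c, D c & a = b * c).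
move=> [sD nD Dpi pr un] Da Db.
pose I u v := [set w | exists p q, [/\ D p, D q & w = u * p + v * q]].
have iI u v: D u -> D v -> ideal D (I u v).
 move=> Du Dv; split; last by move=> _ [p [q [Dp Dq ->]]].
 split.
 - by exists 0, 0; rewrite !mulr0 addr0.
 - move=> _ _ [p [q [Dp Dq ->]]] [p' [q' [Dp' Dq' ->]]].
  by exists (p + p'), (q + q'); rewrite !mulrDr addrACA.
 - move=> d _ Dd [p [q [Dp Dq ->]]]; exists (d * p), (d * q); split=> //.
  by rewrite -[LHS]/(d * _); ring.
have [||_ [u [v [k [Du Dv aE bE ->]]]] mx] := @noeth_max _ K^o D D
 [set J | exists u v k, [/\ D u, D v, a = pi ^+ k * u, b = pi ^+ k * v & J = I u v]] sD nD.
- by move=> _ [u [v [k [Du Dv _ _ ->]]]]; apply: iI.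
- by exists (I a b), a, b, 0%N; rewrite !mul1r.
have unit_case s t: D s -> D t -> D s^-1 -> s != 0 -> exists2 c, D c & t = s * c by move=> Ds; exists (s^-1 * t); [|rewrite mulrA divff ?mul1r].
have [u0|u0] := eqVneq u 0.
 by right; exists 0; [|rewrite aE u0 !mulr0].
have [v0|v0] := eqVneq v 0.
 by left; exists 0; [|rewrite bE v0 !mulr0].
have [[u' Du' uE]|Dui] := un u Du; last first.
 left; have [c Dc E] := unit_case u v Du Dv Dui u0; exists c=> //.
 by rewrite aE bE E mulrA.
have [[v' Dv' vE]|Dvi] := un v Dv; last first.
 right; have [c Dc E] := unit_case v u Dv Du Dvi v0; exists c=> //.
 by rewrite aE bE E mulrA.
exfalso; move/eqP: u0; apply; rewrite uE.
suff : I u' v' `<=` [set 0].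
 move=> /(_ u') ->; first by rewrite mulr0.
 by exists 1, 0; rewrite mulr1 mulr0 addr0.
have sub: I u' v' `<=` I u v.
 apply: mx.
  exists u', v', k.+1; rewrite aE bE uE vE exprSr -!mulrA //.
 move=> _ [p [q [Dp Dq ->]]]; exists (pi * p), (pi * q); split=> //; rewrite uE vE; ring.
have [sI' II'] := iI _ _ Du' Dv'.
pose J := [set j | exists2 c, D c & j = pi * c].
apply: (@nakayama_fg _ K^o D J [set 0] (I u' v') D)=> //.
- by move=> s _ Ds [c Dc ->]; exists (s * c); [|ring].
- by move=> _ _ [c Dc ->] [d Dd ->]; exists (c + d); [|rewrite mulrDr].
- by move=> _ [c Dc ->].
- move=> _ [c Dc ->]; have D1: D (1 - pi * c) by [].
 have nz: 1 - pi * c != 0 by rewrite subr_eq0 eq_sym; apply/eqP; apply: pr.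
 exists (1 - pi * c)^-1; last by rewrite mulVf.
 have [[d Dd E]|//] := un _ D1.
 exfalso; apply: (pr (c + d))=> //.
 by rewrite mulrDr -E addrC subrK.
- move=> w /sub[p [q [Dp Dq ->]]]; exists 0, (pi * (u' * p + v' * q)); split=> //.
  by apply: spn_mem; [exists 1; rewrite ?mulr1|exists p, q].
 by rewrite uE vE; ring.
Qed.
Lemma dvr_good D pi : dvr D pi -> good D.
move=> dD P [iP P1 Pp]; have [sD nD Dpi pr un] := dD; left.
have [s [sP Ps]] := nD P (proj1 iP) (proj2 iP).
have Ds v: v \in s -> D v by move=> /sP; apply: idealS.
have [g Pg Hg]: exists2 g, P g & forall v, v \in s -> exists2 c, D c & v = g * c.
 elim: s sP Ds {Ps} => [|v s IH] sP Ds; first by exists 0.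
 have [w ws|w ws|g Pg Hg] := IH; [by apply: sP; rewrite inE ws orbT|by apply: Ds; rewrite inE ws orbT|].
 have [|[c Dc E]|[c Dc E]] := dvr_total dD (Ds _ (mem_head v s)) (b := g).
 - exact: idealS Pg.
 - exists v; first exact: sP.
  move=> w; rewrite inE=> /orP[/eqP->|/Hg[d Dd ->]].
   by exists 1; rewrite ?mulr1.
  by exists (c * d); [|rewrite E mulrA].
 - exists g=> // w; rewrite inE=> /orP[/eqP->|/Hg//].
  by exists c.
exists g=> // a /Ps; elim=> [|d w v Dd ws _ [c Dc ->]].
 by exists 0; [|rewrite mulr0].
have [c' Dc' ->] := Hg w ws.
exists (d * c' + c)=> //.
by rewrite -[_ *: _]/(d * (g * c')); ring.
Qed.
End Regular.

(** * Length *)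

Section Length.
Variables (R : comPzRingType) (V : lmodType R).
Implicit Types (D : set R) (C M B : set V) (n : nat).

Definition chain D C B n : Prop := exists N : nat -> set V,
 [/\ C `<=` N 0%N, N n `<=` B, forall i, (i <= n)%N -> smod D (N i)
  & forall i, (i < n)%N -> N i `<` N i.+1].

(* [B / C] has length [n]. *)
Definition flen D C B n : Prop := chain D C B n /\ ~ chain D C B n.+1.
Lemma chain0 D C B : smod D B -> C `<=` B -> chain D C B 0.
by move=> CB; exists (fun=> B). Qed.
Lemma chain_ltn D C B n k : (k <= n)%N -> chain D C B n -> chain D C B k.
move=> /subnK <-; elim: (n - k)%N=> [//|j IH] [N [CN NB sN pN]]; apply: IH.
exists N; split=> //; first by apply: subset_trans NB; case: (pN (j + k)%N).
- by move=> i ij; apply: sN; apply: leq_trans.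
- by move=> i ij; apply: pN; apply: leq_trans.
Qed.
Lemma chain_sub D C C' B B' n : C' `<=` C -> B `<=` B' -> chain D C B n -> chain D C' B' n.
by move=> CC BB [N [CN]]; exists N; split=> //;
 [apply: subset_trans CN|apply: subset_trans BB].
Qed.
Lemma chain_incl D C B n : chain D C B n -> C `<=` B.
by move=> /(chain_ltn (leq0n n))[N [CN NB _ _]]; apply: subset_trans NB. Qed.
Lemma chain_rcons D C M B n : smod D B -> M `<` B -> chain D C M n -> chain D C B n.+1.
move=> sB [MB nBM] [N [CN NB sN pN]].
exists (fun i=> if (i <= n)%N then N i else B); rewrite ltnn; split=> //.
- by move=> i; case: ifP=> [|].
- move=> i; rewrite ltnS=> iin; rewrite iin.
 case: ifP=> [|]; first exact: pN.
 move/negbT; rewrite -leqNgt=> ni.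
 have ->: i = n by apply/eqP; rewrite eqn_leq iin.
 split; first exact: subset_trans MB.
 by move=> BN; apply: nBM; apply: subset_trans NB.
Qed.
Lemma chain_count D C (f : nat -> set V) n : (forall i, smod D (f i)) ->
 (forall i, f i `<=` f i.+1) -> C `<=` f 0%N ->
 chain D C (f n) (\sum_(i < n) ~~ `[< f i.+1 `<=` f i >]).
move=> sf fS Cf; elim: n=> [|n IH]; first by rewrite big_ord0; apply: chain0.
rewrite big_ord_recr /=; case: asboolP=> [H|H] /=.
 by rewrite addn0; apply: chain_sub IH.
by rewrite addn1; apply: chain_rcons.
Qed.
(** By the modular law a strict step of a chain is strict in its traces on [M] or in its sums with
    [M], and [chain_count] turns the strict steps of either family into a chain. *)
Lemma chain_split D C M B n : subring D -> smod D C -> smod D M -> C `<=` M -> M `<=` B -> smod D B ->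
 chain D C B n -> exists a b, [/\ chain D C M a, chain D M B b & (n <= a + b)%N].
move=> sD sC sM CM MB sB [N [CN NB sN pN]].
pose N' i := N (minn i n).
have sN' i: smod D (N' i) by apply: sN; apply: geq_minr.
have N'S i: N' i `<=` N' i.+1.
 rewrite /N'; case: ltnP=> h.
  by rewrite (minn_idPl h); case: (pN i).
 by rewrite (minn_idPr _) // ltnW.
have CN': C `<=` N' 0%N by rewrite /N' min0n.
have N'B: N' n `<=` B by rewrite /N' minnn.
pose f i := N' i `&` M; pose g i := sadd M (N' i).
exists (\sum_(i < n) ~~ `[< f i.+1 `<=` f i >])%N, (\sum_(i < n) ~~ `[< g i.+1 `<=` g i >])%N; split.
- apply: (@chain_sub D C C (f n))=> //; first by move=> v [].
 apply: chain_count=> //.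
  by move=> i v [/N'S].
 by move=> v; split; [exact: CN'|exact: CM].
- apply: (@chain_sub D M M (g n))=> //; first exact: sadd_min.
 apply: chain_count=> //.
  by move=> i _ [u [w [Mu /N'S Nw ->]]]; exists u, w.
 exact: saddl.
rewrite -big_split /= -{1}(card_ord n) -sum1_card; apply: leq_sum=> i _.
case: asboolP=> [Hf|]; case: asboolP=> [Hg|] //=; exfalso.
have [_] := pN i (ltn_ord i); apply=> v.
have ->: N i.+1 = N' i.+1 by rewrite /N' (minn_idPl (ltn_ord i)).
have ->: N i = N' i by rewrite /N' (minn_idPl (ltnW (ltn_ord i))).
move=> Nv; have [u [w [Mu Nw vE]]] := Hg _ (saddr sM Nv).
have Mu': f i.+1 u.
 split=> //; have ->: u = v - w by rewrite vE addrK.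
 by apply: smodB=> //; exact: N'S.
by rewrite vE; case: (Hf _ Mu').
Qed.
Lemma chain_cat D C M B a b : chain D C M a -> chain D M B b -> chain D C B (a + b).
move=> c1 [N [MN NB sN pN]]; elim: b B NB sN pN=> [|b IH] B NB sN pN.
 by rewrite addn0; apply: chain_sub c1=> //; apply: subset_trans NB.
rewrite addnS; apply: (@chain_sub D C C (N b.+1))=> //.
apply: (chain_rcons (sN _ (leqnn _)) (pN b (ltnSn _))).
by apply: IH=> // i ib; [apply: sN|apply: pN]; apply: ltnW.
Qed.
Lemma flen_uniq D C B n k : flen D C B n -> flen D C B k -> n = k.
move=> [cn nn] [ck nk]; apply/eqP; rewrite eqn_leq; apply/andP; split;
rewrite leqNgt; apply/negP=> h; [apply: nk; exact: chain_ltn cn|apply: nn; exact: chain_ltn ck].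
Qed.
Lemma flen_add D C M B a b : subring D -> smod D C -> smod D M -> smod D B ->
 flen D C M a -> flen D M B b -> flen D C B (a + b).
move=> sD sC sM sB [ca na] [cb nb]; split; first exact: chain_cat cb.
move=> /(chain_split sD sC sM (chain_incl ca) (chain_incl cb) sB)[a' [b' [ca' cb' le]]].
have ha: (a' <= a)%N by rewrite leqNgt; apply/negP=> h; apply: na; apply: chain_ltn h _.
have hb: (b' <= b)%N by rewrite leqNgt; apply/negP=> h; apply: nb; apply: chain_ltn h _.
by have := leq_trans le (leq_add ha hb); rewrite ltnn.
Qed.
Lemma chain_bound_add D C M B a b : subring D -> smod D C -> smod D M -> smod D B ->
 C `<=` M -> M `<=` B ->
 ~ chain D C M a -> ~ chain D M B b -> ~ chain D C B (a + b).
move=> sD sC sM sB CM MB na nb /(chain_split sD sC sM CM MB sB)[a' [b' [ca' cb' le]]].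
have ha: (a' < a)%N by rewrite ltnNge; apply/negP=> h; apply: na; apply: chain_ltn h _.
have hb: (b' < b)%N by rewrite ltnNge; apply/negP=> h; apply: nb; apply: chain_ltn h _.
by have := leq_trans (leq_add ha (ltnW hb)) le; rewrite ltnn.
Qed.
Lemma flen_exists D C B n : smod D B -> C `<=` B -> ~ chain D C B n -> exists k, flen D C B k.
move=> sB CB nn; pose P k := `[< chain D C B k >].
have P0: exists k, P k by exists 0%N; apply/asboolP; apply: chain0.
have Pb k: P k -> (k <= n)%N by move=> /asboolP c; rewrite leqNgt; apply/negP=> h; apply: nn; apply: chain_ltn (ltnW h) c.
case: (ex_maxnP P0 Pb)=> k /asboolP ck kmax; exists k; split=> // ck1.
by have := kmax k.+1 (asboolT ck1); rewrite ltnn.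
Qed.
Lemma flen_split D C M B n : subring D -> smod D C -> smod D M -> smod D B ->
 C `<=` M -> M `<=` B -> flen D C B n ->
 exists a b, [/\ flen D C M a, flen D M B b & n = (a + b)%N].
move=> sD sC sM sB CM MB fl; have [cn nn] := fl.
have [|a fa] := @flen_exists D C M n.+1 sM CM; first by move=> /(chain_sub (@subset_refl _ C) MB).
have [|b fb] := @flen_exists D M B n.+1 sB MB; first by move=> /(chain_sub CM (@subset_refl _ B)).
by exists a, b; split=> //; apply: (flen_uniq fl); apply: flen_add fb.
Qed.
Lemma flen0P D C B : smod D C -> smod D B -> C `<=` B -> flen D C B 0 -> B `<=` C.
move=> sC sB CB [_ n1]; apply: contrapT=> H; apply: n1.
by apply: (@chain_rcons D C C)=> //; apply: chain0.
Qed.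
Lemma flen_refl D C : smod D C -> flen D C C 0.
move=> sC; split; first exact: chain0.
case=> N [CN NB sN pN]; have [_] := pN 0%N isT; apply.
exact: subset_trans CN.
Qed.
Lemma chain_simple D C v : subring D -> smod D C ->
 (forall a, D a -> C (a *: v) \/ exists2 b, D b & b * a = 1) ->
 ~ chain D C (sadd C (spn D [set v])) 2.
move=> sD sC Hv [N [CN NB sN pN]].
have spv w: spn D [set v] w -> exists2 d, D d & w = d *: v.
 elim=> [|d x u Dd -> _ [e De ->]]; first by exists 0; [|rewrite scale0r].
 by exists (d + e); [|rewrite scalerDl].
have [N01 n01] := pN 0%N isT; have [N12 n12] := pN 1%N isT.
apply: n12; have Nv: N 1%N v.
 apply: contrapT=> Nv; apply: n01=> w Nw.
 have [u [_ [Cu /spv[d Dd ->] wE]]] := NB _ (N12 _ Nw).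
 have [Cdv|[b Db bd]] := Hv d Dd; first by apply: CN; rewrite wE.
 exfalso; apply: Nv; have ->: v = b *: (w - u) by rewrite wE addrAC subrr add0r scalerA bd scale1r.
 apply: (smodZ (sN 1%N isT))=> //; apply: (smodB sD (sN 1%N isT))=> //.
 by apply: N01; apply: CN.
move=> w /NB[u [_ [Cu /spv[d Dd ->] ->]]].
apply: (smodD (sN 1%N isT)); first by apply: N01; apply: CN.
exact: (smodZ (sN 1%N isT)).
Qed.
Lemma chain_fg_bound D C (s : seq V) : subring D -> smod D C ->
 (forall v a, v \in s -> D a -> C (a *: v) \/ exists2 b, D b & b * a = 1) ->
 exists n, ~ chain D C (sadd C (spn D [set` s])) n.
move=> sD sC; elim: s=> [|v s IH] H.
 exists 1%N; case=> N [CN NB sN pN]; have [_] := pN 0%N isT; apply.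
 by move=> w /NB[u [_ [Cu /spn_nilP -> ->]]].
have [|n Hn] := IH; first by move=> w a ws; apply: H; rewrite inE ws orbT.
exists (n + 2)%N; apply: chain_bound_add Hn _=> //.
- exact: saddl.
- move=> _ [u [w [Cu Sw ->]]]; exists u, w; split=> //.
 by apply: spn_mono Sw=> // z /= zs; rewrite inE zs orbT.
move=> c; apply: (@chain_simple D (sadd C (spn D [set` s])) v)=> //.
 move=> a Da; have [Ca|] := H v a (mem_head _ _) Da; last by right.
 by left; apply: saddl.
apply: chain_sub c=> // _ [u [w [Cu /(spn_consP sD)[d [w' [Dd Sw' ->]]] ->]]].
exists (u + w'), (d *: v); split; [by exists u, w'|exact: spn_mem|].
by rewrite addrCA [u + _ + _]addrC.
Qed.
End Length.

Section LengthMap.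
Variables (R : comPzRingType) (V V' : lmodType R) (f : {linear V -> V'}).
Variables (D : set R) (C B : set V) (C' B' : set V').
Hypotheses (sD : subring D) (sC : smod D C) (sB : smod D B) (sC' : smod D C') (sB' : smod D B').
Hypotheses (CB' : C' `<=` B') (fB : forall b, B b -> B' (f b))
 (B'f : forall v, B' v -> exists u b, [/\ C' u, B b & v = u + f b])
 (fC : forall b, B b -> (C' (f b) <-> C b)).
(** The hypotheses say that [f] induces an isomorphism from [B / C] onto [B' / C']; chains are moved
    by images enlarged by [C'], and back by preimages in [B]. *)
Lemma chain_map n : C `<=` B -> chain D C B n <-> chain D C' B' n.
move=> CB; split=> -[N [CN NB sN pN]].
 have NnB i: (i <= n)%N -> N i `<=` B.
  move=> iin; apply: subset_trans NB; move/subnK: (iin)=> <-.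
  suff H k: (k + i <= n)%N -> N i `<=` N (k + i)%N by apply: H; rewrite subnK.
  elim: k=> [|k IH] ki //.
  apply: subset_trans (IH (ltnW ki)) _.
  by case: (pN (k + i)%N).
 exists (fun i=> sadd C' [set v | exists2 w, N i w & v = f w]); split.
 - apply: (@saddl _ _ D); split=> [|_ _ [u Nu ->] [w Nw ->]|a _ Da [w Nw ->]].
  + by exists 0; [|rewrite linear0].
  + by exists (u + w); [exact: (smodD (sN 0%N _))|rewrite linearD].
  + by exists (a *: w); [exact: (smodZ (sN 0%N _))|rewrite linearZ].
 - apply: (sadd_min sB' CB')=> _ [w Nw ->]; apply: fB; exact: NB.
 - move=> i iin; apply: sadd_smod=> //; split=> [|_ _ [u Nu ->] [w Nw ->]|a _ Da [w Nw ->]].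
  + by exists 0; [|rewrite linear0].
  + by exists (u + w); [|rewrite linearD].
  + by exists (a *: w); [|rewrite linearZ].
 - move=> i iin; have [sub nsub] := pN i iin; split.
   by move=> _ [u [_ [Cu [w Nw ->] ->]]]; exists u, (f w); split=> //; exists w=> //; apply: sub.
  move=> H; apply: nsub=> v Nv.
  have [|u [_ [Cu [w Nw ->] E]]] := H (f v).
   by exists 0, (f v); rewrite add0r; split; [|exists v|].
  have /fC CC: B (v - w) by apply: (smodB sD sB); [exact: NnB Nv|exact: NnB (ltnW iin) _ Nw].
  rewrite -(subrK w v); apply: (smodD (sN i (ltnW iin)))=> //.
  have NC: C `<=` N i.
   apply: subset_trans CN _; rewrite -[i]addn0.
   elim: (i) (ltnW iin)=> [|k IH] kn //.
   apply: subset_trans (IH (ltnW kn)) _.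
   by rewrite addSn; case: (pN k%N); rewrite ?addn0.
  by apply: NC; apply/CC; rewrite linearB E addrK.
exists (fun i=> B `&` [set w | N i (f w)]); split=> //.
- by move=> v; split; [exact: CB|apply: CN; apply/fC=> //; apply: CB].
- move=> i iin; split=> [|u v [Bu Nu] [Bv Nv]|a v Da [Bv Nv]]; split=> //.
 + by rewrite /= linear0.
 + by rewrite /= linearD.
 + by rewrite /= linearZ; apply: smodZ.
- move=> i iin; have [sub nsub] := pN i iin; split; first by move=> v [Bv /sub].
 move=> H; apply: nsub=> v Nv.
 have CNi k: (k <= n)%N -> C' `<=` N k.
  elim: k=> [|k IH] kn //.
  apply: subset_trans (IH (ltnW kn)) _.
  by case: (pN k).
 have NnB: N i.+1 `<=` B'.
  apply: subset_trans NB; move/subnK: (iin)=> <-.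
  suff H' k: (k + i.+1 <= n)%N -> N i.+1 `<=` N (k + i.+1)%N by apply: H'; rewrite subnK.
  elim: k=> [|k IH] ki //.
  apply: subset_trans (IH (ltnW ki)) _.
  by case: (pN (k + i.+1)%N).
 have [u [b [Cu Bb vE]]] := B'f (NnB _ Nv).
 have [|_ Nfb] := H b.
  split=> //=; have ->: f b = v - u by rewrite vE addrAC subrr add0r.
  by apply: smodB=> //; apply: CNi.
 by rewrite vE; apply: (smodD (sN _ (ltnW iin)))=> //; apply: CNi=> //; apply: ltnW.
Qed.
Lemma flen_map n : C `<=` B -> flen D C B n <-> flen D C' B' n.
by move=> CB; rewrite /flen !chain_map. Qed.
End LengthMap.

(** * Blowing up the maximal ideal *)

Section PolyCoef.
Variable K : fieldType.
Implicit Types (A P : set K) (p q r : {poly K}).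
Lemma monic_division A p q : subring A -> pcoef A p -> pcoef A q -> p \is monic ->
 exists d r, [/\ pcoef A d, pcoef A r, q = p * d + r & (size r < size p)%N].
move=> sA Ap Aq mp.
have p0: (0 < size p)%N by rewrite size_poly_gt0 monic_neq0.
elim: {q}size {-2}q (leqnn (size q)) Aq=> [|n IH] q sq Aq.
 exists 0, q; split=> //; first by rewrite mulr0 add0r.
 by move: sq; rewrite leqn0=> /eqP ->.
have [lt|le] := ltnP (size q) (size p).
 by exists 0, q; rewrite mulr0 add0r.
have sq0: (0 < size q)%N by apply: leq_trans le.
pose m : {poly K} := lead_coef q *: 'X^(size q - size p).
have Am: pcoef A m by move=> i; rewrite coefZ coefXn; case: eqP=> _; rewrite ?mulr1 ?mulr0; [exact: Aq|].
have [||d [r [Ad Ar E lt]]] := IH (q - p * m)=> //.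
- apply/leq_sizeP=> j nj; have [gt|] := ltnP (size q).-1 j.
  rewrite coefB [q`_j]nth_default; last by rewrite -(prednK sq0).
  rewrite nth_default ?subr0 //.
  apply: leq_trans (size_polyMleq _ _) _.
  have : (size m <= (size q - size p).+1)%N.
   by apply: leq_trans (size_scale_leq _ _) _; rewrite size_polyXn.
  move=> h; have := leq_add (leqnn (size p)) h; rewrite addnS subnKC // => h2.
  by rewrite -subn1 leq_subLR; apply: leq_trans h2 _; rewrite -(prednK sq0).
 rewrite leq_eqVlt=> /orP[/eqP ->|]; last by move: sq; lia.
 have := lead_coefM p m; rewrite (monicP mp) mul1r.
 rewrite {2}/m lead_coefZ lead_coefXn mulr1=> H.
 have lq0: lead_coef q != 0 by rewrite lead_coef_eq0 -size_poly_gt0.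
 have smm: size (p * m) = size q.
  rewrite size_monicM ?scaler_eq0 ?negb_or ?lq0 ?monic_neq0 ?monicXn //.
  rewrite size_scale // size_polyXn; lia.
 by rewrite coefB -{2}smm -!lead_coefE H subrr.
exists (d + m), r; split=> //.
by rewrite mulrDr addrAC -E subrK.
Qed.
(** Induction on the total size: a leading coefficient in [P] is cut off, which preserves hypothesis
    and conclusion; if neither is in [P], the leading coefficient of the product is not in [P]
    either. *)
Lemma gauss_pcoef A P p q : subring A -> primei A P -> pcoef A p -> pcoef A q ->
 pcoef P (p * q) -> pcoef P p \/ pcoef P q.
move=> sA pP; have [iP P1 Pp] := pP.
have P0 := ideal0 iP.
elim: {p q}(size p + size q)%N {-2}p {-2}q (leqnn (size p + size q))=> [|n IH] p q sn Ap Aq Ppq.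
 by left=> i; move: sn; rewrite leqn0 addn_eq0=> /andP[p0]; rewrite nth_default // (eqP p0).
have [p0|p0] := posnP (size p); first by left=> i; rewrite nth_default // p0.
have [q0|q0] := posnP (size q); first by right=> i; rewrite nth_default // q0.
have trunc r: pcoef A r -> (0 < size r)%N -> P (lead_coef r) ->
  let r' := r - lead_coef r *: 'X^((size r).-1) in
  [/\ pcoef A r', (size r' < size r)%N & (forall s, pcoef A s -> pcoef P (r * s) -> pcoef P (r' * s)) /\ (pcoef P r' -> pcoef P r)].
 move=> Ar r0 Pr r'.
 have Pm: pcoef P (lead_coef r *: 'X^((size r).-1)) by move=> i; rewrite coefZ coefXn; case: eqP; rewrite ?mulr1.
 split; last split.
 - by move=> i; rewrite coefB; apply: srB=> //; apply: (idealS iP).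
 - rewrite -(prednK r0); apply/leq_sizeP=> j; rewrite leq_eqVlt=> /orP[/eqP<-|lt].
   by rewrite coefB coefZ coefXn eqxx mulr1 subrr.
  rewrite coefB coefZ coefXn (gtn_eqF lt) mulr0 subr0 nth_default //.
  by rewrite -(prednK r0).
 - move=> s As Prs i; rewrite mulrBl coefB; apply: idealB=> //.
  rewrite coefM; apply: (smod_sum (N := (P : set K^o)))=> [|j _]; first by case: iP.
  exact: (idealMr iP).
 - by move=> Pr' i; rewrite -(subrK (lead_coef r *: 'X^((size r).-1)) r) coefD; apply: (idealD iP).
have [Plp|Plp] := pselect (P (lead_coef p)).
 have [Ap' sp' [H1 H2]] := trunc p Ap p0 Plp.
 have [|||] := IH _ q _ Ap' Aq; [|exact: H1|by move/H2; left|by right].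
 by move: sn; lia.
have [Plq|Plq] := pselect (P (lead_coef q)).
 have [Aq' sq' [H1 H2]] := trunc q Aq q0 Plq.
 have [|||] := IH p _ _ Ap Aq'; [|by rewrite mulrC; apply: H1=> //; rewrite mulrC|by left|by move/H2; right].
 by move: sn; lia.
have := Ppq (size (p * q)).-1; rewrite -lead_coefE lead_coefM.
by move=> /Pp[|||]; rewrite lead_coefE.
Qed.
Lemma expr_sum_ideal A (I : set K) a b n m : subring A -> ideal A I -> A a -> A b ->
 I (a ^+ n) -> I (b ^+ m) -> I ((a + b) ^+ (n + m)).
move=> sA iI Aa Ab Ia Ib; rewrite exprDn.
apply: (smod_sum (N := (I : set K^o)))=> [|i _]; first by case: iI.
rewrite -mulr_natr; apply: (idealMr iI).
 by elim: ('C(_, _))=> [|k]; [exact: sr0|rewrite -natr1].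
have [le|lt] := leqP n (n + m - i).
 rewrite -(subnK le) exprD //.
have le: (m <= i)%N by move: lt; lia.
rewrite -(subnK le) exprD //.
Qed.
End PolyCoef.

Section Blowup.
Variables (K : fieldType) (A : set K) (x y : K).
Hypothesis rA : rlr2 A x y.
Let sA := rlr_sub rA.
Let Ax := rlr_x rA.
Let Ay := rlr_y rA.
Let x0 := rlr_x0 rA.
Let im := mi_ideal rA.
Let t := y / x.
Let B := adj A t.
Let sB : subring B := adj_subring t sA.
Let AB : A `<=` B := adj_sub t sA.
Let sP : subring (pcoef A) := pcoef_sub sA.
Lemma xt : x * t = y. by rewrite mulrCA divff ?mulr1. Qed.
Lemma chart_t : B t. exact: adj_gen. Qed.
Lemma clear_x p n : pcoef A p -> (size p <= n.+1)%N -> A (x ^+ n * p.[t]).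
move=> Ap sp; rewrite horner_coef mulr_sumr; apply: sr_sum=> // i _.
have le: (i <= n)%N by have := ltn_ord i; lia.
rewrite -(subnK le) exprD mulrACA [_ p`_i]mulrC -exprMn xt.
by do 2?apply: srM.
Qed.
Lemma chart_clear b : B b -> exists n, A (x ^+ n * b).
by case=> p Ap ->; exists (size p); apply: clear_x. Qed.
Lemma reg_pow n a b : A a -> A b -> y ^+ n * a = x * b -> exists2 c, A c & a = x * c.
elim: n b=> [|n IH] b Aa Ab; first by rewrite mul1r; exists b.
rewrite exprS -mulrA=> E; have [|c] := rlr_reg rA _ Ab E; last exact: IH.
exact.
Qed.
(** In a relation of degree [n + 1] regularity makes the leading coefficient a multiple [x c], and
    [x c t^(n + 1) = y c t^n] rewrites the relation in lower degree. This is what makes the fibre of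
    the chart over the closed point an affine line. *)
Lemma horner0_coef p : pcoef A p -> p.[t] = 0 -> pcoef (mi A x y) p.
elim: {p}size {-2}p (leqnn (size p))=> [|n IH] p sp Ap pt0.
 by move=> i; rewrite nth_default; [|apply: leq_trans sp _].
case: n IH sp=> [|n] IH sp.
 rewrite (size1_polyC sp) hornerC in pt0 *; rewrite pt0=> i.
 by rewrite coefC if_same.
pose q := p - p`_n.+1 *: 'X^(n.+1).
have Aq: pcoef A q.
 move=> i; rewrite coefB coefZ coefXn; apply: srB=> //.
 by case: eqP; rewrite ?mulr1 ?mulr0.
have sq: (size q <= n.+1)%N.
 apply/leq_sizeP=> j; rewrite coefB coefZ coefXn leq_eqVlt=> /orP[/eqP<-|lt].
  by rewrite eqxx mulr1 subrr.
 by rewrite gtn_eqF // mulr0 subr0 nth_default //; apply: leq_trans lt.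
have pt: p.[t] = q.[t] + p`_n.+1 * t ^+ n.+1 by rewrite hornerD hornerN hornerZ hornerXn subrK.
have [||c Ac E] := @reg_pow n.+1 p`_n.+1 (- (x ^+ n * q.[t])) (Ap _).
- by apply: srN=> //; apply: clear_x.
- have /eqP := pt0; rewrite pt addr_eq0=> /eqP Eq.
 by rewrite Eq -xt exprMn [x ^+ n.+1]exprS; ring.
pose r := q + (y * c) *: 'X^n.
have Ar: pcoef A r.
 move=> i; rewrite coefD coefZ coefXn; apply: srD=> //.
 by case: eqP; rewrite ?mulr1 ?mulr0.
have /IH: (size r <= n.+1)%N.
 apply: leq_trans (size_polyD _ _) _; rewrite geq_max sq /=.
 by apply: leq_trans (size_scale_leq _ _) _; rewrite size_polyXn.
move=> /(_ Ar) Hr.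
have mr: pcoef (mi A x y) r.
 apply: Hr; rewrite hornerD hornerZ hornerXn -xt.
 by rewrite -pt0 pt E exprS; ring.
move=> i; rewrite -[p](subrK (p`_n.+1 *: 'X^(n.+1))) -/q -[q](addrK ((y * c) *: 'X^n)) -/r.
rewrite coefD coefB !coefZ !coefXn E; apply: (idealD im); first apply: (idealB sA)=> //.
 by case: eqP=> _; rewrite ?mulr1 ?mulr0; [exact: mi_y|].
by case: eqP=> _; rewrite ?mulr1 ?mulr0; [exact: mi_x|].
Qed.
(** With [coef_exc] this identifies [B / x B] with the polynomial ring over [A / m] in the class of
    [t], so that questions about the exceptional line become questions about coefficients modulo
    [m]. *)
Lemma exc_coef p : pcoef A p -> (exists2 b, B b & p.[t] = x * b) -> pcoef (mi A x y) p.
move=> Ap [_ [q Aq ->] E].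
have Aq': pcoef A (x *: q) by move=> i; rewrite coefZ; apply: srM.
have /horner0_coef H: (p - x *: q).[t] = 0 by rewrite hornerD hornerN hornerZ E subrr.
move=> i; rewrite -[p](subrK (x *: q)) coefD; apply: (idealD im); last first.
 by rewrite coefZ; apply: mi_x.
exact: H.
Qed.
Lemma coef_exc p : pcoef (mi A x y) p -> exists2 b, B b & p.[t] = x * b.
move=> mp; rewrite horner_coef.
have : forall i, i \in index_enum 'I_(size p) -> True -> exists2 b, B b & p`_i * t ^+ i = x * b.
 move=> i _ _; have [b [c [Ab Ac ->]]] := mp i.
 exists (b * t ^+ i + c * t ^+ i.+1); last by rewrite -xt exprS; ring.
 by apply: srD=> //; apply: srM=> //; [exact: AB|exact: srX chart_t|exact: AB|exact: srX chart_t].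
elim/big_ind: _=> [|u v IHu IHv H|i _ H].
- by exists 0; [|rewrite mulr0].
- have [b Bb ->] := IHu H; have [c Bc ->] := IHv H.
 by exists (b + c); [|rewrite mulrDr].
- exact: H.
Qed.
Lemma exc_mulI b c : B b -> B c -> (exists2 d, B d & b * c = x * d) ->
 (exists2 d, B d & b = x * d) \/ (exists2 d, B d & c = x * d).
move=> [p Ap ->] [q Aq ->]; rewrite -hornerM=> /(exc_coef (srM sP Ap Aq)).
move=> /(gauss_pcoef sA (mi_prime rA) Ap Aq)[/coef_exc|/coef_exc]; [by left|by right].
Qed.
Lemma chart_proper : ~ (exists2 b, B b & 1 = x * b).
move=> [b Bb E]; have /(_ 0%N): pcoef (mi A x y) 1 by apply: exc_coef; [|exists b; rewrite ?hornerC].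
by rewrite coef1; exact: rlr_proper.
Qed.

Section AtPoint.
Variable n : set K.
Hypotheses (mn : maxi B n) (nx : n x).
Let pn : primei B n := maxi_prime sB mn.
Let inn : ideal B n. by case: pn. Qed.
Let L := Loc B n.
Let sL : subring L := Loc_subring sB pn.
Let BL : B `<=` L := Loc_sub sB pn.

(** [B / x B] is a polynomial ring over a field, so its maximal ideals are principal: [phi] has
    least size among the polynomials with value in [n] that are nonzero modulo [m], and division by
    it leaves remainders with coefficients in [m], that is, multiples of [x]. *)
Lemma point_equation : exists phi, [/\ phi \is monic, pcoef A phi, n phi.[t]
 & forall b, n b -> exists c d, [/\ B c, B d & b = x * c + phi.[t] * d]].
pose Q k := `[< exists p, [/\ pcoef A p, (size p <= k)%N, n p.[t] & ~ pcoef (mi A x y) p] >].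
have exQ: exists k, Q k.
 (* The ideal [x B] is not maximal: otherwise [t], which is no multiple of [x], would have an
    inverse [q] modulo [x], but [1 - 'X * q] has constant coefficient 1. *)
 have [b nb nxb]: exists2 b, n b & ~ (exists2 d, B d & b = x * d).
  apply: contrapT=> H.
  have nB b: n b -> exists2 d, B d & b = x * d by move=> nb; apply: contrapT=> H'; apply: H; exists b.
  have nt: ~ n t.
   move=> /nB[d Bd E]; have /(_ 1%N): pcoef (mi A x y) 'X by apply: exc_coef; [exact: pcoefX|exists d; rewrite ?hornerX].
   by rewrite coefX; exact: rlr_proper.
  have [_ _ /(_ _ chart_t nt)[b [q Aq ->]]] := mn.
  move=> /nB[d Bd E]; have /(_ 0%N): pcoef (mi A x y) (1 - 'X * q).
   apply: exc_coef; last by exists d; rewrite // hornerD hornerN hornerM hornerX hornerC.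
   exact: (srB sP (sr1 sP) (srM sP (pcoefX sA) Aq)).
  by rewrite coefB coefXM coef1 subr0; exact: rlr_proper.
 have [p Ap E] := idealS inn nb; exists (size p); apply/asboolP; exists p.
 by rewrite -E; split=> //; move/coef_exc; rewrite -E.
case: (ex_minnP exQ)=> k /asboolP[p [Ap sp np nmp]] kmin.
have sk: size p = k by apply/eqP; rewrite eqn_leq sp; apply: kmin; apply/asboolP; exists p.
have p0: (0 < size p)%N.
 rewrite lt0n size_poly_eq0; apply/eqP=> p0; apply: nmp=> i.
 by rewrite p0 coef0.
have ml: ~ mi A x y (lead_coef p).
 move=> ml; pose q := p - lead_coef p *: 'X^((size p).-1).
 have mm: pcoef (mi A x y) (lead_coef p *: 'X^((size p).-1)) by move=> i; rewrite coefZ coefXn; case: eqP; rewrite ?mulr1 ?mulr0.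
 have : (k <= (size p).-1)%N.
  apply: kmin; apply/asboolP; exists q; split.
  - by move=> i; rewrite coefB; apply: srB=> //; apply: (idealS im).
  - apply/leq_sizeP=> j; rewrite leq_eqVlt=> /orP[/eqP<-|lt].
    by rewrite coefB coefZ coefXn eqxx mulr1 subrr.
   by rewrite coefB coefZ coefXn (gtn_eqF lt) mulr0 subr0 nth_default // -(prednK p0).
  - have [b Bb E] := coef_exc mm.
   by rewrite hornerD hornerN E.
  - move=> mq; apply: nmp=> i; rewrite -[p](subrK (lead_coef p *: 'X^((size p).-1))) coefD.
   exact: (idealD im).
 by rewrite -sk; lia.
have l0 := mi_neq0 rA ml.
have Al: A (lead_coef p)^-1 by apply: (rlr_unit rA); rewrite lead_coefE.
exists ((lead_coef p)^-1 *: p).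
have mphi: (lead_coef p)^-1 *: p \is monic by rewrite monicE lead_coefZ mulVf.
have Aphi: pcoef A ((lead_coef p)^-1 *: p) by move=> i; rewrite coefZ; apply: srM.
split=> //; first rewrite hornerZ //.
move=> b nb; have [q Aq bE] := idealS inn nb.
have [d [r [Ad Ar qE sr]]] := monic_division sA Aphi Aq mphi.
have [c Bc rE]: exists2 c, B c & r.[t] = x * c.
 apply: coef_exc; apply: contrapT=> nmr.
 have : (k <= size r)%N.
  apply: kmin; apply/asboolP; exists r; split=> //.
  have ->: r.[t] = b - d.[t] * ((lead_coef p)^-1 * p.[t]) by rewrite bE qE hornerD hornerM hornerZ; ring.
  apply: (idealB sB)=> //; apply: (idealMl inn); first by exists d.
  exact.
 by move: sr; rewrite size_scale ?invr_neq0 // sk; move=> /leq_trans h /h; rewrite ltnn.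
exists c, d.[t]; split=> //; first by exists d.
by rewrite bE qE hornerD hornerM rE addrC.
Qed.
(** The second parameter is [phi(t)]: the element [x] is prime in [B] by Gauss's lemma and does not
    divide [phi(t)], as [phi] is monic; this is the regularity condition, and [point_equation] gives
    the generators of the maximal ideal. *)
Lemma blowup_rlr2 : exists w, rlr2 L x w.
have [phi [mphi Aphi nphi Hn]] := point_equation; exists phi.[t].
have Bphi := idealS inn nphi.
have n0 s: ~ n s -> s != 0 := @prime_neq0 _ _ _ pn s.
split=> //.
- by apply: Loc_noeth=> //; apply: noeth_adj=> //; exact: (rlr_noeth rA).
- by apply: BL; apply: AB.
- exact: BL.
- move=> [_ [_ [[a [s [Ba Bs ns ->]]] [b [u [Bb Bu nu ->]]] E]]].
 apply: (primeMn pn Bs Bu ns nu).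
 have ->: s * u = x * (a * u) + b * s * phi.[t]=> //.
  rewrite -[LHS]mulr1 E; have := n0 _ ns; have := n0 _ nu=> ? ?; by field; apply/andP.
- move=> v /(Loc_unit pn)[[]//|[a [s [na Bs ns ->]]] H].
 exfalso; apply: H; have [c [d [Bc Bd ->]]] := Hn _ na.
 exists (c / s), (d / s); split; [by exists c, s|by exists d, s|].
 by rewrite mulrDl !mulrA.
- move=> _ _ [a [s [Ba Bs ns ->]]] [b [u [Bb Bu nu ->]]] E.
 have E': phi.[t] * (a * u) = x * (b * s).
  have := n0 _ ns; have := n0 _ nu=> u0 s0.
  transitivity (phi.[t] * (a / s) * (s * u)); first by field.
  by rewrite E; field.
 have [d Bd aE]: exists2 d, B d & a * u = x * d.
  have [|||[d Bd E'']|] := @exc_mulI phi.[t] (a * u)=> //.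
  + by exists (b * s).
  + exfalso; have := exc_coef Aphi (ex_intro2 _ _ d Bd E'') (size phi).-1.
   by rewrite -lead_coefE (monicP mphi); exact: rlr_proper.
 exists (d / (s * u)).
  by exists d, (s * u); split=> //; exact: (primeMn pn).
 have := n0 _ ns; have := n0 _ nu=> u0 s0.
 rewrite mulrA -aE; by field; apply/andP.
Qed.
End AtPoint.
(** Where [x] is inverted the chart agrees with [A], so [n] is governed by its trace on [A], a prime
    avoiding [x] and hence principal. The generator is zero when the trace is, and then the
    localization is a field. *)
Lemma chart_off_dvr n : primei B n -> ~ n x -> exists pi, dvr (Loc B n) pi.
move=> pn nnx; have [inn n1 np] := pn.
have BL := Loc_sub sB pn.
have pA: primei A (n `&` A).
 split; first (split=> //).
 - split=> [|a b [na Aa] [nb]|a b Aa [nb Ab]] //.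
  + by split; [apply: (idealMl inn)=> //; exact: AB|exact: srM].
 - by case.
 - move=> a b Aa Ab [nab]; have [|] := np a b (AB Aa) (AB Ab) nab; by [left|right].
have [pi [npi Api] Hpi]: exists2 g, (n `&` A) g & forall a, (n `&` A) a -> exists2 c, A c & a = g * c by apply: (prime_principal_aux rA)=> // -[].
exists pi; split=> //.
- by apply: Loc_noeth=> //; apply: noeth_adj=> //; exact: (rlr_noeth rA).
- by apply: BL; apply: AB.
- move=> _ [b [s [Bb Bs ns ->]]] E; apply: (ns); have s0 := prime_neq0 pn ns.
 by rewrite -[s]mul1r -E -mulrA divfK.
- move=> v /(Loc_unit pn)[[_]|[b [s [nb Bs ns ->]]]]; [by right|left].
 have [k Ak] := chart_clear (idealS inn nb).
 have [|c Ac E] := Hpi (x ^+ k * b)=> //.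
 have nk: ~ n (x ^+ k) by move=> /(primeX sB pn (AB Ax)).
 exists (c / x ^+ k / s).
  apply: srM=> //; last exact: Loc_inv.
  apply: srM=> //; first by apply: BL; apply: AB.
  exact: Loc_inv.
 have s0 := prime_neq0 pn ns; have k0 := prime_neq0 pn nk.
 rewrite !mulrA -E; by field; apply/andP.
Qed.
Lemma exceptional_dvr : let P := [set v | exists2 b, B b & v = x * b] in
 primei B P /\ dvr (Loc B P) x.
move=> P; have iP: ideal B P.
 split; last by move=> _ [b Bb ->].
 split=> [|_ _ [b Bb ->] [c Bc ->]|b _ Bb [c Bc ->]].
 - by exists 0; [|rewrite mulr0].
 - by exists (b + c); [|rewrite mulrDr].
 - by exists (b * c); [|rewrite mulrCA].
have pP: primei B P by split=> //; [exact: chart_proper|move=> b; exact: exc_mulI].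
split=> //; have BL := Loc_sub sB pP; split=> //.
- by apply: Loc_noeth=> //; apply: noeth_adj=> //; exact: (rlr_noeth rA).
- by apply: BL; apply: AB.
- move=> _ [b [s [Bb Bs ns ->]]] E; apply: ns; exists b=> //.
 have s0: s != 0 by apply/eqP=> s0; move: E; rewrite s0 invr0 !mulr0=> /eqP; rewrite eq_sym oner_eq0.
 by rewrite -[s]mul1r -E -mulrA divfK.
- move=> v /(Loc_unit pP)[[_]|[_ [s [[b Bb ->] Bs ns ->]]]]; [by right|left].
 by exists (b / s); [exists b, s|rewrite mulrA].
Qed.
End Blowup.

(** * The colength of an ideal drops under blowing up *)
Lemma spn_sub_ideal (K : fieldType) (A I : set K) (c : seq K) : ideal A I ->
 (forall a, a \in c -> I a) -> spn A ([set` c] : set K^o) `<=` I.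
by move=> [sI _] cI; apply: spn_min. Qed.
Lemma spn_is_ideal (K : fieldType) (A : set K) (c : seq K) : subring A ->
 (forall a, a \in c -> A a) -> ideal A (spn A ([set` c] : set K^o)).
move=> sA cA; split=> //.
apply: spn_sub_ideal=> //; split=> //; split=> [||a b]=> //; exact: srM.
Qed.

Section Drop.
Variables (K : fieldType) (A : set K) (x y : K).
Hypothesis rA : rlr2 A x y.
Let sA := rlr_sub rA.
Let Ax := rlr_x rA.
Let Ay := rlr_y rA.
Let x0 := rlr_x0 rA.
Let im := mi_ideal rA.
Let t := y / x.
Let B := adj A t.
Let sB : subring B := adj_subring t sA.
Let AB : A `<=` B := adj_sub t sA.
Let sP : subring (pcoef A) := pcoef_sub sA.

(* The powers of the maximal ideal, read off on the chart: elements x^e p(y/x) with deg p <= e. *)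
Definition mpow e : set K :=
 [set v | exists p, [/\ pcoef A p, (size p <= e.+1)%N & v = x ^+ e * p.[y / x]]].
Lemma mpow_sub e : mpow e `<=` A.
by move=> _ [p [Ap sp ->]]; apply: clear_x. Qed.
Lemma mpow_ideal e : ideal A (mpow e).
split; last exact: mpow_sub.
split.
- by exists 0; rewrite size_poly0 horner0 mulr0.
- move=> _ _ [p [Ap sp ->]] [q [Aq sq ->]]; exists (p + q); rewrite hornerD mulrDr; split=> //.
 by apply: leq_trans (size_polyD _ _) _; rewrite geq_max sp.
- move=> a _ Aa [p [Ap sp ->]]; exists (a *: p); rewrite hornerZ; split.
 + by move=> i; rewrite coefZ; apply: srM.
 + exact: leq_trans (size_scale_leq _ _) sp.
 + by rewrite mulrCA.
Qed.
Lemma mpow_mono e : mpow e.+1 `<=` mi A x y.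
apply: (proper_mi rA (mpow_ideal _))=> -[p [Ap _ E]].
apply: (chart_proper rA); exists (x ^+ e * p.[t]); last by rewrite E exprS mulrA.
by apply: srM=> //; exists p.
Qed.
Variable (c : seq K).
Let cc := spn A ([set` c] : set K^o).
Let icc : (forall a, a \in c -> A a) -> ideal A cc.
exact: spn_is_ideal. Qed.
(** The exponent [e] is the order of the ideal, the largest one with [c] inside [m^e]; it is at most
    [N] since [x^N] is not in [m^(N + 1)]. Were all quotients divisible by [x], [exc_coef] would
    push [c] into the next power. *)
Lemma order_exists N : (forall a, a \in c -> A a) -> cc (x ^+ N) ->
 exists e, [/\ forall a, a \in c -> mpow e a & exists2 a, a \in c &
  ~ (exists2 b, B b & a / x ^+ e = x * b)].
move=> Ac ccx.
have mp0: forall a, a \in c -> mpow 0 a.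
 move=> a /Ac Aa; exists a%:P; rewrite hornerC mul1r size_polyC; split=> //.
  exact: pcoefC.
 by case: (a == 0).
pose Q e := `[< forall a, a \in c -> mpow e a >].
have exQ: exists e, Q e by exists 0%N; apply/asboolP.
have Qb e: Q e -> (e <= N)%N.
 move=> /asboolP Qe; rewrite leqNgt; apply/negP=> lt; apply: (chart_proper rA).
 have /(_ _ ccx)[p [Ap sp E]]: cc `<=` mpow e by apply: spn_sub_ideal=> //; exact: mpow_ideal.
 have xN0: x ^+ N != 0 by rewrite expf_neq0.
 exists (x ^+ (e - N.+1) * p.[t]).
  by apply: srM=> //; exists p.
 apply: (mulfI xN0); rewrite {1}E -{1}(subnK lt) exprD exprS; ring.
case: (ex_maxnP exQ Qb)=> e /asboolP Qe emax; exists e; split=> //.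
apply: contrapT=> H; suff /emax: Q e.+1 by rewrite ltnn.
apply/asboolP=> a ac.
have [p [Ap sp aE]] := Qe a ac.
have xe0: x ^+ e != 0 by rewrite expf_neq0.
have [b Bb bE]: exists2 b, B b & p.[t] = x * b.
 apply: contrapT=> H'; apply: H; exists a=> // -[b Bb E]; apply: H'; exists b=> //.
 by rewrite -E aE mulrAC divff // mul1r.
have mp := exc_coef rA Ap (ex_intro2 _ _ b Bb bE).
have Ht v j: A v -> (j <= e.+1)%N -> mpow e.+1 (x ^+ e.+1 * (v * t ^+ j)).
 move=> Av je; exists (v *: 'X^j); rewrite hornerZ hornerXn; split=> //.
  by move=> i; rewrite coefZ coefXn; case: eqP; rewrite ?mulr1 ?mulr0.
 by apply: leq_trans (size_scale_leq _ _) _; rewrite size_polyXn.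
rewrite aE horner_coef mulr_sumr.
apply: (smod_sum (N := (mpow e.+1 : set K^o)))=> [|i _]; first by case: (mpow_ideal e.+1).
have ie: (i <= e)%N by have := ltn_ord i; lia.
have [b1 [b2 [Ab1 Ab2 ->]]] := mp i.
have ->: x ^+ e * ((x * b1 + y * b2) * t ^+ i) =
  x ^+ e.+1 * (b1 * t ^+ i) + x ^+ e.+1 * (b2 * t ^+ i.+1).
 by rewrite -(xt rA) -/t [t ^+ i.+1]exprS [x ^+ e.+1]exprS; ring.
by apply: (idealD (mpow_ideal _)); apply: Ht=> //; apply: leq_trans.
Qed.

Section AtPoint.
Variable n : set K.
Hypotheses (mn : maxi B n) (nx : n x).
Let pn : primei B n := maxi_prime sB mn.
Let L := Loc B n.
Let sL : subring L := Loc_subring sB pn.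
Let BL : B `<=` L := Loc_sub sB pn.
Hypothesis Ac : forall a, a \in c -> A a.
(** Let [J] be the ideal of the quotients [a / x^e] in [L]. Each class of [L / J] is represented by
    a polynomial in [t] of degree at most [e], that is, by an element of [m^e] divided by [x^e]. So
    the length of [L / J] is at most that of [m^e / (c)], which is less than that of [A / (c)]
    because [e > 0]. *)
Theorem blowup_drop N k : cc (x ^+ N) -> ~ cc 1 -> ~ chain A (cc : set K^o) (A : set K^o) k.+1 ->
 exists w e, [/\ rlr2 L x w, forall a, a \in c -> L (a / x ^+ e),
  exists N', spn L ([set` [seq a / x ^+ e | a <- c]] : set K^o) (x ^+ N') /\
       spn L ([set` [seq a / x ^+ e | a <- c]] : set K^o) (w ^+ N')
  & ~ chain L (spn L ([set` [seq a / x ^+ e | a <- c]] : set K^o)) (L : set K^o) k].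
move=> ccx cc1 nch.
have [w rL] := blowup_rlr2 rA mn nx.
have [e [ce [a0 a0c na0]]] := order_exists Ac ccx.
have xe0: x ^+ e != 0 by rewrite expf_neq0.
set c' := [seq a / x ^+ e | a <- c]; set J := spn L ([set` c'] : set K^o).
have ccmp: cc `<=` mpow e by apply: spn_sub_ideal=> //; exact: mpow_ideal.
have c'B a: a \in c -> B (a / x ^+ e) by move=> /ce[p [Ap _ ->]]; rewrite mulrAC divff // mul1r; exists p.
have iJ: ideal L J by apply: spn_is_ideal=> // _ /mapP[a /c'B Ba ->].
have ccJ a: cc a -> J (a / x ^+ e).
 elim=> [|d b v Ad bc _ IH]; first by rewrite mul0r.
 rewrite mulrDl; apply: (idealD iJ)=> //; rewrite -mulrA; apply: (idealMl iJ).
  by apply: BL; apply: AB.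
 by apply: spn_gen; [|exact: map_f].
have JxN: J (x ^+ N).
 rewrite -[x ^+ N](divfK xe0) mulrC; apply: (idealMl iJ); last exact: ccJ.
 exact.
pose psi := a0 / x ^+ e.
have Jpsi: J psi by apply: spn_gen; [|exact: map_f].
have Bpsi: B psi := c'B _ a0c.
have n0 s: ~ n s -> s != 0 := @prime_neq0 _ _ _ pn s.
have nB s: n s -> B s by case: pn=> iN _ _; apply: idealS.
have in_n b: B b -> n (x * b) by move=> Bb; case: pn.
have nLpsi: ~ (exists2 b, L b & psi = x * b).
 move=> [_ [b [s [Bb Bs ns ->]]] E].
 have [|||[d Bd E']|] := @exc_mulI _ _ _ _ rA s psi=> //.
  by exists b=> //; rewrite E; have := n0 _ ns=> s0; field.
 by apply: ns; rewrite E'; apply: in_n.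
have [l [u [d [Lu mu Ld psiE]]]] := rlr_yadic rL (BL Bpsi) nLpsi.
(* A common exponent for all non-units [x b + w d'] of [L]: the power [x^N] lies in [J], and since
   [psi] is [w^l] times a unit modulo [x], so does [w^(l (1 + N))]; the binomial expansion adds the
   two exponents. *)
pose M := (N + l * (1 + N))%N.
have Lw: L w := rlr_y rL.
have Jw: J (w ^+ (l * (1 + N))).
 have u0 := mi_neq0 rL mu.
 have ->: w ^+ (l * (1 + N)) = (u^-1 * (psi - (x * d))) ^+ (1 + N) by rewrite psiE addrK [w ^+ l * u]mulrC mulKf // exprM.
 rewrite exprMn; apply: (idealMl iJ); first by apply: srX=> //; apply: (rlr_unit rL).
 apply: expr_sum_ideal=> //; first exact: BL.
 by rewrite -mulrN exprMn.
have Jnu nu: mi L x w nu -> J (nu ^+ M).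
 move=> [b [d' [Lb Ld' ->]]]; apply: expr_sum_ideal=> //.
  by rewrite exprMn.
 by rewrite exprMn.
(* The inverse of a denominator [s] is approximated by [b'] times the geometric series in
   [nu0 = 1 - s b'], cut off at the power [nu0^M] that lies in [J]. *)
have LBJ v: L v -> exists2 b, B b & J (v - b).
 move=> [b [s [Bb Bs ns ->]]].
 have [_ _ /(_ _ Bs ns)[b' Bb' nu]] := mn.
 set nu0 := 1 - s * b' in nu.
 have s0 := n0 _ ns.
 exists (b * b' * \sum_(i < M) nu0 ^+ i).
  apply: srM=> //; apply: sr_sum=> // i _.
  by apply: srX=> //; exact: nB.
 have ->: b / s - b * b' * \sum_(i < M) nu0 ^+ i = b / s * nu0 ^+ M.
  apply: (mulfI s0); rewrite mulrBr.
  have ->: s * (b * b' * \sum_(i < M) nu0 ^+ i) = b * ((1 - nu0) * \sum_(i < M) nu0 ^+ i) by rewrite /nu0; ring.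
  rewrite -[1 - nu0]opprB mulNr -subrX1; by field.
 apply: (idealMl iJ); first by exists b, s.
 apply: Jnu; apply: (proper_mi rL (P := [set v | exists a s, [/\ n a, B s, ~ n s & v = a / s]])).
 - split; last by move=> _ [a [s' [na Bs' ns' ->]]]; exists a, s'; split=> //; exact: nB.
  have [iN _ _] := pn; split.
  + exists 0, 1; rewrite mul0r; by case: pn.
  + move=> _ _ [a [s1 [na Bs1 ns1 ->]]] [a' [s2 [na' Bs2 ns2 ->]]].
   exists (a * s2 + a' * s1), (s1 * s2); split=> //; first exact: (primeMn pn).
   by have := n0 _ ns1; have := n0 _ ns2=> ? ?; field; apply/andP.
  + move=> _ _ [a [s1 [Ba Bs1 ns1 ->]]] [a' [s2 [na' Bs2 ns2 ->]]].
   exists (a * a'), (s1 * s2); split=> //; first exact: (primeMn pn).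
   by rewrite -[LHS]/(a / s1 * (a' / s2)) mulf_div.
 - move=> [a [s' [na Bs' ns' E]]]; apply: (ns'); have s'0 := n0 _ ns'.
  by rewrite -[s']mul1r E divfK.
 - by exists nu0, 1; rewrite divr1; case: pn.
(* B is spanned modulo J by the polynomials of degree at most e in y/x *)
pose E := [set v | exists p, [/\ pcoef A p, (size p <= e.+1)%N & v = p.[t]]].
have [pp [App spp psiP]] := ce a0 a0c.
have psiP': psi = pp.[t] by rewrite /psi psiP mulrAC divff // mul1r.
have [j [pj0 pj1 mj]]: exists j, [/\ (j <= e)%N, ~ mi A x y pp`_j & forall i, (j < i)%N -> mi A x y pp`_i].
 pose Q j := `[< ~ mi A x y pp`_j >].
 have exQ: exists j, Q j.
  apply: contrapT=> H; apply: na0; have := @coef_exc _ _ _ _ rA pp.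
  rewrite -psiP'; apply=> i; apply: contrapT=> H'; apply: H; exists i; exact/asboolP.
 have Qb j: Q j -> (j <= e)%N.
  move=> /asboolP Qj; rewrite leqNgt; apply/negP=> lt; apply: Qj.
  by rewrite nth_default; [|apply: leq_trans lt].
 case: (ex_maxnP exQ Qb)=> j Qj jmax; exists j; split; [exact: Qb|exact/asboolP|].
 move=> i ji; apply: contrapT=> H; have := jmax i (asboolT H); by rewrite leqNgt ji.
have pj_0 := mi_neq0 rA pj1.
have Apj: A (pp`_j)^-1 by apply: (rlr_unit rA).
(* [pp] cut after its last coefficient outside [m] and made monic. Its value at [t] is a multiple of
   [psi] modulo [x], so division by it leaves degree at most [e] modulo [J + x B]; iteration
   replaces [x B] by [x^N B]. *)
pose q1 := \poly_(i < j.+1) ((pp`_j)^-1 * pp`_i).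
have Aq1: pcoef A q1 by move=> i; rewrite coef_poly; case: ifP=> _; [exact: srM|].
have sq1: size q1 = j.+1 by rewrite size_poly_eq // mulVf ?oner_neq0.
have mq1: q1 \is monic by rewrite monicE lead_coefE sq1 coef_poly ltnSn mulVf.
have [b1 Bb1 q1E]: exists2 b, B b & q1.[t] = (pp`_j)^-1 * psi + x * b.
 have [|b Bb bE] := @coef_exc _ _ _ _ rA (q1 - (pp`_j)^-1 *: pp).
  move=> i; rewrite coefB coefZ coef_poly; case: ifP=> h; first by rewrite subrr.
  rewrite sub0r; apply: (idealN sA im); apply: (idealMl im)=> //; apply: mj.
  by rewrite ltnNge -ltnS h.
 by exists b=> //; rewrite psiP' -bE hornerD hornerN hornerZ addrC subrK.
have BE1 b: B b -> exists v w b', [/\ E v, J w, B b' & b = v + w + x * b'].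
 move=> [p Ap ->]; have [d1 [r [Ad1 Ar -> sr]]] := monic_division sA Aq1 Ap mq1.
 exists r.[t], (d1.[t] * ((pp`_j)^-1 * psi)), (b1 * d1.[t]); split.
 - exists r; split=> //; apply: leq_trans (ltnW sr) _; by rewrite sq1.
 - apply: (idealMl iJ); first by apply: BL; exists d1.
  exact.
 - by apply: srM=> //; exists d1.
 - by rewrite hornerD hornerM q1E; ring.
have ED u' v': E u' -> E v' -> E (u' + v').
 move=> [p [Ap sp ->]] [q [Aq sq ->]]; exists (p + q); rewrite hornerD; split=> //.
 by apply: leq_trans (size_polyD _ _) _; rewrite geq_max sp.
have EZ a v': A a -> E v' -> E (a * v').
 move=> Aa [p [Ap sp ->]]; exists (a *: p); rewrite hornerZ; split=> //.
  by move=> i; rewrite coefZ; apply: srM.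
 exact: leq_trans (size_scale_leq _ _) sp.
have BEk i b: B b -> exists v w b', [/\ E v, J w, B b' & b = v + w + x ^+ i * b'].
 elim: i b=> [|i IH] b Bb.
  exists 0, 0, b; rewrite mul1r !add0r; split=> //.
  by exists 0; rewrite size_poly0 horner0.
 have [v [w1 [b' [Ev Jw1 Bb' ->]]]] := IH b Bb.
 have [v' [w2 [b2 [Ev' Jw2 Bb2 ->]]]] := BE1 b' Bb'.
 exists (v + x ^+ i * v'), (w1 + x ^+ i * w2), b2; split=> //.
 - by apply: ED=> //; apply: EZ.
 - by rewrite exprS; ring.
have LE v: L v -> exists2 v', E v' & J (v - v').
 move=> /LBJ[b Bb Jb]; have [v' [w1 [b' [Ev' Jw1 Bb' bE]]]] := BEk N b Bb.
 exists v'=> //; have ->: v - v' = (v - b) + (w1 + x ^+ N * b') by rewrite bE; ring.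
 apply: (idealD iJ)=> //.
exists w, e; split=> //.
- by move=> a /c'B.
- exists M; split; by rewrite exprD.
move=> [F [JF FL sF pF]]; apply: nch.
(* A generator of order zero would be a unit, against [cc1]. So [m^e] is a proper ideal, and [A] can
   be put on top of the chain. *)
have e0: (0 < e)%N.
 rewrite lt0n; apply/eqP=> e0; apply: cc1.
 have ma0: ~ mi A x y a0.
  move=> ma0; apply: na0; have := @coef_exc _ _ _ _ rA a0%:P.
  rewrite hornerC e0 divr1; apply=> i; rewrite coefC; case: eqP=> //.
 rewrite -(mulVf (mi_neq0 rA ma0)); apply: (idealMl (icc Ac))=> //.
  by apply: (rlr_unit rA)=> //; exact: Ac.
apply: (@chain_rcons _ K^o A cc (mpow e)).
- by case: (ring_ideal rA).
- split; first exact: mpow_sub.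
 move=> H; apply: (rlr_proper rA); rewrite -(prednK e0) in H; apply: mpow_mono; apply: H=> //.
have JFi i: (i <= k)%N -> J `<=` F i.
 elim: i=> [//|i IH] ik; apply: subset_trans (IH (ltnW ik)) _; by case: (pF i).
exists (fun i=> [set a | mpow e a /\ F i (a / x ^+ e)]); split.
- by move=> a; split; [exact: ccmp|apply: JF; exact: ccJ].
- by move=> a [].
- move=> i ik; have ime := mpow_ideal e; split.
 + by split; [|rewrite mul0r].
 + move=> a b [ma Fa] [mb Fb]; split=> //.
  by rewrite mulrDl.
 + move=> a b Aa [mb Fb]; split; first exact: (idealMl ime).
  by rewrite -mulrA; apply: smodZ=> //; apply: BL; apply: AB.
- move=> i ik; have [sub nsub] := pF i ik; split; first by move=> a [ma].
 move=> H; apply: nsub=> v Fv.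
 have FkL: F i.+1 `<=` L.
  apply: subset_trans FL; move/subnK: (ik)=> <-.
  suff H' j': (j' + i.+1 <= k)%N -> F i.+1 `<=` F (j' + i.+1)%N by apply: H'; rewrite subnK.
  elim: j'=> [|j' IH] h //.
  apply: subset_trans (IH (ltnW h)) _; by case: (pF (j' + i.+1)%N).
 have [_ [p [Ap sp ->]] Jv] := LE v (FkL _ Fv).
 have xp: x ^+ e * p.[t] / x ^+ e = p.[t] by rewrite mulrAC divff // mul1r.
 have [|_] := H (x ^+ e * p.[t]).
  split; first by exists p.
  rewrite xp; have ->: p.[t] = v - (v - p.[t]) by rewrite opprB addrC subrK.
  by apply: smodB=> //; apply: JFi.
 rewrite xp=> Fp; rewrite -(subrK p.[t] v); apply: (smodD (sF _ (ltnW ik)))=> //.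
 exact: (JFi _ (ltnW ik)).
Qed.
End AtPoint.
End Drop.

(** * Removing a common factor, and finite colength *)

Section Primitive.
Variables (K : fieldType) (A : set K) (x y : K).
Hypothesis rA : rlr2 A x y.
Let sA := rlr_sub rA.

(* Dividing by a greatest common divisor: the ideals c/g <= A are bounded, and a maximal one lies in no proper principal ideal. *)
Lemma primitive_part (c : seq K) : (forall a, a \in c -> A a) -> (exists2 a, a \in c & a != 0) ->
 exists g, [/\ g != 0, forall a, a \in c -> A (a / g)
 & exists N, spn A ([set` [seq a / g | a <- c]] : set K^o) (x ^+ N) /\
       spn A ([set` [seq a / g | a <- c]] : set K^o) (y ^+ N)].
move=> Ac [a0 a0c a00].
have iI g: (forall a, a \in c -> A (a / g)) -> ideal A (spn A ([set` [seq a / g | a <- c]] : set K^o)) by move=> H; apply: spn_is_ideal=> // _ /mapP[a /H Ha ->].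
have [||_ [g [g0 Ag ->]] mx] := @noeth_max _ K^o A A
 [set J | exists g, [/\ g != 0, forall a, a \in c -> A (a / g) &
  J = spn A ([set` [seq a / g | a <- c]] : set K^o)]] sA (rlr_noeth rA).
- by move=> _ [g [g0 Ag ->]]; apply: iI.
- by exists (spn A ([set` [seq a / 1 | a <- c]] : set K^o)), 1; split=> [|a /Ac|]; rewrite ?oner_neq0 ?divr1.
set J := spn A _ in mx; have iJ: ideal A J := iI g Ag.
(* A prime over [J] avoiding [z] would be generated by a common divisor [h]; by maximality the
   division by [h] does not enlarge [J], so [J = h J], and Nakayama gives [J = 0]. *)
have key z: A z -> (forall P, primei A P -> ~ P z ->
  exists2 h, P h & forall a, P a -> exists2 d, A d & a = h * d) -> exists N, J (z ^+ N).
 move=> Az Hpr; apply: contrapT=> nJ.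
 have [|P [pP JP Pz]] := ex_prime_avoiding sA (rlr_noeth rA) iJ Az.
  by move=> N JN; apply: nJ; exists N.
 have [h Ph Hh] := Hpr P pP Pz; have [iP P1 _] := pP.
 have Jag a: a \in c -> J (a / g) by move=> ac; apply: spn_gen; [|exact: map_f].
 have h0: h != 0.
  apply/eqP=> h0; have [d Ad E] := Hh _ (JP _ (Jag _ a0c)).
  by move: E; rewrite h0 mul0r=> /eqP; rewrite mulf_eq0 invr_eq0 (negPf a00) (negPf g0).
 have gh0: g * h != 0 by rewrite mulf_neq0.
 have Agh a: a \in c -> A (a / (g * h)).
  move=> ac; have [d Ad E] := Hh _ (JP _ (Jag _ ac)).
  suff ->: a / (g * h) = d by [].
  by rewrite invfM mulrA E mulrAC divff ?mul1r.
 have sub: J `<=` spn A ([set` [seq a / (g * h) | a <- c]] : set K^o).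
  apply: spn_sub_ideal; first exact: iI.
  move=> _ /mapP[a ac ->]; have ->: a / g = h * (a / (g * h)) by field; apply/andP.
  apply: (idealMl (iI _ Agh)); first exact: idealS Ph.
  by apply: spn_gen; [|exact: map_f].
 have Jh: forall v, spn A ([set` [seq a / (g * h) | a <- c]] : set K^o) v -> J v by apply: mx sub; exists (g * h).
 have Z1: J `<=` [set 0].
  apply: (rlr_nakayama rA)=> //; first by split=> [|_ ->].
  move=> v Jv; exists 0, (v / h); split=> //.
   elim: Jv=> [|d b u Ad /mapP[a ac ->] _ IH]; first by rewrite mul0r.
   rewrite mulrDl; apply: (idealD iJ)=> //; rewrite -mulrA; apply: (idealMl iJ)=> //.
   have ->: a / g / h = a / (g * h) by rewrite invfM mulrA.
   by apply: Jh; apply: spn_gen; [|exact: map_f].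
  exists h; first exact: (proper_mi rA iP).
  by rewrite add0r mulrCA divff ?mulr1.
 have := Z1 _ (Jag _ a0c)=> /eqP; rewrite mulf_eq0 invr_eq0.
 by rewrite (negPf a00) (negPf g0).
have [N1 J1] := key x (rlr_x rA) (fun P=> @prime_principal_aux _ _ _ _ rA P).
have [N2 J2] := key y (rlr_y rA) (fun P=> @prime_principal_aux _ _ _ _ (rlr2_sym rA) P).
exists g; split=> //; exists (N1 + N2)%N; split; rewrite exprD.
 by apply: (idealMr iJ)=> //; apply: srX=> //; exact: (rlr_x rA).
by apply: (idealMl iJ)=> //; apply: srX=> //; exact: (rlr_y rA).
Qed.
(** Filtration by [Q k = J + m^k]: each quotient is spanned by finitely many monomials of degree
    [k], which [m] kills, so it has finite length; for large [k] every monomial is divisible by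
    [x^N] or [y^N], and [Q k] is inside [J]. *)
Lemma colength_bound (c : seq K) N : (forall a, a \in c -> A a) ->
 spn A ([set` c] : set K^o) (x ^+ N) -> spn A ([set` c] : set K^o) (y ^+ N) ->
 exists k, ~ chain A (spn A ([set` c] : set K^o)) (A : set K^o) k.
move=> Ac Jx Jy; set J := spn A _.
have iJ: ideal A J.
 exact: spn_is_ideal.
pose M := (N + N)%N.
(* the monomials x^i y^j of degree at least k together with J *)
pose mons k : seq K^o := [seq x ^+ i * y ^+ (k - i) | i <- iota 0 k.+1].
pose Q k := sadd J (spn A [set` mons k]).
have sQ k: smod A (Q k) by apply: sadd_smod; [case: iJ|exact: spn_smod].
have monsP k i j: (i + j = k)%N -> (x ^+ i * y ^+ j : K^o) \in mons k.
 move=> ijk; apply/mapP; exists i; first by rewrite mem_iota; lia.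
 by rewrite -ijk addKn.
have monsE k v: v \in mons k -> exists i j, [/\ (i + j = k)%N & v = x ^+ i * y ^+ j] by move=> /mapP[i]; rewrite mem_iota=> ik ->; exists i, (k - i)%N; split=> //; rewrite subnKC.
have Qmi k v a: v \in mons k -> A a -> mi A x y a -> Q k.+1 (a * v).
 move=> /monsE[i [j [ijk ->]]] Aa [b [d [Ab Ad ->]]].
 exists 0, ((x * b + y * d) * (x ^+ i * y ^+ j)); rewrite add0r; split=> //.
 have ->: (x * b + y * d) * (x ^+ i * y ^+ j) = b * (x ^+ i.+1 * y ^+ j) + d * (x ^+ i * y ^+ j.+1) by rewrite !exprS; ring.
 by apply: spnD; apply: (@spn_mem _ K^o)=> //; apply: monsP; lia.
have QS k: Q k.+1 `<=` Q k.
 apply: sadd_min; [exact: sQ|by apply: (@saddl _ _ A); exact: spn_smod|].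
 apply: spn_min; first exact: sQ.
 move=> _ /monsE[i [j [ijk ->]]]; apply: (@saddr _ _ A); first by case: iJ.
 have := rlr_x rA; have := rlr_y rA=> Ay Ax.
 case: i ijk=> [|i] ijk.
  case: j ijk=> [|j] ijk; first by [].
  rewrite [y ^+ j.+1]exprS mulrCA; apply: (@spn_mem _ K^o)=> //; apply: monsP; lia.
 rewrite [x ^+ i.+1]exprS -mulrA; apply: (@spn_mem _ K^o)=> //; apply: monsP; lia.
have bd k: exists b, ~ chain A (Q k.+1) (Q k) b.
 have [|b nb] := @chain_fg_bound _ K^o A (Q k.+1) (mons k) sA (sQ _).
  move=> v a vm Aa; have [ma|ma] := pselect (mi A x y a); first by left; apply: Qmi.
  right; exists a^-1; first exact: (rlr_unit rA).
  by rewrite mulVf // (mi_neq0 rA ma).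
 exists b=> H; apply: nb; apply: chain_sub H=> //.
 move=> _ [u [w [Ju Sw ->]]]; exists u, w; split=> //.
 by apply: (@saddl _ _ A)=> //; exact: spn_smod.
have big: Q (M + M)%N `<=` J.
 apply: sadd_min=> //; apply: spn_sub_ideal=> //.
 move=> _ /monsE[i [j [ijk ->]]]; have := rlr_x rA; have := rlr_y rA=> Ay Ax.
 have [le|lt] := leqP N i.
  rewrite -(subnK le) exprD -mulrA [x ^+ N * _]mulrC mulrA; apply: (idealMl iJ)=> //.
 have le: (N <= j)%N by move: ijk lt; rewrite /M; lia.
 rewrite -(subnK le) exprD mulrA; apply: (idealMl iJ)=> //.
have [b nb]: exists b, ~ chain A (Q (M + M)%N) (Q 0%N) b.
 elim: (M + M)%N=> [|k [b nb]].
  by exists 1%N; case=> F [CF FB sF pF]; have [_] := pF 0%N isT; apply; apply: subset_trans FB CF.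
 have [b' nb'] := bd k; exists (b' + b)%N.
 apply: (chain_bound_add sA (sQ k.+1) (sQ k) (sQ 0%N))=> //.
 by elim: (k)=> [//|k' IH]; apply: subset_trans (QS k') IH.
exists b=> H; apply: nb; apply: chain_sub H=> // a Aa.
exists 0, a; rewrite add0r; split=> //.
rewrite -[a]mulr1; apply: (@spn_mem _ K^o)=> //.
by have := @monsP 0%N 0%N 0%N erefl; rewrite !expr0 mulr1.
Qed.
End Primitive.

(** * Koszul complexes *)

Section Koszul.
Variables (R : comPzRingType) (V : lmodType R).
Implicit Types (G : nat -> set V) (l : seq R) (B : set V).

(* The Koszul complex on d elements is the d-fold iterated mapping cone. *)
Fixpoint KT (d : nat) : lmodType R :=
 if d is d'.+1 then (KT d' * KT d')%type else V.

(** The second entry of a pair is the component along the basis vector of the head of [l], one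
    homological degree up; the sign makes the square of the map zero. *)
Fixpoint dK (d : nat) (l : seq R) : KT d -> KT d :=
 match d return KT d -> KT d with
 | 0=> fun=> 0
 | d'.+1=> fun z=> (dK (behead l) z.1 + head 0 l *: z.2, - dK (behead l) z.2)
 end.

(* The components in homological degree p lie in G p. *)
Fixpoint inK (d : nat) (G : nat -> set V) : set (KT d) :=
 match d return set (KT d) with
 | 0=> G 0%N
 | d'.+1=> fun z=> inK G z.1 /\ inK (G \o succn) z.2
 end.

Fixpoint k0 (d : nat) (v : V) : KT d :=
 match d return KT d with 0=> v | d'.+1=> (k0 d' v, 0) end.
Fixpoint proj0 (d : nat) : KT d -> V :=
 match d return KT d -> V with 0=> id | d'.+1=> fun z=> proj0 z.1 end.

Definition mkp (d : nat) (u v : KT d) : KT d.+1 := (u, v).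
Lemma mkpP d (z : KT d.+1) : exists u v, z = mkp u v.
by case: z=> u v; exists u, v. Qed.
Lemma mkp_inj d (u v u' v' : KT d) : mkp u v = mkp u' v' -> u = u' /\ v = v'.
by case. Qed.
Lemma mkpD d (u v u' v' : KT d) : mkp u v + mkp u' v' = mkp (u + u') (v + v').
by []. Qed.
Lemma mkpZ d a (u v : KT d) : a *: mkp u v = mkp (a *: u) (a *: v).
by []. Qed.
Lemma mkpN d (u v : KT d) : - mkp u v = mkp (- u) (- v).
by []. Qed.
Lemma mkp0 d : 0 = mkp (0 : KT d) 0.
by []. Qed.
Lemma dK_mkp d l (u v : KT d) :
 dK l (mkp u v) = mkp (dK (behead l) u + head 0 l *: v) (- dK (behead l) v).
by []. Qed.
Lemma dK_cons d a l (u v : KT d) : dK (a :: l) (mkp u v) = mkp (dK l u + a *: v) (- dK l v).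
by []. Qed.
Lemma inK_mkp d G (u v : KT d) : inK G (mkp u v) <-> inK G u /\ inK (G \o succn) v.
by []. Qed.
Lemma dKD d l (u v : KT d) : dK l (u + v) = dK l u + dK l v.
elim: d l u v=> [|d IH] l u v; first by rewrite addr0.
have [u1 [u2 ->]] := mkpP u; have [v1 [v2 ->]] := mkpP v.
by rewrite !dK_mkp !IH scalerDr opprD addrACA.
Qed.
Lemma dKZ d l a (u : KT d) : dK l (a *: u) = a *: dK l u.
elim: d l u=> [|d IH] l u; first by rewrite scaler0.
have [u1 [u2 ->]] := mkpP u.
by rewrite !dK_mkp mkpZ !IH scalerDr scalerN !scalerA [_ * a]mulrC.
Qed.
Lemma dK0 d l : dK l (0 : KT d) = 0.
by apply: (addrI (dK l 0)); rewrite -dKD !addr0. Qed.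
Lemma dKN d l (u : KT d) : dK l (- u) = - dK l u.
by rewrite -scaleN1r dKZ scaleN1r. Qed.
Lemma dKB d l (u v : KT d) : dK l (u - v) = dK l u - dK l v.
by rewrite dKD dKN. Qed.
Lemma dK_dK d l (u : KT d) : dK l (dK l u) = 0.
elim: d l u=> [//|d IH] l u; have [u1 [u2 ->]] := mkpP u.
by rewrite !dK_mkp dKD !dKN !IH !oppr0 dKZ add0r scalerN subrr.
Qed.
Lemma inK_smod d D G : (forall p, smod D (G p)) -> smod D (@inK d G).
elim: d G=> [|d IH] G sG //.
split=> [|u v [u1 u2] [v1 v2]|a v Da [v1 v2]]; split.
- exact: smod0.
- exact: smod0.
- exact: smodD.
- exact: smodD.
- exact: smodZ.
- exact: smodZ.
Qed.
Lemma inK_mono d G G' : (forall p, G p `<=` G' p) -> @inK d G `<=` @inK d G'.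
elim: d G G'=> [|d IH] G G' H z /=; first exact: H.
by case=> z1 z2; split; [exact: IH|apply: IH z2=> p; exact: H].
Qed.
Lemma inK0 d G : (forall p, G p 0) -> @inK d G 0.
elim: d G=> [|d IH] G G0 //.
by rewrite mkp0; split; apply: IH=> // p.
Qed.
Lemma inKD d G (u v : KT d) : (forall p u v, G p u -> G p v -> G p (u + v)) ->
 inK G u -> inK G v -> inK G (u + v).
elim: d G u v=> [|d IH] G u v GD; first exact: GD.
have [u1 [u2 ->]] := mkpP u; have [v1 [v2 ->]] := mkpP v.
move=> /inK_mkp[Gu1 Gu2] /inK_mkp[Gv1]; split; apply: IH=> // p; exact: GD.
Qed.
Lemma inKZ d G G' a (u : KT d) : (forall p u, G p u -> G' p (a *: u)) ->
 inK G u -> inK G' (a *: u).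
elim: d G G' u=> [|d IH] G G' u GZ; first exact: GZ.
have [u1 [u2 ->]] := mkpP u.
move=> /inK_mkp[Gu1 Gu2]; split; [exact: IH Gu1|apply: IH Gu2=> p; exact: GZ].
Qed.
Lemma inKN d G (u : KT d) : (forall p u, G p u -> G p (- u)) -> inK G u -> inK G (- u).
by move=> GN; rewrite -scaleN1r; apply: inKZ=> p v /GN; rewrite scaleN1r. Qed.
Lemma inK_k0 d G v : (forall p, G p 0) -> G 0%N v -> inK G (k0 d v).
elim: d G=> [//|d IH] G G0 Gv; split; first exact: IH.
by apply: inK0=> p.
Qed.
Lemma k0S d v : k0 d.+1 v = mkp (k0 d v) 0. by []. Qed.
Lemma proj0S d (u v : KT d) : proj0 (mkp u v) = proj0 u. by []. Qed.
Lemma k0D d u v : k0 d (u + v) = k0 d u + k0 d v.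
by elim: d=> [//|d IH]; rewrite !k0S mkpD IH addr0. Qed.
Lemma k0Z d a v : k0 d (a *: v) = a *: k0 d v.
by elim: d=> [//|d IH]; rewrite !k0S mkpZ IH scaler0. Qed.
Lemma dK_k0 d l v : dK l (k0 d v) = 0.
by elim: d l=> [//|d IH] l; rewrite dK_mkp IH dK0 scaler0 addr0 oppr0. Qed.
Lemma proj0K d v : proj0 (k0 d v) = v. by elim: d. Qed.
Lemma proj0D d (u v : KT d) : proj0 (u + v) = proj0 u + proj0 v.
elim: d u v=> [//|d IH] u v; have [u1 [u2 ->]] := mkpP u; have [v1 [v2 ->]] := mkpP v.
by rewrite !proj0S.
Qed.
Lemma proj0Z d a (u : KT d) : proj0 (a *: u) = a *: proj0 u.
elim: d u=> [//|d IH] u; have [u1 [u2 ->]] := mkpP u.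
by rewrite !proj0S.
Qed.
Lemma inK_proj0 d G (u : KT d) : inK G u -> G 0%N (proj0 u).
by elim: d G u=> [//|d IH] G u; case=> /IH. Qed.

Fixpoint lcomb B l : set V := if l is a :: l' then
 [set v | exists b c, [/\ B b, lcomb B l' c & v = c + a *: b]] else [set 0].
Lemma lcomb_proj0 l d G (z : KT d) : d = size l -> inK G z -> lcomb (G 1%N) l (proj0 (dK l z)).
move=> dE; subst; elim: l z=> [//|a l IH] z; have [u [v ->]] := @mkpP (size l) z.
move=> /inK_mkp[Gu Gv]; exists (proj0 v), (proj0 (dK l u)).
by split; [exact: inK_proj0 Gv|exact: IH|rewrite proj0S proj0D proj0Z].
Qed.

(** [G] bounds the cycles and [G'] the chains: in vanishing statements they differ by one
    homological degree, in graded ones they coincide. *)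
Definition ex2 d G G' l : Prop := forall z : KT d, inK G z -> dK l z = 0 ->
 exists2 w : KT d, inK G' w & dK l w = z.
Lemma ex2_cons d G G' a l : (forall p u v, G p u -> G p v -> G p (u + v)) ->
 (forall p v, G' p.+1 v -> G p (a *: v)) -> (forall p v, G' p v -> G' p (- v)) ->
 ex2 d G G' l -> ex2 d (G \o succn) (G' \o succn) l -> ex2 d.+1 G G' (a :: l).
move=> GD aG G'N e1 e2 z; have [u [v ->]] := mkpP z; move=> /inK_mkp[Gu Gv].
rewrite dK_cons=> /mkp_inj[E1 E2].
have dv0: dK l v = 0 by apply: oppr_inj; rewrite oppr0.
have [w2 Gw2 E] := e2 v Gv dv0.
have [||w1 Gw1 E'] := e1 (u + a *: w2).
- by apply: inKD=> //; apply: inKZ Gw2.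
- by rewrite dKD dKZ E.
exists (mkp w1 (- w2)); first by split=> //; apply: inKN=> // p; exact: G'N.
by rewrite dK_cons dKN opprK E E' scalerN addrK.
Qed.

(* Tails of the complex: vanishing of the homology in all degrees at least k. *)
Definition tails B k : nat -> set V := fun p=> if (k <= p)%N then B else [set 0].
Definition HV d B k l : Prop := forall j, (k <= j)%N -> ex2 d (tails B j) (tails B j.+1) l.

Section Tails.
Variable B : set V.
Hypothesis sB : smod setT B.
Lemma tails_smod k p : smod setT (tails B k p).
by rewrite /tails; case: ifP. Qed.
Lemma tails_succ k : tails B k.+1 \o succn = tails B k.
by []. Qed.
Lemma tail_smod k d : smod setT (@inK d (tails B k)).
exact: inK_smod (tails_smod k). Qed.
Lemma tailN k d (z : KT d) : inK (tails B k) z -> inK (tails B k) (- z).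
exact: (smodN (@srT R) (tail_smod _ _)). Qed.
Lemma tail_mkp k d (u v : KT d) : inK (tails B k.+1) (mkp u v) <->
 inK (tails B k.+1) u /\ inK (tails B k) v.
exact. Qed.
Lemma HV_cons d k a l : HV d B k l -> HV d.+1 B k.+1 (a :: l).
move=> H [//|j] kj; apply: ex2_cons.
- by move=> p u v; apply: (smodD (tails_smod _ _)).
- by move=> p v; rewrite /tails; case: ifP=> _; exact: smodZ.
- by move=> p v; apply: (smodN (@srT R) (tails_smod _ _)).
- by apply: H; apply: ltnW.
- by rewrite !tails_succ; apply: H.
Qed.
(** Exterior multiplication [h] by the basis vector of an entry [c] satisfies [d h + h d = c]; so
    every entry, and by linearity the ideal they generate, annihilates homology. *)
Lemma homotopy j l b (z : KT (size l)) : spn setT ([set` l] : set R^o) b ->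
 inK (tails B j) z -> dK l z = 0 -> exists2 y, inK (tails B j.+1) y & dK l y = b *: z.
have mem c: c \in l -> exists h : KT (size l) -> KT (size l),
 [/\ forall u v, h (u + v) = h u + h v, forall a u, h (a *: u) = a *: h u,
 forall i u, inK (tails B i) u -> inK (tails B i.+1) (h u) &
 forall u, dK l (h u) + h (dK l u) = c *: u].
 elim: l {z} => [//|a l IH]; rewrite inE=> /orP[/eqP->|/IH[h [hD hZ hB hE]]].
  exists (fun u=> mkp 0 u.1); split.
  - by move=> u v; rewrite mkpD addr0.
  - by move=> k u; rewrite mkpZ scaler0.
  - move=> i u; have [u1 [u2 ->]] := @mkpP (size l) u=> -[Bu1 _].
   by apply/tail_mkp; split=> //; exact: smod0 (tail_smod _ _).
  - move=> u; have [u1 [u2 ->]] := @mkpP (size l) u.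
   by rewrite /= dK0 add0r mkpD addr0 addKr.
 have h0: h 0 = 0 by apply: (addrI (h 0)); rewrite -hD !addr0.
 have hN u: h (- u) = - h u by rewrite -scaleN1r hZ scaleN1r.
 exists (fun u=> mkp (h u.1) (- h u.2)); split.
 - move=> u v; have [u1 [u2 ->]] := @mkpP (size l) u; have [v1 [v2 ->]] := @mkpP (size l) v.
  by rewrite !hD opprD.
 - move=> k u; have [u1 [u2 ->]] := @mkpP (size l) u; rewrite mkpZ.
  by rewrite !hZ -scalerN.
 - move=> i u; have [u1 [u2 ->]] := @mkpP (size l) u=> -[Bu1 Bu2].
  apply/tail_mkp; split; first exact: hB.
  apply: tailN; case: i Bu1 Bu2=> [|i] Bu1 Bu2; last by rewrite tails_succ in Bu2; exact: hB.
  have /hB: inK (tails B 0) u2 by [].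
  by apply: inK_mono=> p; rewrite /tails; case: ifP=> [_|_ v ->].
 - move=> u; have [u1 [u2 ->]] := @mkpP (size l) u; rewrite /= mkpD mkpZ.
  by rewrite hD hZ !dKN !hN !opprK scalerN addrACA addNr addr0 !hE.
elim=> [|r c v _ /mem[h [hD hZ hB hE]] _ IH] Bz dz.
 by exists 0; [exact: smod0 (tail_smod _ _)|rewrite dK0 scale0r].
have [y By E] := IH Bz dz.
exists (r *: h z + y).
 by apply: (smodD (tail_smod _ _))=> //; apply: (smodZ (tail_smod _ _))=> //; exact: hB.
have h0: h 0 = 0 by apply: (addrI (h 0)); rewrite -hD !addr0.
by rewrite dKD dKZ E scalerDl -scalerA -hE dz h0 addr0.
Qed.
(** By the cone sequence, vanishing for [a :: l] one degree up makes [a] injective on the homology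
    of [l], while by [homotopy] the power [a^N] acts on it as zero. *)
Lemma HV_remove k a l N : spn setT ([set` l] : set R^o) (a ^+ N) ->
 HV (size l).+1 B k.+1 (a :: l) -> HV (size l) B k l.
move=> aN H j kj z Bz dz.
have inj (v: KT (size l)) : inK (tails B j) v -> dK l v = 0 ->
  (exists2 y, inK (tails B j.+1) y & dK l y = a *: v) -> exists2 y, inK (tails B j.+1) y & dK l y = v.
 move=> Bv dv [y By E]; have [||w + E'] := H j.+1 kj (mkp (- y) v).
 - by apply/tail_mkp; split=> //; exact: tailN.
 - by rewrite dK_cons dKN E dv addNr oppr0.
 move: E'; have [w1 [w2 ->]] := mkpP w; rewrite dK_cons=> /mkp_inj[_ E2] /tail_mkp[_ Bw2].
 by exists (- w2); [exact: tailN|rewrite dKN].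
have [y By E] := homotopy aN Bz dz.
elim: N {aN} y By E=> [|M IHM] y By E; first by exists y=> //; rewrite E scale1r.
have [|||y' By' E'] := inj (a ^+ M *: z).
- exact: (smodZ (tail_smod _ _)).
- by rewrite dKZ dz scaler0.
- by exists y=> //; rewrite scalerA -exprS.
exact: IHM E'.
Qed.
Lemma lcomb_bound l c : lcomb B l c -> exists2 u : KT (size l), inK (tails B 1) u & dK l u = k0 _ c.
elim: l c=> [|a l IH] c; first by move=> ->; exists 0.
move=> [b [c' [Bb /IH[u Bu E] ->]]]; exists (mkp u (k0 _ b)).
 apply/tail_mkp; split=> //; exact: inK_k0.
by rewrite dK_cons E dK_k0 oppr0 -[k0 (size (a :: l)) _]/(mkp (k0 (size l) _) 0) k0D k0Z.
Qed.
(** A relation between [a c] and elements of [l B] is a cycle of homological degree one for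
    [a :: l]; the second component of a chain bounding it exhibits [c] in [l B]. *)
Lemma HV_regular a l c : HV (size l).+1 B 1 (a :: l) -> B c -> lcomb B l (a *: c) -> lcomb B l c.
move=> H Bc /lcomb_bound[u Bu E].
have [||w + E'] := H 1%N isT (mkp (- u) (k0 _ c)).
- apply/tail_mkp; split; first exact: tailN.
 exact: inK_k0.
- by rewrite dK_cons dKN E k0Z addNr dK_k0 oppr0.
move: E'; have [w1 [w2 ->]] := mkpP w; rewrite dK_cons=> /mkp_inj[_ E2] /tail_mkp[_ Bw2].
by have := lcomb_proj0 erefl (tailN Bw2); rewrite dKN E2 proj0K.
Qed.
(** The cone sequence makes [a] surjective on the homology of [l] in positive degrees, and this
    homology is a subquotient of a Noetherian module, so Nakayama kills it. *)
Lemma HV_nakayama a l (J : set R) : noethm setT B -> J a -> (forall b c, J c -> J (b * c)) ->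
 (forall b c, J b -> J c -> J (b + c)) -> (forall j, J j -> exists2 c, [set: R] c & c * (1 - j) = 1) ->
 HV (size l).+1 B 1 (a :: l) -> HV (size l) B 1 l.
move=> nB Ja JM JD Ju H j j1.
have nK d: noethm setT (@inK d (fun=> B)).
 elim: d=> [//|d IH] N sN NB.
 pose N1 : set (KT d) := [set u | exists v, N (mkp u v)].
 pose N2 : set (KT d) := [set v | N (mkp 0 v)].
 have [||s1 [s1N Ns1]] := IH N1.
 - split=> [|u u' [v Nv] [v' Nv']|b u _ [v Nv]].
  + by exists 0; exact: smod0 sN.
  + by exists (v + v'); rewrite -mkpD.
  + by exists (b *: v); rewrite -mkpZ; exact: smodZ.
 - by move=> u [v /NB[]].
 have [||s2 [s2N Ns2]] := IH N2.
 - split=> [|u u' Nv Nv'|b u _ Nv]; first exact: smod0 sN.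
  + by rewrite /N2 /= -[0]addr0 -mkpD.
  + by rewrite /N2 /= -(scaler0 _ b) -mkpZ; exact: smodZ.
 - by move=> v /NB[].
 have /choice[g gP]: forall u, exists v, u \in s1 -> N (mkp u v) by move=> u; have [/s1N[v]|] := boolP (u \in s1); [exists v|exists 0].
 exists ([seq mkp u (g u) | u <- s1] ++ [seq mkp 0 v | v <- s2]); split.
  by move=> z; rewrite mem_cat=> /orP[/mapP[u /gP Nu ->]|/mapP[v /s2N Nv ->]].
 set T := spn _ _.
 have T1 u: spn setT [set` s1] u -> exists v, N (mkp u v) /\ T (mkp u v).
  elim=> [|b u' u'' _ us _ [v [Nv Tv]]].
   by exists 0; split; [exact: smod0 sN|].
  exists (b *: g u' + v); rewrite -mkpD -mkpZ; split.
   by apply: smodD=> //; apply: smodZ=> //; exact: gP.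
  apply: smodD=> //; apply: smodZ=> //; apply: spn_gen=> //=.
  by rewrite mem_cat (map_f (fun u=> mkp u (g u))).
 have T2 v: spn setT [set` s2] v -> T (mkp 0 v).
  elim=> [|b v' v'' _ vs _ Tv] //.
  rewrite -[0]addr0 -mkpD; apply: smodD=> //; rewrite -(scaler0 _ b) -mkpZ.
  apply: smodZ=> //; apply: spn_gen=> //=.
  by rewrite mem_cat orbC map_f.
 move=> z; have [u [v ->]] := mkpP z=> Nz.
 have [v' [Nv' Tv']] := T1 u (Ns1 _ (ex_intro _ v Nz)).
 have ->: mkp u v = mkp u v' + mkp 0 (v - v') by rewrite mkpD addr0 addrC subrK.
 apply: smodD=> //; apply: T2; apply: Ns2; rewrite /N2 /=.
 have ->: mkp 0 (v - v') = mkp u v - mkp u v' by rewrite mkpD subrr.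
 exact.
pose C : set (KT (size l)) := [set z | exists2 w, inK (tails B j.+1) w & dK l w = z].
pose N : set (KT (size l)) := [set z | inK (tails B j) z /\ dK l z = 0].
suff HC: N `<=` C by move=> z Bz dz; apply: HC.
have tB i d: @inK d (tails B i) `<=` @inK d (fun=> B) by apply: inK_mono=> p; rewrite /tails; case: ifP=> [|_ v ->].
apply: (@nakayama_fg R (KT (size l)) setT J)=> //.
- split=> [|_ _ [u Bu <-] [v Bv <-]|b _ _ [u Bu <-]].
 + by exists 0; [exact: smod0 (tail_smod _ _)|rewrite dK0].
 + by exists (u + v); [exact: (smodD (tail_smod _ _))|rewrite dKD].
 + by exists (b *: u); [exact: (smodZ (tail_smod _ _))|rewrite dKZ].
- split=> [|u v [Bu du] [Bv dv]|b u _ [Bu du]]; split.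
 + exact: smod0 (tail_smod _ _).
 + by rewrite dK0.
 + exact: (smodD (tail_smod _ _)).
 + by rewrite dKD dv addr0.
 + exact: (smodZ (tail_smod _ _)).
 + by rewrite dKZ du scaler0.
- by move=> z [/tB].
- by move=> b c _; exact: JM.
- move=> z [Bz dz]; case: j j1 @C @N Bz=> [//|j] j1 C N Bz.
 have [||w + E'] := H j.+1 j1 (mkp z 0).
 + by apply/tail_mkp; split=> //; exact: smod0 (tail_smod _ _).
 + by rewrite dK_cons dz dK0 scaler0 addr0 oppr0.
 move: E'; have [w1 [w2 ->]] := mkpP w; rewrite dK_cons=> /mkp_inj[E1 E2] /tail_mkp[Bw1 Bw2].
 exists (dK l w1), (a *: w2); split=> //; first by exists w1.
 apply: spn_mem=> //; split=> //; apply: oppr_inj; by rewrite oppr0.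
Qed.
End Tails.

(** * Permuting the sequence *)

Definition kiso d (l l' : seq R) : Prop := exists f g : KT d -> KT d,
 [/\ forall a u v, f (a *: u + v) = a *: f u + f v /\ g (a *: u + v) = a *: g u + g v,
   forall z, dK l' (f z) = f (dK l z), forall z, dK l (g z) = g (dK l' z),
   forall z, f (g z) = z
  & forall G z, (forall p v, G p v -> G p (- v)) -> inK G z -> inK G (f z) /\ inK G (g z)].
Lemma kiso_refl d l : kiso d l l.
by exists id, id. Qed.
Lemma kiso_trans d l1 l2 l3 : kiso d l1 l2 -> kiso d l2 l3 -> kiso d l1 l3.
move=> [f [g [fL df dg fg GG]]] [f' [g' [fL' df' dg' fg' GG']]].
exists (f' \o f), (g \o g'); split=> /=.
- by move=> a u v; rewrite (fL a u v).1 (fL' _ _ _).1 (fL' a u v).2 (fL _ _ _).2.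
- by move=> z; rewrite df' df.
- by move=> z; rewrite dg dg'.
- by move=> z; rewrite fg.
- move=> G z GN Gz; split; first by apply: (GG' _ _ GN _).1; apply: (GG _ _ GN _).1.
 by apply: (GG _ _ GN _).2; apply: (GG' _ _ GN _).2.
Qed.
Lemma kiso_cons d a l l' : kiso d l l' -> kiso d.+1 (a :: l) (a :: l').
move=> [f [g [fL df dg fg GG]]].
have lin (h: KT d -> KT d) : (forall a u v, h (a *: u + v) = a *: h u + h v) ->
 [/\ forall u v, h (u + v) = h u + h v, forall k u, h (k *: u) = k *: h u & forall u, h (- u) = - h u].
 move=> hL; have h0: h 0 = 0 by have := hL (-1) 0 0; rewrite scaler0 addr0 scaleN1r addNr.
 have hZ k u: h (k *: u) = k *: h u by have := hL k u 0; rewrite h0 !addr0.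
 by split=> [u|//|u]; [have := hL 1 u; rewrite !scale1r|rewrite -scaleN1r hZ scaleN1r].
have [fD fZ fN] := lin f (fun a u v=> (fL a u v).1).
have [gD gZ gN] := lin g (fun a u v=> (fL a u v).2).
exists (fun z=> mkp (f z.1) (f z.2)), (fun z=> mkp (g z.1) (g z.2)); split.
- move=> b u v; have [u1 [u2 ->]] := mkpP u; have [v1 [v2 ->]] := mkpP v.
 by rewrite !fD !fZ !gD !gZ.
- by move=> z; rewrite !dK_cons !df fD fZ fN.
- by move=> z; rewrite !dK_cons !dg gD gZ gN.
- by move=> z; have [u [v ->]] := mkpP z; rewrite !fg.
- move=> G z GN; have [u [v ->]] := mkpP z=> /inK_mkp[Gu Gv]; split; split;
[exact: (GG _ _ GN Gu).1|apply: (GG (G \o succn) _ _ Gv).1=> p; exact: GN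
  |exact: (GG _ _ GN Gu).2|apply: (GG (G \o succn) _ _ Gv).2=> p; exact: GN].
Qed.
(** Exchanging two basis vectors exchanges the components along each of them and changes the sign of
    the component along their product. *)
Lemma kiso_swap d a b l : kiso d.+2 (a :: b :: l) (b :: a :: l).
pose f (z : KT d.+2) : KT d.+2 := mkp (mkp z.1.1 z.2.1) (mkp z.1.2 (- z.2.2)).
have zP z: exists p q r s : KT d, z = mkp (mkp p q) (mkp r s) by have [u [v]] := mkpP z; have [p [q ->]] := mkpP u; have [r [s ->]] := mkpP v; exists p, q, r, s.
have fE (p q r s: KT d) : f (mkp (mkp p q) (mkp r s)) = mkp (mkp p r) (mkp q (- s)) by [].
have fL k (u v: KT d.+2) : f (k *: u + v) = k *: f u + f v.
 have [p [q [r [s ->]]]] := zP u; have [p' [q' [r' [s' ->]]]] := zP v.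
 rewrite -[LHS]/(mkp (mkp (k *: p + p') (k *: r + r')) (mkp (k *: q + q') (- (k *: s + s')))).
 rewrite -[RHS]/(mkp (mkp (k *: p + p') (k *: r + r')) (mkp (k *: q + q') (k *: - s - s'))).
 by rewrite opprD scalerN.
have fd a' b' z: dK (b' :: a' :: l) (f z) = f (dK (a' :: b' :: l) z).
 have [p [q [r [s ->]]]] := zP z.
 rewrite -[LHS]/(mkp (mkp (dK l p + a' *: r + b' *: q) (- dK l r + b' *: - s))
  (mkp (- (dK l q + a' *: - s)) (- - dK l (- s)))).
 rewrite -[RHS]/(mkp (mkp (dK l p + b' *: q + a' *: r) (- (dK l r + b' *: s)))
  (mkp (- dK l q + a' *: s) (- - - dK l s))).
 by rewrite dKN !scalerN !opprD !opprK addrAC.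
exists f, f; split=> //.
- by move=> z; have [p [q [r [s ->]]]] := zP z; rewrite !fE opprK.
- move=> G z GN; have [p [q [r [s ->]]]] := zP z; rewrite fE=> -[[Gp Gq] [Gr Gs]].
 have Gs': inK ((G \o succn) \o succn) (- s) by apply: inKN=> // v; exact: GN.
 by [].
Qed.
Lemma kiso_perm l l' : perm_eq l l' -> kiso (size l) l l'.
elim: l l'=> [|a l IH] l' pl.
 by move: pl; rewrite perm_sym=> /perm_nilP ->; exact: kiso_refl.
have /splitPr al: a \in l' by rewrite -(perm_mem pl).
case: al pl=> l2 l3 pl.
have pl': perm_eq l (l2 ++ l3) by move: pl; rewrite perm_sym perm_catC perm_cons perm_catC perm_sym.
apply: kiso_trans (kiso_cons a (IH _ pl')) _; rewrite (perm_size pl').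
elim: l2 {pl pl'} => [|b l2 IH2] /=; first exact: kiso_refl.
apply: kiso_trans (kiso_swap _ _ _ _) _; exact: kiso_cons.
Qed.
Lemma ex2_perm G G' l l' : (forall p v, G p v -> G p (- v)) -> (forall p v, G' p v -> G' p (- v)) ->
 perm_eq l l' -> ex2 (size l) G G' l -> ex2 (size l') G G' l'.
move=> GN G'N pl; have := kiso_perm pl; rewrite -(perm_size pl).
move=> [f [g [fL df dg fg GG]]] H z Gz dz.
have g0: g 0 = 0 by have := (fL (-1) 0 0).2; rewrite scaler0 addr0 scaleN1r addNr.
have [||w Gw E] := H (g z); [exact: (GG _ _ GN Gz).2|by rewrite dg dz|].
by exists (f w); [exact: (GG _ _ G'N Gw).1|rewrite df E].
Qed.
Lemma HV_perm B k l l' : smod setT B -> perm_eq l l' -> HV (size l) B k l -> HV (size l') B k l'.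
move=> sB pl H j kj; apply: ex2_perm pl (H j kj)=> p v;
 exact: (smodN (@srT R) (tails_smod sB _ _)).
Qed.

(** * Choosing components *)
Lemma inK_split d (G G1 G2 : nat -> set V) a (z : KT d) :
 (forall p v, G p v -> exists u w, [/\ G1 p u, G2 p w & v = u + a *: w]) -> inK G z ->
 exists z1 z2, [/\ inK G1 z1, inK G2 z2 & z = z1 + a *: z2].
elim: d G G1 G2 z=> [|d IH] G G1 G2 z H; first exact: H.
have [u [v ->]] := mkpP z=> /inK_mkp[Gu Gv].
have [u1 [u2 [Gu1 Gu2 ->]]] := IH G G1 G2 u H Gu.
have [v1 [v2 [Gv1 Gv2 ->]]] := IH (G \o succn) (G1 \o succn) (G2 \o succn) v (fun p=> H p.+1) Gv.
by exists (mkp u1 v1), (mkp u2 v2).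
Qed.
Lemma inK_denom d (G : nat -> set V) (S : set R) (z : KT d) :
 S 1 -> (forall a b, S a -> S b -> S (a * b)) -> (forall p a v, S a -> G p v -> G p (a *: v)) ->
 inK (fun p=> [set v | exists2 s, S s & G p (s *: v)]) z -> exists2 s, S s & inK G (s *: z).
move=> S1 SM; elim: d G z=> [|d IH] G z GS //.
have [u [v ->]] := mkpP z=> /inK_mkp[Gu Gv].
have [s Ss Gsu] := IH G u GS Gu.
have [t St Gtv] := IH (G \o succn) v (fun p=> GS p.+1) Gv.
exists (s * t); first exact: SM.
rewrite mkpZ; apply/inK_mkp; split; first by rewrite mulrC -scalerA; apply: inKZ Gsu=> p w; exact: GS.
by rewrite -scalerA; apply: inKZ Gtv=> p w; exact: GS.
Qed.
End Koszul.

Section KoszulMap.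
Variables (R R' : comPzRingType) (V : lmodType R) (V' : lmodType R').
Variables (phi : R -> R') (f : V -> V').
Hypotheses (phi0 : phi 0 = 0) (fD : forall u v, f (u + v) = f u + f v)
 (fZ : forall a v, f (a *: v) = phi a *: f v).

Fixpoint mapK (d : nat) : KT V d -> KT V' d :=
 match d return KT V d -> KT V' d with
 | 0=> f
 | d'.+1=> fun z=> mkp (mapK z.1) (mapK z.2)
 end.
Let f0 : f 0 = 0.
by apply: (addrI (f 0)); rewrite -fD !addr0. Qed.
Let fN v : f (- v) = - f v.
by apply: (addrI (f v)); rewrite -fD !subrr. Qed.
Lemma mapK_mkp d (u v : KT V d) : mapK (mkp u v) = mkp (mapK u) (mapK v).
by []. Qed.
Lemma mapKD d (u v : KT V d) : mapK (u + v) = mapK u + mapK v.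
elim: d u v=> [|d IH] u v //.
have [u1 [u2 ->]] := mkpP u; have [v1 [v2 ->]] := mkpP v.
by rewrite !mapK_mkp !IH.
Qed.
Lemma mapK0 d : mapK (0 : KT V d) = 0.
by apply: (addrI (mapK 0)); rewrite -mapKD !addr0. Qed.
Lemma mapKN d (u : KT V d) : mapK (- u) = - mapK u.
by apply: (addrI (mapK u)); rewrite -mapKD !subrr mapK0. Qed.
Lemma mapKZ d a (u : KT V d) : mapK (a *: u) = phi a *: mapK u.
elim: d u=> [|d IH] u //.
by have := u; rewrite !mapK_mkp !IH.
Qed.
Lemma mapK_dK d l (u : KT V d) : mapK (dK l u) = dK (map phi l) (mapK u).
elim: d l u=> [|d IH] l u //.
have [u1 [u2 ->]] := mkpP u; rewrite dK_mkp !mapK_mkp dK_mkp mapKD mapKN !IH mapKZ.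
by case: l=> //=; rewrite phi0.
Qed.
Lemma inK_mapK d G G' (u : KT V d) : (forall p v, G p v -> G' p (f v)) -> inK G u -> inK G' (mapK u).
elim: d G G' u=> [|d IH] G G' u H; first exact: H.
have [u1 [u2 ->]] := mkpP u=> /inK_mkp[G1 G2]; split; first exact: IH G1.
by apply: IH G2=> p; exact: H.
Qed.
Lemma mapK_lift d G G' (u : KT V' d) : (forall p v, G' p v -> exists2 w, G p w & f w = v) ->
 inK G' u -> exists2 w, inK G w & mapK w = u.
elim: d G G' u=> [|d IH] G G' u H; first exact: H.
have [u1 [u2 ->]] := mkpP u=> /inK_mkp[G1 G2].
have [w1 Gw1 <-] := IH _ _ _ H G1.
have [w2 Gw2 <-] := IH (G \o succn) _ _ (fun p=> H p.+1) G2.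
by exists (mkp w1 w2).
Qed.
Lemma mapK_eq d (u : KT V d) G : (forall p v, G p v -> f v = 0 -> v = 0) -> inK G u -> mapK u = 0 -> u = 0.
elim: d G u=> [|d IH] G u H; first exact: H.
have [u1 [u2 ->]] := mkpP u=> /inK_mkp[G1 G2]; rewrite mapK_mkp [in X in X -> _]mkp0=> /mkp_inj[E1 E2].
by rewrite (IH _ _ H G1 E1) (IH _ _ (fun p=> H p.+1) G2).
Qed.
End KoszulMap.
#[local] Hint Resolve inK_smod tails_smod tail_smod : smods.

(** * Integral elements *)

Section Integral.
Variables (r : nat) (K : fieldType).
Notation E := {mpoly K[r]}.
Implicit Types (A D : set K) (U S : seq E) (v w u : E).

Inductive monn U : nat -> set E :=
| monn_one : monn U 0 1
| monn_mul n u w : u \in U -> monn U n w -> monn U n.+1 (u * w).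
Definition mon U : set E := [set w | exists n, monn U n w].
Definition prodset (X : set E) S : set E := [set w | exists x e, [/\ X x, e \in S & w = x * e]].

(* integrality over the ring D[U] *)
Definition int D U v : Prop := exists S, (exists2 e, e \in S & e != 0) /\
 forall e, e \in S -> spn D (prodset (mon U) S) (v * e).
Lemma monn_cat U n k v w : monn U n v -> monn U k w -> monn U (n + k) (v * w).
move=> Hv Hw; elim: Hv=> [|m u v' uU _ IH]; first by rewrite mul1r.
by rewrite -mulrA; constructor.
Qed.
Lemma monM U v w : mon U v -> mon U w -> mon U (v * w).
by move=> [n Hv] [k]; exists (n + k)%N; apply: monn_cat. Qed.
Lemma mon1 U : mon U 1. by exists 0%N; constructor. Qed.
Lemma monn_gen U u : u \in U -> monn U 1 u.
by move=> uU; rewrite -[u]mulr1; do 2?constructor. Qed.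
Lemma mon_gen U u : u \in U -> mon U u.
by exists 1%N; apply: monn_gen. Qed.
Lemma monn_homog U n w : (forall u, u \in U -> u \is 1.-homog) -> monn U n w -> w \is n.-homog.
move=> hU; elim=> [|m u v uU _ IH]; first by rewrite dhomog1.
by have := dhomogM (hU u uU) IH.
Qed.
Lemma spn_mul D (X Y Z : set E) (v w : E) : subring D ->
 (forall x y, X x -> Y y -> spn D Z (x * y)) -> spn D X v -> spn D Y w -> spn D Z (v * w).
move=> sD H Sv Sw.
elim: Sv=> [|d x v' Dd Xx _ IH]; first by rewrite mul0r.
rewrite mulrDl -scalerAl; apply: spnD=> //; apply: smodZ=> //.
elim: Sw=> [|d' y w' Dd' Yy _ IH']; first by rewrite mulr0.
by rewrite mulrDr -scalerAr; apply: spnD=> //; apply: smodZ=> //; apply: H.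
Qed.
Lemma spn_mulE D (X Y : set E) (e v : E) : subring D -> (forall x, X x -> spn D Y (x * e)) ->
 spn D X v -> spn D Y (v * e).
move=> sD H; elim=> [|d x w Dd /H Hx _ IH]; first by rewrite mul0r.
by rewrite mulrDl -scalerAl.
Qed.
Lemma rees_mul D U v w : subring D -> spn D (mon U) v -> spn D (mon U) w -> spn D (mon U) (v * w).
move=> sD; apply: spn_mul=> // x y mx my; apply: spn_gen=> //; exact: monM.
Qed.
Lemma rees1 D U : subring D -> spn D (mon U) 1.
by move=> sD; apply: spn_gen; [|exact: mon1]. Qed.
Lemma int_rees D U v : subring D -> spn D (mon U) v -> int D U v.
move=> sD Sv; exists [:: 1]; split; first by exists 1; rewrite ?oner_neq0.
move=> e; rewrite inE=> /eqP ->; apply: spn_mulE Sv=> // x mx.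
apply: spn_gen=> //.
by exists x, 1.
Qed.
Lemma int_combine D U S S' v : subring D ->
 (forall e, e \in S -> spn D (prodset (mon U) S) (v * e)) ->
 forall e e', e \in S -> e' \in S' -> spn D (prodset (mon U) [seq a * b | a <- S, b <- S']) (v * (e * e')).
move=> sD H e e' eS e'S; rewrite mulrA; apply: spn_mulE (H e eS)=> // _ [m [f [mm fS ->]]].
apply: spn_gen=> //.
by exists m, (f * e'); rewrite mulrA.
Qed.
(** Witnesses [S] of [v] and [S'] of [w] combine to the set of products, nonzero because the
    polynomial ring is a domain, on which both [v] and [w] act. *)
Lemma int_op D U (op : E -> E -> E) v w : subring D ->
 (forall S, (forall e, e \in S -> spn D (prodset (mon U) S) (v * e)) ->
      (forall e, e \in S -> spn D (prodset (mon U) S) (w * e)) ->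
       forall e, e \in S -> spn D (prodset (mon U) S) (op v w * e)) ->
 int D U v -> int D U w -> int D U (op v w).
move=> sD Hop [S [[e0 e0S e00] HS]] [S' [[e1 e1S e10] HS']].
exists [seq a * b | a <- S, b <- S']; split.
 by exists (e0 * e1); [|rewrite mulf_neq0].
apply: Hop=> _ /allpairsP[[a b] /= [aS bS ->]]; first exact: int_combine.
rewrite [a * b]mulrC; apply: spn_mono (int_combine sD HS' bS aS)=> // _ [m [f [mm /allpairsP[[c d] /= [cS dS ->]] ->]]].
by exists m, (d * c); rewrite [c * d]mulrC.
Qed.
Lemma int_add D U v w : subring D -> int D U v -> int D U w -> int D U (v + w).
move=> sD; apply: (int_op sD)=> S Hv Hw e eS; rewrite mulrDl; apply: spnD; [exact: Hv|exact: Hw].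
Qed.
Lemma int_mul D U v w : subring D -> int D U v -> int D U w -> int D U (v * w).
move=> sD; apply: (int_op sD)=> S Hv Hw e eS; rewrite mulrAC mulrC.
apply: (@spn_trans _ E D (fun z=> exists m f, [/\ mon U m, f \in S & z = m * (w * f)]))=> //.
 move=> _ [m [f [mm fS ->]]]; rewrite mulrC; apply: spn_mulE (Hw f fS)=> // _ [m' [f' [mm' fS' ->]]].
 rewrite mulrAC; apply: spn_gen=> //.
 by exists (m' * m), f'; split=> //; exact: monM.
rewrite mulrC; apply: spn_mulE (Hv e eS)=> // _ [m [f [mm fS ->]]].
by apply: spn_gen; [|exists m, f; rewrite -mulrA [f * w]mulrC].
Qed.
Lemma int_scale D U a v : subring D -> D a -> int D U v -> int D U (a *: v).
move=> sD Da Hv; rewrite -mul_mpolyC; apply: int_mul=> //; apply: int_rees=> //.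
by rewrite -[a%:MP]mulr1 mul_mpolyC; apply: spn_mem=> //; exact: mon1.
Qed.
Lemma int_smod D U : subring D -> smod D (int D U).
move=> sD; split=> [|u v|a v]; [|exact: int_add|exact: int_scale].
exact: int_rees.
Qed.
Lemma rees_sub D D' U U' : subring D' -> D `<=` D' -> (forall u, u \in U -> spn D' (mon U') u) ->
 spn D (mon U) `<=` spn D' (mon U').
move=> sD' DD' UU'; apply: subset_trans (_ : spn D' (mon U) `<=` _); first exact: spn_mono.
apply: spn_trans=> // w [n]; elim=> [|k u w' /UU' uU _ IH]; first exact: rees1.
exact: rees_mul.
Qed.
Lemma int_sub D D' U U' : subring D' -> D `<=` D' -> (forall u, u \in U -> spn D' (mon U') u) ->
 int D U `<=` int D' U'.
move=> sD' DD' UU' v [S [Sn HS]]; exists S; split=> // e eS.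
apply: (@spn_trans _ E D' (prodset (mon U) S))=> //; last exact: spn_mono (HS e eS).
move=> _ [m [f [mm fS ->]]].
apply: (@spn_mulE D' (mon U'))=> //.
 by move=> x mx; apply: spn_gen; [|exists x, f].
apply: (rees_sub sD' (@subset_refl _ D') UU')=> //.
Qed.
(** The witnesses of the elements of [U'] multiply to one set [F] serving all of them; the products
    of [S] and [F] are then a witness for [v] over [U]. *)
Lemma int_trans D U U' v : subring D -> (forall u, u \in U' -> int D U u) -> int D U' v -> int D U v.
move=> sD HU' [S [[e0 e0S e00] HS]].
have [F [[f0 f0F f00] HF]]: exists F, (exists2 f, f \in F & f != 0) /\
  forall u f, u \in U' -> f \in F -> spn D (prodset (mon U) F) (u * f).
 elim: U' HU' {HS} => [|u U' IH] H.
  by exists [:: 1]; split=> //; exists 1; rewrite ?oner_neq0.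
 have [|F [[f fF f0] HF]] := IH; first by move=> w wU; apply: H; rewrite inE wU orbT.
 have [G [[g gG g0] HG]] := H u (mem_head _ _).
 exists [seq a * b | a <- F, b <- G]; split; first by exists (f * g); [|rewrite mulf_neq0].
 move=> w _ /[swap] /allpairsP[[a b] /= [aF bG ->]]; rewrite inE=> /orP[/eqP->|wU].
  rewrite [a * b]mulrC; apply: spn_mono (int_combine sD HG bG aF)=> // _ [m [h [mm /allpairsP[[c d] /= [cS dS ->]] ->]]].
  by exists m, (d * c); rewrite [c * d]mulrC.
 by apply: int_combine=> // z; exact: HF.
have HM w f: mon U' w -> f \in F -> spn D (prodset (mon U) F) (w * f).
 move=> [n]; elim=> [|k u w' uU' _ IH] fF.
  by rewrite mul1r; apply: spn_gen; [|exists 1, f; rewrite mul1r; split=> //; exact: mon1].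
 rewrite -mulrA mulrC; apply: spn_mulE (IH fF)=> // _ [m [f' [mm f'F ->]]].
 rewrite -mulrA mulrC [f' * u]mulrC; apply: spn_mulE (HF u f' uU' f'F)=> // _ [m' [f2 [mm' f2F ->]]].
 rewrite mulrAC; apply: spn_gen=> //.
 by exists (m' * m), f2; split=> //; exact: monM.
exists [seq a * b | a <- S, b <- F]; split; first by exists (e0 * f0); [|rewrite mulf_neq0].
move=> _ /allpairsP[[e f] /= [eS fF ->]]; rewrite mulrA; apply: spn_mulE (HS e eS)=> // _ [w [e' [mw e'S ->]]].
rewrite mulrAC; apply: spn_mulE (HM w f mw fF)=> // _ [m [f' [mm f'F ->]]].
apply: spn_gen=> //.
by exists m, (e' * f'); rewrite -mulrA [f' * e']mulrC.
Qed.
Lemma spn_Loc_clear D P (X : set E) w : subring D -> primei D P -> spn (Loc D P) X w ->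
 exists s, [/\ D s, ~ P s & spn D X (s *: w)].
move=> sD pP; elim=> [|_ x w' [a [s [Da Ds Ps ->]]] Xx _ [t [Dt Pt St]]].
 by exists 1; case: pP.
exists (s * t); split=> //; first exact: (primeMn pP).
have s0 := prime_neq0 pP Ps.
rewrite scalerDr scalerA [X in X *: x](_ : _ = t * a); last by field.
by apply: spnD; [|rewrite -scalerA].
Qed.
Lemma int_Loc D P U v : subring D -> primei D P -> int (Loc D P) U v ->
 exists s, [/\ D s, ~ P s & int D U (s *: v)].
move=> sD pP [S [Sn HS]].
have gen (T: seq E) : (forall e, e \in T -> spn (Loc D P) (prodset (mon U) S) (v * e)) ->
  exists s, [/\ D s, ~ P s & forall e, e \in T -> spn D (prodset (mon U) S) (s *: (v * e))]; last first.
 have [s [Ds Ps Hs]] := gen S HS.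
 by exists s; split=> //; exists S; split=> // e; rewrite -scalerAl; exact: Hs.
elim: T=> [|e T IH] H.
 by exists 1; case: pP.
have [|s [Ds Ps Hs]] := IH; first by move=> f fT; apply: H; rewrite inE fT orbT.
have [t [Dt Pt Ht]] := spn_Loc_clear sD pP (H e (mem_head _ _)).
exists (s * t); split=> //; first exact: (primeMn pP).
move=> f; rewrite inE=> /orP[/eqP->|fT]; first by rewrite -scalerA.
by rewrite mulrC -scalerA; apply: smodZ=> //; exact: Hs.
Qed.
Lemma int_morph D U v (f : {rmorphism E -> E}) : (forall a w, f (a *: w) = a *: f w) -> injective f ->
 int D U v -> int D (map f U) (f v).
move=> fZ fI [S [[e0 e0S e00] HS]]; exists (map f S); split.
 by exists (f e0); [|rewrite -(rmorph0 f) inj_eq].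
move=> _ /mapP[e eS ->]; rewrite -rmorphM; elim: (HS e eS)=> [|d x w Dd [m [e' [[n mm] e'S ->]]] _ IH].
 by rewrite rmorph0.
rewrite rmorphD fZ; apply: spn_cons=> //; rewrite rmorphM; exists (f m), (f e'); split=> //.
exists n; elim: mm=> [|k u w' uU _ IHw]; first by rewrite rmorph1; constructor.
by rewrite rmorphM; constructor.
Qed.

(** * Gluing integrality from the two charts *)

Section Glue.
Variables (A : set K) (x y : K).
Hypotheses (sA : subring A) (Ax : A x) (Ay : A y).

(** The ideal [(z, w)^n]. Multiplication by [z^n] carries a given element of [A[w / z]] into it for
    large [n], which compares the charts without denominators. *)
Definition msp (z w : K) n : set K :=
 spn A ([set v | exists i j, (i + j = n)%N /\ v = z ^+ i * w ^+ j] : set K^o).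
Lemma msp_swap (z w : K) n : msp z w n = msp w z n.
by apply/seteqP; split; apply: (@spn_mono _ K^o)=> // v [i [j]]; exists j, i; rewrite addnC mulrC.
Qed.
Lemma msp_mul (z w : K) n k a b : msp z w n a -> msp z w k b -> msp z w (n + k) (a * b).
move=> Ha Hb; elim: Ha=> [|d _ v Dd [i [j [ij ->]]] _ IH]; first by rewrite mul0r.
rewrite mulrDl; apply: spnD=> //.
elim: Hb=> [|d' _ v' Dd' [i' [j' [ij' ->]]] _ IH']; first by rewrite mulr0.
rewrite mulrDr; apply: spnD=> //.
rewrite -[_ * _]/(d * (z ^+ i * w ^+ j) * (d' * (z ^+ i' * w ^+ j'))).
have ->: d * (z ^+ i * w ^+ j) * (d' * (z ^+ i' * w ^+ j')) = (d * d') * (z ^+ (i + i') * w ^+ (j + j')) by rewrite !exprD; ring.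
apply: spn_mem=> //.
by exists (i + i')%N, (j + j')%N; rewrite addnACA ij ij'.
Qed.
Lemma msp_clear (z w : K) b : z != 0 -> adj A (w / z) b -> exists N, forall n, (N <= n)%N -> msp z w n (z ^+ n * b).
move=> z0 [p Ap ->]; exists (size p)=> n sn; rewrite horner_coef mulr_sumr.
apply: (smod_sum (N := (msp z w n : set K^o)))=> [|i _] //.
have le: (i <= n)%N by apply: ltnW; apply: leq_trans.
have ->: z ^+ n * (p`_i * (w / z) ^+ i) = p`_i * (z ^+ (n - i) * w ^+ i).
 rewrite -{1}(subnK le) exprD expr_div_n mulrCA; congr (_ _); rewrite -mulrA; congr (_ _).
 by rewrite mulrC divfK // expf_neq0.
by apply: spn_mem=> //; exists (n - i)%N, i; rewrite subnK.
Qed.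
Lemma spn_clear (z w : K) (X : set E) v : z != 0 -> spn (adj A (w / z)) X v ->
 exists N, forall n, (N <= n)%N -> spn (msp z w n) X (z ^+ n *: v).
move=> z0; elim=> [|d u v' /(msp_clear z0)[N HN] Xu _ [N' HN']].
 by exists 0%N=> n; rewrite scaler0.
exists (maxn N N')=> n; rewrite geq_max=> /andP[h1 h2].
by rewrite scalerDr scalerA; apply: spn_cons=> //; [exact: HN|exact: HN'].
Qed.
Lemma int_clear (z w : K) U v : z != 0 -> int (adj A (w / z)) U v -> exists (S : seq E) (N : nat), (exists2 e, e \in S & e != 0) /\
 forall n e, (N <= n)%N -> e \in S -> spn (msp z w n) (prodset (mon U) S) (z ^+ n *: (v * e)).
move=> z0 [S [Sn HS]]; exists S.
have gen (T: seq E) : (forall e, e \in T -> spn (adj A (w / z)) (prodset (mon U) S) (v * e)) ->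
  exists N, forall n e, (N <= n)%N -> e \in T -> spn (msp z w n) (prodset (mon U) S) (z ^+ n *: (v * e)); last first.
 by have [N] := gen S HS; exists N.
elim: T=> [|e T IH] H; first by exists 0%N.
have [|N HN] := IH; first by move=> f fT; apply: H; rewrite inE fT orbT.
have [N' HN'] := spn_clear z0 (H e (mem_head _ _)).
exists (maxn N N')=> n f; rewrite geq_max=> /andP[h1 h2].
by rewrite inE=> /orP[/eqP->|]; [exact: HN'|exact: HN].
Qed.
(** Witnesses [S1] and [S2] over the charts need denominators [x^N] and [y^N]. In the products
    [x^i y^(2 N - i) S1 S2] each monomial contains [x^N] or [y^N], which absorbs the denominator of
    the corresponding chart and returns monomials of the same degree: these products are a witness
    over [A]. *)
Lemma int_glue U v : x != 0 -> y != 0 -> int (adj A (y / x)) U v -> int (adj A (x / y)) U v -> int A U v.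
move=> x0 y0 /(int_clear x0)[S1 [N1 [[e1 e1S e10] H1]]] /(int_clear y0)[S2 [N2 [[e2 e2S e20] H2]]].
pose N := maxn N1 N2; pose M := (N + N)%N.
pose P := [seq a * b | a <- S1, b <- S2].
pose S3 := [seq (x ^+ i * y ^+ (M - i)) *: p | i <- iota 0 M.+1, p <- P].
have step w: spn (msp x y M) (prodset (mon U) P) w -> spn A (prodset (mon U) S3) w.
 elim=> [|d _ w' Hd [m [p [mm pP ->]]] _ IH] //.
 apply: spnD=> //; elim: Hd=> [|a _ c Aa [i [j [ij ->]]] _ IH']; first by rewrite scale0r.
 rewrite scalerDl; apply: spnD=> //; rewrite -scalerA; apply: spn_mem=> //.
 exists m, ((x ^+ i * y ^+ j) *: p); split=> //; last by rewrite scalerAr.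
 have ->: j = (M - i)%N by rewrite -ij addKn.
 apply/allpairsP; exists (i, p); by rewrite mem_iota /= -ij leq_addr.
have pw z k: A z -> (z = x \/ z = y) -> msp x y k (z ^+ k).
 move=> Az [->|->]; rewrite -[X in _ X]mul1r; apply: spn_mem=> //.
 - by exists k, 0%N; rewrite mulr1 addn0.
 - by exists 0%N, k; rewrite mul1r.
exists S3; split.
 exists ((x ^+ 0 * y ^+ (M - 0)) *: (e1 * e2))=> //.
 by rewrite scaler_eq0 mul1r expf_eq0 (negPf y0) andbF mulf_neq0.
move=> _ /allpairsP[[i p] /= [iM /allpairsP[[a b] /= [aS bS ->]] ->]]; apply: step.
have {}iM: (i <= M)%N by move: iM; rewrite -/(iota 0 M.+1) mem_iota.
have [Ni|Ni] := leqP N i.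
 have ->: v * ((x ^+ i * y ^+ (M - i)) *: (a * b)) = (x ^+ (i - N) * y ^+ (M - i)) *: ((x ^+ N *: (v * a)) * b) by rewrite -scalerAr -scalerAl scalerA; congr (_ *: _); [rewrite -{1}(subnK Ni) exprD; ring|ring].
 apply: (spnZ (D := msp x y N))=> [d Hd|].
  have EM: (i - N + (M - i) + N = M)%N by rewrite /M in iM; lia.
  rewrite -[X in msp _ _ X]EM.
  by apply: msp_mul=> //; apply: msp_mul; apply: pw=> //; [left|right].
 elim: (H1 N a (leq_maxl _ _) aS)=> [|d _ w Hd [m [f [mm fS ->]]] _ IH].
  by rewrite mul0r.
 rewrite mulrDl -scalerAl; apply: spn_cons=> //; exists m, (f * b); by rewrite mulrA.
have ->: v * ((x ^+ i * y ^+ (M - i)) *: (a * b)) = (x ^+ i * y ^+ (M - i - N)) *: ((y ^+ N *: (v * b)) * a).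
 have NM: (N <= M - i)%N by rewrite /M; lia.
 by rewrite -scalerAr -scalerAl scalerA; congr (_ *: _); [rewrite -{1}(subnK NM) exprD; ring|ring].
apply: (spnZ (D := msp x y N))=> [d Hd|].
 have EM: (i + (M - i - N) + N = M)%N by rewrite /M in iM *; lia.
 rewrite -[X in msp _ _ X]EM.
 by apply: msp_mul=> //; apply: msp_mul; apply: pw=> //; [left|right].
have := H2 N b (leq_maxr _ _) bS; rewrite msp_swap.
elim=> [|d _ w Hd [m [f [mm fS ->]]] _ IH]; first by rewrite mul0r.
rewrite mulrDl -scalerAl; apply: spn_cons=> //; exists m, (a * f); split=> //; by rewrite mulrCA mulrC.
Qed.
End Glue.

Definition Rb D U n : set E := [set v | v \is n.-homog /\ int D U v].
(* The graded pieces of the normalized Rees algebra in the total degree n part of the Koszul complex. *)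
Definition Rg D U n p : set E := if (p <= n)%N then Rb D U (n - p) else [set 0].
Lemma Rb_smod D U n : subring D -> smod D (Rb D U n).
move=> sD; have sI := int_smod U sD; split=> [|u v [hu iu] [hv iv]|a v Da [hv iv]]; split=> //.
- exact: dhomog0.
- exact: dhomogD.
- exact: dhomogZ.
Qed.
Lemma Rg_smod D U n p : subring D -> smod D (Rg D U n p).
by move=> sD; rewrite /Rg; case: ifP=> _; [exact: Rb_smod|]. Qed.
Lemma Rg_succ D U n : Rg D U n.+1 \o succn = Rg D U n.
exact. Qed.
Lemma Rb_mul D U n k v w : subring D -> Rb D U n v -> Rb D U k w -> Rb D U (n + k) (v * w).
by move=> sD [hv iv] [hw]; split; [exact: dhomogM|exact: int_mul]. Qed.
End Integral.
#[local] Hint Resolve int_smod Rb_smod Rg_smod : smods.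

(** * Polynomial rings over unique factorization-like subrings *)

Section FreeCase.
Variables (r : nat) (K : fieldType).
Notation E := {mpoly K[r]}.
Implicit Types (A D P : set K) (f g v w : E).

Definition mcf D : set E := [set f | forall m, D f@_m].
Definition Xs : seq E := [seq 'X_i | i <- enum 'I_r].
Lemma mcf_smod D P : subring D -> ideal D P -> smod D (mcf P).
move=> sD iP; split=> [m|u v Pu Pv m|a v Da Pv m].
- by rewrite mcoeff0.
- by rewrite mcoeffD; exact: (idealD iP).
- by rewrite mcoeffZ; exact: (idealMl iP).
Qed.
Lemma self_ideal D : subring D -> ideal D D.
by move=> sD; split=> //; split=> [||a b]=> //; exact: srM. Qed.
Lemma mcf_mul D P f g : subring D -> ideal D P -> mcf D f -> mcf P g -> mcf P (f * g).
move=> sD iP Df Pg m; rewrite mcoeffM; have [sP _] := iP.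
by apply: (smod_sum (N := (P : set K^o)))=> // -[k1 k2] _; exact: (idealMl iP).
Qed.
Lemma mcfX D m : subring D -> mcf D 'X_[m].
by move=> sD k; rewrite mcoeffX; case: eqP=> _; [exact: sr1|exact: sr0]. Qed.
Lemma mcf_monn D n f : subring D -> monn Xs n f -> mcf D f.
move=> sD; elim=> [|k u w /mapP[i _ ->] _ IH].
 by move=> m; rewrite mcoeff1; case: eqP=> _; [exact: sr1|exact: sr0].
by apply: (mcf_mul sD (self_ideal sD)); [exact: mcfX|].
Qed.
Lemma monn_X m : monn Xs (mdeg m) 'X_[m].
suff gen n: forall m, mdeg m = n -> monn Xs n 'X_[m] by exact: gen.
elim: n {m} => [|n IH] m.
 by move=> /eqP; rewrite mdeg_eq0=> /eqP ->; rewrite mpolyX0; constructor.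
move=> md; have [i mi]: exists i, (0 < m i)%N.
 apply: contrapT=> H; move: md; rewrite mdegE big1 // => i _.
 by apply/eqP; rewrite -leqn0 leqNgt; apply/negP=> h; apply: H; exists i.
have E1: m = (U_(i) + (m - U_(i)))%MM.
 apply/mnmP=> j; rewrite mnmDE mnmBE mnm1E; case: eqP=> [<-|]; last by rewrite subn0.
 by rewrite add1n subn1 prednK.
have md': mdeg (m - U_(i))%MM = n by move: md; rewrite {1}E1 mdegD mdeg1=> -[].
rewrite E1 mpolyXD; constructor=> //.
exact: IH.
Qed.
Lemma mcf_spn D n f : subring D -> f \is n.-homog -> mcf D f -> spn D (monn Xs n) f.
move=> sD hf Df; rewrite [f]mpolyE; apply: smod_sum_seq=> //.
move=> m mf _; apply: spn_mem=> //; rewrite -(dhomog_mf hf mf); exact: monn_X.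
Qed.

Section Gauss.
Variables (D P : set K).
Hypotheses (sD : subring D) (pP : primei D P).
Lemma mcf_truncate f : mcf D f -> exists f0, [/\ mcf D f0, mcf P (f - f0) & forall m, f0@_m = 0 \/ ~ P f0@_m].
move=> Df; have [iP _ _] := pP.
pose f0 : E := \sum_(m <- msupp f | ~~ `[< P f@_m >]) f@_m *: 'X_[m].
have f0E m: f0@_m = if `[< P f@_m >] then 0 else f@_m.
 rewrite raddf_sum /=.
 under eq_bigr do rewrite mcoeffZ mcoeffX.
 have [ms|ms] := boolP (m \in msupp f).
  rewrite big_mkcond (bigD1_seq m) //= eqxx mulr1 big1 ?addr0; first by case: asboolP.
  by move=> k /negPf km; rewrite km mulr0 if_same.
 rewrite big_seq_cond big1; first by move: ms; rewrite -mcoeff_eq0=> /eqP ->; rewrite if_same.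
 by move=> k /andP[kf]; case: eqP=> [km|]; rewrite ?mulr0 //; move: ms; rewrite -km kf.
exists f0; split=> m; rewrite ?mcoeffB f0E; case: asboolP=> // H.
- by rewrite subrr.
- by left.
- by right.
Qed.
(** Once the terms with coefficients in [P] are dropped, both leading coefficients lie outside [P],
    and so does their product, the leading coefficient of [f0 * g0]. *)
Lemma mcf_gauss f g : mcf D f -> mcf D g -> mcf P (f * g) -> mcf P f \/ mcf P g.
move=> Df Dg Pfg; have [iP P1 Pp] := pP.
have [f0 [Df0 Pf f0P]] := mcf_truncate Df; have [g0 [Dg0 Pg g0P]] := mcf_truncate Dg.
have sP := mcf_smod sD iP.
have [f00|f00] := eqVneq f0 0; first by left; move: Pf; rewrite f00 subr0.
have [g00|g00] := eqVneq g0 0; first by right; move: Pg; rewrite g00 subr0.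
have : mcf P (f0 * g0).
 have ->: f0 * g0 = f * g - ((f - f0) * g + f0 * (g - g0)) by ring.
 apply: (smodB sD sP)=> //; apply: (smodD sP); last exact: mcf_mul.
 by rewrite mulrC; exact: mcf_mul.
move=> /(_ (mlead f0 + mlead g0)%MM); rewrite mleadcM.
have nz (h: E) : h != 0 -> (forall m, h@_m = 0 \/ ~ P h@_m) -> ~ P (mleadc h) by move=> h0 /(_ (mlead h))[/eqP|//]; rewrite mleadc_eq0 (negPf h0).
by move=> /Pp[||/(nz _ f00)//|/(nz _ g00)//].
Qed.
End Gauss.

Section Normal.
Variable D : set K.
Hypotheses (sD : subring D) (nD : noeth D) (gD : good D).
Hypothesis fracD : forall k : K, exists s, [/\ D s, s != 0 & D (s * k)].
Lemma mcf_denom (S : seq E) : exists s, [/\ D s, s != 0 & forall f, f \in S -> mcf D (s *: f)].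
have gen (T: seq K) : exists s, [/\ D s, s != 0 & forall k, k \in T -> D (s * k)].
 elim: T=> [|k T [s [Ds s0 HT]]]; first by exists 1; split; [|exact: oner_neq0|].
 have [t [Dt t0 Dtk]] := fracD k; exists (s * t); split=> //; first exact: mulf_neq0.
 move=> j; rewrite inE=> /orP[/eqP->|/HT Dj]; first by rewrite -mulrA.
 by rewrite [s * t]mulrC -mulrA.
elim: S=> [|f S [s [Ds s0 HS]]]; first by exists 1; split; [|exact: oner_neq0|].
have [t [Dt t0 Ht]] := gen [seq f@_m | m <- msupp f].
exists (s * t); split=> //; first exact: mulf_neq0.
move=> g; rewrite inE=> /orP[/eqP->|/HS Dg] m; rewrite mcoeffZ.
 rewrite -mulrA; apply: srM=> //; have [mf|] := boolP (m \in msupp f).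
  exact: Ht.
 by rewrite -mcoeff_eq0=> /eqP ->.
by rewrite [s * t]mulrC -mulrA; apply: srM=> //; rewrite -mcoeffZ.
Qed.
(** All powers of [v] preserve the module spanned by the witness [S]; so a common denominator of the
    coefficients of [S], times a nonzero member of [S], works for every [k]. *)
Lemma int_almost v : int D Xs v -> exists2 f, f != 0 & mcf D f /\ forall k, mcf D (v ^+ k * f).
move=> [S [[e eS e0] HS]]; have [s [Ds s0 HsS]] := mcf_denom S.
have sM := mcf_smod sD (self_ideal sD).
have SD u: spn D (prodset (mon Xs) S) u -> mcf D (s *: u).
 elim=> [|d x w Dd [m [f [[n mm] fS ->]]] _ IH] //.
 rewrite scalerDr; apply: (smodD sM)=> //; rewrite scalerA mulrC -scalerA scalerAr.
 apply: (smodZ sM)=> //; apply: (mcf_mul sD (self_ideal sD)); [exact: mcf_monn mm|exact: HsS].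
have vk k f: f \in S -> spn D (prodset (mon Xs) S) (v ^+ k * f).
 elim: k f=> [|k IH] f fS.
  rewrite mul1r; apply: spn_gen=> //.
  by exists 1, f; rewrite mul1r; split=> //; exact: mon1.
 have ->: v ^+ k.+1 * f = v ^+ k * f * v by rewrite exprS; ring.
 apply: spn_mulE (IH f fS)=> // _ [m [f' [mm f'S ->]]].
 rewrite -mulrA mulrC [f' * v]mulrC; apply: spn_mulE (HS f' f'S)=> // _ [m' [f2 [mm' f2S ->]]].
 rewrite mulrAC; apply: spn_gen=> //.
 by exists (m' * m), f2; split=> //; exact: monM.
exists (s *: e); first by rewrite scaler_eq0 negb_or s0.
split; first exact: HsS.
by move=> k; rewrite -scalerAr; apply: SD; exact: vk.
Qed.
Lemma not_infinitely_divisible (g a : K) : D g -> a != 0 -> (forall c, D c -> g * c <> 1) ->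
 ~ (forall k, exists2 c, D c & a = g ^+ k * c).
move=> Dg a0 gn H.
have [||_ [c [k [Dc aE ->]]] mx] := @noeth_max _ K^o D D
 [set J | exists c k, [/\ D c, a = g ^+ k * c & J = [set v | exists2 d, D d & v = c * d]]] sD nD.
- move=> _ [c [k [Dc _ ->]]]; split; last by move=> _ [d Dd ->].
 split=> [|_ _ [d Dd ->] [d' Dd' ->]|b _ Db [d Dd ->]].
 + by exists 0; [|rewrite mulr0].
 + by exists (d + d'); [|rewrite mulrDr].
 + by exists (b * d); [|rewrite mulrCA].
- have [c] := H 0%N; exists [set v | exists2 d, D d & v = c * d]; by exists c, 0%N.
have [c' Dc' aE'] := H k.+1.
have g0: g != 0 by apply/eqP=> g0; move: a0; rewrite aE' g0 exprS !mul0r eqxx.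
have cE: c = g * c'.
 have gk: g ^+ k != 0 by rewrite expf_neq0.
 by apply: (mulfI gk); rewrite -aE aE' exprSr mulrA.
have [|||d Dd E1] := mx [set v | exists2 d, D d & v = c' * d] _ _ c'.
- by exists c', k.+1.
- by move=> _ [d Dd ->]; exists (g * d); [|rewrite cE; ring].
- by exists 1; [|rewrite mulr1].
apply: (gn d Dd); have c'0: c' != 0 by apply/eqP=> c0; move: a0; rewrite aE' c0 mulr0 eqxx.
by apply: (mulfI c'0); rewrite {2}E1 cE; ring.
Qed.
(** Otherwise take [b] with the ideal of [a] clearing the coefficients of [b v] maximal, hence a
    prime [P]; put [w = b v]. If [D :_K P = D], the coefficients of [w] lie in [D]. If [P = g D],
    write the [f] of [int_almost] as [g^k f1] with [f1] outside [P[X]]; then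
    [(g w)^(k + 1) f1 = g w^(k + 1) f] lies in [P[X]], while [g w] and [f1] do not, against Gauss's
    lemma. *)
Lemma int_free v : int D Xs v -> mcf D v.
move=> iv; apply: contrapT=> nv.
have sM := mcf_smod sD (self_ideal sD).
pose J b : set K := [set a | D a /\ mcf D (a *: (b *: v))].
have iJ b: ideal D (J b).
 split; last by move=> a [].
 split=> [|a c [Da Ha] [Dc Hc]|a c Da [Dc Hc]].
 - by split; [|rewrite scale0r].
 - by split; [|rewrite scalerDl].
 - by split; [exact: srM|rewrite -scalerA].
have [||_ [b [Db nb ->]] mx] := @noeth_max _ K^o D D
 [set I | exists b, [/\ D b, ~ mcf D (b *: v) & I = J b]] sD nD.
- by move=> _ [b [_ _ ->]]; exact: iJ.
- by exists (J 1), 1; rewrite scale1r.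
have pJ: primei D (J b).
 split=> //; first by case; rewrite scale1r.
 move=> a1 a2 Da1 Da2 [_ H12]; have [|n2] := pselect (J b a2); [by right|left].
 apply: (mx (J (a2 * b))).
 - exists (a2 * b); split=> //.
  by move=> H; apply: n2; split=> //; rewrite scalerA.
 - move=> a [Da Ha]; split=> //.
  have ->: a *: ((a2 * b) *: v) = a2 *: (a *: (b *: v)) by rewrite !scalerA; congr (_ *: _); ring.
  exact.
 - by split=> //; rewrite scalerA mulrA -scalerA.
pose w := b *: v.
have iw: int D Xs w by exact: int_scale.
have [[g [Dg Hg] Jg]|H] := gD pJ; last first.
 apply: nb=> m; apply: H=> a [Da]; rewrite -mcoeffZ //.
have [s [Ds s0 Hs]] := mcf_denom [:: w].
have [c0 Dc0 sE]: exists2 c, D c & s = g * c by apply: Jg; split=> //; apply: Hs.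
have g0: g != 0 by apply/eqP=> g0; move: s0; rewrite sE g0 mul0r eqxx.
have gn c: D c -> g * c <> 1.
 move=> Dc E; have [_ n1 _] := pJ; apply: n1; rewrite -E; apply: idealMr=> //.
have JE: J b = [set a | exists2 c, D c & a = g * c].
 apply/seteqP; split=> [a /Jg//|_ [c Dc ->]]; apply: idealMr=> //.
have [f f0 [Df Hf]] := int_almost iw.
have Dh: mcf D (g *: w) by [].
have [k [f1 [Df1 fE nf1]]]: exists k f1, [/\ mcf D f1, f = g ^+ k *: f1 & ~ mcf (J b) f1].
 apply: contrapT=> H.
 have Hk k: exists2 f1, mcf D f1 & f = g ^+ k *: f1.
  elim: k=> [|k [f1 Df1 E1]]; first by exists f; rewrite ?scale1r.
  have Pf1: mcf (J b) f1 by apply: contrapT=> n1; apply: H; exists k, f1.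
  exists (g^-1 *: f1); last by rewrite scalerA exprSr mulfK.
  move=> m; rewrite mcoeffZ; have := Pf1 m; rewrite JE=> -[c Dc ->].
  by rewrite mulrA mulVf.
 have [m fm]: exists m, f@_m != 0 by exists (mlead f); rewrite mleadc_eq0.
 apply: (not_infinitely_divisible Dg fm gn)=> k.
 by have [f1 Df1 ->] := Hk k; exists f1@_m; rewrite ?mcoeffZ.
have nh: ~ mcf (J b) (g *: w).
 move=> Hh; apply: nb=> m; have := Hh m; rewrite mcoeffZ JE=> -[c Dc /(mulfI g0) E].
 by rewrite/w E.
have : mcf (J b) ((g *: w) ^+ k.+1 * f1).
 have ->: (g *: w) ^+ k.+1 * f1 = g *: (w ^+ k.+1 * f) by rewrite fE exprZn -scalerAl -scalerAr scalerA exprS.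
 by move=> m; rewrite mcoeffZ JE; exists ((w ^+ k.+1 * f)@_m)=> //; exact: Hf.
elim: k.+1=> [|j IH]; first by rewrite mul1r.
rewrite exprS -mulrA=> /(mcf_gauss sD pJ Dh)[|/nh//|/IH//].
elim: j {IH} => [|j IH]; first by rewrite mul1r.
by rewrite exprS -mulrA; exact: (mcf_mul sD (self_ideal sD)).
Qed.
End Normal.

(** * Exactness for variables *)

(** The analogue of [Rg] for the algebra generated by [l], without integral closure. *)
Definition Pg D (l : seq E) n p : set E := if (p <= n)%N then spn D (monn l (n - p)) else [set 0].
Lemma Pg_succ D l n : Pg D l n.+1 \o succn = Pg D l n.
exact. Qed.
Lemma Pg_smod D l n p : subring D -> smod D (Pg D l n p).
by move=> sD; rewrite /Pg; case: ifP. Qed.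
Lemma Pg_mul D l n p a v : subring D -> a \in l -> Pg D l n p.+1 v -> Pg D l n p (a * v).
move=> sD al; rewrite /Pg; case: ifP=> h; last by move=> ->; rewrite mulr0; case: ifP.
rewrite (ltnW h)=> Sv; elim: Sv=> [|d x w Dd mx _ IH]; first by rewrite mulr0.
rewrite mulrDr -scalerAr; apply: spn_cons=> //.
have ->: (n - p = (n - p.+1).+1)%N by lia.
by constructor.
Qed.
Lemma Pg_mono D (l l' : seq E) n p : {subset l <= l'} -> Pg D l n p `<=` Pg D l' n p.
move=> ll; rewrite /Pg; case: ifP=> _ //.
apply: spn_mono=> // w.
by elim=> [|k u v /ll]; constructor.
Qed.
Lemma scaleK_inj d (a : E) (z : KT (E^o) d) : a != 0 -> a *: z = 0 -> z = 0.
move=> a0; elim: d z=> [|d IH] z.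
 by rewrite /= => /eqP; rewrite mulf_eq0 (negPf a0)=> /eqP.
have [u [v ->]] := mkpP z; rewrite mkpZ [X in _ X -> _]mkp0=> /mkp_inj[/IH -> /IH ->] //.
Qed.

Definition eps (i : 'I_r) : E -> E := comp_mpoly [tuple (if j == i then 0 else 'X_j) | j < r].
Lemma epsX i j : eps i 'X_j = if j == i then 0 else 'X_j.
by rewrite /eps comp_mpolyXU -tnth_nth tnth_mktuple. Qed.
(** Write the first component as [u0 + X_i u'] with [u0] free of [X_i]. Setting [X_i = 0] in the
    cycle equation gives [d u0 = 0], cancelling [X_i] gives [v = - d u'], and [u0] bounds by
    induction. Positive total degree excludes the constants, the only homology. *)
Lemma variables_exact D (s : seq 'I_r) n : subring D -> uniq s -> (0 < n)%N ->
 ex2 (V := E^o) (size s) (Pg D [seq 'X_i | i <- s] n) (Pg D [seq 'X_i | i <- s] n) [seq 'X_i | i <- s].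
move=> sD; elim: s=> [|i s IH] /= us n0.
 move=> z; rewrite /= /Pg leq0n subn0=> Sz _; exists 0=> //.
 rewrite /=; elim: Sz=> [//|d x w _ mx]; exfalso.
 by case: mx n0.
case/andP: us=> is_ us; set l := [seq 'X_i | i <- s]; set l' := 'X_i :: l.
move=> z; have [u [v ->]] := mkpP z=> /inK_mkp[Gu Gv].
rewrite dK_cons=> /mkp_inj[E1 _].
have X0: 'X_i != 0 :> E by apply/eqP=> /mpolyP/(_ U_(i)%MM)/eqP; rewrite mcoeffX eqxx mcoeff0 oner_eq0.
have mons k w: monn l' k w -> monn l k w \/ exists2 w', monn l' k.-1 w' & (0 < k)%N /\ w = 'X_i * w'.
 elim=> [|k' u' w'' ul mw [IHw|[w3 mw3 [k0 ->]]]]; first by left; constructor.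
  move: ul; rewrite inE=> /orP[/eqP->|]; last by left; constructor.
  by right; exists w''.
 right; move: ul mw; case: k' k0 mw3=> [//|k'] _ mw3 ul mw.
 exists (u' * w3); last by split=> //; ring.
 by constructor.
have [|u0 [u' [Gu0 Gu' uE]]] := @inK_split _ E^o _ _ (Pg D l n) (Pg D l' n \o succn) 'X_i u _ Gu.
 move=> p w; rewrite /Pg; case: ifP=> h; last by move=> /=; exists 0, 0; rewrite scaler0 addr0; case: ifP.
 elim=> [|d x w' Dd mx _ [a [b [Ha Hb ->]]]].
  by exists 0, 0; rewrite scaler0 addr0; split=> //=; case: ifP.
 have [mx'|[x' mx' [k0 ->]]] := mons _ _ mx.
  exists (d *: x + a), b; split=> //.
  by rewrite addrA.
 exists a, (d *: x' + b); split=> //=.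
  have h': (p < n)%N by rewrite -subn_gt0.
  move: Hb; rewrite /= h'=> Hb; apply: spn_cons=> //.
  by have ->: (n - p.+1)%N = (n - p).-1 by rewrite subnS.
 by rewrite/(a + 'X_i * (d *: x' + b)) mulrDr -scalerAr addrCA.
have epsl w: (exists n p, Pg D l n p w) -> eps i w = w.
 move=> [k [p]]; rewrite /Pg; case: ifP=> _; last by move=> ->; rewrite /eps rmorph0.
 elim=> [|d x w' _ mx _ IHw]; first by rewrite /eps rmorph0.
 rewrite /eps comp_mpolyD comp_mpolyZ -!/(eps _) IHw; congr (_ *: _ + _).
 elim: mx=> [|k' y w2 /mapP[j js ->] _ IHy]; first by rewrite /eps rmorph1.
 rewrite /eps rmorphM /= -!/(eps i) IHy epsX; case: eqP=> // ji.
 by move: is_; rewrite -ji js.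
have epsD a b: eps i (a + b) = eps i a + eps i b by rewrite /eps comp_mpolyD.
have epsZ (a: E) (b : E^o) : eps i (a *: b : E^o) = eps i a *: (eps i b : E^o) by rewrite /eps rmorphM.
have Gdu0: @inK E E^o _ (Pg D l n) (dK l u0).
 suff gen d (m: seq E) k (q : KT E^o d) : {subset m <= l} -> @inK E E^o _ (Pg D l k) q -> @inK E E^o _ (Pg D l k) (dK m q).
  exact: gen.
 elim: d m k q=> [|d IHd] m k q ml Gq //.
 move: Gq; have [q1 [q2 ->]] := mkpP q=> /inK_mkp[G1 G2].
 have bl: {subset behead m <= l} by move=> y /mem_behead /ml.
 rewrite dK_mkp; apply/inK_mkp; split.
  apply: inKD; first by move=> p a b; exact: (smodD (Pg_smod l k p sD)).
   exact: IHd.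
  apply: inKZ G2=> p a /= Ga.
  case: m ml {bl} => [|y m] ml /=; first by rewrite scale0r; exact: smod0 (Pg_smod _ _ _ sD).
  by apply: Pg_mul=> //; apply: ml.
 apply: inKN; first by move=> p a; exact: (smodN sD (Pg_smod _ _ _ sD)).
 case: k G2 {G1} => [|k] G2; last by rewrite Pg_succ in G2; exact: IHd.
 suff ->: q2 = 0 by rewrite dK0; apply: inK0.
 have : inK (fun=> [set 0]) q2 by [].
 elim: (d) q2 {G2} => [//|e IHe] y; have [y1 [y2 ->]] := mkpP y=> /inK_mkp[/IHe -> /IHe ->] //.
have Ex: dK l u0 + 'X_i *: (dK l u' + v) = 0 by rewrite -E1 uE dKD dKZ scalerDr addrA.
have du0: dK l u0 = 0.
 have := congr1 (@mapK _ _ E^o E^o (eps i) (size s)) Ex.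
 rewrite (@mapKD E E E^o E^o _ epsD) (@mapKZ E E E^o E^o (eps i) _ epsZ) epsX eqxx scale0r addr0 (@mapK0 E E E^o E^o _ epsD).
 move=> <-; have gen d q (G: nat -> set E) : (forall p w, G p w -> eps i w = w) -> @inK E E^o d G q -> @mapK E E E^o E^o (eps i) d q = q.
  elim: d q G=> [|d IHd] q G HG; first exact: HG.
  have [q1 [q2 ->]] := mkpP q=> /inK_mkp[G1 G2]; rewrite mapK_mkp (IHd _ _ HG G1).
  by rewrite (IHd _ _ (fun p=> HG p.+1)).
 by rewrite (gen _ _ (Pg D l n)) // => p w Hw; apply: epsl; exists n, p.
have Ev: v = - dK l u'.
 have /(scaleK_inj X0)/eqP: 'X_i *: (dK l u' + v) = 0 by rewrite -Ex du0 add0r.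
 by rewrite addrC addr_eq0=> /eqP.
have [w0 Gw0 dw0] := IH us n0 u0 Gu0 du0.
exists (mkp w0 u'); first split=> //.
 apply: inK_mono Gw0=> p; apply: Pg_mono=> y yl; by rewrite inE yl orbT.
by rewrite dK_cons dw0 uE Ev.
Qed.
End FreeCase.
#[local] Hint Resolve mcf_smod Pg_smod : smods.

(** * Linear forms with one relation: the free case *)
Lemma inKT (R : comPzRingType) (V : lmodType R) d (z : KT V d) : inK (fun=> [set: V]) z.
by elim: d z. Qed.

Section LinearForms.
Variables (r : nat) (K : fieldType).
Notation E := {mpoly K[r]}.
Implicit Types (A D P : set K) (f g v w : E).

Definition rform q (M : 'M[K]_(q, r)) i : E := \sum_j M i j *: 'X_j.
Definition forms q (M : 'M[K]_(q, r)) : seq E := [seq rform M i | i <- enum 'I_q].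
Lemma rowform_homog q (M : 'M[K]_(q, r)) i : rform M i \is 1.-homog.
by apply: rpred_sum=> j _; apply: rpredZ; rewrite dhomogX /= mdeg1. Qed.
Lemma forms_homog q (M : 'M[K]_(q, r)) u : u \in forms M -> u \is 1.-homog.
by move=> /mapP[i _ ->]; exact: rowform_homog. Qed.
Lemma rowform_mulmx p q (N : 'M[K]_(p, q)) (M : 'M[K]_(q, r)) i :
 rform (N *m M) i = \sum_j N i j *: rform M j.
rewrite /rform; under eq_bigr do rewrite mxE scaler_suml.
rewrite exchange_big /=; apply: eq_bigr=> j _; rewrite scaler_sumr.
by apply: eq_bigr=> k; rewrite scalerA.
Qed.
Lemma morph_ext (f g : {rmorphism E -> E}) : (forall a v, f (a *: v) = a *: f v) ->
 (forall a v, g (a *: v) = a *: g v) -> (forall i, f 'X_i = g 'X_i) -> f =1 g.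
move=> fZ gZ fX v; rewrite [v]mpolyE !rmorph_sum; apply: eq_bigr=> m _.
rewrite fZ gZ mpolyXE_id !rmorph_prod; congr (_ _); apply: eq_bigr=> i _.
by rewrite !rmorphXn fX.
Qed.

Section Change.
Variable N : 'M[K]_r.
Hypothesis uN : N \in unitmx.

Definition subst (Q : 'M[K]_r) : {rmorphism E -> E} := comp_mpoly [tuple rform Q i | i < r].
Lemma substX Q i : subst Q 'X_i = rform Q i.
by rewrite /= comp_mpolyXU -tnth_nth tnth_mktuple. Qed.
Lemma substZ Q a v : subst Q (a *: v) = a *: subst Q v.
by rewrite /= comp_mpolyZ. Qed.
Lemma subst_rowform q Q (M : 'M[K]_(q, r)) i : subst Q (rform M i) = rform (M *m Q) i.
rewrite rowform_mulmx rmorph_sum; apply: eq_bigr=> j; by rewrite substZ substX.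
Qed.
Lemma rowform1 i : rform 1%:M i = 'X_i.
rewrite /rform (bigD1 i) //= big1=> [|j ji]; first by rewrite mxE eqxx scale1r addr0.
by rewrite mxE eq_sym (negPf ji) scale0r.
Qed.
Lemma substK Q Q' : Q *m Q' = 1%:M -> cancel (subst Q) (subst Q').
move=> QQ v; apply: (@morph_ext (subst Q' \o subst Q) idfun)=> //.
 by move=> a w /=; rewrite !substZ.
by move=> i /=; rewrite substX subst_rowform QQ rowform1.
Qed.
Lemma subst_homog Q n v : v \is n.-homog -> subst Q v \is n.-homog.
move=> hv; rewrite [v]mpolyE rmorph_sum big_seq; apply: rpred_sum=> m mv.
rewrite substZ; apply: rpredZ; rewrite -(dhomog_mf hv mv).
suff : subst Q 'X_[m] \is (mdeg m).-homog by [].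
have := monn_X; elim=> [|k u w /mapP[i _ ->] _ IH]; first by rewrite rmorph1; exact: dhomog1.
by rewrite rmorphM substX; have := dhomogM (rowform_homog Q i) IH.
Qed.
Lemma spn_subst D Q n v : spn D (monn (Xs r K) n) v -> spn D (monn (forms Q) n) (subst Q v).
elim=> [|d x w Dd mx _ IH]; first by rewrite rmorph0.
rewrite rmorphD substZ; apply: spn_cons=> //.
elim: mx=> [|k u y /mapP[i _ ->] _ IHy]; first by rewrite rmorph1; constructor.
by rewrite rmorphM substX; constructor.
Qed.
Variable D : set K.
Hypotheses (sD : subring D) (nD : noeth D) (gD : good D).
Hypothesis fracD : forall k : K, exists s, [/\ D s, s != 0 & D (s * k)].
(** An invertible linear substitution turns the forms into variables, where [int_free] applies; it
    commutes with scalars, so it may be taken over [K] although the coefficients that matter are in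
    [D]. *)
Lemma Rb_free n : Rb D (forms N) n = spn D (monn (forms N) n).
have VN: N *m invmx N = 1%:M by rewrite mulmxV.
have NV: invmx N *m N = 1%:M by rewrite mulVmx.
apply/seteqP; split=> v.
 move=> [hv iv]; rewrite -(substK NV v); apply: spn_subst; apply: mcf_spn=> //.
  exact: subst_homog.
 apply: int_free=> //; have := int_morph (substZ (invmx N)) (can_inj (substK NV)) iv.
 congr int; rewrite -map_comp; apply: eq_map=> i /=.
 by rewrite subst_rowform VN rowform1.
move=> Sv; split.
 elim: Sv=> [|d x w Dd mx _ IH]; first exact: dhomog0.
 by apply: dhomogD=> //; apply: dhomogZ; apply: monn_homog mx; exact: forms_homog.
apply: int_rees=> //; apply: spn_mono Sv=> //; by exists n.
Qed.
Lemma free_exact n : (0 < n)%N ->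
 ex2 (V := E^o) r (Pg D (forms N) n) (Pg D (forms N) n) (forms N).
move=> n0; have VN: N *m invmx N = 1%:M by rewrite mulmxV.
have se: size (enum 'I_r) = r by rewrite size_enum_ord.
have := variables_exact sD (enum_uniq 'I_r) n0; rewrite se -/(Xs r K)=> H z Gz dz.
have fD (u v: E^o) : subst N (u + v) = subst N u + subst N v by rewrite rmorphD.
have fZ (a: E) (v : E^o) : subst N (a *: v) = subst N a *: (subst N v : E^o) :> E^o by exact: rmorphM.
have lift p v: Pg D (forms N) n p v -> exists2 w, Pg D (Xs r K) n p w & subst N w = v.
 rewrite /Pg; case: ifP=> _; last by move=> ->; exists 0; rewrite ?rmorph0.
 elim=> [|d x w Dd mx _ [w' Sw' <-]]; first by exists 0; [|rewrite rmorph0].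
 have [y my <-]: exists2 y, monn (Xs r K) (n - p) y & subst N y = x.
  elim: mx=> [|k u y /mapP[i _ ->] _ [y' my' <-]]; first by exists 1; [constructor|rewrite rmorph1].
  exists ('X_i * y'); last by rewrite rmorphM substX.
  by constructor.
 by exists (d *: y + w'); [|rewrite rmorphD substZ].
have [z' Gz' zE] := @mapK_lift E E E^o E^o (subst N) r _ _ z lift Gz.
have mE u: @mapK E E E^o E^o (subst N) r (dK (Xs r K) u) =
  dK (forms N) (@mapK E E E^o E^o (subst N) r u).
 rewrite (@mapK_dK E E E^o E^o (subst N)) ?rmorph0 //; congr dK.
 by rewrite -map_comp; apply: eq_map=> i /=; rewrite substX.
have [|w' Gw' wE] := H z' Gz'.
 apply: (@mapK_eq E E E^o E^o (subst N) r _ (fun=> setT)).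
 - by move=> _ v _ E0; apply: (can_inj (substK VN)); rewrite [LHS]E0 rmorph0.
 - exact: inKT.
 - by rewrite mE zE.
exists (@mapK E E E^o E^o (subst N) r w'); last by rewrite -mE wE.
apply: inK_mapK Gw'=> p v; rewrite /Pg; case: ifP=> _; first exact: spn_subst.
by move=> -> /=; rewrite comp_mpoly0.
Qed.
End Change.

Section OneRelation.
Variables (M : 'M[K]_(r.+1, r)) (c : 'rV[K]_r.+1).
Hypotheses (cM : c *m M = 0) (kerM : forall w : 'rV_r.+1, w *m M = 0 -> exists k, w = k *: c).
Notation U := (forms M).
Variable D : set K.
Hypotheses (sD : subring D) (nD : noeth D) (gD : good D).
Hypothesis fracD : forall k : K, exists s, [/\ D s, s != 0 & D (s * k)].
Variable i0 : 'I_r.+1.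
Hypotheses (c0 : c 0 i0 != 0) (ci0 : forall j, exists2 d, D d & c 0 j = d * c 0 i0).
Let N : 'M[K]_r := row' i0 M.
(** A relation among the remaining rows is a multiple [k c] whose entry at [i0] vanishes, while that
    of [c] does not; so [k = 0]. *)
Lemma minor_unit : N \in unitmx.
rewrite -row_free_unit; apply: inj_row_free=> v vN.
pose w : 'rV_r.+1 := \row_j (if unlift i0 j is Some k then v 0 k else 0).
have wM: w *m M = 0.
 apply/rowP=> k; rewrite !mxE (bigD1_ord i0) //= !mxE unlift_none mul0r add0r.
 have := congr1 (fun A : 'rV_r=> A 0 k) vN; rewrite !mxE=> vNk.
 transitivity (\sum_j v 0 j * N j k)=> //.
 by apply: eq_bigr=> j; rewrite !mxE liftK.
have [k wE] := kerM wM.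
have k0: k = 0.
 have := congr1 (fun A : 'rV_r.+1=> A 0 i0) wE; rewrite !mxE unlift_none=> /esym/eqP.
 by rewrite mulf_eq0 (negPf c0) orbF=> /eqP.
apply/rowP=> j; have := congr1 (fun A : 'rV_r.+1=> A 0 (lift i0 j)) wE.
by rewrite k0 scale0r !mxE liftK.
Qed.
Lemma minor_rowform j : rform N j = rform M (lift i0 j).
by apply: eq_bigr=> k; rewrite !mxE. Qed.
Lemma forms_perm : perm_eq (rform M i0 :: forms N) U.
have ->: forms N = [seq rform M i | i <- [seq lift i0 j | j <- enum 'I_r]] by rewrite -map_comp; apply: eq_map=> j; rewrite minor_rowform.
rewrite -/(map (rform M) (i0 :: [seq lift i0 j | j <- enum 'I_r])); apply: perm_map.
apply: uniq_perm; rewrite ?enum_uniq //=.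
 rewrite map_inj_uniq ?enum_uniq ?andbT; last exact: lift_inj.
 by apply/mapP=> -[j _ /eqP]; rewrite (negPf (neq_lift _ _)).
move=> i; rewrite mem_enum inE; case: (unliftP i0 i)=> [j ->|->]; rewrite ?eqxx //.
by apply/orP; right.
Qed.
Lemma dependent_form : rform M i0 = \sum_j (- (c 0 (lift i0 j) / c 0 i0)) *: rform N j.
have : \sum_i c 0 i *: rform M i = 0.
 have := rowform_mulmx c M 0; rewrite cM; rewrite /rform big1 // => j _.
 by rewrite mxE scale0r.
rewrite (bigD1_ord i0) //= => /eqP; rewrite addr_eq0=> /eqP E1.
rewrite -[LHS]scale1r -(mulVf c0) -scalerA E1 scalerN scaler_sumr -sumrN.
by apply: eq_bigr=> j; rewrite scalerA scaleNr minor_rowform [_^-1 * _]mulrC.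
Qed.
Lemma forms_spn n u : monn U n u -> spn D (monn (forms N) n) u.
have one v: v \in U -> spn D (monn (forms N) 1) v.
 rewrite -(perm_mem forms_perm) inE=> /orP[/eqP->|vN]; last first.
  by apply: spn_gen; [|exact: monn_gen].
 rewrite dependent_form; apply: smod_sum=> [|j _] //.
 apply: spn_mem; last exact: monn_gen.
 apply: srN=> //; have [d Dd ->] := ci0 (lift i0 j); by rewrite mulfK.
elim=> [|k v w vU _ IH]; first by apply: spn_gen; [|constructor].
rewrite -add1n; apply: (spn_mul sD _ (one v vU) IH)=> a b ma mb.
by apply: spn_gen; [|exact: monn_cat].
Qed.
Lemma Rb_principal n : Rb D U n = spn D (monn (forms N) n) /\ Rb D U n = spn D (monn U n).
have NU u: u \in forms N -> u \in U by rewrite -(perm_mem forms_perm) inE=> ->; rewrite orbT.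
have H1: Rb D U n `<=` Rb D (forms N) n.
 move=> v [hv iv]; split=> //; apply: int_sub iv=> // u uU.
 by apply: spn_mono (forms_spn (monn_gen uU))=> //; exists 1%N.
have H2: spn D (monn (forms N) n) `<=` spn D (monn U n).
 apply: spn_mono=> // w; elim=> [|]; constructor=> //; exact: NU.
have H3: spn D (monn U n) `<=` Rb D U n.
 apply: spn_min=> //.
 move=> w mw; split; first by apply: monn_homog mw; exact: forms_homog.
 by apply: int_rees=> //; apply: spn_gen; [|exists n].
have E1 := Rb_free minor_unit sD nD gD fracD n.
split; apply/seteqP; split=> //.
- by rewrite -E1.
- exact: subset_trans H3.
- by apply: subset_trans H1 _; rewrite E1.
Qed.
(** With the form of index [i0] at the head, the complex is a cone over that of [r] independent
    forms. Its second component has total degree [n - 1], which must be positive for the inner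
    complex to be exact: this is the origin of [1 < n]. *)
Lemma principal_exact n : (1 < n)%N ->
 ex2 (V := E^o) (size U) (Rg D U n) (Rg D U n) U.
move=> n1; have RP k: Rg D U k = Pg D (forms N) k by apply/funext=> p; rewrite /Rg /Pg; case: ifP=> // _; exact: (Rb_principal _).1.
have RN k p v: Rg D U k p v -> Rg D U k p (- v)=> //.
apply: (@ex2_perm E E^o _ _ _ _ (RN n) (RN n) forms_perm); rewrite /= size_map size_enum_ord.
apply: ex2_cons.
- by move=> p u v; exact: (smodD (Rg_smod U n p sD)).
- move=> p v; rewrite /Rg; case: ifP=> h; last first.
  by move=> ->; rewrite scaler0; case: ifP=> _ //; exact: smod0 (Rb_smod _ _ sD).
 rewrite (ltnW h)=> Rv; have ->: (n - p = 1 + (n - p.+1))%N by lia.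
 apply: Rb_mul=> //; split; first exact: rowform_homog.
 apply: int_rees=> //; apply: spn_gen=> //.
 exact: mon_gen.
- exact: RN.
- by rewrite RP; apply: free_exact=> //; [exact: minor_unit|exact: ltnW].
- case: n n1=> [//|n]; rewrite RP; apply: free_exact=> //; exact: minor_unit.
Qed.
End OneRelation.
End LinearForms.

(** * Exactness of the Koszul complex of a reduction *)

Section Core.
Variables (r : nat) (K : fieldType).
Notation E := {mpoly K[r]}.
Implicit Types (A B D P : set K) (v w : E).
Variables (M : 'M[K]_(r.+1, r)) (c : 'rV[K]_r.+1).
Hypotheses (cM : c *m M = 0) (kerM : forall w : 'rV_r.+1, w *m M = 0 -> exists k, w = k *: c).
Hypothesis c0 : c != 0.
Notation U := (forms M).
Notation cs := [seq c 0 i | i <- enum 'I_r.+1].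

(** Under this condition the relation can be solved over [D] for one of the forms, so that the
    algebra generated by [U] over [D] is a polynomial ring. *)
Definition dominated D := exists2 i0, c 0 i0 != 0 & forall j, exists2 d, D d & c 0 j = d * c 0 i0.
Definition fracs D := forall k : K, exists s, [/\ D s, s != 0 & D (s * k)].
Definition exact_at D n := ex2 (V := E^o) (size U) (Rg D U n) (Rg D U n) U.
Lemma dominated_exact D n : subring D -> noeth D -> good D -> fracs D -> dominated D -> (1 < n)%N ->
 exact_at D n.
by move=> sD nD gD fD [i0 c00] n1; exact: (principal_exact cM kerM sD nD gD fD c00). Qed.
Lemma dominated_Rb D n : subring D -> noeth D -> good D -> fracs D -> dominated D ->
 Rb D U n = spn D (monn U n).
by move=> sD nD gD fD [i0 c00 ci0]; exact: (Rb_principal cM kerM sD nD gD fD c00 ci0 n).2. Qed.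
Lemma dvr_dominated D pi g : dvr D pi -> g != 0 -> (forall i, D (c 0 i / g)) -> dominated D.
move=> dD g0 Dc; have sD := dvr_subring dD.
have H (s: seq 'I_r.+1) : (exists2 i, i \in s & c 0 i != 0) -> exists i0, [/\ i0 \in s, c 0 i0 != 0 &
  forall j, j \in s -> exists2 d, D d & c 0 j = d * c 0 i0].
 elim: s=> [[]//|a s IH] [i]; rewrite inE.
 have [s0 _ _|ns] := pselect (exists2 i, i \in s & c 0 i != 0); last first.
  move=> /predU1P[-> ca|si ci]; last by case: ns; exists i.
  exists a; split=> //; move=> j /predU1P[->|sj].
   by exists 1; [|rewrite mul1r].
  exists 0=> //.
  by rewrite mul0r; apply/eqP/negP=> /negP cj; case: ns; exists j.
 have [i0 [si0 ci0 H]] := IH s0.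
 have [[d Dd /(congr1 (fun z=> z * g)) dE]|[d Dd /(congr1 (fun z=> z * g)) dE]] := dvr_total dD (Dc i0) (Dc a).
  exists i0; split=> //; first by rewrite inE si0 orbT.
  move=> j /predU1P[->|/H//]; exists d=> //.
  by rewrite divfK // in dE; rewrite dE mulrAC divfK // mulrC.
 rewrite divfK // mulrAC divfK // in dE.
 exists a; split=> //.
  by apply: contra_neq ci0=> ca; rewrite dE ca mul0r.
 move=> j /predU1P[->|/H[d' Dd' ->]]; first by exists 1; [|rewrite mul1r].
 by exists (d' * d); [|rewrite dE mulrCA mulrC].
have [|i0 [_ ci0 H0]] := H (enum 'I_r.+1).
 have [i ci]: exists i, c 0 i != 0.
  apply/existsP; apply: contraNT c0; rewrite negb_exists=> /forallP H0.
  by apply/eqP/rowP=> i; rewrite mxE; apply/eqP; have := H0 i; rewrite negbK.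
 by exists i.
by exists i0=> // j; apply: H0.
Qed.
Lemma fracs_sub D D' : D `<=` D' -> fracs D -> fracs D'.
by move=> DD fD k; have [s [Ds]] := fD k; exists s; split=> //; exact: DD. Qed.
Lemma Rb_sub D D' n : subring D' -> D `<=` D' -> Rb D U n `<=` Rb D' U n.
move=> sD' DD v [hv iv]; split=> //; apply: int_sub iv=> // u uU.
by apply: spn_gen; [|exact: mon_gen].
Qed.
Lemma Rg_sub D D' n p : subring D' -> D `<=` D' -> Rg D U n p `<=` Rg D' U n p.
by move=> v; rewrite /Rg; case: ifP=> // _; exact: Rb_sub. Qed.
Lemma RgZ D n p a v : subring D -> D a -> Rg D U n p v -> Rg D U n p (a%:MP *: (v : E^o)).
by move=> Da; rewrite -[a%:MP *: _]/(a%:MP * v) mul_mpolyC.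
Qed.
Lemma Rb_monn D n : subring D -> spn D (monn U n) `<=` Rb D U n.
move=> sD; apply: spn_min=> //.
move=> w mw; split; first by apply: monn_homog mw; exact: forms_homog.
by apply: int_rees=> //; apply: spn_gen; [|exists n].
Qed.
Lemma Rg_dK D n d (z : KT E^o d) (l : seq E) : subring D ->
 {subset l <= U} -> inK (V := E^o) (Rg D U n) z -> inK (V := E^o) (Rg D U n) (dK l z).
move=> sD; have s0 k p: Rg D U k p 0 by [].
elim: d n z l=> [|d IH] n z l lU; first by move=> _; exact: s0.
have bU: {subset behead l <= U} by move=> u /mem_behead/lU.
have [u [v ->]] := mkpP z=> /inK_mkp[Gu]; case: n Gu=> [|n] Gu.
 have ->: Rg D U 0 \o succn = fun=> [set 0] by [].
 move=> Gv; have v0: v = 0 by elim: (d) v Gv=> [//|d' IH'] v'; have [v1 [v2 ->]] := mkpP v'=> /inK_mkp[/IH'-> /IH'->].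
 rewrite v0 dK_mkp scaler0 addr0 dK0 oppr0; split; first exact: IH.
 exact: inK0.
rewrite Rg_succ=> Gv; rewrite dK_mkp; split; last first.
 rewrite Rg_succ; apply: inKN; last exact: IH.
 by move=> p w; exact: (smodN sD).
apply: inKD; first by move=> p a b; exact: (smodD (Rg_smod _ _ _ sD)).
 exact: IH.
case: l lU bU=> [|a l] lU _ /=.
 by rewrite scale0r; apply: inK0.
apply: inKZ Gv=> p w; rewrite /Rg; case: ifP=> pn; last first.
 by move=> ->; rewrite scaler0; case: ifP=> _ //; exact: smod0 (Rb_smod _ _ sD).
rewrite ltnW //= => Rw; have ->: (n.+1 - p = 1 + (n - p))%N by lia.
apply: Rb_mul=> //; apply: Rb_monn=> //; apply: spn_gen=> //; apply: monn_gen.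
exact: lU.
Qed.
(** The [b] for which [b z] bounds form an ideal of [B]. If it is proper it lies in a maximal ideal
    [P], but clearing the denominators of a bounding chain over the localization produces a member
    outside [P]. *)
Lemma exact_local_global B n : subring B -> noeth B ->
 (forall P, maxi B P -> exact_at (Loc B P) n) -> exact_at B n.
move=> sB nB H z Gz dz.
pose I : set K := [set b | B b /\ exists2 w, inK (V := E^o) (Rg B U n) w & dK U w = b%:MP *: z].
have iI: ideal B I.
 split; last by move=> b [].
 split=> [|b b' [Bb [w Gw wE]] [Bb' [w' Gw' wE']]|a b Ba [Bb [w Gw wE]]].
 - split=> //.
  exists 0; last by rewrite dK0 scale0r.
  by apply: inK0=> p; exact: smod0 (Rg_smod _ _ _ sB).
 - split=> //.
  exists (w + w'); last by rewrite dKD wE wE' mpolyCD scalerDl.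
  by apply: inKD=> // p u v; exact: (smodD (Rg_smod _ _ _ sB)).
 - split; first exact: srM.
  exists (a%:MP *: w); last by rewrite dKZ wE scalerA -mpolyCM.
  by apply: inKZ Gw=> p u; exact: RgZ.
have [[_ [w Gw wE]]|nI] := pselect (I 1); first by exists w=> //; rewrite wE scale1r.
have [P mP IP] := ex_maximal sB nB iI nI; have pP := maxi_prime sB mP.
have [|w Gw wE] := H P mP z _ dz.
 by apply: inK_mono Gz=> p; apply: Rg_sub=> //; exact: Loc_sub.
pose S : set E := [set a | exists s, [/\ B s, ~ P s & a = s%:MP]].
have P1: ~ P 1 by case: pP.
have [||||_ [s [Bs Ps ->]] Gsw] := @inK_denom E E^o (size U) (Rg B U n) S w.
- by exists 1.
- move=> _ _ [s [Bs Ps ->]] [s' [Bs' Ps' ->]]; exists (s * s'); rewrite mpolyCM.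
 by split=> //; exact: (primeMn pP).
- by move=> p _ v [s [Bs Ps ->]]; exact: RgZ.
- apply: inK_mono Gw=> p v; rewrite /Rg; case: ifP=> _; last first.
  move=> ->; exists 1; last by rewrite scaler0.
  by exists 1.
 move=> [hv iv]; have [s [Bs Ps isv]] := int_Loc sB pP iv.
 exists s%:MP; first by exists s.
 rewrite -[_ *: _]/(s%:MP * v) mul_mpolyC; split=> //; exact: dhomogZ.
case: Ps; apply: IP; split=> //; exists (s%:MP *: w)=> //.
by rewrite dKZ wE.
Qed.
Lemma fracs_ex D : subring D -> fracs D -> forall k, exists a b, [/\ D a, D b & k = a / b].
by move=> sD fD k; have [s [Ds]] := fD k; exists (s * k), s; rewrite mulrAC mulfV ?mul1r.
Qed.
Lemma dvr_exact D pi g n : dvr D pi -> fracs D -> g != 0 -> (forall i, D (c 0 i / g)) -> (1 < n)%N ->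
 exact_at D n.
move=> dD fD g0 Dc n1; have [sD nD _ _ _] := dD.
apply: dominated_exact=> //; first exact: dvr_good dD.
exact: dvr_dominated dD g0 Dc.
Qed.
Lemma dvr_Rb D pi g n : dvr D pi -> fracs D -> g != 0 -> (forall i, D (c 0 i / g)) ->
 Rb D U n = spn D (monn U n).
move=> dD fD g0 Dc; have [sD nD _ _ _] := dD.
apply: dominated_Rb=> //; first exact: dvr_good dD.
exact: dvr_dominated dD g0 Dc.
Qed.

(** * Splitting over the overlap of the two charts *)

Section Chart.
Variables (A : set K) (x y g : K).
Hypotheses (rA : rlr2 A x y) (fA : fracs A) (g0 : g != 0) (Ac : forall i, A (c 0 i / g)).
Let sA := rlr_sub rA.
Let t := y / x.
Let B := adj A t.
Let B' := adj A (x / y).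
Let sB : subring B := adj_subring t sA.
Let sB' : subring B' := adj_subring (x / y) sA.
Let AB : A `<=` B := adj_sub t sA.
Let x0 := rlr_x0 rA.
Let y0 := rlr_x0 (rlr2_sym rA).
Let t0 : t != 0. by rewrite mulf_neq0 ?invr_neq0. Qed.
Let nB : noeth B := noeth_adj (t := t) sA (rlr_noeth rA).
Let fB : fracs B := fracs_sub AB fA.
Let tV : x / y = t^-1. by rewrite invf_div. Qed.
Let B't : B' t^-1. by rewrite -tV; exact: adj_gen. Qed.
Let AB' : A `<=` B' := adj_sub (x / y) sA.
Let BLoc n : primei B n -> forall i, Loc B n (c 0 i / g).
by move=> pn i; apply: (Loc_sub sB pn); exact: AB. Qed.
Lemma off_exceptional_Rb P n v : primei B P -> ~ P x -> Rb B U n v ->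
 exists s, [/\ B s, ~ P s & spn B (monn U n) (s *: v)].
move=> pP Px Rv; have [pi dL] := chart_off_dvr rA pP Px.
apply: (spn_Loc_clear sB pP); rewrite -(dvr_Rb n dL (fracs_sub (Loc_sub sB pP) fB) g0 (BLoc pP)).
by apply: Rb_sub Rv; [|exact: Loc_sub].
Qed.
(** On monomials in [U] the coefficients are Laurent polynomials in [t], which are cut between the
    negative and the other exponents. *)
Lemma laurent_split m n v : spn B (monn U n) v ->
 exists a b, [/\ Rb B U n a, Rb B' U n b & t ^- m *: v = a + b].
elim=> [|_ u w [p Ap ->] mu _ [a [b [Ra Rb' E0]]]].
 by exists 0, 0; rewrite scaler0 addr0.
have Ru D d: subring D -> D d -> Rb D U n (d *: u) by move=> sD Dd; apply: Rb_monn.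
pose p1 := drop_poly m p; pose p0 := take_poly m p.
exists (p1.[t] *: u + a), ((t ^- m * p0.[t]) *: u + b); split.
- apply: smodD=> //; apply: Ru=> //; exists p1=> // i.
 by rewrite coef_drop_poly.
- apply: smodD=> //; apply: Ru=> //.
 rewrite horner_coef mulr_sumr; apply: sr_sum=> // i _.
 have im: (i < m)%N by apply: leq_trans (ltn_ord i) (size_take_poly _ _).
 have ->: t ^- m * (p0`_i * t ^+ i) = p0`_i * t^-1 ^+ (m - i) by rewrite mulrCA; rewrite -(subnK (ltnW im)) exprD invfM mulfVK ?expf_neq0 // addnK exprVn.
 apply: srM=> //.
 by apply: AB'; rewrite coef_take_poly im.
rewrite scalerDr E0 scalerA addrACA -scalerDl; congr (_ *: _ + _).
rewrite -(poly_take_drop m p) hornerD hornerM hornerXn mulrDr addrC; congr (_ + _).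
by rewrite mulrC mulfK // expf_neq0.
Qed.
Let mip : forall p : {poly K}, pcoef A p -> ~ pcoef (mi A x y) p ->
 exists a psi q, [/\ pcoef A psi, A (psi`_0)^-1, psi`_0 != 0, pcoef (mi A x y) q & p = 'X^a * psi + q].
move=> p; elim: size {-2}p (leqnn (size p))=> [|n IH] {}p.
 by rewrite leqn0 size_poly_eq0=> /eqP-> _ []; move=> i; rewrite coef0; exact: smod0 (mi_ideal rA).1.
move=> sp Ap mp; have [m0|m0] := pselect (mi A x y p`_0); last first.
 exists 0%N, p, 0; rewrite mul1r addr0; split=> //.
 - exact: (rlr_unit rA).
 - exact: (mi_neq0 rA).
 - by move=> i; rewrite coef0; exact: smod0 (mi_ideal rA).1.
have pE: p = drop_poly 1 p * 'X + (p`_0)%:P.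
 rewrite -[LHS](poly_take_drop 1) addrC; congr (_ _).
 by apply/polyP=> i; rewrite coef_take_poly coefC; case: i.
have [||H|a [psi [q [Apsi u0 p0 mq qE]]]] := IH (drop_poly 1 p).
- by rewrite size_drop_poly; lia.
- by move=> i; rewrite coef_drop_poly.
- by apply: mp=> -[//|j]; have := H j; rewrite coef_drop_poly addn1.
exists a.+1, psi, (q * 'X + (p`_0)%:P); split=> //.
- move=> i; rewrite coefD coefMX coefC; case: i=> [|i] /=; first by rewrite add0r.
 by rewrite addr0.
by rewrite {1}pE qE mulrDl addrA exprSr -!mulrA [psi * _]mulrC.
Qed.
(** Vanishing of first cohomology for the degree [n] part. The ideal [I] of multipliers of [v] into
    the span of the monomials in [U] contains a power of [x] and an element not divisible by [x],
    hence some [t^j h(t)] with [h(0)] invertible. Then [1 = al t^k + be h] splits [t^-k v] into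
    [al v] and a multiple by a power of [t^-1] of an element of that span, to which [laurent_split]
    applies. *)
Lemma normal_split n k v : Rb B U n v ->
 exists a b, [/\ Rb B U n a, Rb B' U n b & t ^- k *: v = a + b].
move=> Rv; pose I : set K := [set b | B b /\ spn B (monn U n) (b *: v)].
have iI: ideal B I.
 split; last by move=> b [].
 split=> [|b b' [Bb Sb] [Bb' Sb']|a b Ba [Bb Sb]].
 - by split; [|rewrite scale0r].
 - by split; [|rewrite scalerDl].
 - by split; [exact: srM|rewrite -scalerA].
have Bx: B x by apply: AB; exact: rlr_x rA.
have [N IN]: exists N, I (x ^+ N).
 apply: contrapT=> nI; have [N IN|P [pP IP Px]] := ex_prime_avoiding sB nB iI Bx.
  by apply: nI; exists N.
 have [s [Bs Ps Ss]] := off_exceptional_Rb pP Px Rv.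
 by apply: Ps; apply: IP.
have [pP dL] := exceptional_dvr rA; set P := [set v | _] in pP dL.
have [b [Bb Pb Ib]]: exists b, [/\ B b, ~ P b & I b].
 have : Rb (Loc B P) U n v by apply: Rb_sub Rv; [|exact: Loc_sub].
 rewrite (dvr_Rb n dL (fracs_sub (Loc_sub sB pP) fB) g0 (BLoc pP))=> /(spn_Loc_clear sB pP)[s [Bs Ps Ss]].
 by exists s.
case: Bb Pb Ib=> p Ap -> Pp Ip.
have [|a [psi [q [Apsi u0 p0 mq qE]]]] := mip Ap.
 by move=> /(coef_exc rA).
have [d Bd dE] := coef_exc rA mq; rewrite -/t in dE.
pose h := psi ^+ N.+1.
have Ah: pcoef A h by exact: srX Apsi.
have Ih: I (t ^+ (a * N.+1) * h.[t]).
 have := @expr_sum_ideal K B I p.[t] (- (x * d)) 1 N sB iI.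
 have ->: p.[t] - (x * d) = t ^+ a * psi.[t] by rewrite qE hornerD dE addrK hornerM hornerXn.
 rewrite exprMn exprM horner_exp; apply=> //.
 - by exists p.
 - rewrite exprNn exprMn //.
pose u := (h`_0)^-1.
have hE: h`_0 = psi`_0 ^+ N.+1 by rewrite -!horner_coef0 horner_exp.
have h00: h`_0 != 0 by rewrite hE expf_neq0.
have Au: A u by rewrite /u hE -exprVn.
(* With [u] the inverse of [h(0)], the polynomial [1 - u h] is divisible by the variable; its [k]-th
   power and the geometric sum give the combination. *)
have [al [be [Aal Abe E1]]]: exists al be, [/\ pcoef A al, pcoef A be & 1 = al * 'X^k + be * h].
 have sP := pcoef_sub sA.
 have hX: exists2 h1, pcoef A h1 & 1 - u%:P * h = h1 * 'X.
  exists (drop_poly 1 (1 - u%:P * h)).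
   move=> i; rewrite coef_drop_poly.
   apply: (srB sP (sr1 sP) (srM sP _ Ah)); exact: pcoefC.
  rewrite -[LHS](poly_take_drop 1) -[RHS]add0r; congr (_ + _).
  apply/polyP=> i; rewrite coef_take_poly coef0; case: i=> //=.
  by rewrite coefB coefCM coef1 mulVf ?subrr.
 have [h1 Ah1 h1E] := hX.
 exists (h1 ^+ k), (u%:P * \sum_(i < k) (1 - u%:P * h) ^+ i); split=> //.
 - apply: (srM sP); first exact: pcoefC.
  by apply: (sr_sum _ sP)=> i _; rewrite h1E; apply: (srX _ sP); apply: (srM sP Ah1); exact: pcoefX.
 rewrite -exprMn -h1E; have := subrX1 (1 - u%:P * h) k.
 set s := \sum_(i < k) _=> sE.
 have ->: u%:P * s * h = - ((1 - u%:P * h - 1) * s) by ring.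
 by rewrite -sE; ring.
have [a' [b' [Ra Rb' abE]]] := laurent_split (k + a * N.+1)
 (smodZ (spn_smod _ sB) (ex_intro2 _ _ be Abe erefl) Ih.2).
exists (al.[t] *: v + a'), b'; split=> //.
 by apply: smodD=> //; apply: smodZ=> //; exists al.
rewrite -addrA -abE !scalerA -scalerDl; congr (_ *: _).
have := congr1 (fun q=> q.[t]) E1; rewrite hornerC hornerD !hornerM hornerXn=> /(congr1 (fun z=> t ^- k * z)).
rewrite mulr1 {1}mulrDr=> ->; congr (_ _); first by rewrite mulrC mulfK // expf_neq0.
by rewrite exprD; field; rewrite ?expf_neq0.
Qed.
End Chart.

Section Cech.
Variables (A : set K) (x y : K).
Hypothesis rA : rlr2 A x y.
Let sA := rlr_sub rA.
Let x0 := rlr_x0 rA.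
Let y0 := rlr_x0 (rlr2_sym rA).
Let t := y / x.
Let B := adj A t.
Let B' := adj A (x / y).
Let sB : subring B := adj_subring t sA.
Let sB' : subring B' := adj_subring (x / y) sA.
Let AB : A `<=` B := adj_sub t sA.
Let AB' : A `<=` B' := adj_sub (x / y) sA.
Let Bt : B t. exact: adj_gen. Qed.
Let t0 : t != 0. by rewrite mulf_neq0 ?invr_neq0. Qed.
Let nB : noeth B := noeth_adj (t := t) sA (rlr_noeth rA).
Lemma chart_denom n v : Rb B' U n v -> exists k, Rb B U n (t ^+ k *: v).
move=> [hv iv]; pose I : set K := [set b | B b /\ int B U (b *: v)].
have iI: ideal B I.
 split; last by move=> b [].
 split=> [|b b' [Bb Sb] [Bb' Sb']|a b Ba [Bb Sb]].
 - by split; [|rewrite scale0r].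
 - by split; [|rewrite scalerDl].
 - by split; [exact: srM|rewrite -scalerA].
apply: contrapT=> nk; have [k Ik|P [pP IP Pt]] := ex_prime_avoiding sB nB iI Bt.
 by apply: nk; exists k; split; [exact: dhomogZ|exact: Ik.2].
have BL: B' `<=` Loc B P.
 apply: adj_min=> //.
  by move=> a /AB; exact: Loc_sub.
 by rewrite -invf_div; exact: Loc_inv.
have [|s [Bs Ps isv]] := @int_Loc _ _ B P U v sB pP.
 apply: int_sub iv=> //.
 by move=> u uU; apply: spn_gen; [|exact: mon_gen].
by apply: Ps; apply: IP.
Qed.
(** Bounding chains [w] and [w'] over the charts differ by a cycle, which over the overlap is the
    boundary of some [t^-k s]; splitting this chain as [s1 + s2] gives [w - d s1 = w' + d s2], with
    components integral over both charts and therefore over [A] by [int_glue]. *)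
Lemma cech_exact n :
 (forall n k v, Rb B U n v -> exists a b, [/\ Rb B U n a, Rb B' U n b & t ^- k *: v = a + b]) ->
 exact_at B n -> exact_at B' n -> exact_at A n.
move=> split_ H H' z Gz dz.
have GN D: subring D -> forall p v, Rg D U n p v -> Rg D U n p (- v)=> //.
have GD D: subring D -> forall p u v, Rg D U n p u -> Rg D U n p v -> Rg D U n p (u + v)=> //.
have [|w Gw wE] := H z _ dz; first by apply: inK_mono Gz=> p; exact: Rg_sub.
have [|w' Gw' w'E] := H' z _ dz; first by apply: inK_mono Gz=> p; exact: Rg_sub.
have [||||_ [k ->] Gtw] := @inK_denom E E^o (size U) (Rg B U n) [set a | exists k, a = (t ^+ k)%:MP] w'.
- by exists 0%N.
- by move=> _ _ [k ->] [l ->]; exists (k + l)%N; rewrite exprD mpolyCM.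
- by move=> p _ v [k ->]; apply: RgZ.
- apply: inK_mono Gw'=> p v; rewrite /Rg; case: ifP=> _; last first.
  by move=> ->; exists 1; [exists 0%N|rewrite scaler0].
 move=> /chart_denom[k Rk]; exists (t ^+ k)%:MP; first by exists k.
 by rewrite -[_ *: _]/((t ^+ k)%:MP * v) mul_mpolyC.
pose T : E := (t ^+ k)%:MP; pose T' : E := (t ^- k)%:MP.
have TT: T' * T = 1 by rewrite -mpolyCM mulVf ?expf_neq0.
have [||s Gs sE] := H (T *: (w - w')).
- rewrite scalerBr; apply: inKD; first exact: GD.
  by apply: inKZ Gw=> p v; apply: RgZ.
 by apply: inKN=> //; exact: GN.
- by rewrite dKZ dKB wE w'E subrr scaler0.
have [] := @inK_split E E^o (size U) (fun p=> [set v | exists2 u, Rg B U n p u & v = T' *: (u : E^o)])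
 (Rg B U n) (Rg B' U n) 1 (T' *: s).
- move=> p _ [u Gu ->]; move: Gu; rewrite /Rg; case: ifP=> _; last first.
  by move=> ->; exists 0, 0; rewrite !scaler0 addr0.
 move=> /(split_ _ k)[a [b [Ra Rb' abE]]]; exists a, b; split=> //.
 by rewrite scale1r -[LHS]/(T' * u) mul_mpolyC.
- by apply: inKZ Gs=> p u; exists u.
move=> s1 [s2 [G1 G2 /esym sE']].
have E1: w - dK U s1 = w' + dK U s2.
 have E2: w - w' = dK U s1 + dK U s2 by rewrite -dKD -[s2]scale1r sE' dKZ sE scalerA TT scale1r.
 by apply/eqP; rewrite subr_eq -addrA [dK U s2 + _]addrC -E2 addrC subrK.
have U1 D (v: KT E^o (size U)) : subring D -> inK (V := E^o) (Rg D U n) v ->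
  inK (V := E^o) (Rg D U n) (dK U v) by move=> sD; exact: Rg_dK.
have G3: inK (V := E^o) (Rg B U n) (w - dK U s1).
 by apply: inKD=> //; [exact: GD|apply: inKN; [exact: GN|exact: U1]].
have G4: inK (V := E^o) (Rg B' U n) (w - dK U s1).
 by rewrite E1; apply: inKD=> //; [exact: GD|exact: U1].
exists (w - dK U s1); last by rewrite dKB dK_dK subr0.
have inKI d (G1' G2' G3': nat -> set E) (v : KT E^o d) : (forall p u, G1' p u -> G2' p u -> G3' p u) ->
  inK (V := E^o) G1' v -> inK (V := E^o) G2' v -> inK (V := E^o) G3' v.
 elim: d G1' G2' G3' v=> [|d IH] F1 F2 F3 v FF; first exact: FF.
 have [v1 [v2 ->]] := mkpP v=> /inK_mkp[F11 F12] /inK_mkp[F21 F22]; split; first exact: IH F11 F21.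
 by apply: IH F12 F22=> p; exact: FF.
apply: inKI G3 G4=> p u; rewrite /Rg; case: ifP=> // _ [hu iu] [_ iu']; split=> //.
by apply: int_glue iu'=> //; [exact: rlr_x rA|exact: rlr_y rA].
Qed.
End Cech.
(** Induction on a strict bound [k] for the colength of the ideal of the [c_i / g]. For the unit
    ideal one entry divides the others. Otherwise both charts are examined at their maximal ideals:
    on the exceptional line [blowup_drop] lowers the bound, with [g] replaced by [g x^e]; elsewhere
    the local ring is a valuation ring or a field. *)
Theorem core_exact k (A : set K) x y g n : rlr2 A x y -> fracs A -> g != 0 -> (forall i, A (c 0 i / g)) ->
 (exists N, spn A ([set` [seq a / g | a <- cs]] : set K^o) (x ^+ N) /\
      spn A ([set` [seq a / g | a <- cs]] : set K^o) (y ^+ N)) ->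
 ~ chain A (spn A ([set` [seq a / g | a <- cs]] : set K^o)) (A : set K^o) k -> (1 < n)%N ->
 exact_at A n.
elim: k A x y g n=> [|k IH] A x y g n rA fA g0 Ac [N [Nx Ny]] nch n1; have sA := rlr_sub rA.
 case: nch; apply: chain0; first exact: (ring_ideal rA).1.
 apply: spn_sub_ideal; first exact: ring_ideal rA.
 by move=> _ /mapP[_ /mapP[i _ ->] ->].
have Acs a: a \in [seq a / g | a <- cs] -> A a by move=> /mapP[_ /mapP[i _ ->] ->].
have [one|none] := pselect (spn A ([set` [seq a / g | a <- cs]] : set K^o) 1).
 have [i ui]: exists i, ~ mi A x y (c 0 i / g).
  apply: contrapT=> ni; apply: (rlr_proper rA); move: one; apply: spn_sub_ideal; first exact: mi_ideal.
  move=> _ /mapP[_ /mapP[i _ ->] ->]; apply: contrapT=> h; by apply: ni; exists i.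
 have ci: c 0 i / g != 0 := mi_neq0 rA ui.
 apply: dominated_exact=> //; first exact: rlr_noeth rA.
  apply: rlr2_good rA; exact: fracs_ex.
 exists i; first by move: ci; rewrite mulf_eq0 negb_or=> /andP[].
 move=> j; exists ((c 0 j / g) * (c 0 i / g)^-1); first by apply: srM=> //; exact: (rlr_unit rA).
 have ci0: c 0 i != 0 by move: ci; rewrite mulf_eq0 negb_or=> /andP[].
 by rewrite invf_div mulrA divfK // divfK.
have chart x' y': rlr2 A x' y' -> spn A ([set` [seq a / g | a <- cs]] : set K^o) (x' ^+ N) ->
  exact_at (adj A (y' / x')) n.
 move=> rA' Nx'; set B := adj _ _; have sB: subring B by [].
 have nB: noeth B by exact: noeth_adj (rlr_noeth rA).
 have AB: A `<=` B by exact: adj_sub.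
 apply: exact_local_global=> // P mP; have pP := maxi_prime sB mP.
 have fL: fracs (Loc B P) by apply: fracs_sub fA=> a /AB; exact: Loc_sub.
 have [Px|Px] := pselect (P x'); last first.
  have [pi dL] := chart_off_dvr rA' pP Px.
  by apply: (dvr_exact dL fL g0)=> // i; apply: (Loc_sub sB pP); exact: AB.
 have [w [e [rL Lc [N' [Nx2 Nw]] nch']]] := blowup_drop rA' mP Px Acs Nx' none nch.
 have E1: [seq a / x' ^+ e | a <- [seq a / g | a <- cs]] = [seq a / (g * x' ^+ e) | a <- cs] by rewrite -map_comp; apply: eq_map=> a; rewrite invfM mulrA.
 rewrite E1 in Nx2 Nw nch' Lc.
 apply: IH rL fL _ _ _ nch' n1.
 - by rewrite mulf_neq0 // expf_neq0 // (rlr_x0 rA').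
 - move=> i; rewrite invfM mulrA; apply: Lc=> //.
 - by exists N'.
apply: (cech_exact rA).
- exact: (normal_split rA fA g0).
- exact: chart.
- exact: chart (rlr2_sym rA) Ny.
Qed.
End Core.

(** * Reductions with rank plus one generators *)

Section Residue.
Variables (K : fieldType) (A : set K) (x y : K).
Hypothesis rA : rlr2 A x y.
Let sA := rlr_sub rA.
Notation m := (mi A x y).
Let pm : primei A m := mi_prime rA.
Let im : ideal A m := mi_ideal rA.

Definition infres := forall s : seq K, (forall b, b \in s -> A b) ->
 exists a, A a /\ forall b, b \in s -> ~ m (a - b).
(** If all values were in [m], a root modulo [m] outside the list [s] of those already used could be
    split off again and again, each time lowering the size; the residue classes do not run out. *)
Lemma nonvanishing p : infres -> pcoef A p -> (exists i, ~ m p`_i) -> exists2 a, A a & ~ m p.[a].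
move=> inf; suff H n (s: seq K) (q : {poly K}) : (forall b, b \in s -> A b) -> (size q <= n)%N -> pcoef A q ->
  (forall a, A a -> (forall b, b \in s -> ~ m (a - b)) -> m q.[a]) -> forall i, m q`_i.
 move=> Ap [i mi_]; apply: contrapT=> np; apply: mi_; apply: (H (size p) [::])=> // a Aa _.
 by apply: contrapT=> mpa; apply: np; exists a.
elim: n s q=> [|n IH] s q As.
 by rewrite leqn0 size_poly_eq0=> /eqP-> _ _ i; rewrite coef0.
move=> sq Aq H; have [t [At ts]] := inf s As.
have At': pcoef A ('X - t%:P) by apply: (srB (pcoef_sub sA)); [exact: pcoefX|exact: pcoefC].
have [d [r [Ad Ar qE]]] := monic_division sA At' Aq (monicXsubC t).
rewrite size_XsubC=> /size1_polyC rE.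
have rt: r = q.[t]%:P by rewrite qE hornerD hornerM hornerXsubC subrr mul0r add0r rE hornerC.
have mr: m q.[t] by exact: H.
have md: forall i, m d`_i.
 apply: (IH (t :: s))=> //.
 - by move=> b; rewrite inE=> /predU1P[->|/As].
 - have [->|d0] := eqVneq d 0; first by rewrite size_poly0.
  rewrite -ltnS; apply: leq_trans sq.
  have sd: size (('X - t%:P) * d) = (size d).+1 by rewrite size_monicM ?monicXsubC // size_XsubC.
  rewrite qE size_polyDl sd // rE; apply: leq_ltn_trans (size_polyC_leq1 _) _.
  by rewrite ltnS size_poly_gt0.
 - move=> a Aa ab; have mq: m q.[a] by apply: H=> // b sb; apply: ab; rewrite inE sb orbT.
  have Ada: A d.[a] by rewrite horner_coef; apply: sr_sum=> // i _; apply: srM.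
  have [_ _ pr] := pm; case: (pr (a - t) d.[a])=> //.
   have := idealB sA im mq mr; congr m.
   by rewrite {1}qE rt hornerD hornerM hornerXsubC hornerC addrK.
  by move=> h; case: (ab t).
move=> i; rewrite qE rt coefD coefC mulrBl coefB mulrC coefMX coefCM.
apply: (idealD im); last case: i=> //=.
apply: (idealB sA im); last exact: (idealMl im).
by case: i=> /=.
Qed.
Lemma yadic_minimal (I : finType) (f : I -> K) : (forall i, A (f i)) ->
 (exists i, ~ exists2 c, A c & f i = x * c) ->
 exists i0, (~ exists2 c, A c & f i0 = x * c) /\
 forall j, exists b c, [/\ A b, A c & f j = b * f i0 + x * c].
move=> Af [i fi]; pose P k := `[< exists j u c, [/\ A u, ~ m u, A c & f j = y ^+ k * u + x * c] >].
have exP: exists k, P k.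
 have [k [u [c [Au mu Ac E]]]] := rlr_yadic rA (Af i) fi.
 by exists k; apply/asboolP; exists i, u, c.
case: (ex_minnP exP)=> k /asboolP[i0 [u [c [Au mu Ac E]]]] kmin.
have nx j a v e: A v -> ~ m v -> A e -> f j = y ^+ a * v + x * e -> ~ exists2 c', A c' & f j = x * c'.
 move=> Av mv Ae -> [c' Ac' E']; have : exists2 z, A z & v = x * z.
  apply: (@reg_pow _ _ _ _ rA a v (c' - e))=> //.
  by rewrite mulrBr -E' addrK.
 by move=> [z Az vE]; apply: mv; rewrite vE; exact: mi_x.
exists i0; split; first exact: nx E.
move=> j; have [[e Ae fE]|nj] := pselect (exists2 e, A e & f j = x * e).
 by exists 0, e; rewrite mul0r add0r.
have [l [v [e [Av mv Ae fE]]]] := rlr_yadic rA (Af j) nj.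
have kl: (k <= l)%N by apply: kmin; apply/asboolP; exists j, v, e.
have u0 := mi_neq0 rA mu; have Au' := rlr_unit rA Au mu; have Ay := rlr_y rA.
exists (y ^+ (l - k) * v / u), (e - y ^+ (l - k) * v / u * c); split=> //.
rewrite fE E -[in LHS](subnK kl) exprD; field=> //.
Qed.
(** Gaussian elimination over the valuation ring [A / x]: for each functional at most one vector,
    with value of least [y]-adic order, is spent as pivot. The functional [phi j] is only assumed
    integral once the earlier ones are divisible by [x], because the functionals will be successive
    [x]-adic digits of coefficients. *)
Lemma unit_relation (V : lmodType K) T n (w : 'I_n -> V) (phi : nat -> V -> K) :
 (forall j a u v, phi j (a *: u + v) = a * phi j u + phi j v) -> (T < n)%N ->
 (forall j a, (j < T)%N -> (forall i, A (a i)) ->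
  (forall i, (i < j)%N -> exists2 c, A c & phi i (\sum_k a k *: w k) = x * c) ->
  A (phi j (\sum_k a k *: w k))) ->
 exists a, [/\ forall i, A (a i), exists i, ~ m (a i) &
  forall j, (j < T)%N -> exists2 c, A c & phi j (\sum_k a k *: w k) = x * c].
have [_ m1 _] := pm.
elim: T n w phi=> [|T IH] [|n] // w phi lin Tn H.
 by exists (fun=> 1); split=> //; exists ord0.
have phi0 j: phi j 0 = 0 by have := lin j (-1) 0 0; rewrite scaler0 addr0 mulN1r addNr.
have phiS j (I: finType) (a : I -> K) v : phi j (\sum_k a k *: v k) = \sum_k a k * phi j (v k) by elim/big_rec2: _=> // i u v' _ <-.
have Aw i: A (phi 0%N (w i)).
 have := H 0%N (fun k=> if k == i then 1 else 0) isT; rewrite (bigD1 i) //= eqxx scale1r big1 ?addr0; last first.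
  by move=> j /negPf->; rewrite scale0r.
 by apply=> // k; case: ifP.
have [hx|/existsNP[i hi]] := pselect (forall i, exists2 c, A c & phi 0%N (w i) = x * c).
 have x0 a: (forall i, A (a i)) -> exists2 c, A c & phi 0%N (\sum_k a k *: w k) = x * c.
  have /choice[c cE]: forall i, exists c, A c /\ phi 0%N (w i) = x * c by move=> i; have [c] := hx i; exists c.
  move=> Aa; exists (\sum_k a k * c k); first by apply: sr_sum=> // k _; apply: srM=> //; exact: (cE k).1.
  by rewrite phiS mulr_sumr; apply: eq_bigr=> k; rewrite (cE k).2 mulrCA.
 have [|||a [Aa ua aE]] := IH n.+1 w (phi \o succn).
 - by move=> j; exact: lin.
 - exact: ltnW.
 - move=> j a jT Aa ji; apply: H=> // -[|] ij; [exact: x0|exact: ji].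
 by exists a; split=> // -[|] jT; [exact: x0|exact: aE].
have [i0 [hi0 /choice[b /choice[c bcE]]]] := yadic_minimal Aw (ex_intro _ i hi).
pose w' j := w (lift i0 j) - b (lift i0 j) *: w i0.
pose up (a : 'I_n -> K) k := if unlift i0 k is Some j then a j else - \sum_j a j * b (lift i0 j).
have upE a: \sum_k up a k *: w k = \sum_j a j *: w' j.
 rewrite (bigD1_ord i0) //= /up unlift_none.
 under eq_bigr do rewrite liftK.
 under [RHS]eq_bigr do rewrite scalerBr scalerA.
 by rewrite sumrB addrC scaleNr scaler_suml.
have Aup a: (forall j, A (a j)) -> forall k, A (up a k).
 move=> Aa k; rewrite /up; case: unlift=> // ; apply: srN=> //; apply: sr_sum=> // j _.
 by apply: srM; have [] := bcE (lift i0 j).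
have x0 a: (forall i, A (a i)) -> exists2 e, A e & phi 0%N (\sum_k up a k *: w k) = x * e.
 move=> Aa; exists (\sum_k a k * c (lift i0 k)).
  by apply: sr_sum=> // k _; apply: srM; have [] := bcE (lift i0 k).
 rewrite upE phiS mulr_sumr; apply: eq_bigr=> k _; rewrite mulrCA; congr (_ _).
 rewrite /w' -scaleNr addrC lin.
 by have [_ _ ->] := bcE (lift i0 k); rewrite mulNr addrC addrAC subrr add0r.
have [|||a [Aa [k ua] aE]] := IH n w' (phi \o succn)=> //.
- by move=> j; exact: lin.
- move=> j a jT Aa ji; rewrite -upE; apply: (H j.+1)=> //; first exact: Aup.
 by move=> [|] ij; [exact: x0|rewrite upE; exact: ji].
exists (up a); split; [exact: Aup|by exists (lift i0 k); rewrite /up liftK|].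
by move=> [|] jT; [exact: x0|rewrite upE; exact: aE].
Qed.
End Residue.
Lemma digit_sum b k N : (0 < b)%N -> (\sum_(i < k) (N %/ b ^ i %% b) * b ^ i = N %% b ^ k)%N.
case: b=> // b _; elim: k=> [|k IH]; first by rewrite big_ord0 modn1.
rewrite big_ord_recr /= IH.
have E1: N = (N %/ b.+1 ^ k %/ b.+1 * b.+1 ^ k.+1 + (N %/ b.+1 ^ k %% b.+1 * b.+1 ^ k + N %% b.+1 ^ k))%N by rewrite expnS mulnA addnA -mulnDl -!divn_eq.
rewrite addnC; symmetry; rewrite {1}E1 modnMDl modn_small //.
have H d e p: (d < b.+1)%N -> (e < p)%N -> (d * p + e < b.+1 * p)%N.
 move=> db ep; apply: (@leq_trans (d.+1 * p)); last by rewrite leq_mul2r db orbT.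
 by rewrite addnC ltn_add2r.
by rewrite expnS; apply: H; rewrite ltn_pmod // expn_gt0.
Qed.
Lemma leq_expn p q k : (p <= q)%N -> (p ^ k <= q ^ k)%N.
by case: k=> pq; rewrite // leq_exp2r. Qed.

Section Reduction.
Variables (r : nat) (K : fieldType).
Notation E := {mpoly K[r.+1]}.
Variables (A : set K) (x y : K).
Hypotheses (rA : rlr2 A x y) (infA : infres A x y).
Let sA := rlr_sub rA.
Implicit Types (g h U : seq E) (u v w : E).

Fixpoint words g n : seq E := if n is n'.+1 then [seq u * w | u <- g, w <- words g n'] else [:: 1].
Lemma wordsP g n w : w \in words g n <-> monn g n w.
split.
 elim: n w=> [|n IH] w /=; first by rewrite inE=> /eqP->; constructor.
 by move=> /allpairsP[[u v] [ug /IH mv ->]]; constructor.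
elim=> //.
Qed.
Lemma spn_words D g n : spn D (monn g n) = spn D [set` words g n] :> set E.
by congr spn; apply/seteqP; split=> w /wordsP. Qed.

Definition mulset U g n : set E := [set v | exists u w, [/\ u \in U, monn g n w & v = u * w]].

(* U generates a reduction of the module generated by g: N^(k+1) = U N^k for some k. *)
Definition Red U g := exists k, spn A (monn g k.+1) `<=` spn A (mulset U g k).
Lemma monn_spn_cat g n k v w : spn A (monn g n) v -> spn A (monn g k) w -> spn A (monn g (n + k)) (v * w).
by apply: spn_mul=> // a b ma mb; apply: spn_gen; [|exact: monn_cat].
Qed.

(** The degree [n] part of the ideal generated by [U] in the Rees algebra of [g]. *)
Definition Qn U g n : set E := if n is n'.+1 then spn A (mulset U g n') else [set 0].
Lemma Qn_smod U g n : smod A (Qn U g n).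
by case: n=> [|]. Qed.
Lemma Qn_mul U g n k v w : Qn U g n v -> spn A (monn g k) w -> Qn U g (n + k) (v * w).
case: n=> [|n] Qv Nw.
 by move: Qv ->; rewrite mul0r; exact: smod0 (Qn_smod _ _ _).
rewrite addSn; apply: (spn_mul sA _ Qv Nw)=> _ b [u [w' [uU mw' ->]]] mb.
apply: spn_gen=> //.
by exists u, (w' * b); rewrite mulrA; split=> //; exact: monn_cat.
Qed.

Section Drop.
Variables (g g' h : seq E) (t : E).
Hypotheses (tN : spn A (monn g 1) t).

(* [u] of degree [n] equals [a t^n] modulo the products with a factor in [h]. *)
Definition Cg n u a := [/\ A a, spn A (monn g n) u & Qn h g n (u - a *: t ^+ n)].
Let tX n : spn A (monn g n) (t ^+ n).
elim: n=> [|n IH]; first by apply: spn_gen; [|constructor].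
by rewrite exprS; exact: (monn_spn_cat tN).
Qed.
Lemma Cg1 : Cg 0 1 1.
by split=> //; rewrite scale1r subrr. Qed.
Lemma Cg_mul n k u v a b : Cg n u a -> Cg k v b -> Cg (n + k) (u * v) (a * b).
move=> [Aa Nu Qu] [Ab Nv Qv]; split=> //; first exact: monn_spn_cat.
have ->: u * v - (a * b) *: t ^+ (n + k) = (u - a *: t ^+ n) * v + (v - b *: t ^+ k) * (a *: t ^+ n) by rewrite -!mul_mpolyC exprD; ring.
apply: (smodD (Qn_smod _ _ _)); first exact: Qn_mul.
by rewrite addnC; apply: Qn_mul=> //; apply: smodZ.
Qed.
Lemma Cg_exp u a k : Cg 1 u a -> Cg k (u ^+ k) (a ^+ k).
move=> H; elim: k=> [|k IH]; first exact: Cg1.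
by rewrite !exprS; exact: (Cg_mul H).
Qed.
Lemma Cg_t k : Cg k (t ^+ k) 1.
by split=> //; rewrite scale1r subrr; exact: smod0 (Qn_smod _ _ _). Qed.
Lemma Cg_sum (I : finType) n (c a : I -> K) (u : I -> E) : (forall i, A (c i)) -> (forall i, Cg n (u i) (a i)) ->
 Cg n (\sum_i c i *: u i) (\sum_i c i * a i).
move=> Ac; split.
- by apply: sr_sum=> // i _; apply: srM; have [] := H i.
- by apply: smod_sum=> [|i _] //; apply: smodZ; have [] := H i.
rewrite scaler_suml -sumrB; apply: smod_sum=> [|i _]; first exact: Qn_smod.
by rewrite -scalerA -scalerBr; apply: (smodZ (Qn_smod _ _ _)); have [] := H i.
Qed.
(** Modulo the ideal of [h] every word in [g'] is a multiple of a power of [t], so a [t^(n + 1)] in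
    [(h) + m] puts all words of length [n + 1] there. As [g'] is a reduction, these words times
    [N^k] span [N^(n + 1 + k)], and Nakayama removes [m]. *)
Lemma Red_step n : Red g' g -> (forall u, u \in g' -> exists a, Cg 1 u a) ->
 sadd (Qn h g n.+1) (spn (mi A x y) (monn g n.+1)) (t ^+ n.+1) -> Red h g.
move=> [k kE] g'h tQ; have im := mi_ideal rA.
have sm n': smod A (spn (mi A x y) (monn g n')).
 split=> //; move=> a v Aa; apply: spnZ=> d //.
have step j: spn A (monn g (j + k)) `<=`
  spn A [set v | exists w' w, [/\ monn g' j w', monn g k w & v = w' * w]].
 elim: j=> [|j IH]; first by apply: spn_mono=> // w; exists 1, w; rewrite mul1r; split=> //; constructor.
 apply: spn_trans=> // w; rewrite addSn=> mw; inversion mw; subst.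
 have /IH Sw: spn A (monn g (j + k)) w0 by [].
 rewrite mulrC; apply: (spn_mulE sA _ Sw)=> _ [w' [w1 [mw' mw1 ->]]].
 have /kE Su: spn A (monn g k.+1) (u * w1) by apply: spn_gen; [|constructor].
 have ->: w' * w1 * u = u * w1 * w' by ring.
 apply: (spn_mulE sA _ Su)=> _ [u' [w2 [u'g mw2 ->]]].
 apply: spn_gen=> //.
 by exists (u' * w'), w2; split=> //; [constructor|rewrite mulrAC].
have word j w: monn g' j w -> exists a, Cg j w a.
 elim=> [|j' u w' /g'h[a Ca] _ [b Cb]]; first by exists 1; exact: Cg1.
 by exists (a * b); exact: (Cg_mul Ca).
pose n' := n.+1; have sS: smod A (sadd (Qn h g (n' + k)) (spn (mi A x y) (monn g (n' + k)))).
 by apply: sadd_smod=> //; exact: Qn_smod.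
exists (n + k)%N; apply: (@nakayama_fg _ _ A (mi A x y) _ _ (spn A (monn g (n' + k))))=> //.
- by rewrite spn_words; apply: fg_noeth=> //; exact: rlr_noeth rA.
- by case: im.
- exact: mi_1B.
move=> v /(step n') Sv; have sub: sadd (Qn h g (n' + k)) (spn (mi A x y) (monn g (n' + k))) `<=`
  sadd (spn A (mulset h g (n + k))) (spn (mi A x y) (spn A (monn g (n' + k)))).
 move=> _ [q [s [Qq Ss ->]]]; exists q, s; split=> //; apply: spn_mono Ss=> //.
apply: sub; move: v Sv; apply: spn_min=> // _ [w' [w [mw' mw ->]]].
have [a [Aa Nw' Qw']] := word _ _ mw'.
have [q [s [Qq Ss wE]]]: sadd (Qn h g n') (spn (mi A x y) (monn g n')) w'.
 rewrite -[w'](subrK (a *: t ^+ n')); apply: (smodD (sadd_smod (Qn_smod _ _ _) (sm n'))).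
  exact: saddl.
 exact: (smodZ (sadd_smod (Qn_smod _ _ _) (sm n'))).
exists (q * w), (s * w); split; [|  |by rewrite wE mulrDl].
 exact: Qn_mul.
elim: Ss=> [|d z v md mz _ IH]; first by rewrite mul0r.
by rewrite mulrDl -scalerAl; constructor=> //; exact: monn_cat.
Qed.
End Drop.
Lemma Red_refl g : Red g g.
exists 0%N; apply: spn_mono=> // w mw; inversion mw; subst.
by exists u, w0.
Qed.

Section Bounded.
Variables (g : seq E) (N0 : nat).
Hypotheses (gA : forall u, u \in g -> mcf A u) (g1 : forall u, u \in g -> u \is 1.-homog).
Hypothesis gX : forall i, spn A (monn g 1) (x ^+ N0 *: 'X_i).
Lemma monn_mcf n w : monn g n w -> mcf A w.
elim=> [|k u v ug _ IH]; first by rewrite -mpolyX0; exact: mcfX.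
by apply: (mcf_mul sA (self_ideal sA))=> //; exact: gA.
Qed.
Lemma clear_Xs n w : spn A (monn (Xs r.+1 K) n) w -> spn A (monn g n) (x ^+ (N0 * n) *: w).
move=> Sw; rewrite -mul_mpolyC mulrC; apply: (spn_mulE sA _ Sw)=> {Sw}w.
elim=> [|k u v /mapP[i _ ->] _ IH].
 by rewrite muln0 mulr1; apply: spn_gen; [|constructor].
have ->: 'X_i * v * (x ^+ (N0 * k.+1))%:MP = (x ^+ N0 *: 'X_i) * (v * (x ^+ (N0 * k))%:MP) by rewrite -mul_mpolyC mulnS exprD; ring.
exact: (monn_spn_cat (gX i)).
Qed.

(** All exponents but the last range freely up to [n], and the last one makes up the degree. Some
    entries may exceed degree [n]; what counts is that every monomial of degree [n] occurs and that
    the length is [(n + 1)^r]. *)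
Definition mnms n : seq 'X_{1..r.+1} :=
 [seq [multinom if unlift ord_max i is Some j then (f j : nat) else (n - \sum_j f j)%N | i < r.+1]
  | f : {ffun 'I_r -> 'I_n.+1}].
Lemma size_mnms n : size (mnms n) = (n.+1 ^ r)%N.
by rewrite size_map -cardE card_ffun !card_ord. Qed.
Lemma mem_mnms n m : mdeg m = n -> m \in mnms n.
move=> mn; have E0: mdeg m = (m ord_max + \sum_j m (lift ord_max j))%N by rewrite mdegE (bigD1_ord ord_max).
have le j: (m (lift ord_max j) < n.+1)%N by rewrite -mn E0 (bigD1 j) //=; lia.
apply/mapP; exists [ffun j=> Ordinal (le j)]=> //.
apply/mnmP=> i; rewrite mnmE; case: unliftP=> [j ->|->]; first by rewrite ffunE.
under eq_bigr do rewrite ffunE /=.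
by rewrite -mn E0 addnK.
Qed.
(** A form of degree [n] with coefficients divisible by [x^(N0 n + 1)] lies in [x N^n], since
    [x^(N0 n)] carries forms over [A] into [N^n]. This amounts to [(n + 1)^r (N0 n + 1)] conditions
    modulo [x], a number of order [n^(r + 1)]. *)
Lemma degree_relation n T (w : 'I_T -> E) : (forall i, spn A (monn g n) (w i)) ->
 (n.+1 ^ r * (N0 * n).+1 < T)%N ->
 exists a, [/\ forall i, A (a i), exists i, ~ mi A x y (a i) &
  exists2 z, spn A (monn g n) z & \sum_i a i *: w i = x *: z].
move=> mw nT; have x0 := rlr_x0 rA; have s0: (0 < size (mnms n))%N by rewrite size_mnms expn_gt0.
set s := mnms n in s0; rewrite -size_mnms -/s in nT.
(* The remainder of the index [j] selects a monomial and its quotient an [x]-adic digit; all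
   monomials are treated for one digit before the next. *)
pose phi j v := v@_(nth 0%MM s (j %% size s)) / x ^+ (j %/ size s).
have Av a: (forall i, A (a i)) -> mcf A (\sum_k a k *: w k).
 move=> Aa; apply: smod_sum=> [|i _]; first exact: mcf_smod (self_ideal sA).
 apply: (smodZ (N := mcf A) (D := A))=> //; first exact: mcf_smod (self_ideal sA).
 by apply: spn_min (mw i); [exact: mcf_smod (self_ideal sA)|exact: monn_mcf].
have [||a [Aa ua aE]] := unit_relation rA (phi := phi) (w := w) _ nT.
- by move=> j a u v; rewrite /phi mcoeffD mcoeffZ mulrDl mulrA.
- move=> j a jT Aa ji; rewrite /phi; have [jlt|jge] := ltnP j (size s).
  by rewrite (divn_small jlt) divr1; exact: Av.
 have [|c Ac] := ji (j - size s)%N; first lia.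
 rewrite /phi; have ->: (j = (j - size s) + size s)%N by lia.
 rewrite addnK modnDr divnDr // divnn s0 addn1=> E0.
 by rewrite exprSr invfM mulrA E0 mulrAC mulfV.
exists a; split=> //; pose v := \sum_k a k *: w k.
have hv: v \is n.-homog.
 apply: rpred_sum=> i _; apply: rpredZ; elim: (mw)=> [|d u v' _ mu _ IH]; first exact: dhomog0.
 by apply: dhomogD=> //; apply: dhomogZ; exact: monn_homog mu.
have mv: mcf A (x ^- (N0 * n).+1 *: v).
 move=> m; rewrite mcoeffZ; have [mn|mn] := eqVneq (mdeg m) n; last first.
  by rewrite (dhomog_nemf_coeff hv mn) mulr0.
 have ms := mem_mnms mn; rewrite -/s in ms.
 have [|c Ac] := aE (N0 * n * size s + index m s)%N.
  by rewrite [(size s * _)%N]mulnC addnC ltn_add2r index_mem.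
 rewrite /phi modnMDl modn_small ?index_mem // nth_index // divnMDl // divn_small ?index_mem // addn0.
 move=> E0; rewrite exprS invfM mulrAC -mulrA E0.
 by rewrite mulrA mulVf.
exists (x ^+ (N0 * n) *: (x ^- (N0 * n).+1 *: v)).
 by apply: clear_Xs; apply: mcf_spn=> //; exact: dhomogZ.
by rewrite !scalerA -exprS mulfV ?scale1r // expf_neq0.
Qed.
(** Noether normalization of the special fibre, of dimension at most [r + 2]. Monomials in the
    [r + 2] elements [us], filled up with [t] to degree [n], outnumber the conditions of
    [degree_relation], so a relation with a unit coefficient holds modulo [x]. Modulo [h], where
    [us_i] becomes [tau^(b^i) t], it reads as the value at [tau] of a polynomial times [t^n];
    distinct monomials give distinct powers of [tau] by uniqueness of base [b] digits, and a [tau]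
    with value outside [m] puts [t^n] into [(h) + m]. *)
Lemma drop_generator (us vs : seq E) t : size us = r.+2 -> (forall u, u \in us ++ t :: vs -> spn A (monn g 1) u) ->
 Red (us ++ t :: vs) g ->
 exists h, [/\ size h = (size (us ++ t :: vs)).-1, forall u, u \in h -> spn A (monn g 1) u & Red h g].
(* Exponents up to [e] give [b^(r + 2)] monomials of degree at most [n]. The choice of [e] yields
   [(n + 1)^r (N0 n + 1) <= e b^(r + 1) < b^(r + 2)]. *)
move=> sus uN rd; pose e := (r.+2 ^ r * (N0 * r.+2).+1)%N; pose b := e.+1; pose n := (r.+2 * e)%N.
pose T := (b ^ r.+2)%N; pose dg N i := (N %/ b ^ i %% b)%N.
have dgb N i: (dg N i <= e)%N by rewrite -ltnS ltn_pmod.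
have dgn N: (\sum_(i < r.+2) dg N i <= n)%N by rewrite /n -[r.+2 in X in (_ <= X)%N]card_ord -sum_nat_const; apply: leq_sum.
have usN i: (i < r.+2)%N -> spn A (monn g 1) us`_i by move=> ir; apply: uN; rewrite mem_cat mem_nth ?sus.
have tN: spn A (monn g 1) t by apply: uN; rewrite mem_cat mem_head orbT.
pose w (N : 'I_T) : E := \prod_(i < r.+2) us`_i ^+ dg N i * t ^+ (n - \sum_(i < r.+2) dg N i).
have [||a [Aa [i0 ui0] [z Sz zE]]] := @degree_relation n T w.
- move=> N.
 have X k u j: spn A (monn g k) u -> spn A (monn g (k * j)) (u ^+ j).
  move=> Su; elim: j=> [|j IH]; first by rewrite muln0; apply: spn_gen=> //; constructor.
  by rewrite exprS mulnS; exact: monn_spn_cat.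
 rewrite -(subnKC (dgn N)); apply: monn_spn_cat; last first.
  by have := X 1%N t (n - \sum_(i < r.+2) dg N i)%N tN; rewrite mul1n.
 elim/big_ind2: _=> [|k u k' u'|i _]; first by apply: spn_gen=> //; constructor.
  exact: monn_spn_cat.
 by have := X 1%N _ (dg N i) (usN i (ltn_ord i)); rewrite mul1n.
- rewrite /T /b; apply: (@leq_ltn_trans ((r.+2 * b) ^ r * ((N0 * r.+2).+1 * b))).
  by apply: leq_mul; [apply: leq_expn|]; nia.
 by rewrite expnMn mulnACA -expnSr [X in (_ < X)%N]expnS ltn_mul2r expn_gt0 leqnn.
have [tau At mtau]: exists2 tau, A tau & ~ mi A x y (\poly_(N < T) (if insub N is Some i then a i else 0)).[tau].
 apply: (nonvanishing rA infA); last by exists i0; rewrite coef_poly ltn_ord valK.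
 by move=> i; rewrite coef_poly; case: ifP; [case: insub |].
have pE: (\poly_(N < T) (if insub N is Some i then a i else 0)).[tau] = \sum_i a i * tau ^+ i by rewrite horner_poly; apply: eq_bigr=> i; rewrite valK.
rewrite pE in mtau.
pose h := [seq us`_i - tau ^+ (b ^ i) *: t | i <- iota 0 r.+2] ++ vs.
have C1 u v a': A a' -> spn A (monn g 1) u -> u - a' *: t = v -> v \in h -> Cg g h t 1 u a'.
 move=> Aa' Nu uE vh; split=> //; rewrite uE; apply: spn_gen=> //; exists v, 1.
 by rewrite mulr1; split=> //; constructor.
have Cus i: (i < r.+2)%N -> Cg g h t 1 us`_i (tau ^+ (b ^ i)).
 move=> ir; apply: C1=> //; first exact: usN.
 by rewrite mem_cat; apply/orP; left; apply/mapP; exists i; rewrite ?mem_iota.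
have Cw N: Cg g h t n (w N) (tau ^+ N).
 have ->: tau ^+ N = (\prod_(i < r.+2) (tau ^+ (b ^ i)) ^+ dg N i) * 1.
  rewrite mulr1; under eq_bigr do rewrite -exprM mulnC.
  by rewrite -expr_sum digit_sum // modn_small.
 rewrite -(subnKC (dgn N)); apply: Cg_mul=> //; last exact: Cg_t.
 elim/big_ind3: _=> [|k u a1 k' u' a2|i _]; [exact: Cg1|exact: Cg_mul|].
 by apply: Cg_exp=> //; exact: Cus.
have [_ _ Qz] := Cg_sum Aa Cw; rewrite zE in Qz.
exists h; split.
- by rewrite !size_cat size_map size_iota sus addnS.
- move=> u; rewrite mem_cat=> /orP[/mapP[i]|uv]; last by apply: uN; rewrite mem_cat inE uv !orbT.
 rewrite mem_iota=> /= ir ->; apply: (smodB sA (spn_smod _ sA)); first exact: usN.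
 exact.
have n1: n = n.-1.+1 by rewrite prednK // muln_gt0 muln_gt0 expn_gt0.
apply: (Red_step tN (n := n.-1) rd).
 move=> u; rewrite mem_cat inE=> /orP[ui|/predU1P[->|uv]].
 - exists (tau ^+ (b ^ index u us)); rewrite -{1}(nth_index 0 ui); apply: Cus.
  by rewrite -sus index_mem.
 - by exists 1; have := Cg_t h tN.
 - exists 0; apply: C1; rewrite ?scale0r ?subr0 //.
   by apply: uN; rewrite mem_cat inE uv !orbT.
  by rewrite mem_cat uv orbT.
rewrite -n1; set c := \sum_i _ in mtau Qz.
have c0 := mi_neq0 rA mtau.
have Ac: A c by apply: sr_sum=> // i _; apply: srM.
have Ac': A c^-1 by exact: (rlr_unit rA).
exists (- (c^-1 *: (x *: z - c *: t ^+ n))), (c^-1 *: (x *: z)); split.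
- by apply: (smodN sA (Qn_smod _ _ _)); apply: (smodZ (Qn_smod _ _ _)).
- rewrite scalerA; apply: spnZ Sz=> d Ad.
 by rewrite -mulrA mulrCA; apply: mi_x.
- by rewrite scalerBr opprB subrK scalerA mulVf ?scale1r.
Qed.
End Bounded.
End Reduction.
#[local] Hint Resolve Qn_smod : smods.

(** * Integral equations *)
Lemma subring_prod (R : comPzRingType) (D : set R) I (s : seq I) (P : pred I) (F : I -> R) :
 subring D -> (forall i, P i -> D (F i)) -> D (\prod_(i <- s | P i) F i).
move=> sD; apply: big_ind=> //.
Qed.

Section Monic.
Variables (r : nat) (K : fieldType).
Notation E := {mpoly K[r]}.
Implicit Types (D : set K) (U S : seq E) (v : E).

Definition rees_subring D U : set E := spn D (mon U).
Lemma rees_subringP D U : subring D -> subring (rees_subring D U).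
move=> sD; split; first exact: rees1.
 exact.
by move=> a b; exact: rees_mul.
Qed.

Definition minteg D U v := exists p, [/\ p \is monic, pcoef (rees_subring D U) p & root p v].
Lemma prodset_coef D U S w : subring D -> spn D (prodset (mon U) S) w ->
 exists a : 'I_(size S) -> E, (forall j, rees_subring D U (a j)) /\ w = \sum_j a j * S`_j.
move=> sD; have sR := rees_subringP U sD.
elim=> [|d _ v Dd [m [e [mm eS ->]]] _ [a [Ra ->]]].
 exists (fun=> 0); split=> //.
 by rewrite big1 // => j; rewrite mul0r.
have ie: (index e S < size S)%N by rewrite index_mem.
exists (fun j=> a j + (if j == Ordinal ie then d *: m else 0)); split.
 move=> j; apply: srD=> //; case: ifP=> _ //.
under [RHS]eq_bigr do rewrite mulrDl; rewrite big_split /= addrC; congr (_ + _).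
rewrite (bigD1 (Ordinal ie)) //= eqxx big1 ?addr0; first by rewrite nth_index // scalerAl.
by move=> j /negPf->; rewrite mul0r.
Qed.

(* The determinant trick. *)
Lemma int_minteg D U v : subring D -> int D U v -> minteg D U v.
move=> sD [S [[e eS e0] HS]]; have sR := rees_subringP U sD; have sP := pcoef_sub sR.
have /choice[a aE]: forall i : 'I_(size S), exists a : 'I_(size S) -> E,
  (forall j, rees_subring D U (a j)) /\ v * S`_i = \sum_j a j * S`_j.
 by move=> i; apply: prodset_coef=> //; apply: HS; exact: mem_nth.
pose a' : 'M_(size S) := \matrix_(i, j) a i j.
exists (char_poly a'); split; first exact: char_poly_monic.
 rewrite /char_poly; apply: sr_sum=> // s _; apply: (srM sP)=> //.
 apply: subring_prod=> // i _; rewrite !mxE; apply: (srB sP); last by apply: pcoefC=> //; exact: (aE _).1.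
 by case: eqP=> _; [exact: pcoefX|exact: sr0].
pose B := v%:M - a'.
have dE: (char_poly a').[v] = \det B.
 rewrite -/(horner_eval v _) -det_map_mx; congr (\det _); apply/matrixP=> i j.
 by rewrite !mxE rmorphB rmorphMn /= /horner_eval hornerX hornerC.
rewrite rootE dE; pose c : 'cV_(size S) := \col_j S`_j.
have Bc: B *m c = 0.
 apply/colP=> i; rewrite mulmxBl mul_scalar_mx !mxE (aE i).2; apply/eqP; rewrite subr_eq0; apply/eqP.
 by apply: eq_bigr=> j; rewrite !mxE.
have : (\det B)%:M *m c = 0 by rewrite -mul_adj_mx -mulmxA Bc mulmx0.
have ie: (index e S < size S)%N by rewrite index_mem.
move=> /colP/(_ (Ordinal ie)); rewrite mul_scalar_mx !mxE nth_index // => /eqP.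
by rewrite mulf_eq0 (negPf e0) orbF.
Qed.
Lemma minteg_int D U v : subring D -> minteg D U v -> int D U v.
move=> sD [p [mp Rp rp]]; have s1: (1 < size p)%N.
 rewrite ltnNge; apply/negP=> /size1_polyC pE; move: rp mp; rewrite pE rootC=> /eqP->.
 by rewrite monicE lead_coefC eq_sym oner_eq0.
pose n := (size p).-1; have n0: (0 < n)%N by rewrite /n; lia.
have sS: smod D (spn D (prodset (mon U) [seq v ^+ i | i <- iota 0 n])) by [].
have inS i: (i < n)%N -> v ^+ i \in [seq v ^+ i | i <- iota 0 n] by move=> iN; apply/mapP; exists i; rewrite ?mem_iota.
exists [seq v ^+ i | i <- iota 0 n]; split.
 by exists 1; [rewrite -(expr0 v); exact: inS|exact: oner_neq0].
move=> e /mapP[i]; rewrite mem_iota add0n=> /= iN ->; rewrite -exprS.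
have [iN1|iN1] := ltnP i.+1 n.
 apply: spn_gen=> //.
 by exists 1, (v ^+ i.+1); rewrite mul1r; split=> //; [exact: mon1|exact: inS].
have ->: i.+1 = n by lia.
move: rp; rewrite rootE horner_coef -(ltn_predK s1) big_ord_recr /= -/n.
have ->: p`_n = 1 by move: mp; rewrite monicE=> /eqP.
rewrite mul1r addrC addr_eq0=> /eqP->; apply: (smodN sD sS); apply: smod_sum=> [//|j _].
apply: (spn_mulE sD _ (Rp j))=> m mm; apply: spn_gen=> //.
by exists m, (v ^+ j); split=> //; exact: inS.
Qed.
End Monic.

Section AlgMap.
Variables (r k : nat) (K : fieldType) (f : {rmorphism {mpoly K[r]} -> {mpoly K[k]}}).
Hypothesis fZ : forall a w, f (a *: w) = a *: f w.
Lemma rees_map D (U : seq {mpoly K[r]}) (U' : seq {mpoly K[k]}) w : subring D ->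
 (forall u, u \in U -> rees_subring D U' (f u)) -> spn D (mon U) w -> spn D (mon U') (f w).
move=> sD fU; elim=> [|d x v Dd [n mx] _ IH]; first by rewrite rmorph0.
rewrite rmorphD fZ; apply: spnD=> //; apply: smodZ=> //.
elim: mx=> [|j u w' uU _ IHw]; first by rewrite rmorph1; exact: rees1.
by rewrite rmorphM; apply: rees_mul=> //; exact: fU.
Qed.
Lemma int_map D (U : seq {mpoly K[r]}) (U' : seq {mpoly K[k]}) v : subring D ->
 (forall u, u \in U -> rees_subring D U' (f u)) -> int D U v -> int D U' (f v).
move=> sD fU /(int_minteg sD)[p [mp Rp rp]]; apply: minteg_int=> //.
exists (map_poly f p); split; first exact: monic_map.
 by move=> i; rewrite coef_map; exact: rees_map (Rp i).
by rewrite rootE horner_map (rootP rp) rmorph0.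
Qed.
End AlgMap.

(** * The reduction of a module of finite colength in a free module *)
Lemma monn_inv r (K : fieldType) (g : seq {mpoly K[r]}) n w : monn g n.+1 w ->
 exists u w', [/\ u \in g, monn g n w' & w = u * w'].
by move=> mw; inversion mw as [|n' u w']; exists u, w'. Qed.
Lemma homog1E r (K : fieldType) (v : {mpoly K[r]}) : v \is 1.-homog -> v = \sum_j v@_(U_(j)) *: 'X_j.
move=> hv; apply/mpolyP=> m; rewrite raddf_sum /=.
have [/eqP/mdeg1P[i /eqP->]|mn] := eqVneq (mdeg m) 1%N.
 rewrite (bigD1 i) //= mcoeffZ mcoeffX eqxx mulr1 big1 ?addr0 // => j ji.
 rewrite mcoeffZ mcoeffX; case: eqP=> [/(congr1 (fun m : 'X_{1..r} => m i))|]; last by rewrite mulr0.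
 by rewrite !mnm1E eqxx (negPf ji).
rewrite (dhomog_nemf_coeff hv mn) big1 // => j _; rewrite mcoeffZ mcoeffX.
by case: eqP=> [mE|]; [move: mn; rewrite -mE mdeg1|rewrite mulr0].
Qed.
Lemma kernel_line (K : fieldType) r (M : 'M[K]_(r.+1, r)) : (forall l : 'cV_r, M *m l = 0 -> l = 0) ->
 exists c : 'rV_r.+1, [/\ c != 0, c *m M = 0 & forall w : 'rV_r.+1, w *m M = 0 -> exists k, w = k *: c].
move=> inj; have rM: \rank M = r.
 rewrite -mxrank_tr; apply/eqP; apply: inj_row_free=> v.
 move=> /(congr1 trmx); rewrite trmx_mul trmxK trmx0=> /inj/(congr1 trmx).
 by rewrite trmxK trmx0.
have rk: \rank (kermx M) = 1%N by rewrite mxrank_ker rM subSnn.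
have /rowV0Pn[c ck c0]: kermx M != 0 by rewrite -mxrank_eq0 rk.
exists c; split=> //; first by apply/eqP; rewrite -sub_kermx.
move=> w /eqP; rewrite -sub_kermx=> wk.
have : (kermx M <= c)%MS.
 by rewrite -(mxrank_leqif_sup ck) rk rank_rV c0.
by move=> /(submx_trans wk) /sub_rVP[k]; exists k.
Qed.
Lemma common_denom (K : fieldType) (A : set K) (s : seq K) : subring A -> fracs A ->
 exists t, [/\ A t, t != 0 & forall a, a \in s -> A (t * a)].
move=> sA fA; elim: s=> [|a s [t [At t0 H]]]; first by exists 1; rewrite oner_neq0.
have [u [Au u0 ua]] := fA a; exists (t * u); split=> //; first exact: mulf_neq0.
move=> b; rewrite inE=> /predU1P[->|/H tb]; first by rewrite -mulrA.
by rewrite mulrAC.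
Qed.

Section Redn.
Variables (r : nat) (K : fieldType).
Notation E := {mpoly K[r.+1]}.
Variables (A : set K) (x y : K).
Hypotheses (rA : rlr2 A x y) (infA : infres A x y) (fA : fracs A).
Let sA := rlr_sub rA.
Implicit Types (g h U : seq E) (u v w : E).

(* g generates a submodule of A^(r+1) of finite colength. *)
Record cofinite g : Prop := Cofinite {
 cof_mcf : forall u, u \in g -> mcf A u;
 cof_homog : forall u, u \in g -> u \is 1.-homog;
 cof_x : exists k, forall i, spn A (monn g 1) (x ^+ k *: 'X_i);
 cof_y : exists k, forall i, spn A (monn g 1) (y ^+ k *: 'X_i) }.

(** The rows of [M] hold the coefficients of a reduction with one form more than the rank. Its
    relation [c] is freed of common factors, so that the ideal of its entries has finite colength
    and [core_exact] applies. *)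
Record redn g (M : 'M[K]_(r.+2, r.+1)) (c : 'rV[K]_r.+2) : Prop := Redn {
 redn_cM : c *m M = 0;
 redn_ker : forall w : 'rV_r.+2, w *m M = 0 -> exists k, w = k *: c;
 redn_sub : forall u, u \in forms M -> spn A (monn g 1) u;
 redn_red : Red A (forms M) g;
 redn_A : forall i, A (c 0 i);
 redn_xy : exists N, spn A ([set` [seq c 0 i | i <- enum 'I_r.+2]] : set K^o) (x ^+ N) /\
           spn A ([set` [seq c 0 i | i <- enum 'I_r.+2]] : set K^o) (y ^+ N);
 redn_exact : forall n, (1 < n)%N -> exact_at M A n }.
Lemma ex_reduction g : cofinite g ->
 exists U, [/\ size U = r.+2, forall u, u \in U -> spn A (monn g 1) u & Red A U g].
move=> [gA g1 [k gX] _]; have H n h: (size h <= n)%N -> (forall u, u \in h -> spn A (monn g 1) u) -> Red A h g ->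
 exists U, [/\ size U = r.+2, forall u, u \in U -> spn A (monn g 1) u & Red A U g].
 elim: n h=> [|n IH] h hn hN rh; have [hr|hr] := leqP (size h) r.+2.
 - exists (h ++ nseq (r.+2 - size h) 0); split; first by rewrite size_cat size_nseq subnKC.
   by move=> u; rewrite mem_cat=> /orP[/hN//|/nseqP[->]].
  have [l lE] := rh; exists l; apply: subset_trans lE _; apply: spn_mono=> // _ [u [w [uh mw ->]]].
  by exists u, w; rewrite mem_cat uh.
 - by have := leq_trans hr hn.
 - exists (h ++ nseq (r.+2 - size h) 0); split; first by rewrite size_cat size_nseq subnKC.
   by move=> u; rewrite mem_cat=> /orP[/hN//|/nseqP[->]].
  have [l lE] := rh; exists l; apply: subset_trans lE _; apply: spn_mono=> // _ [u [w [uh mw ->]]].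
  by exists u, w; rewrite mem_cat uh.
 have hE: h = take r.+2 h ++ h`_r.+2 :: drop r.+3 h by rewrite -drop_nth // cat_take_drop.
 have [|||h' [h's h'N rh']] := @drop_generator r K A x y rA infA g k gA g1 gX (take r.+2 h) (drop r.+3 h) h`_r.+2.
 - by rewrite size_takel // ltnW.
 - by rewrite -hE.
 - by rewrite -hE.
 by rewrite -hE in h's; apply: (IH h')=> //; rewrite h's -ltnS prednK // (leq_ltn_trans _ hr).
apply: (H (size g) g)=> //; last exact: Red_refl.
by move=> u ug; apply: spn_gen; [|exact: monn_gen].
Qed.
Lemma Red_int g U : (exists2 u, u \in g & u != 0) -> Red A U g -> forall u, u \in g -> int A U u.
move=> [u0 u0g u00] [k kE] u ug; exists (words g k); split.
 exists (u0 ^+ k); last by rewrite expf_neq0.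
 apply/wordsP; elim: k {kE} => [|k IH]; first constructor.
 by rewrite exprS; constructor.
move=> e /wordsP me; have : spn A (mulset U g k) (u * e).
 by apply: kE; apply: spn_gen; [|constructor].
apply: spn_mono=> // _ [u' [w [uU mw ->]]]; exists u', w; split=> //; first exact: mon_gen.
exact/wordsP.
Qed.
Lemma cofinite_neq0 g : cofinite g -> exists2 u, u \in g & u != 0.
move=> [_ _ [k gX] _]; apply: contrapT=> ng; have := gX ord0.
have : spn A (monn g 1) `<=` [set 0].
 apply: spn_min=> //.
 move=> w /monn_inv[u [w' [ug _ ->]]]; have [->|u0] := eqVneq u 0; first by rewrite mul0r.
 by case: ng; exists u.
move=> H /H /eqP; rewrite scaler_eq0 expf_eq0 (negPf (rlr_x0 rA)) andbF /=.
by move=> /eqP/(congr1 (mcoeff U_(ord0))); rewrite mcoeffX eqxx mcoeff0=> /eqP; rewrite oner_eq0.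
Qed.
Theorem reduction_exists g : cofinite g -> exists M c, redn g M c.
move=> cg; have [U [sU UN rU]] := ex_reduction cg; have [gA g1 [k gX] _] := cg.
pose M : 'M_(r.+2, r.+1) := \matrix_(i, j) U`_i@_U_(j).
have UE: forms M = U.
 apply: (@eq_from_nth _ 0)=> [|i]; first by rewrite size_map size_enum_ord.
 rewrite size_map size_enum_ord=> ir; rewrite (nth_map ord0) ?size_enum_ord //.
 rewrite [RHS]homog1E; first by apply: eq_bigr=> j; rewrite mxE nth_enum_ord.
 have UU: U`_i \in U by rewrite mem_nth // sU.
 elim: (UN _ UU)=> [|d w v _ mw _ IH]; first exact: dhomog0.
 by apply: dhomogD=> //; apply: dhomogZ; exact: monn_homog mw.
(* A common zero [l] of [U] is a zero of [g], since [u^(j + 1)] lies in [U N^j] for some [j]; then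
   all [x^k X_i] vanish at [l], so [l = 0]. Hence the rank is full and the relations form a line. *)
have inj (l: 'cV_r.+1) : M *m l = 0 -> l = 0.
 move=> Ml; pose ev v := meval (fun j=> l j 0) v.
 have evU u: u \in U -> ev u = 0.
  rewrite -UE=> /mapP[i _ ->]; rewrite /ev raddf_sum /=.
  transitivity ((M *m l) i 0); last by rewrite Ml mxE.
  by rewrite mxE; apply: eq_bigr=> j; rewrite mevalZ mevalXU.
 have evS X v: spn A X v -> (forall w, X w -> ev w = 0) -> ev v = 0 by elim=> [|d w v' _ Xw _ IH] H; [exact: meval0|rewrite /ev mevalD mevalZ -!/(ev _) IH // H // mulr0 addr0].
 have evg u: u \in g -> ev u = 0.
  move=> ug; have [j jE] := rU; have : spn A (mulset U g j) (u ^+ j.+1).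
   apply: jE; apply: spn_gen=> //.
   by elim: j.+1=> [|i]; [constructor|rewrite exprS; constructor].
  move=> /evS H; have : ev (u ^+ j.+1) = 0.
   by apply: H=> _ [u' [w [/evU e0 _ ->]]]; rewrite /ev mevalM -!/(ev _) e0 mul0r.
  by rewrite /ev rmorphXn=> /eqP; rewrite expf_eq0=> /andP[_ /eqP].
 apply/colP=> i; rewrite mxE; have /eqP: x ^+ k * l i 0 = 0.
  rewrite -(mevalXU (fun j=> l j 0)) -mevalZ; apply: (evS _ _ (gX i))=> w mw.
  by have [u [w' [ug _ ->]]] := monn_inv mw; rewrite /ev mevalM -!/(ev _) evg // mul0r.
 by rewrite mulf_eq0 expf_eq0 (negPf (rlr_x0 rA)) andbF=> /eqP.
have [c [c0 cM kM]] := kernel_line inj.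
have [t [At t0 tA]] := common_denom [seq c 0 i | i <- enum 'I_r.+2] sA fA.
have tcA a: a \in [seq (t *: c) 0 i | i <- enum 'I_r.+2] -> A a by move=> /mapP[i _ ->]; rewrite mxE; apply: tA.
have [i ci]: exists i, c 0 i != 0.
 apply/existsP; apply: contraNT c0; rewrite negb_exists=> /forallP H0.
 by apply/eqP/rowP=> i; rewrite mxE; apply/eqP; have := H0 i; rewrite negbK.
have [|q [q0 qA [N [Nx Ny]]]] := primitive_part rA tcA.
 by exists ((t *: c) 0 i); [|rewrite mxE mulf_neq0].
(* The relation with denominators cleared by [t] and the common factor [q] removed. *)
pose d := (t / q) *: c.
have dE j: d 0 j = (t *: c) 0 j / q by rewrite !mxE mulrAC.
have dl: [seq a / q | a <- [seq (t *: c) 0 i | i <- enum 'I_r.+2]] = [seq d 0 i | i <- enum 'I_r.+2] by rewrite -map_comp; apply: eq_map.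
have tq0: t / q != 0 by rewrite mulf_neq0 ?invr_eq0.
have d0: d != 0 by rewrite scaler_eq0 negb_or tq0.
have dM: d *m M = 0 by rewrite -scalemxAl cM scaler0.
have dk (w: 'rV_r.+2) : w *m M = 0 -> exists k, w = k *: d by move=> /kM[l]; exists (l / (t / q)); rewrite scalerA divfK.
have dA j: A (d 0 j) by rewrite dE; apply: qA.
rewrite dl in Nx Ny; exists M, d; split; rewrite ?UE //; first by exists N.
have [n nch]: exists n, ~ chain A (spn A ([set` [seq d 0 i | i <- enum 'I_r.+2]] : set K^o)) A n by apply: colength_bound Nx Ny=> // _ /mapP[j _ ->].
move=> j j1; have d1: [seq a / 1 | a <- [seq d 0 i | i <- enum 'I_r.+2]] = [seq d 0 i | i <- enum 'I_r.+2] by rewrite -[RHS]map_id; apply: eq_map=> a; rewrite divr1.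
apply: (core_exact dM dk d0 rA (g := 1)) j1; rewrite ?d1 ?oner_neq0 //; last exact: nch.
 by move=> l; rewrite divr1.
by exists N.
Qed.
End Redn.

(** * Products of integrally closed modules *)

Section AlgebraMap.
Variables (K : fieldType) (n k : nat) (F : 'I_n -> {mpoly K[k]}).
Definition alg : {rmorphism {mpoly K[n]} -> {mpoly K[k]}} := comp_mpoly [tuple F i | i < n].
Lemma algX i : alg 'X_i = F i.
by rewrite /= comp_mpolyXU -tnth_nth tnth_mktuple. Qed.
Lemma algZ a w : alg (a *: w) = a *: alg w.
exact: comp_mpolyZ. Qed.
Lemma alg1E v : v \is 1.-homog -> alg v = \sum_j v@_(U_(j)) *: F j.
by move=> /homog1E{1}->; rewrite rmorph_sum; apply: eq_bigr=> j; rewrite algZ algX.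
Qed.
End AlgebraMap.

Section Consequences.
Variables (r : nat) (K : fieldType).
Notation E := {mpoly K[r.+1]}.
Variables (A : set K) (x y : K).
Hypotheses (rA : rlr2 A x y) (infA : infres A x y) (fA : fracs A).
Let sA := rlr_sub rA.
Implicit Types (g h U : seq E) (u v w : E).
Lemma monn_Rb g n : (forall u, u \in g -> u \is 1.-homog) -> spn A (monn g n) `<=` Rb A g n.
move=> g1; apply: spn_min=> //.
move=> w mw; split; first exact: monn_homog mw.
by apply: int_rees=> //; apply: spn_gen; [|exists n].
Qed.
Lemma Rb_forms g M c n : cofinite A x y g -> redn A x y g M c -> Rb A g n = Rb A (forms M) n.
move=> cg [_ _ UN rU _ _ _]; have iU := Red_int rA (cofinite_neq0 rA cg) rU.
apply/seteqP; split=> v [hv iv]; split=> //; first exact: int_trans iv.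
by apply: int_sub iv=> // u /UN; apply: spn_mono=> //; exists 1%N.
Qed.
(** An element of homological degree zero is automatically a cycle, so exactness in total degree
    [n + 2] makes it a boundary, that is, a combination of [U] with coefficients of degree
    [n + 1]. *)
Lemma Rb_succ g M c n v : cofinite A x y g -> redn A x y g M c -> Rb A g n.+2 v ->
 lcomb (V := E^o) (Rb A g n.+1) (forms M) v.
move=> cg rg; rewrite !(Rb_forms _ cg rg)=> Rv.
have [||w Gw wE] := redn_exact rg (n := n.+2) isT (z := @k0 E E^o (size (forms M)) v).
- apply: inK_k0=> //.
 by move=> p; exact: smod0 (Rg_smod _ _ _ sA).
- exact: dK_k0.
have := @lcomb_proj0 E E^o (forms M) _ _ w erefl Gw.
by rewrite wE proj0K.
Qed.
Lemma Rb_mcf g n v : (forall u, u \in g -> mcf A u) -> (forall u, u \in g -> u \is 1.-homog) ->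
 Rb A g n v -> mcf A v.
move=> gA g1 [_ iv]; apply: int_free=> //.
- exact: rlr_noeth rA.
- apply: rlr2_good rA; exact: fracs_ex.
apply: int_sub iv=> // u ug; apply: spn_mono (mcf_spn sA (g1 u ug) (gA u ug))=> // w mw.
by exists 1%N.
Qed.
End Consequences.

(* N = span g satisfies m Nbar <= N and (Nbar)^2 = N^2. *)
Definition goodm (K : fieldType) (A : set K) x y n (h : seq {mpoly K[n]}) :=
 (forall a v, mi A x y a -> Rb A h 1 v -> spn A (monn h 1) (a *: v)) /\ Rb A h 2 `<=` spn A (monn h 2).

Section Product.
Variables (r : nat) (K : fieldType).
Notation E := {mpoly K[r.+1]}.
Notation E' := {mpoly K[r.+2]}.
Variables (A : set K) (x y : K).
Hypotheses (rA : rlr2 A x y) (infA : infres A x y) (fA : fracs A).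
Let sA := rlr_sub rA.
Implicit Types (u v w : E).
Variables (g : seq E) (ii : seq K).
Hypothesis cg : cofinite A x y g.
Hypothesis iA : forall a, a \in ii -> A a.
Let I : set K := spn A ([set` ii] : set K^o).
Hypotheses (ix : exists k, I (x ^+ k)) (iy : exists k, I (y ^+ k)).
Notation T := ('X_ord_max : E').
Hypothesis iclosed : forall b, int A [seq a *: T | a <- ii] (b *: T) -> I b.
Let g1 := cof_homog cg.
Let gA := cof_mcf cg.
Let iI : ideal A I := spn_is_ideal sA iA.

Definition prodI : seq E := [seq a *: u | a <- ii, u <- g].
Notation iota' := (alg (fun i : 'I_r.+1=> 'X_(lift ord_max i) : E')).
Lemma mem_prodI a u : a \in ii -> u \in g -> a *: u \in prodI.
by []. Qed.
Lemma prodI_spn1 b z : I b -> spn A (monn g 1) z -> spn A (monn prodI 1) (b *: z).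
move=> Ib; elim=> [|d w v Ad /monn_inv[u [w1 [ug mw ->]]] _ IH] //.
rewrite scalerDr; apply: spnD=> //; rewrite scalerA mulrC -scalerA; apply: smodZ=> //.
elim: Ib=> [|d' a b' Ad' ia _ IHb]; first by rewrite scale0r.
rewrite scalerDl; apply: spnD=> //; rewrite -scalerA; apply: spn_mem=> //.
rewrite scalerAl; inversion mw; constructor=> //; constructor.
Qed.
Lemma prodI_spn2 b b' z : I b -> I b' -> spn A (monn g 2) z -> spn A (monn prodI 2) ((b * b') *: z).
move=> Ib Ib'; elim=> [|d w v Ad /monn_inv[u [w1 [ug mw ->]]] _ IH] //.
rewrite scalerDr; apply: spnD=> //; rewrite scalerA mulrC -scalerA; apply: smodZ=> //.
have ->: (b * b') *: (u * w1) = (b *: u) * (b' *: w1) by rewrite -!mul_mpolyC; ring.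
have S w': monn g 1 w' -> spn A (monn g 1) w' by [].
apply: (@monn_spn_cat r K A x y rA prodI 1); apply: prodI_spn1=> //; apply: S; exact: monn_gen.
Qed.
Lemma prodI_cofinite : cofinite A x y prodI.
have mcfZ a u: A a -> mcf A u -> mcf A (a *: u) by move=> Aa mu m; rewrite mcoeffZ; exact: srM.
split.
- by move=> _ /allpairsP[[a u] [ia ug ->]]; apply: mcfZ; [exact: iA|exact: gA].
- by move=> _ /allpairsP[[a u] [ia ug ->]]; apply: dhomogZ; exact: g1.
- have [k gX] := cof_x cg; have [l Il] := ix.
 by exists (l + k)%N=> i; rewrite exprD -scalerA; exact: prodI_spn1.
- have [k gX] := cof_y cg; have [l Il] := iy.
 by exists (l + k)%N=> i; rewrite exprD -scalerA; exact: prodI_spn1.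
Qed.
Let gT : seq E' := [seq iota' u | u <- g] ++ [seq a *: T | a <- ii].
Let gT_g u : u \in g -> iota' u \in gT.
by move=> ug; rewrite mem_cat map_f. Qed.
Let gT_T a : a \in ii -> a *: T \in gT.
by move=> ia; rewrite mem_cat; apply/orP; right. Qed.
Let iota_homog u : u \is 1.-homog -> iota' u \is 1.-homog.
move=> hu; rewrite alg1E //; apply: rpred_sum=> j _; apply: rpredZ.
by rewrite dhomogX /= mdeg1.
Qed.
Let iota_spn n v : spn A (monn g n) v -> spn A (monn gT n) (iota' v).
elim=> [|d w v' Ad mw _ IH]; first by rewrite rmorph0.
rewrite rmorphD algZ; apply: spn_cons=> //.
elim: mw=> [|k u w' ug _ IHw]; first by rewrite rmorph1; constructor.
by rewrite rmorphM; constructor=> //; rewrite mem_cat map_f.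
Qed.
Let I_spnT b : I b -> spn A (monn gT 1) (b *: T).
elim=> [|d a b' Ad ia _ IH]; first by rewrite scale0r.
rewrite scalerDl; apply: spnD=> //; rewrite -scalerA; apply: spn_mem=> //.
by apply: monn_gen; exact: gT_T.
Qed.
Let gT_cofinite : cofinite A x y gT.
have T1: T \is 1.-homog by rewrite dhomogX /= mdeg1.
have mX i: mcf A ('X_i : E') by exact: mcfX.
have X k l z: (forall i, spn A (monn g 1) (z ^+ k *: 'X_i)) -> I (z ^+ l) -> A z ->
  exists k, forall i, spn A (monn gT 1) (z ^+ k *: 'X_i).
 move=> gX Il Az; exists (k + l)%N=> i; have sS := spn_smod (monn gT 1) sA.
 case: (unliftP ord_max i)=> [j ->|->].
  rewrite addnC exprD -scalerA; apply: smodZ=> //.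
  by rewrite -(algX (fun i=> 'X_(lift ord_max i))) -algZ; exact: iota_spn.
 by rewrite exprD -scalerA; apply: (smodZ sS); [|exact: I_spnT].
split.
- move=> v; rewrite mem_cat=> /orP[/mapP[u ug ->]|/mapP[a ia ->]].
  rewrite alg1E; last exact: g1.
  apply: smod_sum=> [|j _]; first exact: mcf_smod (self_ideal sA).
  by apply: (smodZ (N := mcf A))=> //; [exact: mcf_smod (self_ideal sA)|exact: gA].
 by apply: (smodZ (N := mcf A) (D := A))=> //; [exact: mcf_smod (self_ideal sA)|exact: iA].
- move=> v; rewrite mem_cat=> /orP[/mapP[u ug ->]|/mapP[a ia ->]].
  by apply: iota_homog; exact: g1.
 exact: dhomogZ.
- have [k gX] := cof_x cg; have [l Il] := ix; exact: X Il (rlr_x rA).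
- have [k gX] := cof_y cg; have [l Il] := iy; exact: X Il (rlr_y rA).
Qed.
(** Two specializations separate the summands: [T = 0] leaves the part integral over [g], and
    setting the old variables to zero leaves [b T], integral over [A[I T]], whose coefficient
    [iclosed] puts into [I]. *)
Let split1 (w : E') : Rb A gT 1 w -> exists w0 b, [/\ Rb A g 1 w0, I b & w = iota' w0 + b *: T].
move=> [hw iw]; pose w0 : E := \sum_j w@_(U_(lift ord_max j)) *: 'X_j; pose b := w@_U_(ord_max).
have hw0: w0 \is 1.-homog by apply: rpred_sum=> j _; apply: rpredZ; rewrite dhomogX /= mdeg1.
have wE: w = iota' w0 + b *: T.
 rewrite(homog1E hw) (bigD1_ord ord_max) //= addrC; congr (_ + _).
 by rewrite rmorph_sum; apply: eq_bigr=> j; rewrite algZ algX.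
exists w0, b; split=> //.
- split=> //; pose F i : E := if unlift ord_max i is Some j then 'X_j else 0.
 have Fi u: alg F (iota' u) = u.
  have := @morph_ext r.+1 K (alg F \o iota') idfun; apply=> // [a v|i] /=.
   by rewrite !algZ.
  by rewrite !algX /F liftK.
 have FT: alg F T = 0 by rewrite algX /F unlift_none.
 have := @int_map _ _ _ (alg F) (algZ F) A gT g w sA _ iw.
 rewrite wE rmorphD Fi algZ FT scaler0 addr0; apply=> u; rewrite mem_cat=> /orP[/mapP[u' ug ->]|/mapP[a ia ->]].
  by rewrite Fi; apply: spn_gen; [|exact: mon_gen].
 by rewrite algZ FT scaler0.
- apply: iclosed; pose F (i : 'I_r.+2) : E' := if unlift ord_max i is Some j then 0 else T.
 have Fi u: u \is 1.-homog -> alg F (iota' u) = 0.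
  move=> hu; rewrite (alg1E _ hu) rmorph_sum big1 // => j _.
  by rewrite algZ algX /F liftK scaler0.
 have FT: alg F T = T by rewrite algX /F unlift_none.
 have := @int_map _ _ _ (alg F) (algZ F) A gT [seq a *: T | a <- ii] w sA _ iw.
 rewrite wE rmorphD Fi // algZ FT add0r; apply=> u; rewrite mem_cat=> /orP[/mapP[u' ug ->]|/mapP[a ia ->]].
  by rewrite Fi; [|exact: g1].
 by rewrite algZ FT; apply: spn_gen; [|apply: mon_gen].
Qed.
(** For [v] integral over [I N], the element [T v] is integral of degree two over [N + I T], so by
    [Rb_succ] it is a sum of products of two elements of the closure in degree one, written by
    [split1] as [u0 + d T] and [z0 + b T]. The coefficient of [T] in a product is [d z0 + b u0], a
    member of [I] times the closure of [N]. *)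
Theorem product_closed : Rb A prodI 1 = spn I (Rb A g 1).
apply/seteqP; split=> v.
 move=> [hv iv]; have [M [c rg]] := reduction_exists rA infA fA gT_cofinite.
 have R2: Rb A gT 2 (T * iota' v).
  split; first by apply: (dhomogM (d := 1)); [rewrite dhomogX /= mdeg1|exact: iota_homog].
  pose F (i : 'I_r.+1) : E' := T * 'X_(lift ord_max i).
  have FE u: u \is 1.-homog -> alg F u = T * iota' u.
   move=> hu; rewrite !alg1E // mulr_sumr; apply: eq_bigr=> j _; by rewrite scalerAr.
  rewrite -FE //; apply: (@int_map _ _ _ (alg F) (algZ F)) iv=> // _ /allpairsP[[a u] /= [ia ug ->]].
  rewrite algZ FE; last exact: g1.
  rewrite scalerAl; apply: rees_mul=> //; apply: spn_gen=> //.
   by apply: mon_gen; exact: gT_T.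
  by apply: mon_gen; exact: gT_g.
 pose P (w : E') := exists s p q, spn I (Rb A g 1) s /\ w = iota' p + T * iota' s + T * T * iota' q.
 have PD (w w': E') : P w -> P w' -> P (w + w').
  move=> [s [p [q [Ss ->]]]] [s' [p' [q' [Ss' ->]]]]; exists (s + s'), (p + p'), (q + q').
  by split; [exact: spnD|rewrite !rmorphD; ring].
 have [s [p [q [Ss vE]]]]: P (T * iota' v).
  have UR (u: E') : u \in forms M -> Rb A gT 1 u by move=> /(redn_sub rg); exact: (monn_Rb rA (cof_homog gT_cofinite)).
  have := Rb_succ rA gT_cofinite rg R2; elim: forms UR (T * iota' v)=> [|u l IH] UR w /=.
   by move=> ->; exists 0, 0, 0; rewrite rmorph0 !mulr0 !addr0.
  move=> [z [w' [Rz /IH Pw ->]]]; apply: PD; first by apply: Pw=> u' u'l; apply: UR; rewrite inE u'l orbT.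
  have [z0 [b [Rz0 Ib ->]]] := split1 Rz; have [u0 [d [Ru0 Id ->]]] := split1 (UR u (mem_head _ _)).
  exists (d *: z0 + b *: u0), (u0 * z0), (d * b)%:MP; split.
   by apply: spnD; apply: spn_mem.
  have ->: (d * b)%:MP = (d * b) *: 1 :> E by rewrite -mul_mpolyC mulr1.
  rewrite -[_ *: _]/(_ * _) rmorphD !algZ -!mul_mpolyC; ring.
 (* The powers of [T] are separated by specialization: [t = 0] kills [p], and [t = 1] with [t = x]
    kills [q], because [x (1 - x)] is not zero. *)
 have ev t: t *: v = p + t *: s + (t * t) *: q.
  pose F i : E := if unlift ord_max i is Some j then 'X_j else t%:MP.
  have Fi u: alg F (iota' u) = u.
   have := @morph_ext r.+1 K (alg F \o iota') idfun; apply=> // [a w|i] /=; first by rewrite !algZ.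
   by rewrite !algX /F liftK.
  have := congr1 (alg F) vE; rewrite !rmorphD !rmorphM !Fi algX /F unlift_none.
  by rewrite -mpolyCM !mul_mpolyC.
 have p0: p = 0 by have := ev 0; rewrite !mul0r !scale0r !addr0.
 have E1: v = s + q by have := ev 1; rewrite p0 add0r mulr1 !scale1r.
 have /eqP: (x * (1 - x)) *: q = 0.
  have := ev x; rewrite p0 add0r E1 scalerDr=> /addrI xq.
  by rewrite mulrBr mulr1 scalerBl xq subrr.
 rewrite scaler_eq0 mulf_eq0 (negPf (rlr_x0 rA)) subr_eq0=> /orP[/eqP x1|/eqP q0].
  by case: (rlr_proper rA); rewrite x1; exact: mi_gx.
 by rewrite E1 q0.
elim=> [|b w v' Ib [hw iw] _ IH] //.
apply: smodD=> //; split; first exact: dhomogZ.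
pose F i : E := b *: 'X_i.
have FE u: u \is 1.-homog -> alg F u = b *: u.
 move=> hu; rewrite alg1E // [in RHS](homog1E hu) scaler_sumr; apply: eq_bigr=> j _.
 by rewrite !scalerA mulrC.
rewrite -FE //; apply: (@int_map _ _ _ (alg F) (algZ F)) iw=> // u ug.
rewrite FE; last exact: g1.
have : spn A (monn prodI 1) (b *: u).
 by apply: prodI_spn1=> //; apply: spn_gen; [|exact: monn_gen].
by apply: spn_mono=> //; exists 1%N.
Qed.
(** Let [L] be the closure of [N]. Multiplication by [m] passes through the factor [I] in [I L]. In
    degree two the closure is [U] times the degree one part, so it lies in [I^2 L^2], where [L^2] is
    inside [N^2] by hypothesis. *)
Theorem good_product : goodm A x y g -> goodm A x y prodI.
move=> [gm g2]; split.
 move=> a v ma; rewrite product_closed; elim=> [|b w v' Ib Rw _ IH]; first by rewrite scaler0.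
 rewrite scalerDr; apply: spnD=> //; rewrite scalerA mulrC -scalerA; apply: prodI_spn1=> //; exact: gm.
have [M [c rg]] := reduction_exists rA infA fA prodI_cofinite; move=> v Rv.
have UR u: u \in forms M -> Rb A prodI 1 u by move=> /(redn_sub rg); exact: (monn_Rb rA (cof_homog prodI_cofinite)).
have := Rb_succ rA prodI_cofinite rg Rv; elim: forms UR v {Rv} => [|u l IH] UR v /=; first by move=> ->.
move=> [z [w [Rz /IH Sw ->]]]; apply: spnD; first by apply: Sw=> u' u'l; apply: UR; rewrite inE u'l orbT.
have := UR u (mem_head _ _); rewrite product_closed in Rz *.
rewrite -[_ *: _]/(u * z); elim=> [|b p u' Ib Rp _ IHu]; first by rewrite mul0r.
rewrite mulrDl; apply: spnD=> //; elim: Rz=> [|d q z' Id Rq _ IHz]; first by rewrite mulr0.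
rewrite mulrDr; apply: spnD=> //.
have ->: b *: p * (d *: q) = (b * d) *: (p * q) by rewrite -!mul_mpolyC; ring.
apply: prodI_spn2=> //; apply: g2; exact: (Rb_mul sA Rp).
Qed.
End Product.

(** * Hilbert functions *)

Section Asymptotics.
Import Num.Theory Order.TTheory.
Lemma coef_ge0 d (q : {poly rat}) n0 : (size q <= d.+1)%N -> (forall n, (n0 <= n)%N -> 0 <= q.[n%:R]) -> 0 <= q`_d.
move=> sq H; rewrite leNgt; apply/negP=> qd; pose S := \sum_(i < d) `|q`_i|.
have S0: 0 <= S by apply: sumr_ge0.
pose n := (n0 + (Num.bound (S / - q`_d)).+1)%N.
have n1: 1 <= n%:R :> rat by rewrite ler1n /n addnS.
have nS: S < - q`_d * n%:R.
 rewrite mulrC -ltr_pdivrMr ?oppr_gt0 //.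
 apply: le_lt_trans (ler_norm _) _; apply: lt_trans (archi_boundP (normr_ge0 _)) _.
 rewrite ger0_norm; last by rewrite divr_ge0 // oppr_ge0 ltW.
 by rewrite ltr_nat /n addnS ltnS leq_addl.
have := H n (leq_addr _ _); rewrite (horner_coef_wide _ sq) big_ord_recr /= leNgt=> /negP; apply.
case: d=> [|d] in sq qd S S0 n n1 nS *.
 by rewrite big_ord0 add0r mulr1.
rewrite exprS mulrA -[X in _ < X](subrr (S * n%:R ^+ d)).
apply: ler_ltD.
 rewrite mulr_suml; apply: ler_sum=> i _; apply: le_trans (ler_norm _) _.
 rewrite normrM normrX normr_nat ler_wpM2l //.
 by apply: ler_weXn2l=> //; rewrite -ltnS.
by rewrite ltrNr -mulNr ltr_pM2r ?exprn_gt0 ?(lt_le_trans ltr01) // -mulNr.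
Qed.

(* The polynomial whose value at n is the binomial coefficient (n + d choose d). *)
Definition binp d : {poly rat} := (d`!)%:R^-1 *: \prod_(i < d) ('X + (i.+1)%:R%:P).
Lemma binp_nat d n : (binp d).[n%:R] = 'C(n + d, d)%:R.
rewrite hornerZ horner_prod.
have ->: \prod_(i < d) ('X + i.+1%:R%:P).[n%:R] = ((n + d) ^_ d)%:R :> rat.
 elim: d=> [|d IH]; first by rewrite big_ord0.
 rewrite big_ord_recr /= IH hornerD hornerX hornerC -natrD -natrM !addnS mulnC //.
by rewrite -bin_ffact natrM [LHS]mulrC mulfK // pnatr_eq0 -lt0n fact_gt0.
Qed.
Lemma binp_size d : (size (binp d) <= d.+1)%N /\ (binp d)`_d = (d`!)%:R^-1.
have mon: \prod_(i < d) ('X + i.+1%:R%:P : {poly rat}) \is monic by apply: monic_prod=> i _; exact: monicXaddC.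
have sz: size (\prod_(i < d) ('X + i.+1%:R%:P : {poly rat})) = d.+1.
 elim: d {mon} => [|d IH]; first by rewrite big_ord0 size_poly1.
 rewrite big_ord_recr /= size_Mmonic ?monicXaddC ?size_XaddC ?IH ?addn2 //.
 by rewrite -size_poly_gt0 IH.
split; first by rewrite -sz; exact: size_scale_leq.
by rewrite coefZ -[X in _`_X]/d.+1.-1 -sz -lead_coefE (monicP mon) mulr1.
Qed.
Lemma comp_shift_coef d k (q : {poly rat}) : (size q <= d.+1)%N ->
 (size (q \Po ('X + k%:P)) <= d.+1)%N /\ (q \Po ('X + k%:P))`_d = q`_d.
move=> sq; have kE: 'X + k%:P = 'X - (- k)%:P by rewrite polyCN opprK.
have s2: size (q \Po ('X + k%:P)) = size q by rewrite kE; apply: size_comp_poly2; rewrite size_XsubC.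
split; first by rewrite s2.
have [sd|sd] := eqVneq (size q) d.+1; last first.
 have lt: (size q <= d)%N by rewrite -ltnS ltn_neqAle sd.
 by rewrite !nth_default // s2.
have ->: d = (size q).-1 by rewrite sd.
rewrite -/(lead_coef q) -s2 -/(lead_coef _) lead_coef_comp ?kE ?size_XsubC //.
by rewrite lead_coefXsubC expr1n mulr1.
Qed.
(** Both bounds are polynomials with the same coefficient of degree [d], since a shift of the
    argument does not change it; [0 < d] keeps the constant [w] out of that coefficient. *)
Lemma sandwich d k (lam : nat) (w : rat) (p : {poly rat}) n0 : (size p <= d.+1)%N ->
 (forall n, (n0 <= n)%N -> (lam * 'C(n + d, d))%:R <= p.[n%:R] + w /\ p.[n%:R] + w <= (lam * 'C(n + k + d, d))%:R) ->
 (0 < d)%N -> p`_d = lam%:R / (d`!)%:R.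
move=> sp H d0; have [sb bd] := binp_size d; have [sc cd] := comp_shift_coef k%:R sb.
have dw: w%:P`_d = 0 by rewrite coefC; case: d d0 {sp H sb bd sc cd}.
have sw: (size w%:P%R <= d.+1)%N by apply: leq_trans (size_polyC_leq1 _) _.
have sl (q: {poly rat}) : (size q <= d.+1)%N -> (size (lam%:R *: q : {poly rat}) <= d.+1)%N by apply: leq_trans; exact: size_scale_leq.
have sD (q q': {poly rat}) : (size q <= d.+1)%N -> (size q' <= d.+1)%N -> (size (q - q')%R <= d.+1)%N by move=> s1 s2; apply: leq_trans (size_polyD _ _) _; rewrite size_polyN geq_max s1.
have sD' (q q': {poly rat}) : (size q <= d.+1)%N -> (size q' <= d.+1)%N -> (size (q + q')%R <= d.+1)%N by move=> s1 s2; apply: leq_trans (size_polyD _ _) _; rewrite geq_max s1.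
apply/eqP; rewrite eq_le -subr_ge0 -[X in _ && X]subr_ge0; apply/andP; split.
 have := @coef_ge0 d (lam%:R *: (binp d \Po ('X + k%:R%:P)) - (p + w%:P)) n0.
 rewrite coefB coefD coefZ cd bd dw addr0; apply; first by apply: sD; [exact: sl|exact: sD'].
 move=> n /H[_ h]; rewrite hornerD hornerN hornerZ horner_comp !hornerD hornerX !hornerC -natrD binp_nat -natrM.
 by rewrite subr_ge0.
have := @coef_ge0 d (p + w%:P - lam%:R *: binp d) n0.
rewrite coefB coefD coefZ bd dw addr0; apply; first by apply: sD; [exact: sD'|exact: sl].
move=> n /H[h _]; rewrite hornerD hornerN hornerZ !hornerD !hornerC binp_nat -natrM.
by rewrite subr_ge0.
Qed.
End Asymptotics.

(** * Parameter ideals of a local ring and a finite overring *)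

Section Powers.
Variables (R : comPzRingType) (V : lmodType R).
Implicit Types (s t k : seq R) (B C N : set V) (n : nat).
Notation S := [set: R].
Notation sub := (smod [set: R]).

Inductive mq s : nat -> set R :=
| mq_one : mq s 0 1
| mq_mul n a w : a \in s -> mq s n w -> mq s n.+1 (a * w).
(* Q^n C for the ideal Q generated by s. *)
Definition qp C s n : set V := spn S [set v | exists w c, [/\ mq s n w, C c & v = w *: c]].
Lemma mq_mono s t n : {subset s <= t} -> mq s n `<=` mq t n.
by move=> st w; elim=> [|k a w' /st]; constructor. Qed.
Lemma mq_cat s n (k : nat) v w : mq s n v -> mq s k w -> mq s (n + k) (v * w).
move=> mv mw; elim: mv=> [|i a v' as_ _ IH]; first by rewrite mul1r.
by rewrite -mulrA; constructor.
Qed.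
Lemma mq_split s n (k : nat) w : mq s (n + k) w -> exists u v, [/\ mq s n u, mq s k v & w = u * v].
elim: n w=> [|n IH] w; first by exists 1, w; rewrite mul1r; split=> //; constructor.
rewrite addSn=> mw; inversion mw as [|i a w' as_ mw' E1 E2].
by have [u [v [mu mv ->]]] := IH _ mw'; exists (a * u), v; split=> //; [constructor|rewrite mulrA].
Qed.
Lemma qp_sub C s n : sub (qp C s n). exact. Qed.
Lemma qp_mem C s n w c : mq s n w -> C c -> qp C s n (w *: c).
by move=> mw Cc; apply: spn_gen=> //; exists w, c. Qed.
Lemma qp_min C s n N : sub N -> (forall w c, mq s n w -> C c -> N (w *: c)) -> qp C s n `<=` N.
by move=> sN H; apply: spn_min=> // _ [w [c [mw Cc ->]]]; exact: H. Qed.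
Lemma qp_mono C C' s t n : C `<=` C' -> {subset s <= t} -> qp C s n `<=` qp C' t n.
move=> CC st; apply: qp_min=> [|w c mw Cc] //.
by apply: qp_mem; [exact: mq_mono mw|exact: CC].
Qed.
Lemma qp0 C s : sub C -> qp C s 0 = C.
move=> sC; apply/seteqP; split=> [|c Cc].
 by apply: qp_min=> // w c mw; inversion mw.
by rewrite -[c]scale1r; apply: qp_mem=> //; constructor.
Qed.
Lemma qp_le C s n : sub C -> qp C s n `<=` C.
by move=> sC; apply: qp_min=> // w c _; exact: smodZ. Qed.
Lemma qp_desc C s n : sub C -> qp C s n.+1 `<=` qp C s n.
move=> sC; apply: qp_min=> [|w c mw Cc] //.
inversion mw as [|i a w' as_ mw' E1 E2]; rewrite mulrC -scalerA; apply: qp_mem=> //.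
exact: smodZ.
Qed.
Lemma qp_nil C n : qp C [::] n.+1 = [set 0].
apply/seteqP; split=> [|v ->] //.
by apply: qp_min=> [|w c mw]; [|inversion mw].
Qed.
Lemma qp_mulr C s n a v : a \in s -> qp C s n v -> qp C s n.+1 (a *: v).
move=> as_; elim=> [|d _ w _ [u [c [mu Cc ->]]] _ IH]; first by rewrite scaler0.
rewrite scalerDr; apply: smodD=> //; rewrite scalerA mulrC -scalerA.
by apply: smodZ=> //; rewrite scalerA; apply: qp_mem=> //; constructor.
Qed.
Lemma qp_comp C s n (k : nat) : qp (qp C s k) s n = qp C s (n + k).
apply/seteqP; split; apply: qp_min=> //.
 move=> w c mw; elim=> [|d _ v _ [u [c' [mu Cc ->]]] _ IH]; first by rewrite scaler0.
 rewrite scalerDr; apply: smodD=> //; rewrite scalerA mulrC -scalerA.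
 by apply: smodZ=> //; rewrite scalerA; apply: qp_mem=> //; exact: mq_cat.
move=> w c /mq_split[u [v [mu mv ->]]] Cc; rewrite -scalerA.
by apply: qp_mem=> //; exact: qp_mem.
Qed.

Definition mulby a N : set V := [set v | exists2 u, N u & v = a *: u].
Lemma mulby_sub a N : sub N -> sub (mulby a N).
move=> sN; split=> [|_ _ [u Nu ->] [w Nw ->]|b _ _ [u Nu ->]].
- by exists 0; [|rewrite scaler0].
- by exists (u + w); [|rewrite scalerDr].
- by exists (b *: u); [exact: smodZ|rewrite !scalerA mulrC].
Qed.
Lemma qp_cons C a t n : sub C -> qp C (a :: t) n.+1 = sadd (mulby a (qp C (a :: t) n)) (qp C t n.+1).
move=> sC; have s1 := mulby_sub a (qp_sub C (a :: t) n); have s2 := qp_sub C t n.+1.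
apply/seteqP; split; last first.
 apply: (sadd_min (qp_sub _ _ _)); last by apply: qp_mono=> // b bt; rewrite inE bt orbT.
 by move=> _ [u qu ->]; apply: qp_mulr.
apply: qp_min=> [|w c mw Cc] //.
have : (exists2 w', mq (a :: t) n w' & w = a * w') \/ mq t n.+1 w.
 elim: n w mw {s1 s2} => [|n IH] w mw; inversion mw as [|i b w' bs mw' E1 E2]; move: bs; rewrite inE=> /predU1P[->|bt].
 - by left; exists w'.
 - by right; constructor=> //; inversion mw'; constructor.
 - by left; exists w'.
 - have [[w2 mw2 ->]|] := IH _ mw'; last by right; constructor.
  by left; exists (b * w2); [constructor=> //; rewrite inE bt orbT|rewrite mulrCA].
move=> [[w' mw' ->]|mt].
 by apply: (saddl s2); exists (w' *: c); [exact: qp_mem|rewrite scalerA].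
by apply: (saddr s1); exact: qp_mem.
Qed.
Lemma qp1_lcomb B t : sub B -> qp B t 1 = lcomb B t.
move=> sB; elim: t=> [|a t IH]; first by rewrite qp_nil.
rewrite qp_cons // qp0 // IH; apply/seteqP; split=> v.
 by move=> [_ [c [[b Bb ->]]]]; exists b, c; rewrite addrC.
by move=> [b [c [Bb]]]; exists (a *: b), c; rewrite addrC; split=> //; exists b.
Qed.
End Powers.
Arguments qp_sub {R V} C s n.

Section PowersMap.
Variables (R : comPzRingType) (V V' : lmodType R) (f : {linear V -> V'}).
Lemma qp_map (C : set V) s n : qp (f @` C) s n = f @` (qp C s n).
apply/seteqP; split.
 apply: qp_min=> [|w _ mw [c Cc <-]].
  split=> [|_ _ [u qu <-] [v qv <-]|a _ _ [u qu <-]].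
  - by exists 0; [|rewrite linear0].
  - by exists (u + v); [|rewrite linearD].
  - by exists (a *: u); [exact: smodZ|rewrite linearZ].
 by exists (w *: c); [exact: qp_mem|rewrite linearZ].
move=> _ [v qv <-]; elim: qv=> [|d _ w _ [u [c [mu Cc ->]]] _ IH]; first by rewrite linear0.
rewrite linearP; apply: smodD=> //; apply: smodZ=> //.
by rewrite linearZ; apply: qp_mem=> //; exists c.
Qed.
End PowersMap.

Section Scaling.
Variables (R : comPzRingType) (V : lmodType R) (a : R).
Definition scl (v : V) : V := a *: v.
Lemma scl_linear : linear scl.
by move=> b u v; rewrite /scl scalerDr !scalerA mulrC. Qed.
HB.instance Definition _ := GRing.isLinear.Build R V V *:%R scl scl_linear.
End Scaling.

(** * Lengths modulo powers of a regular sequence *)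

Section Regular.
Variables (R : comPzRingType) (V : lmodType R) (B : set V) (s : seq R).
Implicit Types (t k : seq R).
Notation S := [set: R].
Notation sub := (smod [set: R]).
Hypothesis sB : sub B.
(* Every subsequence of s is B-regular. *)
Hypothesis PR : forall a t t', perm_eq (a :: t ++ t') s -> forall c, B c -> lcomb B t (a *: c) -> lcomb B t c.
Let sT := @srT R.
Let smin := fun C N D=> @sadd_min R V S C N D.

Definition Xq k t n := sadd (qp B k 1) (qp B t n).
Lemma Xq_sub k t n : sub (Xq k t n). exact: sadd_smod. Qed.
Lemma Xq_le k t n : Xq k t n `<=` B.
by apply: (smin sB); exact: qp_le. Qed.
Lemma Xq_shift k b t n : Xq k (b :: t) n `<=` Xq (b :: k) t n.
have sX := Xq_sub (b :: k) t n.
apply: smin=> //.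
 by move=> v qv; apply: saddl; [|apply: qp_mono qv=> // z zk; rewrite inE zk orbT].
case: n sX=> [|n] sX; first by rewrite qp0 // => v Bv; apply: saddr; [|rewrite qp0].
rewrite qp_cons //; apply: smin=> // v; last by move=> qv; apply: saddr.
move=> [u qu ->]; apply: saddl=> //.
by apply: qp_mulr; [|rewrite qp0 //; exact: qp_le qu].
Qed.
Lemma Xq_desc k b t n : Xq k t n.+1 `<=` Xq k (b :: t) n.
apply: smin; first exact: Xq_sub.
 exact: saddl.
move=> v /(qp_desc sB) qv; apply: saddr=> //.
by apply: qp_mono qv=> // z zt; rewrite inE zt orbT.
Qed.
Lemma Xq_mulr k b t n v : Xq k (b :: t) n v -> Xq k (b :: t) n.+1 (b *: v).
move=> [u [w [qu qw ->]]]; exists (b *: u), (b *: w); rewrite scalerDr; split=> //.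
 exact: smodZ.
exact: qp_mulr.
Qed.
Lemma Xq_consE k b t n v : Xq k (b :: t) n.+1 v -> exists u z, [/\ qp B (b :: t) n u, Xq k t n.+1 z & v = b *: u + z].
move=> [p [q [qp_ ]]]; rewrite qp_cons // => -[_ [w [[u qu ->] qw ->]]] ->.
exists u, (p + w); split=> //; last by rewrite addrCA.
by exists p, w.
Qed.
(** Induction on [t], and on [n] inside. Counting [b] among [k], the shorter list gives
    [v = b v1 + z] with [z] in [Xq k t n.+1]; cancelling [b] by the case of the shorter list puts
    [a v1] into the module of exponent [n], hence [v1] by the inner induction, and the factor [b]
    gains one power. *)
Lemma Xq_reg t a k n t' v : perm_eq (a :: k ++ t ++ t') s -> B v -> Xq k t n (a *: v) -> Xq k t n v.
elim: t a k n v t'=> [|b t IHt] a k n v t' ps Bv.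
 case: n=> [_|n]; first by apply: saddr; [|rewrite qp0].
 rewrite /Xq qp_nil=> -[u [_ [qu -> uE]]]; exists v, 0; rewrite addr0; split=> //.
 rewrite qp1_lcomb // in qu *; apply: PR ps _ _ _=> //.
 by rewrite uE addr0.
elim: n v Bv=> [|n IHn] v Bv Xv; first by apply: saddr; [|rewrite qp0].
have [p0 [q [p1 q1 vE]]]: Xq (b :: k) t n.+1 v.
 apply: (IHt a (b :: k) n.+1 v t') (Xq_shift Xv)=> //.
 by apply: perm_trans ps; apply/permP=> P; rewrite /= !count_cat /= !count_cat; lia.
move: p1 vE; rewrite qp_cons // => -[_ [p2 [[v1 Bv1 ->] p2k ->]]] vE; rewrite qp0 // in Bv1.
have Zz: Xq k t n.+1 (p2 + q) by exists p2, q.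
have [u [z' [qu Xz' E1]]] := Xq_consE Xv.
have Bu: B u := qp_le sB qu.
have X1: Xq k t n.+1 (a *: v1 - u).
 apply: (IHt b k n.+1 _ (a :: t')).
 - by apply: perm_trans ps; apply/permP=> P; rewrite /= !count_cat /= !count_cat; lia.
 - by apply: smodB=> //; exact: smodZ.
 rewrite scalerBr; have ->: b *: (a *: v1) - b *: u = z' - a *: (p2 + q).
  have ->: b *: (a *: v1) = a *: v - a *: (p2 + q) by rewrite vE -addrA scalerDr addrK !scalerA mulrC.
  by rewrite E1 addrAC [_ z']addrC addrK.
 by apply: (smodB sT (Xq_sub _ _ _))=> //; exact: (smodZ (Xq_sub _ _ _)).
have Xv1: Xq k (b :: t) n v1.
 apply: IHn=> //; rewrite -(subrK u (a *: v1)); apply: (smodD (Xq_sub _ _ _)); first exact: Xq_desc.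
 exact: saddr.
rewrite vE -addrA; apply: (smodD (Xq_sub _ _ _)); first exact: Xq_mulr.
have [z1 [z2 [q3 q4 ->]]] := Zz; exists z1, z2; split=> //.
by apply: qp_mono q4=> // c ct; rewrite inE ct orbT.
Qed.
Lemma Xq_swap b t k n : Xq (b :: k) t n = sadd (mulby b B) (Xq k t n).
rewrite /Xq qp_cons // qp0 //; apply/seteqP; split=> v.
 by move=> [_ [w [[u [p [Bu qp_ ->]]]]]]; exists u, (p + w); rewrite addrA; split=> //; exists p, w.
by move=> [u [_ [Bu [p [w [qp_ qw ->]]] ->]]]; exists (u + p), w; rewrite addrA; split=> //; exists u, p.
Qed.
(** As for a polynomial ring: multiplication by the head [b] embeds the quotient of one exponent
    into that of the next, with cokernel belonging to the sequence where [b] is moved to [k]; the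
    lengths add up by Pascal's rule. *)
Lemma length_powers lam : flen S (qp B s 1) B lam ->
 forall t k n, perm_eq (k ++ t) s -> flen S (Xq k t n.+1) B ('C(n + size t, size t) * lam).
move=> hl; elim=> [|b t IHt] k n ps.
 rewrite bin0 mul1n /Xq qp_nil; rewrite cats0 in ps.
 have ->: sadd (qp B k 1) [set 0] = qp B s 1=> //.
 apply/seteqP; split=> [_ [u [_ [qu -> ->]]]|v qv].
  by rewrite addr0; apply: qp_mono qu=> // z; rewrite (perm_mem ps).
 exists v, 0; rewrite addr0; split=> //; apply: qp_mono qv=> // z; by rewrite (perm_mem ps).
have step m N: flen S (Xq k (b :: t) m) B N ->
  flen S (Xq k (b :: t) m.+1) B (N + 'C(m + size t, size t) * lam).
 move=> hN; have ps': perm_eq ((b :: k) ++ t) s by apply: perm_trans ps; apply/permP=> P; rewrite !count_cat /=; lia.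
 apply: (@flen_add _ _ _ _ (Xq (b :: k) t m.+1))=> //; try exact: Xq_sub; last exact: IHt.
 rewrite Xq_swap; have sX := Xq_sub k (b :: t) m.+1; have bX := mulby_sub b sB.
 rewrite -(@flen_map _ _ _ (scl b) S (Xq k (b :: t) m) B) //; try by apply: sadd_smod=> //; exact: Xq_sub.
 - move=> v /Xq_consE[u [z [qu]]]; exists (b *: u), z; split=> //; exists u=> //; exact: qp_le qu.
 - by move=> u Bu; apply: saddl; [exact: Xq_sub|exists u].
 - move=> _ [_ [z [[u Bu ->] Xz ->]]]; exists z, u; rewrite addrC; split=> //.
  have [z1 [z2 [q3 q4 ->]]] := Xz; exists z1, z2; split=> //.
  by apply: qp_mono q4=> // c ct; rewrite inE ct orbT.
 - move=> u Bu; split; last exact: Xq_mulr.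
  move=> /Xq_consE[u' [z [qu' Xz E1]]]; rewrite -(subrK u' u); apply: (smodD (Xq_sub _ _ _)).
   apply: Xq_desc; apply: (Xq_reg (t' := [::])); rewrite ?cats0.
   + by apply: perm_trans ps; apply/permP=> P; rewrite /= !count_cat /=; lia.
   + by apply: smodB=> //; exact: qp_le qu'.
   + by rewrite scalerBr; move: E1; rewrite /scl=> ->; rewrite addrAC subrr add0r.
  exact: saddr.
 - exact: Xq_le.
elim: n=> [|n IHn].
 have X0: Xq k (b :: t) 0 = B by apply/seteqP; split; [exact: Xq_le|move=> v Bv; apply: saddr; [|rewrite qp0]].
 have := step 0%N 0%N; rewrite X0 !binn; apply; exact: flen_refl.
have := step n.+1 _ IHn; congr flen; rewrite -mulnDl; congr (_ * _)%N.
by rewrite !addnS [RHS]binS.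
Qed.

Section Overmodule.
Variable C : set V.
Hypotheses (sC : sub C) (CB : C `<=` B).
Lemma qp_absorb t n : (forall b, b \in t -> forall v, B v -> C (b *: v)) -> qp B t n.+1 `<=` qp C t n.
move=> tC; apply: qp_min=> [|w v mw Bv] //.
inversion mw as [|]; rewrite mulrC -scalerA; apply: qp_mem=> //; exact: tC.
Qed.
Lemma qp_absorb1 b t n v : (forall v, B v -> C (b *: v)) -> qp B t n v -> qp C t n (b *: v).
move=> bC; elim=> [|d _ w _ [u [c [mu Bc ->]]] _ IH]; first by rewrite scaler0.
rewrite scalerDr; apply: smodD=> //; rewrite [b *: (d *: _)]scalerA [b * d]mulrC -scalerA.
by apply: smodZ=> //; rewrite [b *: (u *: _)]scalerA [b * u]mulrC -scalerA; apply: qp_mem=> //; exact: bC.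
Qed.
Let Xnil t n v : qp B t n v -> Xq [::] t n v.
by move=> qv; apply: saddr. Qed.
Let nilX t n v : Xq [::] t n v -> qp B t n v.
by rewrite /Xq qp_nil=> -[_ [w [-> qw ->]]]. Qed.

(* Here Q B is contained in C, so Q^n B / Q^n C is a direct sum of copies of B / C. *)
Lemma length_graded w : flen S C B w -> forall t t' n, perm_eq (t ++ t') s ->
 (forall b, b \in t -> forall v, B v -> C (b *: v)) -> (0 < size t)%N ->
 flen S (qp C t n) (qp B t n) ('C(n + (size t).-1, (size t).-1) * w).
move=> hw; elim=> [//|b t IHt] t' n ps tC _ /=.
have bC := tC b (mem_head _ _).
have tC' c: c \in t -> forall v, B v -> C (c *: v) by move=> ct; apply: tC; rewrite inE ct orbT.
have step m N L: flen S (qp C (b :: t) m) (qp B (b :: t) m) N -> flen S (qp C t m.+1) (qp B t m.+1) L ->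
  flen S (qp C (b :: t) m.+1) (qp B (b :: t) m.+1) (N + L).
 move=> hN hL; rewrite !qp_cons //.
 set P := qp B (b :: t) m; set P' := qp C (b :: t) m; set T := qp B t m.+1; set T' := qp C t m.+1.
 have PP: P' `<=` P by exact: qp_mono.
 have TT: T' `<=` T by exact: qp_mono.
 have [sP sP' sT' sT2]: [/\ sub P, sub P', sub T' & sub T] by [].
 have [bP bP']: sub (mulby b P) /\ sub (mulby b P') by split; exact: mulby_sub.
 have reg u: P u -> T (b *: u) -> T u.
  move=> Pu Tbu; apply: nilX; apply: (Xq_reg (a := b) (t' := t'))=> //; first exact: qp_le Pu.
  exact: Xnil.
 apply: (@flen_add _ _ _ _ (sadd (mulby b P) T')); try exact: sadd_smod; first exact: sT.
 - rewrite -(@flen_map _ _ _ (scl b) S P' P) //.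
  + apply: smin; [exact: sadd_smod| |exact: saddr].
   by move=> _ [u Pu ->]; apply: (saddl sT'); exists u.
  + by move=> u Pu; apply: (saddl sT'); exists u.
  + move=> _ [_ [z [[u Pu ->] Tz ->]]]; exists z, u; rewrite addrC; split=> //.
   exact: saddr.
  + move=> u Pu; split; last by move=> Pu'; apply: (saddl sT'); exists u.
   move=> [_ [z [[u' Pu' ->] Tz E1]]]; rewrite -(subrK u' u); apply: smodD=> //.
   have Tuu: T (u - u').
    apply: reg=> //.
    by rewrite scalerBr; move: E1; rewrite /scl=> ->; rewrite addrAC subrr.
   by have := qp_absorb tC' Tuu; apply: qp_mono=> // c ct; rewrite inE ct orbT.
 - rewrite -(@flen_map _ _ _ idfun S T' T) //.
  + by apply: smin; [|exact: saddl|move=> v /TT; exact: saddr].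
  + exact: saddr.
  + by move=> _ [u [z [Pu Tz ->]]]; exists u, z; split=> //; exact: saddl.
  + move=> v Tv; split; last exact: saddr.
   move=> [_ [z [[u Pu ->] Tz E1]]]; rewrite /= in E1; rewrite E1; apply: smodD=> //.
   apply: qp_absorb1=> //; apply: reg=> //.
   by rewrite -[b *: u](addrK z) -E1.
elim: n=> [|n IHn]; first by rewrite !qp0 // binn mul1n.
case: t=> [|c t] in IHt ps tC tC' step IHn *.
 have := step n _ 0%N IHn; rewrite !addn0 !bin0 !qp_nil; apply; apply: flen_refl=> //.
have := step n _ _ IHn (IHt (b :: t') n.+1 _ tC' isT); rewrite -mulnDl /= => H.
have ->: ('C(n.+1 + size (c :: t), size (c :: t)) = 'C(n + (size t).+1, (size t).+1) + 'C(n.+1 + size t, size t))%N by rewrite !addnS [LHS]binS.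
by apply: H; apply: perm_trans ps; apply/permP=> P; rewrite /= ?count_cat /=; lia.
Qed.
End Overmodule.
End Regular.
#[local] Hint Resolve qp_sub : smods.

(** * The Buchsbaum invariant *)

Section DefsLinks.
Variables (R : comPzRingType).
Implicit Types (s : seq R) (I Q : set R).
Notation S := [set: R].
Lemma is_submodP (V : lmodType R) (N : set V) : is_submod N <-> smod S N.
by split=> -[N0 ND NZ]; split=> // a v; [move=> _; exact: NZ|exact: NZ]. Qed.
Lemma spanE (V : lmodType R) (X : set V) : Defs.span X = spn S X.
apply/seteqP; split=> v.
 apply; split; first by apply/is_submodP.
 exact.
elim=> [|d x w _ Xx _ IH]; have [s0 sD sZ] := span_submod X=> //.
by apply: sD=> //; apply: sZ=> N [_]; exact.
Qed.
Lemma colengthP (V : lmodType R) (L : set V) n : colength L n <-> flen S L setT n.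
have H k: submod_chain L k <-> chain S L setT k.
 split=> -[N]; first by move=> [LN sN]; exists N; split=> // i /sN/is_submodP.
 by move=> [LN _ sN]; exists N; split=> // i /sN/is_submodP.
by rewrite /colength !H.
Qed.
Lemma qp1_spn s : qp (V := R^o) setT s 1 = spn S ([set` s] : set R^o).
apply/seteqP; split; last first.
 apply: spn_min=> [|a as_] //.
 by rewrite -[a]mulr1; apply: qp_mem=> //; rewrite -[a]mulr1; constructor=> //; constructor.
apply: qp_min=> [|w c mw _] //.
inversion mw as [|i a w' as_ mw' E1 E2].
have ->: (a * w') *: c = (w' * c) *: (a : R^o) by rewrite -[LHS]/(a * w' * c) -mulrA mulrC.
exact: spn_mem.
Qed.
Lemma ideal_powE s n : ideal_pow (ideal_gen [set` s]) n = qp (V := R^o) setT s n.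
elim: n=> [|n IH]; first by rewrite qp0.
rewrite /= /ideal_mul /smul spanE IH; apply/seteqP; split.
 move=> z Sz; apply: (@spn_min R R^o S _ _ (qp_sub setT s n.+1) _ z Sz)=> {z Sz} _ [a [v [Ia qv ->]]].
 rewrite /ideal_gen spanE in Ia; elim: Ia=> [|d b w _ bs _ IHb]; first by rewrite scale0r.
 rewrite scalerDl; apply: smodD=> //; rewrite -scalerA; apply: smodZ=> //.
 exact: qp_mulr.
apply: (@qp_min R R^o)=> [|w c mw _] //.
inversion mw as [|i a w' as_ mw' E1 E2]; apply: spn_gen=> //; exists a, (w' *: c); split.
- by rewrite /ideal_gen spanE.
- exact: qp_mem.
- by rewrite -[RHS]/(_ * _) mulrA.
Qed.
Lemma radical_submod I : smod S (I : set R^o) -> smod S (radical I : set R^o).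
move=> sI; split=> [|x y [n Ix] [m Iy]|a x _ [n Ix]].
- by exists 1%N; rewrite expr1.
- exists (n + m)%N; rewrite exprDn; apply: (smod_sum (N := I : set R^o))=> // i _.
 rewrite -mulr_natl; apply: smodZ=> //.
 have [ni|ni] := leqP m i.
  by rewrite -(subnK ni) exprD mulrA; apply: smodZ.
 have ->: (n + m - i = m - i + n)%N by lia.
 rewrite exprD mulrAC; exact: smodZ.
- by exists n; rewrite exprMn; exact: smodZ.
Qed.
End DefsLinks.
Lemma ex_binp d : exists q : {poly rat}, [/\ (size q <= d.+1)%N, q`_d = (d`!)%:R^-1 & forall n : nat, q.[n%:R] = 'C(n + d, d)%:R].
by have [sb] := binp_size d; exists (binp d); split=> //; exact: binp_nat. Qed.

Section Buchsbaum.
Variables (R : comPzRingType) (J : set R) (V : lmodType R) (e : V) (B : set V) (l : seq R) (d : nat).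
Notation S := [set: R].
Notation sub := (smod S).
Hypotheses (sJ : sub (J : set R^o)) (Ju : forall j, J j -> exists2 c, S c & c * (1 - j) = 1).
Hypotheses (Jc : forall a, J a \/ exists2 b, S b & b * a = 1) (J1 : ~ J 1).
Hypothesis Jgen : exists gl : seq R, J = spn S ([set` gl] : set R^o).
Hypotheses (einj : forall a, a *: e = 0 -> a = 0) (sB : sub B) (nB : noethm S B) (Be : B e).
Hypotheses (sl : size l = d.+1) (lJ : forall a, a \in l -> J a) (HVl : HV (size l) B 2 l).
Let sT := @srT R.

(** The copy of [R] inside [V]; later [e] is the unit of the normalized Rees algebra, and [B / C] is
    the quotient [B / R]. *)
Definition C : set V := [set v | exists a, v = a *: e].
Lemma C_sub : sub C.
split=> [|_ _ [a ->] [b ->]|a _ _ [b ->]]; first by exists 0; rewrite scale0r.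
 by exists (a + b); rewrite scalerDl.
by exists (a * b); rewrite scalerA.
Qed.
Lemma C_le : C `<=` B. by move=> _ [a ->]; exact: smodZ. Qed.

Definition param (s : seq R) := [/\ size s = d, forall b, b \in s -> J b &
 forall a, J a -> radical (spn S ([set` s] : set R^o)) a].
(** Adjoining the [d] elements of [s] to [l] moves the vanishing bound from 2 to [d + 2]; each of
    the [d + 1] elements of [l] is nilpotent modulo [s], and removing it lowers the bound by one,
    which ends at degree 1 for [s]. Nakayama then discards the members of [t']. *)
Lemma param_regular s : param s -> forall a t t', perm_eq (a :: t ++ t') s ->
 forall c, B c -> lcomb B t (a *: c) -> lcomb B t c.
move=> [sd sJ' sR] a t t' ps c Bc; apply: HV_regular=> //.
have app u k: HV (size l) B k l -> HV (size (u ++ l)) B (size u + k) (u ++ l) by move=> H; elim: u=> [//|b u]; exact: HV_cons.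
have rem l' k: (forall b, b \in l' -> J b) -> HV (size (l' ++ s)) B (size l' + k) (l' ++ s) -> HV (size s) B k s.
 elim: l'=> [//|b l' IH] lJ' H; apply: IH; first by move=> b' b'l; apply: lJ'; rewrite inE b'l orbT.
 have [N bN] := sR b (lJ' b (mem_head _ _)).
 apply: (@HV_remove _ _ _ sB _ b (l' ++ s) N) H.
 by apply: spn_mono bN=> // z zs; rewrite /= mem_cat; apply/orP; right.
have nak l' u: (forall b, b \in l' -> J b) -> HV (size (l' ++ u)) B 1 (l' ++ u) -> HV (size u) B 1 u.
 elim: l'=> [//|b l' IH] lJ' H; apply: IH; first by move=> b' b'l; apply: lJ'; rewrite inE b'l orbT.
 apply: (@HV_nakayama _ _ _ sB b _ J) H=> //.
 - exact: lJ'.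
 - by move=> b' c'; exact: (smodZ sJ).
have H1: HV (size s) B 1 s.
 apply: (rem l 1%N lJ); rewrite sl addn1.
 have ->: (d.+2 = size s + 2)%N by rewrite sd addn2.
 by apply: (HV_perm (l := s ++ l))=> //; [rewrite perm_catC|exact: app].
apply: (nak t' (a :: t)).
 by move=> b bt; apply: sJ'; rewrite -(perm_mem ps) inE mem_cat bt !orbT.
by apply: HV_perm H1=> //; rewrite perm_sym; rewrite perm_catC.
Qed.
(** Take a maximal [M] of infinite colength between [C0] and [B]. An element outside [M] that [J]
    carries into [M] would enlarge it by a simple module, leaving a module of finite colength, a
    contradiction. *)
Lemma finite_length C0 : sub C0 -> C0 `<=` B -> (forall a, J a -> exists N, forall b, B b -> C0 (a ^+ N *: b)) ->
 exists n, flen S C0 B n.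
move=> sC0 CB H; suff [n]: exists n, ~ chain S C0 B n by exact: flen_exists.
apply: contrapT=> nf; have [gl JE] := Jgen.
pose Fam N := [/\ sub N, N `<=` B, C0 `<=` N & forall n, chain S N B n].
have [|M [sM MB CM ch] mx] := @noeth_max _ _ S B Fam sT nB (fun N F=> let: And4 a b _ _ := F in conj a b).
 by exists C0; split=> // n; apply: contrapT=> nc; apply: nf; exists n.
(* Such a [v] is built generator by generator: for each [a] it is multiplied by the largest power of
   [a] that keeps it outside [M]. *)
have [v [Bv Mv gv]]: exists v, [/\ B v, ~ M v & forall a, a \in gl -> M (a *: v)].
 have : forall a, a \in gl -> J a by move=> a; rewrite JE.
 elim: (gl)=> [_|a g IH gJ].
  have [N [MN NB sN pN]] := ch 1%N; have [NN nNN] := pN 0%N isT.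
  have [v N1v N0v]: exists2 v, N 1%N v & ~ N 0%N v by apply: contrapT=> nv; apply: nNN=> v N1v; apply: contrapT=> N0v; apply: nv; exists v.
  by exists v; split=> //; [exact: NB|move=> /MN].
 have [v [Bv Mv gv]] := IH (fun b bg=> gJ b (mem_behead (s := a :: g) bg)).
 have exN: exists N, `[< M (a ^+ N *: v) >] by have [N aN] := H a (gJ a (mem_head _ _)); exists N; apply/asboolP; apply: CM; exact: aN.
 case: (ex_minnP exN)=> -[|N] /asboolP aN mN; first by rewrite scale1r in aN.
 exists (a ^+ N *: v); split; first exact: smodZ.
  by move=> MN; have := mN N; rewrite ltnn; move=> h; have := h (introT (asboolP _) MN).
 move=> b; rewrite inE=> /predU1P[->|bg]; first by rewrite scalerA -exprS.
 by rewrite scalerA mulrC -scalerA; apply: smodZ=> //; exact: gv.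
have sM': sub (sadd M (spn S [set v])) by [].
have MM': M `<=` sadd M (spn S [set v]) by apply: saddl.
have M'B: sadd M (spn S [set v]) `<=` B by apply: sadd_min=> //; apply: spn_min=> // _ ->.
have [n nch]: exists n, ~ chain S (sadd M (spn S [set v])) B n.
 apply: contrapT=> nf'; apply: Mv; apply: (mx (sadd M (spn S [set v])))=> //.
  by split=> //; [exact: subset_trans MM'|move=> n; apply: contrapT=> nc; apply: nf'; exists n].
 by apply: (saddr sM); apply: spn_gen.
have := chain_bound_add sT sM sM' sB MM' M'B (chain_simple sT sM _) nch; apply=> //.
move=> a _; case: (Jc a)=> [Ja|]; [left|by right].
rewrite JE in Ja; elim: Ja=> [|k b w _ bg _ IH]; first by rewrite scale0r.
by rewrite scalerDl; apply: smodD=> //; rewrite -scalerA; apply: smodZ=> //; exact: gv.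
Qed.
Let em (a : R^o) : V := a *: e.
Let em_linear : linear em. by move=> a u v; rewrite /em scalerDl scalerA. Qed.
HB.instance Definition _ := GRing.isLinear.Build R R^o V *:%R em em_linear.
Lemma colength_C (s : seq R) n L : colength (ideal_pow (ideal_gen [set` s]) n : set R^o) L <-> flen S (qp C s n) C L.
rewrite colengthP ideal_powE; have CE: C = em @` setT by apply/seteqP; split=> [_ [a ->]|_ [a _ <-]]; exists a.
have qC: qp C s n = em @` (qp (V := R^o) setT s n) by rewrite CE qp_map.
apply: (@flen_map _ _ _ em)=> //.
- exact: C_sub.
- exact: qp_le C_sub.
- by move=> a; exists a.
- by move=> _ [a ->]; exists 0, a; rewrite add0r.
- move=> a _; rewrite qC; split; last by move=> qa; exists a.
 move=> [b qb E1]; have ->: a = b=> //.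
 by apply/eqP; rewrite -subr_eq0; apply/eqP; apply: einj; rewrite scalerBl; move: E1; rewrite /em=> ->; rewrite subrr.
Qed.
Lemma colength_C1 (s : seq R) L : colength (ideal_gen [set` s] : set R^o) L <-> flen S (qp C s 1) C L.
by rewrite -colength_C ideal_powE qp1_spn /ideal_gen spanE. Qed.
Lemma param_length s : param s -> exists lam, forall n, flen S (qp B s n.+1) B ('C(n + d, d) * lam).
move=> ps; have [sd sJ' sR] := ps.
have [lam hl]: exists lam, flen S (qp B s 1) B lam.
 apply: finite_length; [exact: qp_sub|exact: qp_le|move=> a /sR[N aN]; exists N=> b Bb].
 elim: aN=> [|c f w _ fs _ IH]; first by rewrite scale0r.
 rewrite scalerDl; apply: smodD=> //; rewrite -scalerA; apply: smodZ=> //.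
 by apply: qp_mulr=> //; rewrite qp0.
exists lam=> n; have := length_powers sB (param_regular ps) hl (k := [::]) n (perm_refl s).
rewrite sd; congr flen; apply/seteqP; split=> v.
 by rewrite /Xq qp_nil=> -[_ [w [-> qw ->]]].
by move=> qv; apply: saddr.
Qed.
Lemma param_len_C s n w L : flen S C B w -> flen S (qp C s n.+1) B L ->
 exists2 L', flen S (qp C s n.+1) C L' & (L' + w = L)%N.
move=> hw hL; have [a [b [ha hb ->]]] := flen_split sT (qp_sub C s n.+1) C_sub sB (qp_le C_sub) C_le hL.
by exists a=> //; rewrite (flen_uniq hw hb).
Qed.
Lemma parameter_param Q : parameter_ideal J d Q -> exists2 s, param s & Q = ideal_gen [set` s].
move=> [[_ rQ] [s [ss QE]]]; exists s=> //; have QS: Q = spn S ([set` s] : set R^o) by rewrite QE /ideal_gen spanE.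
split=> // [b bs|]; last by rewrite -rQ QS.
by rewrite -rQ; exists 1%N; rewrite QS.
Qed.
(** Let [w] be the length of [B / C]. As [Q] kills it, [length_graded] gives the length of
    [Q^(n + 1) B / Q^(n + 1) C], which yields the whole Hilbert function of [R]: its leading term is
    [lam], the length of [B / Q B], and for [n = 0] it reads [lam + (d - 1) w]. So the invariant is
    [(d - 1) w]. *)
Theorem buchsbaum_of_annihilated : (0 < d)%N -> (forall a b, J a -> B b -> C (a *: b)) ->
 exists c : ssrint.int, forall Q, parameter_ideal J d Q ->
  exists L f : nat, [/\ colength (Q : set R^o) L, multiplicity d Q f & L%:Z - f%:Z = c].
move=> d0 JB; have [|w hw] := @finite_length C C_sub C_le.
 by move=> a; exists 1%N=> b; exact: JB.
exists (d.-1 * w)%:Z=> _ /parameter_param[s ps ->]; have [lam hl] := param_length ps; have [sd sJ' _] := ps.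
have len n: exists2 L, flen S (qp C s n.+1) C L & (L + w = 'C(n.+1 + d.-1, d.-1) * w + 'C(n + d, d) * lam)%N.
 apply: param_len_C=> //; apply: (@flen_add _ _ _ _ (qp B s n.+1))=> //.
 have := length_graded sB (param_regular ps) C_sub C_le hw (t := s) (t' := [::]) n.+1.
 by rewrite cats0 sd; apply=> // b /sJ' Jb v; exact: JB.
have [L hL LE] := len 0%N; exists L, lam; split; first exact/colength_C1.
 have [q [sb bd qE]] := ex_binp d; have [q' [sb' bd' q'E]] := ex_binp d.-1.
 exists (lam%:R *: q + w%:R *: (q' \Po ('X + 1%:R%:P)) - w%:R%:P).
 have [s1 _] := comp_shift_coef 1%:R sb'.
 rewrite prednK // in s1; have sw: (size (w%:R%:P : {poly rat}) <= d)%N by apply: leq_trans (size_polyC_leq1 _) _.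
 split.
 - apply: leq_trans (size_polyD _ _) _; rewrite geq_max size_polyN; apply/andP; split; last exact: leqW.
  apply: leq_trans (size_polyD _ _) _; rewrite geq_max; apply/andP; split.
   exact: leq_trans (size_scale_leq _ _) sb.
  exact: leq_trans (size_scale_leq _ _) (leqW s1).
 - by rewrite coefB coefD coefZ bd (nth_default _ sw) subr0 coefZ (nth_default _ s1) mulr0 addr0.
 exists 0%N=> n _; have [L' hL' LE'] := len n; exists L'; first exact/colength_C.
 rewrite hornerD hornerN hornerD !hornerZ horner_comp hornerD hornerX !hornerC -natrD qE q'E -!natrM addn1.
 by apply/eqP; rewrite subr_eq -!natrD LE' addnC ![('C(_, _) * _)%N]mulnC.
have {}LE: L = (lam + d.-1 * w)%N.
 move: LE; rewrite binn; rewrite binSn; nia.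
by rewrite LE PoszD addrAC subrr.
Qed.
(** Only the members of [t] are known to kill [B / C], so the quotient is filtered along the
    generators: [a] contributes a copy of [B / C] by regularity, and each member of [t] a copy of
    [B / (a B + C)]. *)
Lemma linear_length a t w wa : param (a :: t) -> flen S C B w ->
 flen S (sadd (mulby a B) C) B wa -> (forall b, b \in t -> forall v, B v -> C (b *: v)) ->
 flen S (qp C (a :: t) 1) (qp B (a :: t) 1) (w + size t * wa).
move=> ps hw hwa tC; have reg := Xq_reg sB (param_regular ps).
have sC := C_sub; have sa := mulby_sub a sB.
have absorb u v: (forall b, b \in u -> forall v, B v -> C (b *: v)) -> qp B u 1 v -> C v by move=> uC qv; apply: (qp_le sC); exact: qp_absorb qv.
apply: (@flen_add _ _ _ _ (sadd (mulby a B) (qp C t 1)))=> //.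
- rewrite qp_cons // qp0 //; have sq := qp_sub C t 1.
 rewrite -(@flen_map _ _ _ (scl a) S C B) //; try by apply: sadd_smod=> //; exact: mulby_sub.
 + apply: (sadd_min (sadd_smod sa sq)); last exact: saddr.
  by move=> _ [u Cu ->]; apply: (saddl sq); exists u=> //; exact: C_le.
 + by move=> u Bu; apply: (saddl sq); exists u.
 + by move=> _ [_ [z [[u Bu ->] qz ->]]]; exists z, u; rewrite addrC; split=> //; exact: saddr (mulby_sub a sC) _ qz.
 + move=> u Bu; split; last by move=> Cu; apply: (saddl sq); exists u.
  move=> [_ [z [[c Cc ->] qz E1]]]; rewrite -(subrK c u); apply: smodD=> //.
  apply: (absorb t)=> //; have : Xq B [::] t 1 (u - c).
   apply: (reg t a [::] 1%N [::]); rewrite ?cats0 //; first by apply: smodB=> //; exact: C_le.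
   rewrite scalerBr; move: E1; rewrite /scl=> ->; rewrite addrAC subrr add0r.
   by apply: saddr; [|apply: qp_mono qz=> //; exact: C_le].
  by rewrite /Xq qp_nil=> -[_ [v [-> qv ->]]].
 + exact: C_le.
rewrite qp_cons // qp0 //.
suff H t1 k: (forall b, b \in k ++ t1 -> forall v, B v -> C (b *: v)) -> perm_eq (a :: k ++ t1) (a :: t) ->
  flen S (sadd (qp B (a :: k) 1) (qp C t1 1)) (sadd (qp B (a :: k) 1) (qp B t1 1)) (size t1 * wa).
 have aE: mulby a B = qp B [:: a] 1.
  by rewrite qp_cons // qp0 // qp_nil; apply/seteqP; split=> [v|_ [v [_ [av -> ->]]]]; [exists v, 0|]; rewrite addr0.
 by rewrite aE; apply: H.
elim: t1 k=> [|b t1 IH] k kC pk.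
 by rewrite !qp_nil; apply: flen_refl; apply: sadd_smod.
have bk: qp B (a :: b :: k) 1 = sadd (mulby b B) (qp B (a :: k) 1).
 rewrite -[X in (mulby b X)](qp0 (b :: a :: k) sB) -qp_cons //.
 by apply/seteqP; split; apply: qp_mono=> // z; rewrite !inE orbCA.
have sak := qp_sub B (a :: k) 1; have sbC := mulby_sub b sC.
have [sq1 sq2 sq3]: [/\ sub (qp C t1 1), sub (qp B t1 1) & sub (qp B (a :: b :: k) 1)] by [].
rewrite (@qp_cons R V C b t1 0 sC) (@qp_cons R V B b t1 0 sB) (qp0 _ sC) (qp0 _ sB) mulSn.
have pk': perm_eq (a :: (b :: k) ++ t1) (a :: t) by apply: perm_trans pk; apply/permP=> P; rewrite /= !count_cat /=; lia.
have kC' z: z \in (b :: k) ++ t1 -> forall v, B v -> C (z *: v) by move=> zk; apply: kC; move: zk; rewrite !(mem_cat, inE)=> /orP[/orP[->|->]|->]; rewrite ?orbT.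
have ->: sadd (qp B (a :: k) 1) (sadd (mulby b B) (qp B t1 1)) = sadd (qp B (a :: b :: k) 1) (qp B t1 1).
 rewrite bk; apply/seteqP; split=> v0.
  by move=> [p [_ [qp_ [q [z [bq qz ->]]] ->]]]; exists (q + p), z; split; rewrite ?addrA ?[p + q]addrC //; exists q, p.
 by move=> [_ [z [[q [p [bq qp_ ->]]]]]]; exists p, (q + z); split; rewrite // ?addrA ?[p + q]addrC //; exists q, z.
apply: (@flen_add _ _ _ _ (sadd (qp B (a :: b :: k) 1) (qp C t1 1)))=> //.
 2: exact: IH.
rewrite -(@flen_map _ _ _ (scl b) S (sadd (mulby a B) C) B) //.
- move=> _ [p [_ [qp_ [_ [z [[c Cc ->] qz ->]]] ->]]]; exists (b *: c + p), z; split=> //; last by rewrite addrA [p + _]addrC.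
 by rewrite bk; exists (b *: c), p; split=> //; exists c=> //; exact: C_le.
- move=> u Bu; apply: (saddl sq1); rewrite bk; apply: (saddl sak); by exists u.
- rewrite bk=> _ [_ [z [[_ [p [[u Bu ->] qp_ ->]]] qz ->]]]; exists (p + z), u; split=> //; last by rewrite [RHS]addrC addrA.
 exists p, z; split=> //; exact: saddr.
- move=> u Bu; split.
  move=> [p [_ [qp_ [_ [z [[c Cc ->] qz ->]]] E1]]].
  have : Xq B (a :: k) t1 1 (u - c).
   apply: (reg t1 b (a :: k) 1%N [::]); rewrite ?cats0.
   - by apply: perm_trans pk; apply/permP=> P; rewrite /= !count_cat /=; lia.
   - by apply: smodB=> //; exact: C_le.
   exists p, z; split=> //; first by apply: qp_mono qz=> //; exact: C_le.
   by rewrite scalerBr; move: E1; rewrite /scl=> ->; rewrite addrCA addrAC subrr add0r.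
  rewrite /Xq qp_cons // qp0 // => -[_ [q [[_ [p' [[v Bv ->] qp' ->]]] qq E2]]].
  exists (a *: v), (p' + q + c); split; first by exists v.
   apply: smodD=> //; apply: (smodD sC).
    by apply: absorb qp'=> z0 zk; apply: kC; rewrite mem_cat zk.
   by apply: absorb qq=> z0 zk; apply: kC; rewrite mem_cat inE zk !orbT.
  by rewrite !addrA -E2 subrK.
 move=> [_ [c [[v Bv ->] Cc ->]]].
 suff : sadd (qp B (a :: k) 1) (sadd (mulby b C) (qp C t1 1)) (b *: (a *: v + c)) by [].
 rewrite scalerDr.
 exists (b *: (a *: v)), (b *: c); split=> //.
  rewrite scalerA mulrC -scalerA; apply: qp_mulr=> //.
  by rewrite qp0 //; exact: smodZ.
 by apply: (saddl sq1); exists c.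
by apply: (sadd_min sB)=> [_ [u Bu ->]|]; [exact: smodZ|exact: C_le].
Qed.
Lemma C_absorb u v : (forall b, b \in u -> forall v, B v -> C (b *: v)) -> qp B u 1 v -> C v.
by move=> uC qv; apply: (qp_le C_sub); exact: qp_absorb qv. Qed.

(* The sandwich Q^(n+k) B <= Q^n C <= Q^n B determines the leading coefficient of the Hilbert polynomial. *)
Lemma multiplicity_eq s lam w k f : (0 < d)%N -> param s -> flen S C B w -> (forall n, flen S (qp B s n.+1) B ('C(n + d, d) * lam)) ->
 qp B s k `<=` C -> multiplicity d (ideal_gen [set` s]) f -> f = lam.
move=> d0 ps hw hl kC [p [sp pd [n0 pn]]].
have : p`_d = lam%:R / d`!%:R.
 apply: (@sandwich d k lam w%:R)=> // n /pn[L /colength_C hL ->].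
 have hT: flen S (qp C s n.+1) B (L + w) by apply: flen_add hw=> //; exact: C_sub.
 have s1: qp B s (n + k).+1 `<=` qp C s n.+1 by rewrite -addSn -qp_comp; exact: qp_mono.
 have s2: qp C s n.+1 `<=` qp B s n.+1 by apply: qp_mono=> //; exact: C_le.
 have [a [b [_ hb E1]]] := flen_split sT (qp_sub B s (n + k).+1) (qp_sub C s n.+1) sB s1 (subset_trans s2 (qp_le sB)) (hl (n + k)%N).
 have [a' [b' [_ hb' E2]]] := flen_split sT (qp_sub C s n.+1) (qp_sub B s n.+1) sB s2 (qp_le sB) hT.
 have Eb := flen_uniq hb' (hl n); have Eb2 := flen_uniq hb hT.
 rewrite -natrD !Num.Theory.ler_nat [(lam * _)%N]mulnC -Eb E2 leq_addl -E2 [(lam * _)%N]mulnC E1 -Eb2.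
 by split=> //; exact: leq_addl.
rewrite pd=> /(congr1 (fun z=> z * d`!%:R)).
have f0: d`!%:R != 0 :> rat by rewrite Num.Theory.pnatr_eq0 -lt0n fact_gt0.
by rewrite !divfK // => /eqP; rewrite Num.Theory.eqr_nat=> /eqP.
Qed.
Hypothesis J_prime : forall a n, J (a ^+ n) -> J a.
Hypothesis Cfin : forall a, J a -> exists N, forall b, B b -> C (a ^+ N *: b).
Lemma param_parameter s : param s -> parameter_ideal J d (ideal_gen [set` s]).
move=> [sd sJ' sR]; have QE: ideal_gen [set` s] = spn S ([set` s] : set R^o) by rewrite /ideal_gen spanE.
have QJ: spn S ([set` s] : set R^o) `<=` J by apply: spn_min.
split; last by exists s.
rewrite QE; split; last by apply/seteqP; split=> [a [n /QJ]|]; [exact: J_prime|].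
split; [exact/is_submodP|by []|move=> a b Qab].
case: (Jc b)=> [/sR|[c _ cb]]; [by right|left].
by rewrite -[a]mulr1 -cb mulrCA; apply: smodZ.
Qed.
Lemma param_powers a t N M : param (a :: t) -> (0 < N)%N -> (0 < M)%N -> param (a ^+ N :: [seq b ^+ M | b <- t]).
move=> [sd sJ' sR] N0 M0; have JX b n: J b -> (0 < n)%N -> J (b ^+ n) by case: n=> // n Jb _; rewrite exprSr; exact: smodZ.
split; first by rewrite /= size_map.
 move=> z; rewrite inE=> /predU1P[->|/mapP[b bt ->]]; apply: JX=> //; apply: sJ'=> //.
 by rewrite inE bt orbT.
move=> z /sR[n zn]; set Q' := spn _ _.
have sr := radical_submod (spn_smod ([set` a ^+ N :: [seq b ^+ M | b <- t]] : set R^o) sT : smod S Q').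
have : radical Q' (z ^+ n).
 move: zn; apply: (@spn_min R R^o S _ _ sr)=> b; rewrite /= inE=> /predU1P[->|bt].
  by exists N; apply: spn_gen=> //=.
 by exists M; apply: spn_gen=> //=; apply/orP; right; apply/mapP; exists b.
by move=> [k]; rewrite -exprM; exists (n * k)%N.
Qed.
(** Replace [t] by powers [u] that kill [B / C]. The parameter ideal of [a^N] and [u], with [a^N B]
    inside [C], has invariant [d - 1] times the length of [B / C]; that of [a] and [u] has [d - 1]
    times the length of [B / (a B + C)]. Equality and [1 < d] force [a B] into [C]. *)
Theorem annihilated_of_buchsbaum (c : ssrint.int) a t : (1 < d)%N ->
 (forall Q, parameter_ideal J d Q ->
  exists L f : nat, [/\ colength (Q : set R^o) L, multiplicity d Q f & L%:Z - f%:Z = c]) ->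
 param (a :: t) -> forall b, B b -> C (a *: b).
move=> d1 Bu ps0; have d0: (0 < d)%N by exact: ltnW.
have [w hw] := finite_length C_sub C_le Cfin.
have CfinS b: J b -> exists2 N, (0 < N)%N & forall v, B v -> C (b ^+ N *: v).
 move=> /Cfin[N bN]; exists N.+1=> // v Bv; rewrite exprS -scalerA; apply: (smodZ C_sub)=> //; exact: bN.
have [M M0 tM]: exists2 M, (0 < M)%N & forall b, b \in t -> forall v, B v -> C (b ^+ M *: v).
 have [_ sJ' _] := ps0; elim: (t) (fun b bt=> sJ' b (mem_behead bt))=> [|b u IH] uJ.
  by exists 1%N.
 have [M M0 uM] := IH (fun z zu=> uJ z (mem_behead (s := b :: u) zu)).
 have [N N0 bN] := CfinS b (uJ b (mem_head _ _)); exists (M + N)%N; first by rewrite addn_gt0 M0.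
 move=> z; rewrite inE=> /predU1P[->|zu] v Bv.
  by rewrite exprD -scalerA; apply: (smodZ C_sub)=> //; exact: bN.
 by rewrite addnC exprD -scalerA; apply: (smodZ C_sub)=> //; exact: uM.
have aC_sub z: sub (sadd (mulby z B) C) by apply: sadd_smod; [exact: mulby_sub|exact: C_sub].
have C_a z: C `<=` sadd (mulby z B) C by apply: saddr; exact: mulby_sub.
have aC_B z: sadd (mulby z B) C `<=` B.
 by apply: (sadd_min sB)=> [_ [u Bv ->]|]; [exact: smodZ|exact: C_le].
have [N N0 aN]: exists2 N, (0 < N)%N & forall v, B v -> C (a ^+ N *: v) by apply: CfinS; have [_ sJ' _] := ps0; apply: sJ'.
pose u := [seq b ^+ M | b <- t].
have uC b: b \in u -> forall v, B v -> C (b *: v) by move=> /mapP[z zt ->]; exact: tM.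
(* The parameter ideal of [z] and [u] has multiplicity [lam] and, by [linear_length], colength
   [lam + (d - 1) wz] in [R]; the constant [c] thus reads off the colength of [z B + C]. *)
have key z k wz: param (z :: u) -> (forall v, B v -> C (z ^+ k *: v)) -> flen S (sadd (mulby z B) C) B wz ->
  c = (d.-1 * wz)%:Z.
 move=> ps zk hz; have [lam hl] := param_length ps; have [sd _ _] := ps.
 have [L [f [hL hf <-]]] := Bu _ (param_parameter ps); move/colength_C1 in hL.
 have ->: f = lam.
  apply: (multiplicity_eq d0 ps hw hl (k := k)) hf=> v qv.
  suff : sadd (mulby (z ^+ k) B) C v.
   by move=> [_ [v' [[b Bb ->] Cv' ->]]]; apply: (smodD C_sub)=> //; exact: zk.
  elim: k v qv {zk} => [|k IH] v; first by rewrite qp0 //; exists v, 0; rewrite addr0; split; [exists v; rewrite ?scale1r|exact: smod0 C_sub|].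
  rewrite qp_cons // => -[_ [v2 [[v1 /IH[_ [v3 [[b Bb ->] Cv3 ->]]] ->] qv2 ->]]].
  exists (z ^+ k.+1 *: b), (z *: v3 + v2); split.
  - by exists b.
  - apply: (smodD C_sub); first exact: (smodZ C_sub).
   apply: (C_absorb uC); elim: (k) qv2=> // i IHi /(qp_desc sB) //.
  - by rewrite scalerDr scalerA -exprS addrA.
 have hg := linear_length ps hw hz uC; have h1 := hl 0%N; rewrite binn mul1n in h1.
 have hT: flen S (qp C (z :: u) 1) B (L + w) by apply: flen_add hw=> //; exact: C_sub.
 have := flen_uniq hT (flen_add sT (qp_sub C _ 1) (qp_sub B _ 1) sB hg h1).
 have ->: size u = d.-1 by rewrite -sd.
 by lia.
have aw: flen S (sadd (mulby (a ^+ N) B) C) B w.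
 have ->: sadd (mulby (a ^+ N) B) C = C=> //.
 apply/seteqP; split=> //.
 by apply: (sadd_min C_sub)=> // _ [v Bv ->]; exact: aN.
have [wa hwa]: exists wa, flen S (sadd (mulby a B) C) B wa.
 by apply: finite_length=> // z /Cfin[k zk]; exists k=> b Bb; apply: C_a; exact: zk.
have c1 := key (a ^+ N) 1%N w (param_powers ps0 N0 M0) (fun v Bv=> aN v Bv) aw.
have ps1 := param_powers ps0 (isT : 0 < 1)%N M0; rewrite expr1 in ps1.
have c2 := key a N wa ps1 aN hwa.
have wE: wa = w.
 have : (d.-1 * wa = d.-1 * w)%N by have := etrans (esym c2) c1; case.
 by move=> /eqP; rewrite eqn_mul2l; lia.
have [i [j [hi hj E1]]] := flen_split sT C_sub (aC_sub a) sB (C_a a) (aC_B a) hw.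
have i0: i = 0%N by have := flen_uniq hwa hj; lia.
rewrite i0 in hi; move=> b Bb; apply: (flen0P C_sub (aC_sub a) (C_a a) hi).
by apply: saddl; [exact: C_sub|exists b].
Qed.
End Buchsbaum.

(** * Localization at a prime and Krull's height theorem *)

Section TypeIdeals.
Variable R : comPzRingType.
Implicit Types (I P Q : set R).
Notation S := [set: R].
Lemma is_idealP I : is_ideal I <-> smod S (I : set R^o).
exact: is_submodP. Qed.
Lemma idM I a b : is_ideal I -> I b -> I (a * b).
by move=> [_ _ H]; exact: H. Qed.
Lemma idMr I a b : is_ideal I -> I b -> I (b * a).
by rewrite mulrC; exact: idM. Qed.
Lemma idD I a b : is_ideal I -> I a -> I b -> I (a + b).
by move=> [_ H _]; exact: H. Qed.
Lemma id0 I : is_ideal I -> I 0. by case. Qed.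
Lemma idN I a : is_ideal I -> I a -> I (- a).
by move=> Ia; rewrite -mulN1r; exact: idM. Qed.
Lemma idB I a b : is_ideal I -> I a -> I b -> I (a - b).
by move=> iI Ia Ib; apply: idD=> //; exact: idN. Qed.
Lemma idDr I a b : is_ideal I -> I a -> I (a + b) -> I b.
by move=> iI Ia Iab; rewrite -[b](addKr a) addrC; exact: idB. Qed.
Lemma ideal_add I a : is_ideal I -> is_ideal [set z | exists i c, I i /\ z = i + a * c].
move=> iI; split=> [|_ _ [i [c [Ii ->]]] [j [c' [Ij ->]]]|b _ [i [c [Ii ->]]]].
- by exists 0, 0; rewrite mulr0 addr0; split=> //; exact: id0.
- by exists (i + j), (c + c'); rewrite mulrDr addrACA; split=> //; exact: idD.
- by exists (b * i), (b * c); rewrite -[_ *: _]/(_ * _) mulrDr mulrCA; split=> //; exact: idM.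
Qed.
Lemma primeXn P a n : prime_ideal P -> P (a ^+ n) -> P a.
by move=> [_ P1 pr]; elim: n=> [|n IH]; rewrite // exprS=> /pr[|]. Qed.
Lemma noethP : noetherian R <-> noethm (V := R^o) S setT.
split=> H I.
 move=> sI _; have [s IE] := H I (proj2 (is_idealP I) sI); rewrite /ideal_gen spanE in IE.
 by exists s; split=> [|]; rewrite IE.
move=> /is_idealP sI; have [s [sI' Is]] := H I sI (fun _ _=> Logic.I); exists s.
rewrite /ideal_gen spanE; apply/seteqP; split=> //; exact: (@spn_min R R^o).
Qed.
Lemma prime_avoiding I (T : set R) : noetherian R -> is_ideal I -> T 1 ->
 (forall a b, T a -> T b -> T (a * b)) -> (forall a, T a -> ~ I a) ->
 exists P, [/\ prime_ideal P, I `<=` P & forall a, T a -> ~ P a].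
move=> /noethP nR iI T1 TM IT.
pose Fam (N : set R^o) := [/\ is_ideal N, I `<=` N & forall a, T a -> ~ N a].
have [|Q [iQ IQ TQ] mx] := @noeth_max _ R^o S setT Fam (@srT R) nR (fun N F=> let: And3 a _ _ := F in conj (proj1 (is_idealP N) a) (fun _ _=> Logic.I)).
 by exists I.
exists Q; split=> //; split=> // [/TQ//|a b Qab].
have big c: ~ Q c -> exists q d, Q q /\ T (q + c * d).
 move=> Qc; apply: contrapT=> nt; apply: Qc.
 apply: (mx [set z | exists i d, Q i /\ z = i + c * d]).
 - split; first exact: ideal_add.
   by move=> z /IQ; exists z, 0; rewrite mulr0 addr0.
  by move=> z Tz [i [d [Qi E]]]; apply: nt; exists i, d; rewrite -E.
 - by move=> z; exists z, 0; rewrite mulr0 addr0.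
 - by exists 0, 1; rewrite mulr1 add0r; split=> //; exact: id0.
apply: contrapT=> /not_orP[/big[q [c [Qq Tq]]] /big[q' [c' [Qq' Tq']]]].
apply: (TQ _ (TM _ _ Tq Tq')).
have ->: (q + a * c) * (q' + b * c') = q * (q' + b * c') + (a * c * q' + (a * b) * (c * c')) by rewrite mulrDl; congr (_ _); rewrite mulrDr; congr (_ _); exact: mulrACA.
by apply: idD=> //; [exact: idMr|apply: idD=> //; [exact: idM|exact: idMr]].
Qed.
End TypeIdeals.

Section Height.
Variable R : comPzRingType.
Notation S := [set: R].
Hypothesis nR : noetherian R.

Definition islocal (J : set R) := [/\ is_ideal J, ~ J 1 & forall a, J a \/ exists b, b * a = 1].
Lemma islocal_sub J P : islocal J -> is_ideal P -> ~ P 1 -> P `<=` J.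
by move=> [iJ J1 Jc] iP P1 a Pa; case: (Jc a)=> // -[b ba]; case: P1; rewrite -ba; exact: idM.
Qed.
Lemma islocal_unit J j : islocal J -> J j -> exists2 c, S c & c * (1 - j) = 1.
move=> [iJ J1 Jc] Jj; case: (Jc (1 - j))=> [J1j|[b]]; last by exists b.
by case: J1; rewrite -(subrK j 1); exact: idD.
Qed.
Lemma islocal_local_ring J : islocal J <-> local_ring J.
split.
 move=> lJ; have [iJ J1 Jc] := lJ.
 have mJ: maximal_ideal J by split=> // I iI I1 JI; apply/seteqP; split=> //; exact: islocal_sub.
 by split=> // m' [im' m1 mx]; apply: esym; apply: mx=> //; exact: islocal_sub.
move=> [[iJ J1 mx] uniq]; split=> // a; have [|Ja] := pselect (J a); [by left|right].
pose I := [set z : R | exists c, z = c * a].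
have iI: is_ideal I.
 split=> [|_ _ [b ->] [c ->]|b _ [c ->]]; first by exists 0; rewrite mul0r.
  by exists (b + c); rewrite mulrDl.
 by exists (b * c); rewrite -mulrA.
apply: contrapT=> na; have I1: ~ I 1 by move=> [b ba]; apply: na; exists b.
pose Fam (N : set R^o) := [/\ is_ideal N, I `<=` N & ~ N 1].
have [|Q [iQ IQ Q1] mxQ] := @noeth_max _ R^o S setT Fam (@srT R) (proj1 (noethP R) nR)
 (fun N F=> let: And3 a _ _ := F in conj (proj1 (is_idealP N) a) (fun _ _=> Logic.I)).
 by exists I.
apply: Ja; suff <-: Q = J by apply: IQ; exists 1; rewrite mul1r.
apply: uniq; split=> // N iN N1 QN; apply/seteqP; split=> //.
by apply: mxQ=> //; split; exact: subset_trans IQ QN.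
Qed.

(* Krull's principal ideal theorem, for the maximal ideal of a local ring. *)
Lemma krull_local J P0 P1 a : islocal J -> prime_ideal P0 -> prime_ideal P1 -> P0 `<` P1 -> P1 `<` J -> J a ->
 exists P', [/\ prime_ideal P', P' a, P0 `<` P' & P' `<` J].
move=> lJ pP0 pP1 [P01 nP10] [P1J nJP1] Ja; have [iJ J1 Jc] := lJ.
have [|P1a] := pselect (P1 a); first by exists P1.
apply: contrapT=> nP'; have [iP0 P01' pr0] := pP0; have [iP1 P11 pr1] := pP1.
have [b P1b P0b]: exists2 b, P1 b & ~ P0 b by apply: contrapT=> nb; apply: nP10=> b P1b; apply: contrapT=> P0b; apply: nb; exists b.
pose I0 : set R := [set z | exists i c, P0 i /\ z = i + a * c]; have iI0: is_ideal I0 by exact: ideal_add.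
have P0I: P0 `<=` I0 by move=> z; exists z, 0; rewrite mulr0 addr0.
have Ia: I0 a by exists 0, 1; rewrite mulr1 add0r; split=> //; exact: id0.
(* A prime over [P0 + (a)] avoiding an element of [J] would be the forbidden [P']; so the radical of
   [P0 + (a)] is [J]. *)
have rad z: J z -> exists N, I0 (z ^+ N).
 move=> Jz; apply: contrapT=> nz.
 have [|||P [pP IP Pz]] := @prime_avoiding R I0 [set w | exists n, w = z ^+ n] nR iI0.
 - by exists 0%N.
 - by move=> _ _ [n ->] [k ->]; exists (n + k)%N; rewrite exprD.
 - by move=> _ [n ->] Iz; apply: nz; exists n.
 apply: nP'; exists P; have [iP P1' _] := pP; split=> //; first exact: IP.
  split; first exact: subset_trans IP.
  by move=> PP0; apply: P1a; apply: P01; apply: PP0; exact: IP.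
 split; first exact: islocal_sub.
 by move=> /(_ z Jz); apply: Pz; exists 1%N.
(* The contraction of [P0 + (b^n)] from the localization at [P1], in the place of a symbolic power
   of [P1] modulo [P0]. *)
pose T n : set R^o := [set z | exists s w c, [/\ ~ P1 s, P0 w & s * z = w + b ^+ n * c]].
have sT n: smod S (T n).
 split=> [|u v [s [w [c [Ps Pw E]]]] [s' [w' [c' [Ps' Pw' E']]]]|r z _ [s [w [c [Ps Pw E]]]]].
 - by exists 1, 0, 0; rewrite !mulr0 addr0; split=> //; exact: id0.
 - exists (s * s'), (s' * w + s * w'), (s' * c + s * c'); split.
  + by move=> /pr1[].
  + by apply: idD=> //; exact: idM.
  + transitivity (s' * (s * u) + s * (s' * v)); first ring.
   by rewrite E E'; ring.
 - exists s, (r * w), (r * c); rewrite mulrCA E mulrDr; split=> //; first exact: idM.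
  by congr _; rewrite mulrCA.
have TT n: T n.+1 `<=` T n by move=> z [s [w [c [Ps Pw E]]]]; exists s, w, (b * c); rewrite E exprSr mulrA.
have sI0 := proj1 (is_idealP _) iI0; have nRm := proj1 (noethP _) nR.
have [gl JE]: exists gl : seq R, J = spn S ([set` gl] : set R^o) by have [gl ->] := nR iJ; exists gl; rewrite /ideal_gen spanE.
have [k [_ hk]]: exists k, flen S (I0 : set R^o) setT k.
 apply: (@finite_length R J R^o setT)=> //.
 - by move=> z; case: (Jc z)=> [|[c]]; [left|right; exists c].
 - by exists gl.
 - by move=> z /rad[N]; exists N=> c _; exact: idMr.
pose F n : set R^o := sadd (T n) I0.
have FF n j: F (n + j)%N `<=` F n.
 elim: j=> [|j IH]; first by rewrite addn0.
 rewrite addnS=> z [u [w [/TT Tu Iw ->]]]; apply: IH; by exists u, w.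
have [n Fn]: exists n, F n `<=` F n.+1.
 apply: contrapT=> nF; apply: hk; exists (fun i=> F (k.+1 - i)%N); split=> //.
 - exact: saddr.
 - move=> i ik; have ->: (k.+1 - i = (k.+1 - i.+1).+1)%N by lia.
  by split=> [|h]; [rewrite -addn1|apply: nF; exists (k.+1 - i.+1)%N].
(* [R / I0] has finite length, so [T n + I0] becomes stationary. An element of [T n] then differs
   from one of [T n.+1] by a multiple [a c], where [c] is in [T n] because [a] is outside [P1], and
   Nakayama applies. *)
have TnS: T n `<=` T n.+1.
 apply: (@nakayama_fg R R^o S J (T n.+1) (T n) setT)=> //.
 - by move=> c d _; exact: idM.
 - by move=> c d; exact: idD.
 - by move=> j /(islocal_unit lJ).
 move=> z Tz; have [|u [_ [Tu [i [c [Pi ->]] zE]]]] := Fn z; first by exists z, 0; rewrite addr0.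
 have Ti l: T l i by exists 1, i, 0; rewrite mul1r mulr0 addr0.
 have Tac: T n (a * c).
  have ->: a * c = z - (u + i) by rewrite zE addrA [X in X - _]addrC addrK.
  by apply: smodB=> //; apply: smodD=> //; exact: TT.
 have Tc: T n c by have [s [w [d [Ps]]]] := Tac; exists (s * a), w, d; rewrite -mulrA; split=> // /pr1[].
 exists (u + i), (a * c); split; first exact: smodD.
  exact: spn_mem.
 by rewrite -addrA.
have [|s [w [c [Ps Pw E]]]] := TnS (b ^+ n).
 by exists 1, 0, 1; rewrite mul1r mulr1 add0r; split=> //; exact: id0.
have : P0 (b ^+ n * (s - b * c)).
 by rewrite mulrBr mulrA -exprSr [_ s]mulrC E addrK.
move=> /pr0[/(primeXn pP0)//|/P01 h]; apply: Ps; rewrite -(subrK (b * c) s).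
by apply: idD=> //; exact: idMr.
Qed.
End Height.

Section LocalizationAtPrime.
Variables (R L : comPzRingType) (P : set R) (phi : {rmorphism R -> L}).
Hypotheses (nR : noetherian R) (pP : prime_ideal P).
Hypotheses (phiu : forall s, ~ P s -> exists t, t * phi s = 1)
 (phif : forall z, exists a s, ~ P s /\ phi s * z = phi a)
 (phi0 : forall a, phi a = 0 -> exists s, ~ P s /\ s * a = 0).
Implicit Types (Q : set R) (I : set L).

Definition lext Q : set L := [set z | exists a s, [/\ Q a, ~ P s & phi s * z = phi a]].
Definition lcontr I : set R := [set a | I (phi a)].
Lemma lcontr_ideal I : is_ideal I -> is_ideal (lcontr I).
move=> iI; split; rewrite /lcontr /=.
- by rewrite rmorph0; exact: id0.
- by move=> a b; rewrite rmorphD; exact: idD.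
- by move=> a b; rewrite rmorphM; exact: idM.
Qed.
Lemma lcontr_prime I : prime_ideal I -> prime_ideal (lcontr I) /\ lcontr I `<=` P.
move=> [iI I1 pr]; split.
 split; [exact: lcontr_ideal|by rewrite /lcontr /= rmorph1|].
 by move=> a b; rewrite /lcontr /= rmorphM=> /pr.
move=> a Ia; apply: contrapT=> /phiu[t ta]; apply: I1; rewrite -ta; exact: idM.
Qed.
Let cancel s z w : ~ P s -> phi s * z = phi s * w -> z = w.
by move=> /phiu[t ts] /(congr1 (fun u=> t * u)); rewrite !mulrA ts !mul1r. Qed.
Lemma lcontr_inj I I' : is_ideal I -> is_ideal I' -> lcontr I `<=` lcontr I' -> I `<=` I'.
move=> iI iI' II z Iz; have [a [s [Ps E]]] := phif z; have [t ts] := phiu Ps.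
have ->: z = t * phi a by rewrite -E mulrA ts mul1r.
by apply: idM=> //; apply: II; rewrite /lcontr /= -E; exact: idM.
Qed.
Lemma lext_ideal Q : is_ideal Q -> is_ideal (lext Q).
have [iP P1 prP] := pP; move=> iQ; split=> [|z w [a [s [Qa Ps E]]] [b [u [Qb Pu E']]]|z w [a [s [Qa Ps E]]]].
- by exists 0, 1; rewrite mulr0 rmorph0; split=> //; exact: id0.
- exists (u * a + s * b), (s * u); split; first by apply: idD=> //; exact: idM.
  by move=> /prP[].
 by rewrite rmorphD !rmorphM -E -E'; ring.
- have [b [u [Pu E']]] := phif z; exists (b * a), (s * u); split; [exact: idM|by move=> /prP[]|].
 by rewrite -[z *: w]/(z * w) !rmorphM -E -E'; ring.
Qed.
Lemma lextP Q a : prime_ideal Q -> Q `<=` P -> lext Q (phi a) <-> Q a.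
move=> [iQ Q1 pr] QP; have [iP P1 prP] := pP; split; last first.
 by move=> Qa; exists a, 1; rewrite rmorph1 mul1r.
move=> [b [s [Qb Ps]]]; rewrite -rmorphM=> /eqP; rewrite -subr_eq0 -rmorphB=> /eqP/phi0[u [Pu E]].
have : Q (u * (s * a)).
 by rewrite -[s * a](subrK b) mulrDr E add0r; exact: idM.
by move=> /pr[/QP//|/pr[/QP//|]].
Qed.
Lemma lext_prime Q : prime_ideal Q -> Q `<=` P -> prime_ideal (lext Q).
move=> pQ QP; have [iQ Q1 pr] := pQ; have [iP P1 prP] := pP; have iL := lext_ideal iQ; split=> //.
 by rewrite -(rmorph1 phi)=> /(lextP _ pQ QP).
move=> z w zw; have [a [s [Ps E]]] := phif z; have [b [u [Pu E']]] := phif w.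
have : lext Q (phi (a * b)).
 have ->: phi (a * b) = (phi s * phi u) * (z * w) by rewrite rmorphM -E -E'; ring.
 exact: idM.
by move=> /(lextP _ pQ QP)/pr[|]; [left; exists a, s|right; exists b, u].
Qed.
Lemma loc_noetherian : noetherian L.
move=> I iI; have [s sE] := nR (lcontr_ideal iI); exists [seq phi a | a <- s].
rewrite /ideal_gen !spanE in sE *; have sI := proj1 (is_idealP I) iI.
apply/seteqP; split=> z; last first.
 apply: (@spn_min L L^o _ _ _ sI)=> _ /mapP[a as_ ->].
 by have : lcontr I a by rewrite sE.
move=> Iz; have [a [u [Pu E]]] := phif z; have [t tu] := phiu Pu.
have ->: z = t *: (phi a : L^o) by rewrite -[_ *: _]/(t * phi a) -E mulrA tu mul1r.
apply: smodZ=> //.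
have : lcontr I a by rewrite /lcontr /= -E; exact: idM.
rewrite sE; elim=> [|r x v _ xs _ IH]; first by rewrite rmorph0.
by rewrite rmorphD rmorphM; apply: spn_cons=> //; exact: map_f.
Qed.
Lemma loc_islocal : islocal (lext P).
have [iP P1 prP] := pP; split; first exact: lext_ideal.
 by rewrite -(rmorph1 phi)=> /(lextP _ pP (fun _ h=> h)).
move=> z; have [a [s [Ps E]]] := phif z; have [|Pa] := pselect (P a); first by left; exists a, s.
right; have [t] := phiu Pa; exists (t * phi s); by rewrite -mulrA E.
Qed.
Lemma lext_proper Q Q' : prime_ideal Q -> prime_ideal Q' -> Q' `<=` P -> Q `<` Q' -> lext Q `<` lext Q'.
move=> pQ pQ' QP [QQ nQ]; split; first by move=> z [a [s [Qa]]]; exists a, s; split=> //; exact: QQ.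
by move=> h; apply: nQ=> a /(lextP _ pQ' QP)/h/(lextP _ pQ (subset_trans QQ QP)).
Qed.
Lemma loc_prime_chain n (Q : nat -> set R) : (forall i, (i <= n)%N -> prime_ideal (Q i) /\ Q i `<=` P) ->
 (forall i, (i < n)%N -> Q i `<` Q i.+1) -> prime_chain L n.
move=> pQ Qp; exists (fun i=> lext (Q i)); split=> i ik; first by have [p] := pQ i ik; exact: lext_prime.
have [p s] := pQ i (ltnW ik); have [p' s'] := pQ i.+1 ik; apply: lext_proper=> //; exact: Qp.
Qed.
End LocalizationAtPrime.

Section AtPrime.
Local Open Scope quotient_scope.
Variables (R : comPzRingType) (P : set R).
Notation T := (~` P).
Notation L := (localization T).
Let den1 : denominator T 1 := proj1 (denominator_submonoid T).
Definition lfrac a s (Hs : denominator T s) : L := \pi_(localization T) (mk_fraction a Hs).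
Lemma lfrac_ex (z : L) : exists a s (Hs : denominator T s), z = lfrac a Hs.
rewrite -[z]reprK; case: repr=> a [s Hs]; by exists a, s, Hs.
Qed.
Lemma lfrac_eq a s (Hs : denominator T s) b t (Ht : denominator T t) :
 lfrac a Hs = lfrac b Ht <-> exists2 u, denominator T u & u * (a * t) = u * (b * s).
split=> [/eqP E|E]; first exact: (elimT (fraction_piP _ _) E).
by apply/eqP; apply: (introT (fraction_piP _ _)).
Qed.
Let denM := proj2 (denominator_submonoid T).
Lemma lfracD a s (Hs : denominator T s) b t (Ht : denominator T t) :
 lfrac a Hs + lfrac b Ht = lfrac (a * t + b * s) (denM Hs Ht).
by rewrite /GRing.add /= -loc_addE; congr \pi; congr (_, exist _ _ _). Qed.
Lemma lfracM a s (Hs : denominator T s) b t (Ht : denominator T t) :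
 lfrac a Hs * lfrac b Ht = lfrac (a * b) (denM Hs Ht).
by rewrite /GRing.mul /= -loc_mulE; congr \pi; congr (_, exist _ _ _). Qed.
Lemma lfracN a s (Hs : denominator T s) : - lfrac a Hs = lfrac (- a) Hs.
by rewrite /GRing.opp /= -loc_oppE; congr \pi; congr (_, exist _ _ _). Qed.
Lemma lfrac0 : (0 : L) = lfrac 0 den1. by rewrite /GRing.zero /=; unlock loc_of. Qed.
Lemma lfrac1 : (1 : L) = lfrac 1 den1. by rewrite /GRing.one /=; unlock loc_of. Qed.

Definition lphi (a : R) : L := lfrac a den1.
Lemma lphi_zmod : zmod_morphism lphi.
by move=> a b; rewrite lfracN lfracD; apply/lfrac_eq; exists 1=> //; ring. Qed.
Lemma lphi_monoid : monoid_morphism lphi.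
by split=> [|a b]; [rewrite lfrac1|rewrite lfracM; apply/lfrac_eq; exists 1=> //; ring]. Qed.
HB.instance Definition _ := GRing.isZmodMorphism.Build R L lphi lphi_zmod.
HB.instance Definition _ := GRing.isMonoidMorphism.Build R L lphi lphi_monoid.
Hypothesis pP : prime_ideal P.
Lemma denominatorE : denominator T = T.
have [iP P1 pr] := pP; apply/seteqP; split; last by move=> s Ps S [_ TS]; exact: TS.
by apply: smallest_sub=> //; split=> // a b Pa Pb /pr[].
Qed.
Lemma lphi_unit s : ~ P s -> exists t, t * lphi s = 1.
move=> Ps; have Hs: denominator T s by rewrite denominatorE.
by exists (lfrac 1 Hs); rewrite lfracM lfrac1; apply/lfrac_eq; exists 1=> //; ring.
Qed.
Lemma lphi_frac z : exists a s, ~ P s /\ lphi s * z = lphi a.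
have [a [s [Hs ->]]] := lfrac_ex z; exists a, s; split; first by move: Hs; rewrite denominatorE.
by rewrite lfracM; apply/lfrac_eq; exists 1=> //; ring.
Qed.
Lemma lphi_ker a : lphi a = 0 -> exists s, ~ P s /\ s * a = 0.
rewrite lfrac0=> /lfrac_eq[u Hu]; rewrite mulr1 mul0r mulr0=> E.
by exists u; move: Hu; rewrite denominatorE.
Qed.
End AtPrime.

(** * Dimension *)

Definition pchain (R : comPzRingType) (P Q : set R) n := exists C : nat -> set R,
 [/\ C 0%N = P, C n = Q, forall i, (i <= n)%N -> prime_ideal (C i) & forall i, (i < n)%N -> C i `<` C i.+1].
Lemma krull_between (R : comPzRingType) (P0 P1 P2 : set R) a : noetherian R -> prime_ideal P0 -> prime_ideal P1 ->
 prime_ideal P2 -> P0 `<` P1 -> P1 `<` P2 -> P2 a -> exists P', [/\ prime_ideal P', P' a, P0 `<` P' & P' `<` P2].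
move=> nR p0 p1 p2 P01 P12 Pa.
have U := lphi_unit p2; have F := lphi_frac p2; have Z := @lphi_ker R P2 p2.
have [P12s P12n] := P12; have P02s: P0 `<=` P2 := subset_trans (proj1 P01) P12s.
have prop := lext_proper p2 Z.
have [||||||P' [pP' Pa' lo hi]] := @krull_local _ (loc_noetherian nR U F) (lext P2 (lphi P2) P2) (lext P2 (lphi P2) P0) (lext P2 (lphi P2) P1) (lphi P2 a).
- exact: loc_islocal.
- exact: lext_prime.
- exact: lext_prime.
- exact: prop.
- exact: prop.
- by apply/lextP.
have [pc cP] := lcontr_prime (phi := lphi P2) U pP'; have [iP' _ _] := pP'.
exists (lcontr (lphi P2) P'); split=> //.
 split; first by move=> z P0z; apply: (proj1 lo); apply/lextP.
 move=> h; apply: (proj2 lo); apply: (lcontr_inj U)=> //; first by case: (lext_prime p2 F Z p0).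
 by move=> z /h P0z; apply/lextP.
split=> // h; apply: (proj2 hi); apply: (lcontr_inj U)=> //; first by case: (loc_islocal p2 U).
by move=> z hz; apply: h; exact: (proj1 (lextP p2 Z z p2 (fun _ k=> k))).
Qed.
(** [krull_between] replaces the prime just below the top by one containing [a], and induction
    treats the shorter chain that ends there: the element moves down the chain at the cost of one
    prime. *)
Lemma pchain_through (R : comPzRingType) n : noetherian R -> forall (P Q : set R) a, pchain P Q n.+1 -> Q a ->
 exists P', [/\ P' a, P `<=` P' & pchain P' Q n].
move=> nR; elim: n=> [|n IH] P Q a [C [C0 Cn pC sC]] Qa.
 exists Q; split=> //; first by rewrite -C0 -Cn; exact: (proj1 (sC 0%N isT)).
 by exists (fun=> Q); split=> // i _; rewrite -Cn; exact: pC.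
have [P' [pP' Pa' lo hi]] := krull_between nR (pC n (leqW (leqnSn _))) (pC n.+1 (leqnSn _)) (pC n.+2 (leqnn _))
 (sC n (leqnSn _)) (sC n.+1 (leqnn _)) (eq_ind_r (fun Q=> Q a) Qa Cn).
have [|P'' [Pa'' PP'' [C' [C0' Cn' pC' sC']]]] := IH P P' a _ Pa'.
 exists (fun i=> if i == n.+1 then P' else C i); rewrite eqxx; split=> // [i iN|i iN].
  by case: eqP=> [//|_]; apply: pC; exact: leqW.
 have ->: (i == n.+1) = false by rewrite ltn_eqF.
 case: eqP=> [[iE]|iE]; first by rewrite iE.
 by apply: sC; rewrite ltnW.
exists P''; split=> //; exists (fun i=> if i == n.+1 then Q else C' i); rewrite eqxx; split=> // [i iN|i iN].
 by case: eqP=> [_|/eqP iN']; [rewrite -Cn; exact: pC|apply: pC'; rewrite -ltnS ltn_neqAle iN'].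
have ->: (i == n.+1) = false by rewrite ltn_eqF.
case: eqP=> [[->]|/eqP iE]; first by rewrite Cn' -Cn.
by apply: sC'; rewrite ltn_neqAle iE.
Qed.
(** A chain longer by one than [s], made to end at [J], would survive the passage through all
    elements of [s] as a strict inclusion of a prime containing [s] in [J], but such a prime
    contains the radical [J]. *)
Lemma dimension_bound (R : comPzRingType) (J : set R) (s : seq R) : noetherian R -> islocal J ->
 (forall a, a \in s -> J a) -> (forall a, J a -> radical (spn setT ([set` s] : set R^o)) a) ->
 ~ prime_chain R (size s).+1.
move=> nR lJ sJ rJ [C [pC sC]].
have H (u: seq R) : (forall a, a \in u -> J a) -> forall P n, pchain P J (size u + n) ->
  exists P', [/\ (forall a, a \in u -> P' a), P `<=` P' & pchain P' J n].
 elim: u=> [_ P|a u IH uJ P n h]; first by exists P.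
 have [P' [Pa PP h']] := pchain_through nR h (uJ a (mem_head _ _)).
 have [P'' [Pu PP'' h'']] := IH (fun b bu=> uJ b (mem_behead (s := a :: u) bu)) P' n h'.
 exists P''; split=> //; last exact: subset_trans PP''.
 by move=> b; rewrite inE=> /predU1P[->|/Pu//]; exact: PP''.
have [iJ J1 Jc] := lJ; have pJ: prime_ideal J.
 split=> // a b Jab; case: (Jc a)=> [|[c ca]]; [by left|right].
 by rewrite -[b]mul1r -ca -mulrA; exact: idM.
pose N := (size s).+1; have CJ: C N `<=` J by have [iC C1 _] := pC N (leqnn _); exact: islocal_sub.
have [|P' [Ps _ [C' [C0' Cn' pC' sC']]]] := H s sJ (C 0%N) 1%N.
 exists (fun i=> if i == N then J else C i); rewrite addn1 eqxx; split=> // [i iN|i iN].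
  by case: eqP=> // _; exact: pC.
 rewrite ltn_eqF //; case: eqP=> [iE|_]; last exact: sC.
 have [s1 s2] := sC i iN; have CiJ: C i.+1 `<=` J by rewrite iE.
 by split; [exact: subset_trans CiJ|move=> h; apply: s2; exact: subset_trans h].
have pP': prime_ideal P' by rewrite -C0'; exact: pC'.
apply: (proj2 (sC' 0%N isT)); rewrite C0' Cn'=> a /rJ[n an]; apply: (primeXn pP').
have [iP' _ _] := pP'; move: an; apply: (@spn_min R R^o _ _ _ (proj1 (is_idealP P') iP'))=> //.
Qed.

(** * Vanishing of the Koszul homology of the normalized Rees algebra *)

Section ComponentMaps.
Variables (R : comPzRingType) (V : lmodType R).
Implicit Types (f : nat -> V -> V) (l : seq R).

Fixpoint cmap f d : KT V d -> KT V d :=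
 match d with 0=> f 0%N | d'.+1=> fun z=> (cmap f z.1, cmap (f \o succn) z.2) end.
Lemma cmap_mkp f d (u v : KT V d) : cmap f (mkp u v) = mkp (cmap f u) (cmap (f \o succn) v).
by []. Qed.
Lemma cmapD f d (u v : KT V d) : (forall p u v, f p (u + v) = f p u + f p v) -> cmap f (u + v) = cmap f u + cmap f v.
elim: d f u v=> [|d IH] f u v fD; first exact: fD.
have [u1 [u2 ->]] := mkpP u; have [v1 [v2 ->]] := mkpP v.
by rewrite !cmap_mkp IH // IH // => p; exact: fD.
Qed.
Lemma cmapZ f f' d a (u : KT V d) : (forall p u, f' p (a *: u) = a *: f p u) -> cmap f' (a *: u) = a *: cmap f u.
elim: d f f' u=> [|d IH] f f' u fZ; first exact: fZ.
by have := u; rewrite !cmap_mkp (IH f) // (IH (f \o succn)) // => p; exact: fZ.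
Qed.
Lemma cmap_dK f f' d l (z : KT V d) : (forall p u v, f' p (u + v) = f' p u + f' p v) ->
 (forall p a u, a \in 0 :: l -> f' p (a *: u) = a *: f p.+1 u) -> (forall p u, f' p (- u) = - f' p u) ->
 cmap f' (dK l z) = dK l (cmap f z).
elim: d f f' l z=> [|d IH] f f' l z fD fZ fN.
 by rewrite /=; have := fZ 0%N 0 0 (mem_head _ _); rewrite !scale0r.
have [u [v ->]] := mkpP z; rewrite dK_mkp !cmap_mkp dK_mkp cmapD //.
have sub a: a \in 0 :: behead l -> a \in 0 :: l by rewrite !inE; case: (a == 0)=> //=; exact: mem_behead.
have c0 g d': (forall p u v, g p (u + v) = g p u + g p v) -> forall u : KT V d', cmap g (- u) = - cmap g u by move=> gD w; apply: (addrI (cmap g w)); rewrite -cmapD // !subrr; apply: (addrI (cmap g 0)); rewrite -cmapD // !addr0.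
rewrite (IH f) //; last by move=> p a w /sub; exact: fZ.
rewrite (cmapZ (f := f \o succn)); last by move=> p w; apply: fZ; case: (l)=> [|].
rewrite c0; last by move=> p; exact: fD.
by rewrite (IH (f \o succn)) // => [p|p a w /sub|p]; [exact: fD|exact: fZ|exact: fN].
Qed.
Lemma inK_cmap f d (G G' : nat -> set V) (z : KT V d) : (forall p v, G p v -> G' p (f p v)) -> inK G z -> inK G' (cmap f z).
elim: d f G G' z=> [|d IH] f G G' z H; first exact: H.
by have [u [v ->]] := mkpP z=> /inK_mkp[Gu Gv]; split; [exact: IH Gu|apply: IH Gv=> p; exact: H].
Qed.
Lemma cmap_id f d (G : nat -> set V) (z : KT V d) : (forall p v, G p v -> f p v = v) -> inK G z -> cmap f z = z.
elim: d f G z=> [|d IH] f G z H; first exact: H.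
by have [u [v ->]] := mkpP z=> /inK_mkp[Gu Gv]; rewrite cmap_mkp (IH _ _ _ H Gu) (IH _ _ _ (fun p=> H p.+1)).
Qed.
Lemma inKI d (G1 G2 G3 : nat -> set V) (z : KT V d) : (forall p v, G1 p v -> G2 p v -> G3 p v) ->
 inK G1 z -> inK G2 z -> inK G3 z.
elim: d G1 G2 G3 z=> [|d IH] F1 F2 F3 v FF; first exact: FF.
have [v1 [v2 ->]] := mkpP v=> /inK_mkp[F11 F12] /inK_mkp[F21 F22]; split; first exact: IH F11 F21.
by apply: IH F12 F22=> p; exact: FF.
Qed.
Lemma inK_regular d (G : nat -> set V) x y (b c : KT V d) :
 (forall p u v, G p u -> G p v -> y *: u + x *: v = 0 -> exists w, [/\ G p w, u = x *: w & v = - (y *: w)]) ->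
 inK G b -> inK G c -> y *: b + x *: c = 0 -> exists w, [/\ inK G w, b = x *: w & c = - (y *: w)].
elim: d G b c=> [|d IH] G b c H; first exact: H.
have [b1 [b2 ->]] := mkpP b; have [c1 [c2 ->]] := mkpP c=> /inK_mkp[B1 B2] /inK_mkp[C1 C2].
rewrite !mkpZ mkpD=> /mkp_inj[E1 E2].
have [w1 [W1 -> ->]] := IH G b1 c1 H B1 C1 E1; have [w2 [W2 -> ->]] := IH (G \o succn) b2 c2 (fun p=> H p.+1) B2 C2 E2.
by exists (mkp w1 w2).
Qed.
Lemma cone_exact d (P : set (KT V d)) a l : (forall u v, P u -> P v -> P (u + v)) -> (forall u, P u -> P (a *: u)) ->
 (forall u, P u -> P (- u)) -> (forall z, P z -> dK l z = 0 -> exists2 w, P w & dK l w = z) ->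
 forall u v, P u -> P v -> dK (a :: l) (mkp u v) = 0 -> exists w1 w2, [/\ P w1, P w2 & dK (a :: l) (mkp w1 w2) = mkp u v].
move=> PD PZ PN H u v Pu Pv; rewrite dK_cons=> /mkp_inj[E1 E2].
have [|w2 Pw2 E3] := H (- v) (PN _ Pv); first by rewrite dKN.
have [||w1 Pw1 E4] := H (u - a *: w2).
- by apply: PD=> //; apply: PN; exact: PZ.
- by rewrite dKB dKZ E3 scalerN opprK.
by exists w1, w2; rewrite dK_cons E4 E3 subrK opprK.
Qed.
End ComponentMaps.

Section GradedVanishing.
Variables (r : nat) (K : fieldType).
Notation E := {mpoly K[r.+1]}.
Variables (A : set K) (x y : K) (g : seq E) (M : 'M[K]_(r.+2, r.+1)) (c : 'rV[K]_r.+2).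
Hypotheses (rA : rlr2 A x y) (fA : fracs A) (cg : cofinite A x y g) (rg : redn A x y g M c).
Let sA := rlr_sub rA.
Notation U := (forms M).
Notation hc n := (@pihomog r.+1 K (@mdeg r.+1) n).
Notation d := (size U).
Notation KU := (KT E^o d).

(* The direct sum of the graded pieces of the normalized Rees algebra. *)
Definition Bg : set E := [set v | forall n, Rb A g n (hc n v)].
Lemma BgD u v : Bg u -> Bg v -> Bg (u + v).
by move=> Bu Bv n; rewrite pihomogD; exact: smodD. Qed.
Lemma Bg0 : Bg 0. by move=> n; rewrite pihomog0. Qed.
Lemma Rb_Bg n : Rb A g n `<=` Bg.
move=> v Rv k; have [hv _] := Rv; have [<-|nk] := eqVneq n k; first by rewrite pihomog_dE.
by rewrite (pihomog_ne0 nk).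
Qed.
Lemma hc_sum (v : E) : exists N, forall n, (N <= n)%N -> v = \sum_(i < n) hc i v.
by exists (mmeasure mdeg v)=> n; exact: pihomog_partitionE. Qed.
Lemma BgM u v : Bg u -> Bg v -> Bg (u * v).
move=> Bu Bv; have [N uE] := hc_sum u; have [N' vE] := hc_sum v.
rewrite (uE N) // (vE N') // mulr_suml; elim/big_ind: _=> [||i _]; [exact: Bg0|exact: BgD|].
rewrite mulr_sumr; elim/big_ind: _=> [||j _]; [exact: Bg0|exact: BgD|].
by apply: Rb_Bg; exact: Rb_mul.
Qed.
Lemma hcM (a : E) n v : a \is 1.-homog -> hc n.+1 (a * v) = a * hc n v.
move=> ha; have [N vE] := hc_sum v; rewrite {1}(vE (N + n.+1)%N) ?leq_addr // mulr_sumr raddf_sum /=.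
have nN: (n < N + n.+1)%N by rewrite addnS ltnS leq_addl.
rewrite (bigD1 (Ordinal nN)) //= big1=> [|i iN].
 by rewrite addr0; apply: pihomog_dE; exact: (dhomogM ha (pihomogP _ _ _)).
apply: (@pihomog_ne0 _ _ _ (1 + i)%N); last by apply: dhomogM=> //; exact: pihomogP.
exact.
Qed.
Lemma hc0M (a v : E) : a \is 1.-homog -> hc 0 (a * v) = 0.
move=> ha; have [N vE] := hc_sum v; rewrite (vE N) // mulr_sumr raddf_sum /= big1 // => i _.
by apply: (@pihomog_ne0 _ _ _ (1 + i)%N)=> //; apply: dhomogM=> //; exact: pihomogP.
Qed.

(** The projection to total degree [n] in homological degree [p]; over all [p] these commute with
    the Koszul differential of linear forms. *)
Definition hcp n p (v : E^o) : E^o := if (p <= n)%N then hc (n - p) v else 0.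
Lemma hcpD n p u v : hcp n p (u + v) = hcp n p u + hcp n p v.
by rewrite /hcp; case: ifP; rewrite ?addr0 // pihomogD. Qed.
Lemma hcpN n p u : hcp n p (- u) = - hcp n p u.
by rewrite /hcp; case: ifP; rewrite ?oppr0 // pihomogN. Qed.
Lemma hcp_U n p (a : E) (u : E^o) : a \in 0 :: U -> hcp n p (a *: u) = a *: hcp n p.+1 u.
rewrite inE=> /predU1P[->|/forms_homog ha].
 by rewrite !scale0r /hcp; case: ifP=> //; rewrite pihomog0.
rewrite -[a *: u]/(a * u) /hcp; have [pn||->] := ltngtP; rewrite ?scaler0 //.
 by have ->: (n - p = (n - p.+1).+1)%N; [lia|exact: hcM].
by rewrite subnn hc0M.
Qed.
Lemma hcp_scalar n (a : K) p (u : E^o) : hcp n p (a%:MP *: u) = (a%:MP : E) *: hcp n p u.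
rewrite -[_ u]/(a%:MP * u) mul_mpolyC /hcp; case: ifP=> _; last by rewrite scaler0.
by rewrite linearZ /= -mul_mpolyC.
Qed.
Lemma hcK_dK n (z : KU) : cmap (hcp n) (dK U z) = dK U (cmap (hcp n) z).
by apply: cmap_dK; [exact: hcpD|move=> u; exact: hcp_U|exact: hcpN]. Qed.
Lemma hcK_sum k (z : KT E^o k) : exists N, forall n, (N <= n)%N -> z = \sum_(i < n) cmap (hcp i) z.
suff H k' (z': KT E^o k') q : exists N, forall n, (N <= n)%N -> z' = \sum_(i < n) cmap (fun p=> hcp i (p + q)) z'.
 have [N zE] := H k z 0%N; exists N=> n /zE {1}->; apply: eq_bigr=> i _; congr (cmap _ z).
 by apply/funext=> p; rewrite addn0.
elim: k' z' q=> [|k' IH] z' q.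
 have [N zE] := hc_sum z'; exists (q + N)%N=> n nN; rewrite /= add0n.
 transitivity (\sum_(0 <= i < n) hcp i q z'); last by rewrite big_mkord.
 rewrite (@big_cat_nat _ _ _ q) //=; last exact: leq_trans (leq_addr _ _) nN.
 rewrite big1_seq ?add0r; last by move=> i /=; rewrite mem_index_iota /hcp=> /andP[_ iq]; rewrite leqNgt iq.
 rewrite -{1}[q]add0n big_addn big_mkord {1}(zE (n - q)%N); last by rewrite leq_subRL // (leq_trans (leq_addr _ _) nN).
 by apply: eq_bigr=> i; rewrite /hcp leq_addl addnK.
have [u [v ->]] := mkpP z'; have [N1 uE] := IH u q; have [N2 vE] := IH v q.+1; exists (N1 + N2)%N=> n nN.
under eq_bigr do rewrite cmap_mkp.
have ->: \sum_(i < n) mkp (cmap (fun p=> hcp i (p + q)) u) (cmap ((fun p=> hcp i (p + q)) \o succn) v) =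
  mkp (\sum_(i < n) cmap (fun p=> hcp i (p + q)) u) (\sum_(i < n) cmap (fun p=> hcp i (p + q.+1)) v).
 elim: {nN} n=> [|n IHn]; first by rewrite !big_ord0.
 rewrite !big_ord_recr /= IHn; congr (mkp _ (_ + cmap _ _)).
 by apply/funext=> p; rewrite addnS.
by rewrite -uE ?(leq_trans (leq_addr _ _) nN) // -vE // (leq_trans (leq_addl _ _) nN).
Qed.

Definition Tg j p : set E^o := tails (Bg : set E^o) j p.
Lemma TgD j p u v : Tg j p u -> Tg j p v -> Tg j p (u + v).
by rewrite /Tg /tails; case: ifP=> _; [exact: BgD|move=> -> ->; rewrite addr0]. Qed.
Lemma Tg0 j p : Tg j p 0.
by rewrite /Tg /tails; case: ifP=> _ //; exact: Bg0. Qed.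
(* Total degree n and homological degree at least j. *)
Definition TR n j p : set E^o := if (j <= p)%N then Rg A g n p else [set 0].
Lemma TR_Tg n j p : TR n j p `<=` Tg j p.
rewrite /TR /Tg /tails; case: (j <= p)%N=> //; rewrite /Rg; case: (p <= n)%N=> v; last by move=> ->; exact: Bg0.
exact: Rb_Bg.
Qed.
Lemma hcp_TR n j p v : Tg j p v -> TR n j p (hcp n p v).
rewrite /TR /Tg /tails /hcp /Rg; case: ifP=> _; first case: ifP=> //.
by move=> ->; case: ifP=> // _; exact: pihomog0.
Qed.

Definition quad (a b e f : KU) : KT E^o d.+2 := mkp (mkp a b) (mkp e f).
Notation L := (x%:MP :: y%:MP :: U).
Lemma dK_quad a b e f : dK L (quad a b e f) =
 quad (dK U a + y%:MP *: b + x%:MP *: e) (- dK U b + x%:MP *: f) (- (dK U e + y%:MP *: f)) (dK U f).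
by rewrite !dK_cons mkpN opprK. Qed.
Definition quadK (P : nat -> nat -> set E^o) j (a b e f : KU) :=
 [/\ inK (P j) a, inK (P j.-1) b, inK (P j.-1) e & inK (P j.-2) f].
Lemma redn_exact_g n : (1 < n)%N -> ex2 (V := E^o) d (Rg A g n) (Rg A g n) U.
move=> n1; have := redn_exact rg n1; rewrite /exact_at.
by have ->: Rg A (forms M) n = Rg A g n by apply/funext=> p; rewrite /Rg -(Rb_forms rA _ cg rg).
Qed.
Lemma Rb0_const v : Rb A g 0 v -> exists2 a, A a & v = a%:MP.
move=> Rv; have mv := Rb_mcf rA fA (cof_mcf cg) (cof_homog cg) Rv; have [hv _] := Rv.
exists v@_0%MM=> //.
apply/mpolyP=> m; rewrite mcoeffC; have [->|m0] := eqVneq; first by rewrite mulr1.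
by rewrite mulr0 (dhomog_nemf_coeff hv) // mdeg_eq0.
Qed.
Let RgD n p u v : Rg A g n p u -> Rg A g n p v -> Rg A g n p (u + v).
exact. Qed.
Let RgN n p u : Rg A g n p u -> Rg A g n p (- u).
exact. Qed.
Let RgZ' n p a (u : E^o) : A a -> Rg A g n p u -> Rg A g n p ((a%:MP : E) *: u).
by move=> Aa Gu; rewrite -[_ u]/(a%:MP * u) mul_mpolyC. Qed.
(** In this range the complex of [U] is exact, and exactness survives the cones of [y] and [x],
    scalars that preserve total degree; the homological degrees are corrected afterwards by
    truncation. *)
Lemma quad_high n j (a b e f : KU) : (1 < n)%N -> quadK (TR n) j a b e f -> dK L (quad a b e f) = 0 ->
 exists a' b' e' f', quadK (TR n) j.+1 a' b' e' f' /\ dK L (quad a' b' e' f') = quad a b e f.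
move=> n1 [Ga Gb Ge Gf] dz; pose P : set KU := inK (Rg A g n : nat -> set E^o).
have sub i (w: KU) : inK (TR n i) w -> P w.
 apply: inK_mono=> p v; rewrite /TR; case: ifP=> // _ -> //.
have PD u v: P u -> P v -> P (u + v) by apply: inKD; exact: RgD.
have PN u: P u -> P (- u) by apply: inKN; exact: RgN.
have PZ s u: A s -> P u -> P (s%:MP *: u) by move=> As; apply: inKZ=> p v; exact: RgZ'.
have H1 := cone_exact PD (fun u=> PZ y u (rlr_y rA)) PN (redn_exact_g n1).
pose P2 : set (KT E^o d.+1) := [set w | exists u v, [/\ P u, P v & w = mkp u v]].
have [|||z Hz|w1 [w2 [[a1 [b1 [Pa1 Pb1 ->]]] [e1 [f1 [Pe1 Pf1 ->]]] wE]]] := @cone_exact _ _ d.+1 P2 x%:MP (y%:MP :: U) _ _ _ _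
  (mkp a b) (mkp e f) (ex_intro _ a (ex_intro _ b (And3 (sub _ _ Ga) (sub _ _ Gb) erefl)))
  (ex_intro _ e (ex_intro _ f (And3 (sub _ _ Ge) (sub _ _ Gf) erefl))) dz.
- by move=> _ _ [u [v [Pu Pv ->]]] [u' [v' [Pu' Pv' ->]]]; exists (u + u'), (v + v'); split=> //; exact: PD.
- by move=> _ [u [v [Pu Pv ->]]]; exists (x%:MP *: u), (x%:MP *: v); split=> //; exact: PZ (rlr_x rA) _.
- by move=> _ [u [v [Pu Pv ->]]]; exists (- u), (- v); split=> //; exact: PN.
- move=> dz0; have [u [v [Pu Pv zE]]] := Hz; rewrite zE in dz0 *.
 by have [w1 [w2 [Pw1]]] := H1 u v Pu Pv dz0; exists (mkp w1 w2)=> //; exists w1, w2.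
(* Truncation below homological degree [i]; it commutes with the differential up to a shift of [i]
   by one, which turns any bounding chain into one of the required degrees. *)
pose tr i p (v : E^o) : E^o := if (i <= p)%N then v else 0.
have trD i p u v: tr i p (u + v) = tr i p u + tr i p v by rewrite /tr; case: ifP; rewrite ?addr0.
have trN i p u: tr i p (- u) = - tr i p u by rewrite /tr; case: ifP; rewrite ?oppr0.
have trG i w: P w -> inK (TR n i) (cmap (tr i) w) by apply: inK_cmap=> p; rewrite /TR /tr; case: ifP.
have trI i (w: KU) : inK (TR n i) w -> cmap (tr i) w = w by apply: cmap_id=> p; rewrite /TR /tr; case: ifP.
have trK i (w: KU) : dK U (cmap (tr i.+1) w) = cmap (tr i) (dK U w).
 apply: esym; apply: cmap_dK=> [|p s u _|] //.
 by rewrite /tr ltnS; case: ifP=> //; rewrite scaler0.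
have trZ i s (w: KU) : cmap (tr i) (s *: w) = s *: cmap (tr i) w by apply: cmapZ=> p u; rewrite /tr; case: ifP=> //; rewrite scaler0.
have tr0 i (w: KU) : (i <= 0)%N -> cmap (tr i) w = w by rewrite leqn0=> /eqP->; apply: cmap_id (inKT w).
have trP i (w: KU) : dK U (cmap (tr i) w) = cmap (tr i.-1) (dK U w) by case: i=> [|]; [rewrite !tr0|].
have trDK i (u v: KU) : cmap (tr i) (u + v) = cmap (tr i) u + cmap (tr i) v by apply: cmapD.
have trNK i (u: KU) : cmap (tr i) (- u) = - cmap (tr i) u by rewrite -scaleN1r trZ scaleN1r.
exists (cmap (tr j.+1) a1), (cmap (tr j) b1), (cmap (tr j) e1), (cmap (tr j.-1) f1); split; first by split; exact: trG.
have /mkp_inj[/mkp_inj[Ea Eb] /mkp_inj[Ee Ef]] := etrans (esym (dK_quad a1 b1 e1 f1)) wE.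
rewrite -(trI _ _ Ga) -(trI _ _ Gb) -(trI _ _ Ge) -(trI _ _ Gf) -Ea -Eb -Ee -Ef dK_quad.
by rewrite ?(trDK, trNK, trZ, trP).
Qed.
(** Homological degree at least two exceeds the total degree, so [a = 0], and [b], [e] have
    components in the degree zero part, which is [A]. There [y b + x e = 0] is solved by regularity
    of [x], [y], and the common factor bounds the cycle. *)
Lemma quad_low n j (a b e f : KU) : (1 < j)%N -> (n <= 1)%N -> quadK (TR n) j a b e f -> dK L (quad a b e f) = 0 ->
 exists a' b' e' f', quadK (TR n) j.+1 a' b' e' f' /\ dK L (quad a' b' e' f') = quad a b e f.
move=> j1 n1 [Ga Gb Ge Gf]; have x0: (x%:MP : E) != 0 by rewrite mpolyC_eq0 (rlr_x0 rA).
have ->: a = 0.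
 have : inK (fun=> [set 0]) a.
  apply: inK_mono Ga=> p v; rewrite /TR /Rg; case: ifP=> // jp; case: ifP=> // pn.
  by have := leq_trans (leq_trans j1 jp) (leq_trans pn n1).
 elim: d (a)=> [//|k IH] z; have [z1 [z2 ->]] := mkpP z=> /inK_mkp[/IH-> /IH->] //.
rewrite dK_quad dK0 add0r=> /mkp_inj[/mkp_inj[E1 E2] _].
have [|dl [Gd bE eE]] := inK_regular _ Gb Ge E1.
 move=> p u v; rewrite /TR /Rg; case: ifP=> jp; last first.
  by move=> ->; exists 0; rewrite !scaler0 oppr0.
 case: ifP=> pn; last by move=> ->; exists 0; rewrite !scaler0 oppr0.
 have ->: (n - p = 0)%N by lia.
 move=> /Rb0_const[s As ->] /Rb0_const[t At ->]; rewrite -![_ *: _]/(_ * _) -!mpolyCM -mpolyCD=> /eqP.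
 rewrite mpolyC_eq0 addr_eq0=> /eqP E3.
 have [|w Aw sE] := rlr_reg rA As (srN sA At); first by rewrite mulrN.
 exists w%:MP; split.
 - split; first by rewrite -[_%:MP]mulr1 mul_mpolyC; apply/dhomogZ/dhomog1.
  by apply: int_rees=> //; rewrite -[_%:MP]mulr1 mul_mpolyC; apply: spn_mem=> //; exact: mon1.
 - by rewrite -[_ *: _]/(_ * _) -mpolyCM sE.
 - rewrite -[_ *: _]/(_ * _) -mpolyCM -mpolyCN; congr _%:MP; apply: (mulfI (rlr_x0 rA)).
  by rewrite mulrN mulrCA -sE E3 opprK.
have fE: f = dK U dl.
 apply/eqP; rewrite -subr_eq0; apply/eqP; apply: (scaleK_inj x0).
 by rewrite scalerBr -dKZ -bE addrC.
exists 0, 0, 0, dl; split.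
 have z0 i: inK (TR n i) (0 : KU)=> //.
  by apply: inK0=> p; rewrite /TR; case: ifP=> // _; exact: smod0 (Rg_smod _ _ _ sA).
by rewrite dK_quad !dK0 !scaler0 !add0r oppr0 -bE -eE -fE add0r.
Qed.
(** A cycle is the sum of its projections to finitely many total degrees; these are cycles, each
    covered by [quad_high] or [quad_low], and the bounding chains are added. *)
Lemma Bg_exact j : (1 < j)%N -> ex2 (V := E^o) d.+2 (tails Bg j) (tails Bg j.+1) L.
case: j=> [//|[//|k]] _ z Gz dz.
have [z1 [z2 zE]] := mkpP z; have [a [b z1E]] := mkpP z1; have [e [f z2E]] := mkpP z2.
have {z1E z2E} zE: z = quad a b e f by rewrite zE z1E z2E.
have [[Ga Gb] [Ge Gf]]: (inK (Tg k.+2) a /\ inK (Tg k.+1) b) /\ (inK (Tg k.+1) e /\ inK (Tg k) f) by rewrite zE in Gz.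
have [N1 aE] := hcK_sum a; have [N2 bE] := hcK_sum b; have [N3 eE] := hcK_sum e; have [N4 fE] := hcK_sum f.
pose h i (u : KU) := cmap (hcp i) u.
have [ze1 [ze2 [ze3 ze4]]]: [/\ dK U a + y%:MP *: b + x%:MP *: e = 0, - dK U b + x%:MP *: f = 0,
  - (dK U e + y%:MP *: f) = 0 & dK U f = 0].
 by move: dz; rewrite zE dK_quad=> /mkp_inj[/mkp_inj[-> ->] /mkp_inj[->]].
have hD i (u v: KU) : h i (u + v) = h i u + h i v by apply: cmapD; exact: hcpD.
have hZ i s u: h i (s%:MP *: u) = s%:MP *: h i u by apply: cmapZ; exact: hcp_scalar.
have h0 i: h i 0 = 0 by apply: (addrI (h i 0)); rewrite -hD !addr0.
have hN i u: h i (- u) = - h i u by apply: (addrI (h i u)); rewrite -hD !subrr.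
have hdK i u: dK U (h i u) = h i (dK U u) by rewrite /h hcK_dK.
have step i: exists2 w : KT E^o d.+2, inK (tails Bg k.+3 : nat -> set E^o) w & dK L w = quad (h i a) (h i b) (h i e) (h i f).
 have Q: quadK (TR i) k.+2 (h i a) (h i b) (h i e) (h i f) by split; [apply: inK_cmap Ga|apply: inK_cmap Gb|apply: inK_cmap Ge|apply: inK_cmap Gf]; exact: hcp_TR.
 have dQ: dK L (quad (h i a) (h i b) (h i e) (h i f)) = 0 by rewrite dK_quad !hdK -!hZ -!hN -!hD -hN ze1 ze2 ze3 ze4 h0.
 have [a' [b' [e' [f' [[A1 A2 A3 A4] <-]]]]]: exists a' b' e' f', quadK (TR i) k.+3 a' b' e' f' /\
   dK L (quad a' b' e' f') = quad (h i a) (h i b) (h i e) (h i f).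
  by have [i1|i1] := ltnP 1 i; [exact: quad_high|exact: quad_low].
 exists (quad a' b' e' f')=> //.
 by split; split; [apply: inK_mono A1|apply: inK_mono A2|apply: inK_mono A3|apply: inK_mono A4]; exact: TR_Tg.
have sum n: exists2 w : KT E^o d.+2, inK (tails Bg k.+3 : nat -> set E^o) w &
  dK L w = quad (\sum_(i < n) h i a) (\sum_(i < n) h i b) (\sum_(i < n) h i e) (\sum_(i < n) h i f).
 elim: n=> [|n [w Gw wE]].
  exists 0; first by apply: inK0; exact: Tg0.
  by rewrite !big_ord0 dK0.
 have [w' Gw' wE'] := step n; exists (w + w'); first by apply: inKD Gw Gw'; exact: TgD.
 by rewrite dKD wE wE' !big_ord_recr.
have [w Gw wE] := sum (N1 + N2 + N3 + N4)%N; exists w=> //.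
by rewrite wE -aE -?bE -?eE -?fE //; lia.
Qed.
End GradedVanishing.

(* The R-module structure on F defined by restriction along psi : R -> F. *)
Definition pull (R : comPzRingType) (F : comNzRingType) (psi : R -> F) : Type := F.
Section Pull.
Variables (R : comPzRingType) (F : comNzRingType) (psi : {rmorphism R -> F}).
HB.instance Definition _ := GRing.Zmodule.on (pull psi).
Definition pull_scale (a : R) (v : pull psi) : pull psi := psi a * (v : F).
Lemma pull_scaleA a b v : pull_scale a (pull_scale b v) = pull_scale (a * b) v.
by rewrite /pull_scale rmorphM mulrA. Qed.
Lemma pull_scale1 : left_id 1 pull_scale. by move=> v; rewrite /pull_scale rmorph1 mul1r. Qed.
Lemma pull_scaleDr : right_distributive pull_scale +%R. by move=> v; exact: mulrDr. Qed.
Lemma pull_scaleDl v : {morph pull_scale^~ v : a b / a + b}.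
by move=> a b; rewrite /pull_scale rmorphD; exact: mulrDl. Qed.
HB.instance Definition _ := GRing.Zmodule_isLmodule.Build R (pull psi)
 pull_scaleA pull_scale1 pull_scaleDr pull_scaleDl.
Lemma pullE a (v : pull psi) : a *: v = psi a * (v : F). by []. Qed.
End Pull.

Section Transfer.
Variables (r : nat) (K : fieldType).
Notation E := {mpoly K[r.+1]}.
Notation Fr := {fraction E}.
Variables (R : comPzRingType) (psi : {rmorphism R -> Fr}) (T Bg : set E).
Hypotheses (T1 : T 1) (TM : forall s t, T s -> T t -> T (s * t)) (T0 : forall s, T s -> s != 0)
 (TB : forall s v, T s -> Bg v -> Bg (s * v)).

Definition fracmod : set (pull psi) := [set v | exists s w, [/\ T s, Bg w & tofrac s * (v : Fr) = tofrac w]].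
(** Localization is exact: a cycle times a common denominator comes from [Bg] and bounds there, and
    the bounding chain is divided by the denominator. Both complexes are compared inside the one
    over the fraction field. *)
Lemma fracmod_HV k (l : seq R) (L : seq E) : map psi l = map (@tofrac _) L -> Bg 0 ->
 (forall j, (k <= j)%N -> ex2 (V := E^o) (size L) (tails Bg j) (tails Bg j.+1) L) ->
 HV (size l) fracmod k l.
move=> lL Bg0 H j kj z Gz dz.
have sz: size l = size L by rewrite -(size_map psi) lL size_map.
rewrite sz in z Gz dz *.
pose f1 : pull psi -> Fr^o := fun v=> v.
pose f2 : E^o -> Fr^o := @tofrac E.
have f2D u v: f2 (u + v) = f2 u + f2 v by exact: rmorphD.
have f2Z a u: f2 (a *: u) = tofrac a *: f2 u by exact: rmorphM.
pose m1 := @mapK _ _ _ Fr^o f1 (size L); pose m2 := @mapK _ _ _ Fr^o f2 (size L).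
pose G' : nat -> set Fr^o := fun p=> [set v | exists2 w : E, tails Bg j p w & v = tofrac w].
have tT s: T s -> tofrac s != 0 by move=> /T0; rewrite tofrac_eq0.
have [||||s [t Tt ->] Gs] := @inK_denom Fr Fr^o (size L) G' [set s | exists2 t, T t & s = tofrac t] (m1 z).
- by exists 1.
- by move=> _ _ [s Ts ->] [t Tt ->]; exists (s * t); [exact: TM|rewrite tofracM].
- move=> p _ _ [s Ts ->] [w Gw ->]; exists (s * w); last by rewrite tofracM.
 by move: Gw; rewrite /tails; case: ifP=> _; [exact: TB|move=> ->; rewrite mulr0].
- apply: inK_mapK Gz=> p v; rewrite /tails; case: ifP=> jp.
  move=> [s [w [Ts Bw vE]]]; exists (tofrac s); first by exists s.
  by exists w; first rewrite /tails jp.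
 by move=> ->; exists 1; [exists 1|exists 0; rewrite /tails ?jp ?scaler0].
have [w Gw wE]: exists2 w, inK (tails Bg j : nat -> set E^o) w & m2 w = tofrac t *: m1 z by apply: mapK_lift Gs=> p _ [w Gw ->]; exists w.
have dw: dK L w = 0.
 apply: (@mapK_eq _ _ E^o Fr^o f2) (inKT _) _=> [p v _ /eqP|].
  by rewrite tofrac_eq0=> /eqP.
 rewrite (@mapK_dK _ _ _ _ (@tofrac E)) // -/m2 wE -lL dKZ -mapK_dK ?rmorph0 //.
 by rewrite dz mapK0 // scaler0.
have [w' Gw' wE'] := H j kj w Gw dw.
have [z' Gz' zE']: exists2 z', inK (tails fracmod j.+1) z' & m1 z' = (tofrac t)^-1 *: m2 w'.
 have : inK (fun p=> [set v | exists2 w : E, tails Bg j.+1 p w & v = (tofrac t)^-1 *: (tofrac w : Fr^o)]) ((tofrac t)^-1 *: m2 w').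
  have : inK (fun p=> [set v : Fr^o | exists2 w : E, tails Bg j.+1 p w & v = tofrac w]) (m2 w') by apply: inK_mapK Gw'=> p v; exists v.
  elim: size (tails Bg j.+1 : nat -> set E) (m2 w')=> [|n IH] G u.
   by case=> v Gv ->; exists v.
  by have [u1 [u2 ->]] := mkpP u=> /inK_mkp[U1 U2]; rewrite mkpZ; split=> //; exact: IH.
 apply: mapK_lift=> p v [w0 Gw0 ->]; exists ((tofrac t)^-1 * tofrac w0)=> //.
 move: Gw0; rewrite /tails; case: ifP=> _ Gw0.
  by exists t, w0; rewrite mulrA divff ?mul1r // tT.
 by rewrite Gw0 mulr0.
exists z'=> //; apply/eqP; rewrite -subr_eq0; apply/eqP.
apply: (@mapK_eq _ _ (pull psi) Fr^o f1) (inKT _) _=> //.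
rewrite mapKD // mapKN // (@mapK_dK _ _ _ _ psi) ?rmorph0 // lL -/(m1 z') zE' dKZ.
rewrite -mapK_dK // wE' -/m2 wE scalerA mulVf ?tT // scale1r.
exact: subrr.
Qed.
End Transfer.

(** * Two-dimensional regular local rings *)

(** A copy of [A] that can carry the structure of an integral domain, over which fractions are
    formed. *)
Definition domain_alias (A : comNzRingType) (dA : forall a b : A, a * b = 0 -> a = 0 \/ b = 0) : Type := A.
Section DomainAlias.
Variables (A : comNzRingType) (dA : forall a b : A, a * b = 0 -> a = 0 \/ b = 0).
Notation D := (domain_alias dA).
HB.instance Definition _ := GRing.ComNzRing.on D.
Definition dunit : pred D := fun a=> `[< exists b : D, b * a = 1 >].
Definition dinv (a : D) : D := if pselect (exists b : D, b * a = 1) is left h then projT1 (cid h) else a.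
Lemma dmulV : {in dunit, left_inverse 1 dinv *%R}.
by move=> a /asboolP; rewrite /dinv; case: pselect=> // h'; case: cid. Qed.
Lemma dunitP a b : b * a = 1 -> dunit a. by move=> ba; apply/asboolP; exists b. Qed.
Lemma dinv_out : {in [predC dunit], dinv =1 id}.
by move=> a /asboolP; rewrite /dinv; case: pselect. Qed.
HB.instance Definition _ := GRing.ComNzRing_hasMulInverse.Build D dmulV dunitP dinv_out.
Lemma d_integral (a b : D) : a * b = 0 -> (a == 0) || (b == 0).
by move=> /dA[]->; rewrite eqxx ?orbT. Qed.
HB.instance Definition _ := GRing.ComUnitRing_isIntegral.Build D d_integral.
End DomainAlias.
Lemma fracW (D : idomainType) (k : {fraction D}) : exists a s : D, s != 0 /\ tofrac s * k = tofrac a.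
elim/quotW: k=> z; exists \n_z, \d_z; split; first exact: denom_ratioP.
unlock tofrac; rewrite -[LHS]FracField.pi_mul; apply/eqmodP.
by rewrite /= FracField.equivfE !numden_Ratio ?mulf_neq0 ?oner_eq0 ?denom_ratioP ?mul1r ?mulr1.
Qed.
Lemma fraction_field (A : comNzRingType) : (forall a b : A, a * b = 0 -> a = 0 \/ b = 0) ->
 exists (K : fieldType) (io : {rmorphism A -> K}), injective io /\ forall k, exists a s, s != 0 /\ io s * k = io a.
move=> dA; pose D := domain_alias dA; pose f (a : A) : {fraction D} := tofrac (a : D).
have fB: zmod_morphism f by move=> a b; exact: rmorphB.
have fM: monoid_morphism f by split=> [|a b]; [|exact: rmorphM].
pose H1 := GRing.isZmodMorphism.Build _ _ f fB; pose H2 := GRing.isMonoidMorphism.Build _ _ f fM.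
pose F : {rmorphism A -> {fraction D}} := HB.pack f H1 H2.
exists {fraction D}, F; split; first by move=> a b /eqP; rewrite tofrac_eq=> /eqP.
by move=> k; have [a [s]] := @fracW D k; exists a, s.
Qed.
(** Krull's theorem puts a prime [P] containing [x] strictly between the bottom of a chain of length
    two and [m]. As [y] is outside [P], [P] lies in [x A + m P] and so in [x A] by Nakayama. The
    bottom prime lies in [x A] without containing [x], hence equals [x] times itself and vanishes:
    [A] is a domain and [x A = P] is prime. *)
Lemma regular_domain (A : comNzRingType) (m : set A) : regular_local m 2 -> exists x y,
 [/\ m = [set v | exists b c, v = x * b + y * c], forall a b : A, a * b = 0 -> a = 0 \/ b = 0, x <> 0 &
   forall a b, y * a = x * b -> exists c, a = x * c].
move=> [[nA lA [[C [pC sC]] nC]] [s [ss mE]]]; have lm := proj2 (islocal_local_ring nA m) lA.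
have [im m1 mu] := lm; case: s ss mE=> [|x [|y [|]]] // _ mE.
have {mE} mE: m = [set v | exists b c, v = x * b + y * c].
 rewrite mE /ideal_gen spanE; apply/seteqP; split=> v.
  elim=> [|d z w _ zs _ [b [c ->]]]; first by exists 0, 0; rewrite !mulr0 addr0.
  rewrite -[d *: z]/(d * z); move: zs; rewrite /= !inE=> /orP[]/eqP->.
   by exists (d + b), c; ring.
  by exists b, (d + c); ring.
 move=> [b [c ->]]; rewrite [x * b]mulrC [y * c]mulrC; apply: spnD; apply: spn_mem=> //=.
have pm: prime_ideal m by split=> // a b; case: (mu a)=> [|[c ca]]; [left|right; rewrite -[b]mul1r -ca -mulrA; exact: idM].
have mx: m x by rewrite mE; exists 1, 0; ring.
have my: m y by rewrite mE; exists 0, 1; ring.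
have p i: (i <= 2)%N -> C i `<=` m by move=> /pC[iC C1 _]; exact: islocal_sub.
have [|P [pP Px s0 sm]] := krull_between nA (pC 0%N isT) (pC 1%N isT) pm (sC 0%N isT) _ mx.
 by have [C12 nC12] := sC 1%N isT; split; [exact: p|move=> mC; apply: nC12; exact: subset_trans (p 2%N isT) mC].
have [iP P1 prP] := pP; have [P0 nP0] := s0; have [Pm nPm] := sm.
have nP y': P y' -> y' = y -> False by move=> Py yE; apply: nPm; rewrite mE=> v [b [c ->]]; apply: idD=> //; apply: idMr=> //; rewrite -yE.
have nak (C0 N: set A) : is_ideal C0 -> is_ideal N -> (forall v, N v -> exists u w, [/\ C0 u, (spn m (N : set A^o)) w & v = u + w]) -> N `<=` C0.
 move=> iC iN H.
 apply: (@nakayama_fg A A^o setT m C0 N setT)=> //.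
 - exact: (proj1 (noethP A)).
 - exact/is_idealP.
 - exact/is_idealP.
 - by move=> a b _; exact: idM.
 - by move=> a b; exact: idD.
 - by move=> j; exact: islocal_unit.
have xI: is_ideal [set v | exists b, v = x * b].
 split; [by exists 0; rewrite mulr0|by move=> _ _ [b ->] [c ->]; exists (b + c); rewrite mulrDr|].
 by move=> a _ [b ->]; exists (a * b); rewrite mulrCA.
have PE v: P v -> exists b, v = x * b.
 apply: (nak _ _ xI iP)=> {}v Pv; have := Pm v Pv; rewrite mE=> -[b [c vE]].
 exists (x * b), (y * c); split=> //; first by exists b.
 have Pc: P c.
  have : P (y * c) by apply: (idDr (a := x * b)); rewrite -?vE //; exact: idMr.
  by move=> /prP[Py|//]; case: (nP y).
 rewrite -[y * c]addr0; apply: spn_cons=> //.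
 by rewrite -mE.
have pC0 := pC 0%N isT; have [iC0 C01 prC0] := pC0.
have nx0: ~ C 0%N x by move=> Cx; apply: nP0=> v /PE[b ->]; exact: idMr.
have C00 v: C 0%N v -> v = 0.
 apply: (nak [set 0] _ _ iC0) v; first by apply/is_idealP.
 move=> v Cv; have [b vE] := PE v (P0 v Cv); exists 0, (x * b); split; rewrite ?add0r //.
 rewrite -[x * b]addr0; apply: spn_cons=> //.
 by case: (prC0 x b); rewrite -?vE.
exists x, y; split=> //; first by move=> a b ab; case: (prC0 a b)=> [|/C00->|/C00->]; [rewrite ab; exact: id0|left|right].
 by move=> x0; apply: nx0; rewrite x0; exact: id0.
by move=> a b E; apply: PE; case: (prP y a)=> // [|Py]; [rewrite E; exact: idMr|case: (nP y)].
Qed.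

Section FractionField.
Variables (A : comNzRingType) (m : set A) (K : fieldType) (io : {rmorphism A -> K}) (x y : A).
Hypotheses (ioI : injective io) (mE : m = [set v | exists b c, v = x * b + y * c]).
Hypotheses (nA : noetherian A) (lm : islocal m) (x0 : x <> 0) (xy : forall a b, y * a = x * b -> exists c, a = x * c).
Notation AK := (range io).
Lemma mi_io a : mi AK (io x) (io y) (io a) <-> m a.
rewrite mE; split=> [[_ [_ [[b _ <-] [c _ <-]]]]|[b [c ->]]]; last first.
 by exists (io b), (io c); rewrite rmorphD !rmorphM.
by rewrite -!rmorphM -rmorphD=> /ioI; exists b, c.
Qed.
Lemma io_rlr2 : rlr2 AK (io x) (io y).
have [im m1 mu] := lm; have sA: subring AK.
 split; first by exists 1; rewrite ?rmorph1.
  by move=> _ _ [a _ <-] [b _ <-]; exists (a - b); rewrite ?rmorphB.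
 by move=> _ _ [a _ <-] [b _ <-]; exists (a * b); rewrite ?rmorphM.
split=> //.
- move=> N sN NA; have [|s [sN' Ns]] := proj1 (noethP A) nA (io @^-1` N) _ (fun _ _=> I).
  split; rewrite /= ?rmorph0 //.
   by move=> u v; rewrite rmorphD.
  by move=> a v _ Nv; rewrite rmorphM; apply: smodZ.
 exists [seq io a | a <- s]; split; first by move=> _ /mapP[a /sN' Na ->].
 move=> v Nv; have [a _ aE] := NA v Nv; rewrite -aE in Nv *; elim: (Ns a Nv)=> [|d z w _ zs _ IH].
  by rewrite rmorph0.
 by rewrite rmorphD rmorphM; apply: spn_cons=> //; exact: map_f.
- by rewrite -(rmorph0 io) (inj_eq ioI); apply/eqP.
- by rewrite -(rmorph1 io) mi_io.
- move=> _ [a _ <-]; rewrite mi_io=> ma; case: (mu a)=> // -[b ba]; exists b=> //.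
 by apply: (mulIf (x := io a)); [apply/eqP=> a0; move: ba=> /(congr1 io); rewrite rmorphM a0 mulr0 rmorph1=> /esym/eqP; rewrite oner_eq0|
  rewrite -rmorphM ba rmorph1 mulVf //; apply/eqP=> a0; move: ba=> /(congr1 io); rewrite rmorphM a0 mulr0 rmorph1=> /esym/eqP; rewrite oner_eq0].
- move=> _ _ [a _ <-] [b _ <-]; rewrite -!rmorphM=> /ioI/xy[c ->]; exists (io c)=> //.
 by rewrite rmorphM.
Qed.
Lemma io_infres : infinite_residue_field m -> infres AK (io x) (io y).
move=> inf s sA; apply: contrapT=> H; apply: inf.
have [s' sE]: exists s', s = map io s'.
 elim: s sA {H} => [|k s IH] sA; first by exists [::].
 have [b bs|s' ->] := IH; first by apply: sA; rewrite inE bs orbT.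
 by have [a _ <-] := sA k (mem_head _ _); exists (a :: s').
apply: (@sub_finite_set _ _ ((fun a : A=> [set b | m (b - a)]) @` [set` s'])); last exact: finite_image.
have [im m1 mu] := lm; move=> _ [a _ <-]; apply: contrapT=> na; apply: H; exists (io a); split=> //.
move=> _ /[!sE] /mapP[b bs' ->]; rewrite -rmorphB mi_io=> mab; apply: na; exists b=> //.
apply/seteqP; split=> c /= mc; first by have := idB im mc mab; rewrite opprB addrA subrK.
by have := idD im mc mab; rewrite addrA subrK.
Qed.
Lemma io_principal P : prime_ideal P -> ~ (P x /\ P y) -> exists2 g, P g & forall a, P a -> exists c, a = g * c.
move=> [iP P1 prP] nP; have ioP a: (io @` P) (io a) -> P a by move=> [b Pb /ioI <-].
have [||_ [g Pg <-] H] := prime_principal (P := io @` P) io_rlr2.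
- split; [split; [split|]| |].
 + by exists 0; [exact: id0|rewrite rmorph0].
 + by move=> _ _ [a Pa <-] [b Pb <-]; exists (a + b); [exact: idD|rewrite rmorphD].
 + by move=> _ _ [a _ <-] [b Pb <-]; exists (a * b); [exact: idM|rewrite rmorphM].
 + by move=> _ [a _ <-].
 + by rewrite -(rmorph1 io)=> /ioP.
 + by move=> _ _ [a _ <-] [b _ <-]; rewrite -rmorphM=> /ioP/prP[|]; [left|right].
- by move=> [/ioP Px /ioP Py]; exact: nP.
exists g=> // a Pa; have [|_ [c _ <-]] := H (io a)=> //.
by rewrite -rmorphM=> /ioI; exists c.
Qed.
End FractionField.

(** * Freeness of the bidual *)

Section Combinations.
Variables (A : comNzRingType) (V : lmodType A).

Definition comb n (e : 'I_n -> V) (a : 'rV[A]_n) : V := \sum_i a 0 i *: e i.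
Lemma combD n (e : 'I_n -> V) a b : comb e (a + b) = comb e a + comb e b.
by rewrite -big_split; apply: eq_bigr=> i; rewrite mxE scalerDl. Qed.
Lemma combZ n (e : 'I_n -> V) c a : comb e (c *: a) = c *: comb e a.
by rewrite scaler_sumr; apply: eq_bigr=> i; rewrite mxE scalerA. Qed.
Lemma comb0 n (e : 'I_n -> V) : comb e 0 = 0.
by rewrite -(scale0r 0) combZ scale0r. Qed.
Lemma combB n (e : 'I_n -> V) a b : comb e (a - b) = comb e a - comb e b.
by rewrite combD -[- b]scaleN1r combZ scaleN1r. Qed.
Lemma comb_delta n (e : 'I_n -> V) i : comb e (delta_mx 0 i) = e i.
rewrite /comb (bigD1 i) //= mxE !eqxx scale1r big1 ?addr0 // => j ji.
by rewrite mxE (negPf ji) scale0r.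
Qed.
Lemma spn_comb (s : seq V) v : spn setT [set` s] v -> exists a, v = comb (fun i : 'I_(size s)=> s`_i) a.
elim=> [|d x w _ xs _ [a ->]]; first by exists 0; rewrite comb0.
have xi: (index x s < size s)%N by rewrite index_mem.
by exists (d *: delta_mx 0 (Ordinal xi) + a); rewrite combD combZ comb_delta nth_index.
Qed.

(* Among the systems generating V up to a multiple outside P, take one of minimal size. *)
Lemma minimal_generators P (s : seq V) : prime_ideal P -> (forall v, spn setT [set` s] v) ->
 exists n (e : 'I_n -> V) t, [/\ ~ P t, forall v, exists a, t *: v = comb e a & forall a, comb e a = 0 -> forall i, P (a 0 i)].
move=> [iP P1 prP] gs; pose W n := `[< exists (e : 'I_n -> V) t, ~ P t /\ forall v, exists a, t *: v = comb e a >].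
have exW: exists n, W n.
 exists (size s); apply/asboolP; exists (fun i=> s`_i), 1; split=> // v.
 by have [a] := spn_comb (gs v); exists a; rewrite scale1r.
case: (ex_minnP exW)=> n /asboolP[e [t [Pt te]]] minW; exists n, e, t; split=> // a ae i.
apply: contrapT=> Pai; case: n e te minW a ae i Pai=> [|n] e te minW a ae i Pai; first by case: i Pai.
suff /minW: W n by rewrite ltnn.
apply/asboolP; exists (fun j=> e (lift i j)), (a 0 i * t); split=> [/prP[]//|v].
have [b bE] := te v; exists (\row_j (a 0 i * b 0 (lift i j) - b 0 i * a 0 (lift i j))).
have E c: comb e c = c 0 i *: e i + comb (fun j=> e (lift i j)) (\row_j c 0 (lift i j)) by rewrite/comb (bigD1_ord i) //=; congr (_ _); apply: eq_bigr=> j; rewrite mxE.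
have aE: a 0 i *: e i = - comb (fun j=> e (lift i j)) (\row_j a 0 (lift i j)) by apply/eqP; rewrite -addr_eq0 -E ae.
rewrite -scalerA bE E scalerDr scalerA mulrC -scalerA aE scalerN -!combZ addrC -combB; congr comb.
by apply/rowP=> j; rewrite !mxE.
Qed.
Lemma relations_trivial (m : set A) n (e : 'I_n -> V) p q : noetherian A -> islocal m -> m p -> m q ->
 (forall a, comb e a = 0 -> exists b c, [/\ comb e b = 0, comb e c = 0 & a = p *: b + q *: c]) ->
 forall a, comb e a = 0 -> a = 0.
move=> nA lm mp mq H; have [im _ _] := lm; have sT := @srT A.
have gT: [set: 'rV[A]_n] `<=` spn setT [set` [seq delta_mx 0 i | i <- enum 'I_n]].
 move=> a _; rewrite (row_sum_delta a); apply: smod_sum=> [|i _] //.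
 by apply: spn_mem=> //=.
have := @nakayama_fg _ _ setT m [set 0] [set a | comb e a = 0] setT; apply=> //.
- by apply: noethm_sub gT _; apply: fg_noeth=> //; exact/noethP.
- split=> /= [|a b ea eb|c a _ ea]; first exact: comb0.
  by rewrite combD eb addr0.
 by rewrite combZ ea scaler0.
- by move=> a b _; exact: idM.
- by move=> a b; exact: idD.
- by move=> j; exact: islocal_unit.
move=> a /H[b [c [eb ec aE]]]; exists 0, a; split; rewrite ?add0r // aE.
by apply: spnD; exact: spn_mem.
Qed.
End Combinations.

Section Duals.
Variables (A : comNzRingType).
Implicit Types V : lmodType A.
Lemma dual_lin V (f : dual_module V) a u v : f (a *: u + v) = a * f u + f v.
by have /asboolP := dual_valP f; exact. Qed.
Lemma dualD V (f : dual_module V) u v : f (u + v) = f u + f v.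
by rewrite -[u]scale1r dual_lin mul1r scale1r. Qed.
Lemma dual0 V (f : dual_module V) : f 0 = 0.
by apply: (addrI (f 0)); rewrite -dualD !addr0. Qed.
Lemma dualZ V (f : dual_module V) a u : f (a *: u) = a * f u.
by rewrite -[_ u]addr0 dual_lin dual0 addr0. Qed.
Lemma dual_sum V (f : dual_module V) n (F : 'I_n -> V) : f (\sum_i F i) = \sum_i f (F i).
by elim/big_rec2: _=> [|i a u _ <-]; [exact: dual0|rewrite dualD]. Qed.
Lemma dual_eq V (f g : dual_module V) : (forall v, f v = g v) -> f = g.
by move=> fg; apply: val_inj; apply/funext. Qed.
Lemma ex_dual V (f : V -> A) : (forall a u v, f (a *: u + v) = a * f u + f v) -> exists g : dual_module V, forall v, g v = f v.
move=> fL; have P: f \in @linear_form A V by [].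
by exists (DualModule P).
Qed.
Lemma dual_scaleE V a (f : dual_module V) v : (a *: f) v = a * f v. by []. Qed.
Lemma dual_sumE V n (F : 'I_n -> dual_module V) v : (\sum_i F i) v = \sum_i F i v.
by elim/big_rec2: _=> [|i a u _ <-]. Qed.
(** A form is determined by its values on the generators, which embeds the dual into a finite free
    module over a Noetherian ring. *)
Lemma dual_fg V (s : seq V) : noetherian A -> (forall v, spn setT [set` s] v) ->
 exists t : seq (dual_module V), forall f, spn setT [set` t] f.
move=> nA gs; pose ev (f : dual_module V) : 'rV_(size s) := \row_i f s`_i.
have ev_inj f g: ev f = ev g -> f = g.
 move=> fg; apply: dual_eq=> v; have [a ->] := spn_comb (gs v); rewrite !dual_sum; apply: eq_bigr=> i _.
 by rewrite !dualZ; congr (_ _); have /rowP/(_ i) := fg; rewrite !mxE.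
have gT: [set: 'rV[A]_(size s)] `<=` spn setT [set` [seq delta_mx 0 i | i <- enum 'I_(size s)]].
 move=> a _; rewrite (row_sum_delta a); apply: smod_sum=> [|i _] //.
 by apply: spn_mem=> //=.
have [|//|t [tN Nt]] := noethm_sub gT (fg_noeth (@srT A) (proj1 (noethP A) nA)) (N := range ev).
 split=> [|_ _ [f _ <-] [g _ <-]|a _ _ [f _ <-]].
 - by exists 0=> //; apply/rowP=> i; rewrite !mxE.
 - by exists (f + g)=> //; apply/rowP=> i; rewrite !mxE.
 - by exists (a *: f)=> //; apply/rowP=> i; rewrite !mxE.
have [u uE]: exists u, t = map ev u.
 elim: t tN {Nt} => [|b t IH] tN; first by exists [::].
 have [c ct|u ->] := IH; first by apply: tN; rewrite inE ct orbT.
 by have [f _ <-] := tN b (mem_head _ _); exists (f :: u).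
exists u=> f; suff [g gu /ev_inj <- //]: exists2 g, spn setT [set` u] g & ev g = ev f.
have : spn setT [set` t] (ev f) by apply: Nt.
elim=> [|d x w _ xt _ [g gu gE]]; first by exists 0; [|apply/rowP=> i; rewrite !mxE].
move: xt; rewrite uE=> /mapP[h hu ->]; exists (d *: h + g); first exact: spn_cons.
by apply/rowP=> i; rewrite -gE !mxE.
Qed.
End Duals.

Section Bidual.
Variables (A : comNzRingType) (m : set A) (x y : A) (M : lmodType A).
Hypotheses (nA : noetherian A) (lm : islocal m) (dA : forall a b : A, a * b = 0 -> a = 0 \/ b = 0).
Hypotheses (mE : m = [set v | exists b c, v = x * b + y * c]) (x0 : x <> 0).
Hypothesis xy : forall a b, y * a = x * b -> exists c, a = x * c.
Hypothesis prin : forall P, prime_ideal P -> ~ (P x /\ P y) -> exists2 g, P g & forall a, P a -> exists c, a = g * c.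
Variable s : seq M.
Hypotheses (gs : forall v, spn setT [set` s] v) (tf : torsion_free M).
Notation F := (dual_module (dual_module M)).
Notation X := (bidual_image M).
(** At a prime [P = g A] the module is free: relations among minimal generators have coefficients
    divisible by [g], and by torsion-freeness the quotient is again a relation, so Nakayama leaves
    none. Coordinates of [t v] are then linear in [v]. *)
Lemma local_coordinates P : prime_ideal P -> ~ (P x /\ P y) -> exists n (e : 'I_n -> M) (f : 'I_n -> dual_module M) t,
 ~ P t /\ forall v, t *: v = \sum_i f i v *: e i.
move=> pP nP; have [iP P1 _] := pP; have [g Pg gP] := prin pP nP; have mg := islocal_sub lm iP P1 Pg.
have [n [e [t [Pt te rel]]]] := minimal_generators pP gs.
have ind: forall a, comb e a = 0 -> a = 0.
 apply: (relations_trivial nA lm mg mg)=> a ea; have [b bE]: exists b, a = g *: b.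
  have H i: exists c, a 0 i = g * c by exact: gP (rel a ea i).
  by exists (\row_i projT1 (cid (H i))); apply/rowP=> i; rewrite !mxE; case: cid.
 have : g *: comb e b = 0 by rewrite -combZ -bE.
 case/tf=> [g0|eb]; first by exists 0, 0; rewrite comb0 bE g0 !scale0r addr0.
 by exists b, 0; rewrite comb0 scaler0 addr0.
pose c v := projT1 (cid (te v)); have cE v: t *: v = comb e (c v) by rewrite /c; case: cid.
have cL a u v: c (a *: u + v) = a *: c u + c v by apply/eqP; rewrite -subr_eq0; apply/eqP/ind; rewrite combB combD combZ -!cE scalerDr !scalerA mulrC subrr.
have H i: exists g : dual_module M, forall v, g v = c v 0 i by apply: ex_dual=> a u v; rewrite cL !mxE.
exists n, e, (fun i=> projT1 (cid (H i))), t; split=> // v; rewrite cE; apply: eq_bigr=> i _.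
by case: cid=> h ->.
Qed.
Lemma local_reflexive P : prime_ideal P -> ~ (P x /\ P y) -> exists2 t, ~ P t & forall v : F, X (t *: v).
move=> pP nP; have [n [e [f [t [Pt tE]]]]] := local_coordinates pP nP; exists t=> // v.
exists (\sum_i v (f i) *: e i)=> //; apply: dual_eq=> h; rewrite dual_scaleE -dualZ.
have ->: t *: h = \sum_i (h (e i) : A) *: f i.
 apply: dual_eq=> w; rewrite dual_scaleE -dualZ tE dual_sum dual_sumE; apply: eq_bigr=> i _.
 by rewrite dualZ mulrC.
by rewrite [LHS]dual_sum dual_sum; apply: eq_bigr=> i; rewrite !dualZ mulrC.
Qed.
(** The ideal of multipliers from the bidual into [M] lies in no prime other than the maximal one,
    by [local_reflexive]; so no prime avoids the powers of [a] and contains it. *)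
Lemma bidual_power a : a = x \/ a = y -> exists k, forall v : F, X (a ^+ k *: v).
move=> axy; apply: contrapT=> H; pose I := [set t | forall v : F, X (t *: v)].
have iI: is_ideal I.
 split=> [v|b c Ib Ic v|b c Ic v].
 - by rewrite scale0r; exists 0=> //; apply: dual_eq; exact: dual0.
 - have [u _ uE] := Ib v; have [w _ wE] := Ic v; exists (u + w)=> //.
  by apply: dual_eq=> h; rewrite scalerDl -uE -wE; exact: dualD.
 - have [u _ uE] := Ic v; exists (b *: u)=> //.
  by apply: dual_eq=> h; rewrite -scalerA -uE; exact: dualZ.
have [|||P [pP IP TP]] := prime_avoiding (T := [set b | exists k, b = a ^+ k]) nA iI.
- by exists 0%N.
- by move=> _ _ [k ->] [l ->]; exists (k + l)%N; rewrite exprD.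
- by move=> _ [k ->] Ik; apply: H; exists k.
have [|t Pt tX] := local_reflexive pP; last by apply: Pt; exact: IP.
by move=> [Px Py]; case: (TP a); [exists 1%N|case: axy=> ->].
Qed.
Lemma bidual_neq0 : (exists v : M, v <> 0) -> exists v : F, v <> 0.
move=> [v v0]; have p0: prime_ideal [set (0 : A)].
 split; [exact/is_idealP|by apply/eqP; rewrite oner_eq0|by []].
have [|n [e [f [t [t0 tE]]]]] := local_coordinates p0; first by move=> [].
exists (bidual_map v)=> bv; have := tE v; rewrite big1=> [/tf[]//|i _].
by rewrite -[f i v]/(bidual_map v (f i)) bv scale0r.
Qed.
Lemma dual_saturated (W : lmodType A) (f g : dual_module W) : y *: f = x *: g -> exists h, f = x *: h.
move=> E; have H v: exists c, f v = x * c by apply: xy; rewrite -!dual_scaleE E.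
pose c v := projT1 (cid (H v)); have cE v: f v = x * c v by rewrite /c; case: cid.
have [|h hE] := @ex_dual A W c; last by exists h; apply: dual_eq=> v; rewrite dual_scaleE hE.
move=> a u v; suff : x * (c (a *: u + v) - (a * c u + c v)) = 0 by case/dA=> // /eqP; rewrite subr_eq0=> /eqP.
by rewrite mulrBr -cE dual_lin !cE; ring.
Qed.
(** A dual module has depth two: [y f = x g] makes [f] divisible by [x]. A relation among minimal
    generators has coefficients [x a1 + y a2]; the divisibility gives a [d] for which [a1 + y d] and
    [a2 - x d] are relations too, so the relations lie in [m] times themselves and vanish. *)
Theorem bidual_free : (exists v : M, v <> 0) ->
 exists r (b : 'I_r.+1 -> F), (forall v, exists a, v = comb b a) /\ (forall a, comb b a = 0 -> a = 0).
move=> /bidual_neq0[v0 nv0]; have [s1 gs1] := dual_fg nA gs; have [s2 gs2] := dual_fg nA gs1.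
have [im m1 mu] := lm; have pm: prime_ideal m.
 by split=> // a b; case: (mu a)=> [|[c ca]]; [left|right; rewrite -[b]mul1r -ca -mulrA; exact: idM].
have [n [b [t [mt te rel]]]] := minimal_generators pm gs2.
have gen v: exists a, v = comb b a.
 case: (mu t)=> // -[u ut]; have [a aE] := te v; exists (u *: a).
 by rewrite combZ -aE scalerA ut scale1r.
have xreg (v: F) : x *: v = 0 -> v = 0.
 move=> xv; apply: dual_eq=> h; have : (x *: v) h = 0 by rewrite xv.
 by rewrite dual_scaleE=> /dA[].
have ind: forall a, comb b a = 0 -> a = 0.
 apply: (relations_trivial nA lm (p := x) (q := y)).
 - by rewrite mE; exists 1, 0; ring.
 - by rewrite mE; exists 0, 1; ring.
 move=> a ab; have H i: exists c : A * A, a 0 i = x * c.1 + y * c.2 by have := rel a ab i; rewrite mE=> -[c [d]]; exists (c, d).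
 pose a1 : 'rV_n := \row_i (projT1 (cid (H i))).1; pose a2 : 'rV_n := \row_i (projT1 (cid (H i))).2.
 have aE: a = x *: a1 + y *: a2 by apply/rowP=> i; rewrite !mxE; case: cid.
 have E: y *: comb b a2 = x *: (- comb b a1) by apply/eqP; rewrite scalerN -subr_eq0 opprK addrC -!combZ -combD -aE ab.
 have [w wE] := dual_saturated E; have [d dE] := gen w.
 exists (a1 + y *: d), (a2 - x *: d); split.
 - apply: xreg; rewrite combD combZ scalerDr -dE scalerA mulrC -scalerA -wE E scalerN subrr //.
 - by rewrite combB combZ -dE wE subrr.
 - by rewrite aE; apply/rowP=> i; rewrite !mxE; ring.
case: n b te rel gen ind=> [|r] b te rel gen ind; last by exists r, b.
by case: nv0; have [a] := gen v0; rewrite /comb big_ord0.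
Qed.
End Bidual.

(** * Rees algebras inside polynomial rings *)
Lemma monn_const r (K : fieldType) (g : seq {mpoly K[r]}) n w : (forall u, u \in g -> u \is 1.-homog) ->
 monn g n.+1 w -> w@_0%MM = 0.
by move=> g1 mw; apply: (dhomog_nemf_coeff (monn_homog g1 mw)); rewrite /= mdeg0. Qed.

Section HomogeneousParts.
Variables (r : nat) (K : fieldType) (A : set K) (g : seq {mpoly K[r.+1]}).
Hypothesis g1 : forall u, u \in g -> u \is 1.-homog.
Notation hc n := (@pihomog r.+1 K (@mdeg r.+1) n).
Lemma hc_spn n u : spn A (mon g) u -> spn A (monn g n) (hc n u).
elim=> [|d w v Ad [k mk] _ IH]; first by rewrite pihomog0.
rewrite pihomogD linearZ /=; apply: spnD=> //; have hw := monn_homog g1 mk.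
have [kn|kn] := eqVneq k n; first by rewrite -kn pihomog_dE //; exact: spn_mem.
by rewrite (pihomog_ne0 kn hw) scaler0.
Qed.
Lemma hc0E (u : {mpoly K[r.+1]}) : hc 0 u = (u@_0%MM)%:MP.
apply/mpolyP=> n; rewrite mcoeffC; have h0: hc 0 u \is 0.-homog by exact: pihomogP.
have [->|n0] := eqVneq; last by rewrite mulr0 (dhomog_nemf_coeff h0) // mdeg_eq0.
have [N uE] := hc_sum u; rewrite mulr1 [in RHS](uE N.+1 (leqnSn N)) big_ord_recl mcoeffD.
rewrite [X in _ + X](raddf_sum (mcoeff 0%MM))big1 ?addr0 // => i _.
have hi: hc (lift ord0 i) u \is (lift ord0 i).-homog by exact: pihomogP.
by apply: (dhomog_nemf_coeff hi); rewrite /= mdeg0.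
Qed.
End HomogeneousParts.

Section SymPoly.
Variables (A : comNzRingType) (K : fieldType) (io : {rmorphism A -> K}) (F : lmodType A) (r : nat) (b : 'I_r.+1 -> F).
Hypotheses (ioI : injective io) (bgen : forall v, exists a, v = comb b a) (bind : forall a, comb b a = 0 -> a = 0).
Notation E := {mpoly K[r.+1]}.
Notation AK := (range io).
Implicit Types (v : F) (z : sym_alg F).
Lemma io_subring : subring AK.
split; first by exists 1; rewrite ?rmorph1.
 by move=> _ _ [a _ <-] [c _ <-]; exists (a - c); rewrite ?rmorphB.
by move=> _ _ [a _ <-] [c _ <-]; exists (a * c); rewrite ?rmorphM.
Qed.
Let sA := io_subring.

Definition co v := projT1 (cid (bgen v)).
Lemma coE v : v = comb b (co v). by rewrite /co; case: cid. Qed.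
Lemma co_lin a v w : co (a *: v + w) = a *: co v + co w.
by apply/eqP; rewrite -subr_eq0; apply/eqP/bind; rewrite combB combD combZ -!coE subrr. Qed.
Definition lin v : E := \sum_i io (co v 0 i) *: 'X_i.
Lemma lin_lin a v w : lin (a *: v + w) = io a *: lin v + lin w.
rewrite /lin co_lin scaler_sumr -big_split; apply: eq_bigr=> i _ /=.
by rewrite !mxE rmorphD rmorphM scalerDl scalerA.
Qed.
Lemma linD v w : lin (v + w) = lin v + lin w.
by rewrite -[v]scale1r lin_lin rmorph1 !scale1r. Qed.
Lemma lin0 : lin 0 = 0. by apply: (addrI (lin 0)); rewrite -linD !addr0. Qed.
Lemma linZ a v : lin (a *: v) = io a *: lin v.
by rewrite -[_ v]addr0 lin_lin lin0 addr0. Qed.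
Lemma lin_b i : lin (b i) = 'X_i.
have ->: b i = comb b (delta_mx 0 i) by rewrite comb_delta.
have coK a: co (comb b a) = a by apply/eqP; rewrite -subr_eq0; apply/eqP/bind; rewrite combB -coE subrr.
rewrite /lin coK (bigD1 i) //= mxE !eqxx rmorph1 scale1r big1 ?addr0 // => j ji.
by rewrite mxE (negPf ji) rmorph0 scale0r.
Qed.
Lemma lin_homog v : lin v \is 1.-homog.
by apply: rpred_sum=> i _; apply: rpredZ; rewrite dhomogX /= mdeg1. Qed.
Lemma lin_mcf v : mcf AK (lin v).
have sM := mcf_smod r.+1 sA (self_ideal sA); apply: smod_sum=> // i _.
by apply: (smodZ sM); [|exact: mcfX].
Qed.
Lemma lin_inj v w : lin v = lin w -> v = w.
move=> E; rewrite (coE v) (coE w); congr comb; apply/rowP=> i; apply: ioI.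
have coef u: (lin u)@_U_(i) = io (co u 0 i).
 rewrite raddf_sum (bigD1 i) //= big1 ?addr0=> [|j ji]; rewrite mcoeffZ mcoeffXU ?eqxx ?mulr1 //.
 by rewrite (negPf ji) mulr0.
by rewrite -!coef E.
Qed.
Lemma lin_onto (u : E) : u \is 1.-homog -> mcf AK u -> exists v, u = lin v.
move=> hu cu; exists (\sum_i projT1 (cid2 (cu U_(i)%MM)) *: b i); rewrite {1}(homog1E hu).
elim/big_rec2: _=> [|i v w _ ->]; first by rewrite lin0.
by rewrite linD linZ lin_b; case: cid2=> c _ ->.
Qed.

Fixpoint sev (t : sym_term F) : E := match t with
 | SymConst a=> (io a)%:MP | SymGen v=> lin v | SymAdd t u=> sev t + sev u
 | SymMul t u=> sev t * sev u | SymOpp t=> - sev t end.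
Lemma sev_cong t u : sym_cong t u -> sev t = sev u.
elim=> //= {t u}.
- by move=> t u v _ ->.
- by move=> t t' u u' _ -> _ ->.
- by move=> t t' u u' _ -> _ ->.
- by move=> t t' _ ->.
- by move=> t u v; rewrite addrA.
- by move=> t u; rewrite addrC.
- by move=> t; rewrite rmorph0 add0r.
- by move=> t; rewrite rmorph0 addNr.
- by move=> t u v; rewrite mulrA.
- by move=> t u; rewrite mulrC.
- by move=> t; rewrite rmorph1 mul1r.
- by move=> t u v; rewrite mulrDl.
- by move=> a c; rewrite rmorphD mpolyCD.
- by move=> a c; rewrite rmorphM mpolyCM.
- by move=> v w; rewrite linD.
- by move=> a v; rewrite linZ mul_mpolyC.
Qed.
Definition psi z : E := sev (repr z).
Lemma psiE t : psi (\pi_(sym_alg F) t)%qT = sev t.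
by apply/sev_cong/sym_piP; rewrite reprK. Qed.
Lemma psi_zmod : zmod_morphism psi.
elim/quotW=> t; elim/quotW=> u.
transitivity (psi (sym_add (\pi_(sym_alg F) t) (sym_opp (\pi_(sym_alg F) u)))%qT)=> //.
by rewrite -sym_oppE -sym_addE !psiE.
Qed.
Lemma psi_const a : psi (sym_const F a) = (io a)%:MP.
by unlock sym_const; rewrite psiE. Qed.
Lemma psi_gen v : psi (sym_gen v) = lin v.
by unlock sym_gen; rewrite psiE. Qed.
Lemma psi_monoid : monoid_morphism psi.
split; first by transitivity (psi (sym_const F 1)); rewrite psi_const rmorph1.
elim/quotW=> t; elim/quotW=> u.
transitivity (psi (sym_mul (\pi_(sym_alg F) t) (\pi_(sym_alg F) u))%qT)=> //.
by rewrite -sym_mulE !psiE.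
Qed.
HB.instance Definition _ := GRing.isZmodMorphism.Build _ _ psi psi_zmod.
HB.instance Definition _ := GRing.isMonoidMorphism.Build _ _ psi psi_monoid.
Lemma psiZ a z : psi (a *: z) = io a *: psi z.
by transitivity (psi (sym_const F a * z)); rewrite rmorphM /= psi_const mul_mpolyC. Qed.
Lemma constE a : a *: (1 : sym_alg F) = sym_const F a. exact: mulr1. Qed.
(** The substitution [th] from polynomials over [A] to the symmetric algebra is onto, because it
    reaches constants and generators, and [psi] after [th] is the coefficientwise embedding by
    [io]. *)
Lemma psi_inj : injective psi.
pose th p : sym_alg F := mmap (in_alg (sym_alg F)) (fun i=> sym_gen (b i)) p.
have thD p q: th (p + q) = th p + th q by exact: rmorphD.
have thM p q: th (p * q) = th p * th q by exact: rmorphM.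
have thN p: th (- p) = - th p by exact: rmorphN.
have onto z: exists p, th p = z.
 elim/quotW: z=> t; elim: t=> [a|v|t [p pE] u [q qE]|t [p pE] u [q qE]|t [p pE]].
 - by exists a%:MP; rewrite /th mmapC /= constE; unlock sym_const.
 - exists (\sum_i co v 0 i *: 'X_i); rewrite /th raddf_sum /=.
  transitivity (\sum_i co v 0 i *: sym_gen (b i)).
   by apply: eq_bigr=> i; rewrite mmapZ mmapX mmap1U -scalerAl mul1r.
  transitivity (sym_gen v); last by unlock sym_gen.
  have gZ a (w: F) : sym_gen (a *: w) = a *: sym_gen w.
   rewrite -[RHS]/(sym_mul (sym_const F a) (sym_gen w)); unlock sym_const sym_gen.
   by rewrite -sym_mulE; apply/sym_piP; exact: sym_genZ.
  have gD (w w': F) : sym_gen (w + w') = sym_gen w + sym_gen w'.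
   rewrite -[RHS]/(sym_add (sym_gen w) (sym_gen w')); unlock sym_gen.
   by rewrite -sym_addE; apply/sym_piP; exact: sym_genD.
  rewrite {2}(coE v) /comb; elim/big_rec2: _=> [|i w z _ ->]; last by rewrite gD gZ.
  by apply: (addrI (sym_gen 0)); rewrite -gD !addr0.
 - by exists (p + q); rewrite thD pE qE sym_addE.
 - by exists (p * q); rewrite thM pE qE sym_mulE.
 - by exists (- p); rewrite thN pE sym_oppE.
have psith p: psi (th p) = map_mpoly io p.
 rewrite rmorph_sum; apply: eq_bigr=> m _; rewrite rmorphM /= constE psi_const; congr (_ _).
 by rewrite rmorph_prod; apply: eq_bigr=> i; rewrite rmorphXn /= psi_gen lin_b.
move=> z w E; apply/eqP; rewrite -subr_eq0; have [q qE] := onto (z - w); rewrite -qE.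
suff ->: q = 0 by rewrite /th mmap0.
by apply/mpolyP=> m; apply: ioI; rewrite -mcoeff_map_mpoly -psith qE rmorphB /= E subrr !mcoeff0 rmorph0.
Qed.
Variables (X : set F) (s : seq F).
Hypothesis XE : X = spn setT [set` s].
Notation g := [seq lin v | v <- s].
Notation S := (rees_ring X).
Lemma g_homog u : u \in g -> u \is 1.-homog.
by move=> /mapP[v _ ->]; exact: lin_homog. Qed.
Lemma g_mcf u : u \in g -> mcf AK u.
by move=> /mapP[v _ ->]; exact: lin_mcf. Qed.
Lemma lin_X v : X v <-> spn AK (monn g 1) (lin v).
rewrite XE; split.
 elim=> [|a w v' _ ws _ IH]; first by rewrite lin0.
 by rewrite lin_lin; apply: spn_cons=> //; apply/monn_gen/map_f.
move=> gv; have [w Xw /lin_inj <- //]: exists2 w, spn setT [set` s] w & lin w = lin v.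
elim: gv=> [|_ _ u [a _ <-] /monn_inv[_ [w1 [/mapP[w ws ->] m0 ->]]] _ [w' Xw' <-]].
 by exists 0; [|exact: lin0].
exists (a *: w + w'); first exact: spn_cons.
by rewrite lin_lin; inversion m0; rewrite mulr1.
Qed.
Notation hc n := (@pihomog r.+1 K (@mdeg r.+1) n).
Lemma rees_lin a z w : rees X z -> rees X w -> rees X (a *: z + w).
by move=> [u _ <-] [v _ <-]; exists (a *: u + v)=> //; rewrite /Defs.rees_map linearP. Qed.
Lemma rees_M z w : rees X z -> rees X w -> rees X (z * w).
by move=> [u _ <-] [v _ <-]; exists (u * v)=> //; rewrite /Defs.rees_map rmorphM. Qed.
Lemma rees_1 : rees X 1. by exists 1=> //; rewrite /Defs.rees_map rmorph1. Qed.
Lemma rees_0 : rees X 0. by exists 0=> //; exact: raddf0. Qed.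
Lemma rees_gen v : v \in s -> rees X (sym_gen v).
move=> vs; have Xv: v \in in_span X by apply/asboolP; rewrite spanE; rewrite XE.
exists (sym_gen (SpanModule Xv))=> //; unlock sym_gen.
by rewrite /Defs.rees_map sym_mapE.
Qed.
Lemma rees_psi z : rees X z -> spn AK (mon g) (psi z).
have sR := rees_subringP g sA; move=> [u _ <-]; elim/quotW: u=> t; rewrite /Defs.rees_map sym_mapE psiE.
elim: t=> [a|v|||] /= //.
- by rewrite -[_%:MP]mulr1 mul_mpolyC; apply: spn_mem; [|exact: mon1].
- have sX: smod setT X by rewrite XE.
 have Xv: X (val v) by have /asboolP := span_valP v; rewrite spanE=> /(spn_min sX (fun _ h=> h)).
 by move/lin_X: Xv; apply: spn_mono=> //; exists 1%N.
Qed.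
Lemma degree_homog n z : sym_degree n z -> psi z \is n.-homog.
rewrite /sym_degree spanE; elim=> [|d w v _ [f _ <-] _ IH]; first by rewrite rmorph0 dhomog0.
rewrite rmorphD /= psiZ; apply: rpredD=> //; apply: rpredZ; rewrite rmorph_prod.
under eq_bigr do rewrite /= psi_gen.
by elim: n f {IH} => [|n IH] f; [rewrite big_ord0 dhomog1|rewrite big_ord_recl; exact: (dhomogM (lin_homog _) (IH _))].
Qed.
Lemma monn_rees n u : spn AK (monn g n) u -> exists2 z, rees_degree X n z & psi z = u.
have H w: monn g n w -> exists f : 'I_n -> F, (forall i, f i \in s) /\ w = psi (\prod_i sym_gen (f i)).
 elim: {u} n w=> [|n IH] w mw; first by exists (fun=> 0); split; [case|inversion mw; rewrite big_ord0 rmorph1].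
 have [_ [w' [/mapP[v vs ->] /IH[f [fs ->]] ->]]] := monn_inv mw.
 exists (fun i=> if unlift ord0 i is Some j then f j else v); split; first by move=> i; case: unlift.
 by rewrite big_ord_recl unlift_none rmorphM /= psi_gen; under [in RHS]eq_bigr do rewrite liftK.
have [d0 dD dZ] := span_submod (range (fun x : 'I_n -> F=> \prod_(i < n) sym_gen (x i))).
elim=> [|_ w v [a _ <-] /H[f [fs ->]] _ [z [rz dz] <-]].
 by exists 0; [split; [exact: rees_0|]|exact: rmorph0].
exists (a *: \prod_i sym_gen (f i) + z); last by rewrite rmorphD /= psiZ.
split; last by apply: dD=> //; apply: dZ=> N [_ NX]; apply: NX.
apply: rees_lin=> //; apply: big_ind=> [||i _]; [exact: rees_1|exact: rees_M|exact: rees_gen].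
Qed.
Lemma rees_degreeP n z : rees_degree X n z <-> spn AK (monn g n) (psi z).
split=> [[/rees_psi/(hc_spn g_homog n) H /degree_homog hz]|/monn_rees[w rw /psi_inj <-] //].
by rewrite pihomog_dE in H.
Qed.
Lemma reesP z : rees X z <-> spn AK (mon g) (psi z).
split=> [|H]; first exact: rees_psi.
have [w rw /psi_inj <- //]: exists2 w, rees X w & psi w = psi z.
elim: H=> [|_ w v [a _ <-] [n mw] _ [z' rz <-]]; first by exists 0; [exact: rees_0|exact: rmorph0].
have [w' [rw _] <-] := monn_rees (spn_gen (sr1 sA) mw).
by exists (a *: w' + z'); [exact: rees_lin|rewrite rmorphD /= psiZ].
Qed.
Lemma ratliff_rushP v : ratliff_rush X v <->
 exists2 l, (0 < l)%N & forall u, spn AK (monn g l) u -> spn AK (monn g l.+1) (lin v * u).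
split=> -[l l0 H]; exists l=> //.
 by move=> _ /monn_rees[z rz <-]; rewrite -psi_gen -rmorphM; apply/rees_degreeP/H.
by move=> z /rees_degreeP/H; rewrite -psi_gen -rmorphM=> /rees_degreeP.
Qed.

Definition rho (z : S) : E := psi (val z).
Lemma rho_zmod : zmod_morphism rho. by move=> u v; rewrite /rho !rmorphB. Qed.
Lemma rho_monoid : monoid_morphism rho. by split=> [|u v]; rewrite /rho ?rmorph1 ?rmorphM. Qed.
HB.instance Definition _ := GRing.isZmodMorphism.Build _ _ rho rho_zmod.
HB.instance Definition _ := GRing.isMonoidMorphism.Build _ _ rho rho_monoid.
Definition rhom : {rmorphism S -> E} := rho.
Lemma rho_inj : injective rho. by move=> u v /psi_inj/val_inj. Qed.
Lemma rho_spn (z : S) : spn AK (mon g) (rho z).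
by apply/reesP; have /asboolP := rees_valP z. Qed.
Lemma rho_onto u : spn AK (mon g) u -> exists z : S, rho z = u.
have H z: rees X z -> exists w : S, val w = z by move=> /asboolP rz; exists (ReesRing rz).
move=> gu; have [z rz]: exists2 z, rees X z & psi z = u; last by have [w <-] := H z rz; exists w.
elim: gu=> [|_ w v [a _ <-] [n mw] _ [z' rz <-]]; first by exists 0; [exact: rees_0|exact: rmorph0].
have [w' [rw _] <-] := monn_rees (spn_gen (sr1 sA) mw).
by exists (a *: w' + z'); [exact: rees_lin|rewrite rmorphD /= psiZ].
Qed.
Lemma integral_closureP v : module_integral_closure X v <-> Rb AK g 1 (lin v).
split=> [[p mp rp]|[_ /(int_minteg sA)[p [mp Rp rp]]]].
 split; first exact: lin_homog.
 apply: minteg_int=> //; exists (map_poly rho p); split.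
 - exact: monic_map.
 - by move=> i; rewrite coef_map; exact: rho_spn.
 - have ->: map_poly rho p = map_poly psi (map_poly val p) by rewrite -map_poly_comp.
  by rewrite -psi_gen; exact: rmorph_root.
have H i: exists z : S, rho z = p`_i by apply: rho_onto; exact: Rp.
pose q := \poly_(i < size p) projT1 (cid (H i)).
have qE: map_poly rho q = p.
 apply/polyP=> i; rewrite coef_map coef_poly; case: ltnP=> ip; first by case: cid.
 by rewrite nth_default //; exact: rmorph0.
exists q.
 apply/monicP/rho_inj; rewrite -(lead_coef_map_inj rho_inj (rmorph0 _)) qE rmorph1; exact/monicP.
have : root (map_poly psi (map_poly val q)) (psi (sym_gen v)) by rewrite -map_poly_comp psi_gen [map_poly _ _]qE.
by rewrite /root horner_map -(rmorph0 psi) (inj_eq psi_inj).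
Qed.
(** The ideal contains everything of positive degree, so the constant term decides; conversely [z]
    is recovered as the sum of its homogeneous parts, each of which belongs to the Rees algebra. *)
Lemma max_idealP m (z : S) : is_ideal m -> rees_max_ideal m z <-> exists2 a, m a & (rho z)@_0%MM = io a.
move=> im; have wc n w: monn g n.+1 w -> w@_0%MM = 0.
 exact: monn_const g_homog.
have c0 u: spn AK (mon g) u -> exists a, u@_0%MM = io a.
 elim=> [|_ w v [a _ <-] [n mw] _ [c vE]]; first by exists 0; rewrite mcoeff0 rmorph0.
 rewrite mcoeffD mcoeffZ vE; case: n mw=> [|n] mw; first by inversion mw; exists (a + c); rewrite mcoeff1 eqxx mulr1 rmorphD.
 by exists c; rewrite (wc n) // mulr0 add0r.
rewrite /rees_max_ideal /= spanE; split=> [|[a ma zE]].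
 rewrite -[rho z]/(psi (rees_val z)); elim=> [|d w v _ Hw _ [c mc vE]]; first by exists 0; [exact: id0|rewrite rmorph0 mcoeff0 rmorph0].
 suff [c' mc' wE]: exists2 c', m c' & (psi w)@_0%MM = io c'.
  exists (d * c' + c); first by apply: idD=> //; exact: idM.
  by rewrite rmorphD /= psiZ mcoeffD mcoeffZ wE vE rmorphD rmorphM.
 case: Hw=> [|[n /= n0 /rees_degreeP]].
  rewrite /smul spanE; elim=> [|e _ v' _ [c1 [u [mc1 /rees_psi/c0[c2 uE] ->]]] _ [c' mc' vE']].
   by exists 0; [exact: id0|rewrite rmorph0 mcoeff0 rmorph0].
  exists (e * (c1 * c2) + c'); last by rewrite rmorphD /= !psiZ mcoeffD !mcoeffZ uE vE' rmorphD !rmorphM.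
  by apply: idD=> //; apply: idM=> //; exact: idMr.
 case: n n0=> // n _ wn; exists 0; first exact: id0.
 elim: wn=> [|e u v' _ mu _ IH]; first by rewrite mcoeff0 rmorph0.
 by rewrite mcoeffD mcoeffZ IH rmorph0 addr0 (wc n) // mulr0.
suff H k: exists2 w, spn setT (smul m (rees X) `|` \bigcup_(n in [set n | (0 < n)%N]) rees_degree X n) w &
  psi w = \sum_(i < k.+1) hc i (rho z).
 have [w Sw wE] := H (mmeasure mdeg (rho z)); have <- //: w = val z.
 by apply: psi_inj; rewrite wE -pihomog_partitionE.
elim: k=> [|k [w Sw wE]].
 exists (a *: 1); last first.
  by rewrite constE psi_const big_ord1 hc0E zE.
 apply: spn_gen=> //; left; rewrite /smul spanE; apply: spn_gen=> //.
 by exists a, 1; split=> //; exists 1=> //; exact: rmorph1.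
have [w' rw' w'E] := monn_rees (hc_spn g_homog k.+1 (rho_spn z)).
exists (w + w'); last by rewrite rmorphD /= wE w'E [RHS]big_ord_recr.
by apply: spnD=> //; apply: spn_gen=> //; right; exists k.+1.
Qed.
End SymPoly.

(** * The Buchsbaum property of a Rees algebra *)

Section Noetherian.
Variables (S : comNzRingType) (R : comPzRingType) (f : {rmorphism S -> R}).
Lemma noetherian_of_range : injective f -> noeth (range f) -> noetherian S.
move=> fI nF; apply/noethP=> I sI _; have [||t [tI It]] := nF (f @` I).
- split; first by exists 0; [|exact: rmorph0].
  by move=> _ _ [a Ia <-] [c Ic <-]; exists (a + c); [|exact: rmorphD].
 by move=> _ _ [a _ <-] [c Ic <-]; exists (a * c); [exact: smodZ|exact: rmorphM].
- by move=> _ [a _ <-].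
have [u [uI uE]]: exists u, (forall a, a \in u -> I a) /\ t = map f u.
 elim: t tI {It} => [|b t IH] tI; first by exists [::].
 have [c ct|u [uI ->]] := IH; first by apply: tI; rewrite inE ct orbT.
 have [a Ia <-] := tI b (mem_head _ _); exists (a :: u); split=> // c.
 by rewrite inE=> /predU1P[->|/uI].
exists u; split=> // a Ia; have [c cu /fI <- //]: exists2 c, spn setT ([set` u] : set S^o) c & f c = f a.
have : spn (range f) ([set` t] : set R^o) (f a) by apply: It.
elim=> [|_ w v [d _ <-] wt _ [c cu <-]]; first by exists 0; [|exact: rmorph0].
move: wt; rewrite uE=> /mapP[e eu ->]; exists (d * e + c); last by rewrite rmorphD rmorphM.
exact: spn_cons.
Qed.
End Noetherian.
Lemma noeth_mon r (K : fieldType) (A : set K) (g : seq {mpoly K[r]}) : subring A -> noeth A -> noeth (spn A (mon g)).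
move=> sA nA; elim: g=> [|u g IH].
 move=> I sI IA; have sI': smod A ([set a | I a%:MP] : set K^o).
  split; first by rewrite /=; exact: smod0 sI.
   by move=> a b; rewrite /= mpolyCD; exact: (smodD sI).
  move=> a b Aa Ib; rewrite /= mpolyCM; apply: smodZ=> //.
  by rewrite -[_%:MP]mulr1 mul_mpolyC; apply: spn_mem=> //; exact: mon1.
 have cst (v: {mpoly K[r]}) : spn A (mon [::]) v -> exists2 a, A a & v = a%:MP.
  elim=> [|d w v' Ad [n mw] _ [a Aa ->]]; first by exists 0.
  inversion mw as [|]=> //.
  exists (d + a)=> //.
  by rewrite -mul_mpolyC mulr1 mpolyCD.
 have [a /IA/cst[c Ac /eqP]|t [tI It]] := nA _ sI'; first by rewrite mpolyC_eq=> /eqP ->.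
 exists [seq a%:MP | a <- t]; split; first by move=> _ /mapP[a /tI Ia ->].
 move=> v Iv; have [a Aa vE] := cst v (IA v Iv); rewrite vE in Iv *; elim: (It a Iv)=> [|d w b Ad wt _ H] //.
 rewrite mpolyCD mpolyCM; apply: spn_cons=> //; last exact: map_f.
 by rewrite -[_%:MP]mulr1 mul_mpolyC; apply: spn_mem=> //; exact: mon1.
have sR := rees_subringP g sA; have <-: adj (spn A (mon g)) u = spn A (mon (u :: g)); last exact: noeth_adj.
have sR' := rees_subringP (u :: g) sA; have sub n w: monn g n w -> monn (u :: g) n w.
 by elim=> [|k v w' vg]; constructor=> //; rewrite inE vg orbT.
apply/seteqP; split; first apply: adj_min=> //.
- by apply: spn_mono=> // w [n]; exists n; exact: sub.
- by apply: spn_gen; [|apply: mon_gen].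
apply: spn_min=> [|w [n]].
 split=> //; move=> a v Aa uv.
 rewrite -mul_mpolyC; apply: srM=> //; apply: adj_sub=> //.
 by rewrite -[_%:MP]mulr1 mul_mpolyC.
elim=> [|k v w' vg _ H] //.
apply: srM=> //; move: vg; rewrite inE=> /predU1P[->|vg]; first exact: adj_gen.
by apply: adj_sub=> //; apply: spn_gen; [|exact: mon_gen].
Qed.

Section ParameterPowers.
Variables (K : fieldType) (A : set K) (x y : K).
Hypothesis rA : rlr2 A x y.
Let sA := rlr_sub rA.
Lemma rlr_reg_pow n w e : A w -> A e -> y ^+ n * w = x * e -> exists2 c, A c & w = x * c.
move=> Aw; elim: n e=> [|n IH] e Ae; first by rewrite mul1r; exists e.
rewrite exprS -mulrA=> /(rlr_reg rA)[||c Ac /IH] //; last exact.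
by apply: srM=> //; apply: srX=> //; exact: rlr_y rA.
Qed.
Lemma x_prime a b : A a -> A b -> (exists2 c, A c & a * b = x * c) ->
 (exists2 c, A c & a = x * c) \/ (exists2 c, A c & b = x * c).
move=> Aa Ab [e Ae E]; apply: contrapT=> /not_orP[na nb].
have [k [u [c [Au mu Ac aE]]]] := rlr_yadic rA Aa na; have [l [v [d [Av mv Ad bE]]]] := rlr_yadic rA Ab nb.
have [Ay Ax] := (rlr_y rA, rlr_x rA).
have [|||f Af uvE] := @rlr_reg_pow (k + l) (u * v) (e - c * b - y ^+ k * u * d)=> //.
- by rewrite !mulrBr -E aE bE exprD; ring.
have [_ _ pr] := mi_prime rA; case: (pr u v)=> //; rewrite uvE.
by exists f, 0; rewrite mulr0 addr0.
Qed.
End ParameterPowers.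

(** * The local ring of the Rees algebra and its finite overmodule [B] *)

Section ReesLocal.
Variables (r : nat) (K : fieldType).
Notation E := {mpoly K[r.+1]}.
Notation Fr := {fraction E}.
Variables (A : set K) (x y : K) (g : seq E).
Hypotheses (rA : rlr2 A x y) (infA : infres A x y) (fA : fracs A) (cg : cofinite A x y g).
Let sA := rlr_sub rA.
Variables (S : comNzRingType) (rho : {rmorphism S -> E}) (P : set S).
Hypotheses (rhoI : injective rho) (rhoS : forall z, spn A (mon g) (rho z)).
Hypotheses (rhoO : forall u, spn A (mon g) u -> exists z, rho z = u) (PE : forall z, P z <-> mi A x y (rho z)@_0%MM).
Notation Sg := (spn A (mon g)).
Notation R := (localization (~` P)).
Notation hc n := (@pihomog r.+1 K (@mdeg r.+1) n).
Let sS : subring Sg := rees_subringP g sA.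
Let g1 := cof_homog cg.
Let iM := mi_ideal rA.
Lemma Sg_const u : Sg u -> A u@_0%MM.
elim=> [|d w v Ad [n mw] _ IH]; first by rewrite mcoeff0.
rewrite mcoeffD mcoeffZ; apply: srD=> //; apply: srM=> //; case: n mw=> [|n] mw.
 by inversion mw; rewrite mcoeff1 eqxx; exact: sr1.
by rewrite (monn_const g1 mw).
Qed.
Lemma Sg_C a : A a -> Sg a%:MP.
by move=> Aa; rewrite -[_%:MP]mulr1 mul_mpolyC. Qed.
Lemma Sg_monn n w : spn A (monn g n) w -> Sg w.
by apply: spn_mono=> //; exists n. Qed.
Lemma mi_prime_io a b : A a -> A b -> mi A x y (a * b) -> mi A x y a \/ mi A x y b.
by have [_ _] := mi_prime rA; apply. Qed.
Lemma P_prime : prime_ideal P.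
split; [split| |].
- by apply/PE; rewrite rmorph0 mcoeff0.
- by move=> a b /PE Pa /PE Pb; apply/PE; rewrite rmorphD mcoeffD.
- move=> a b /PE Pb; apply/PE; rewrite rmorphM (rmorphM (mcoeff 0%MM)); apply: (idealMl iM)=> //.
 exact: Sg_const.
- by move=> /PE; rewrite rmorph1 mcoeff1 eqxx; exact: rlr_proper.
- move=> a b /PE; rewrite rmorphM (rmorphM (mcoeff 0%MM))=> /mi_prime_io[|||H]; try exact: Sg_const.
  by left; apply/PE.
 by right; apply/PE.
Qed.
Let pP := P_prime.
Notation J := (lext P (lphi P) P).
Lemma S_noetherian : noetherian S.
apply: (noetherian_of_range rhoI); have ->: range rho = Sg by apply/seteqP; split=> [_ [z _ <-]|u /rhoO[z <-]].
exact: noeth_mon (rlr_noeth rA).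
Qed.
Lemma R_noetherian : noetherian R.
exact: (loc_noetherian S_noetherian (lphi_unit pP) (lphi_frac pP)). Qed.
Lemma R_local : islocal J.
exact: (loc_islocal pP (lphi_unit pP) (lphi_frac pP) (lphi_ker pP)). Qed.

Definition fr (z : R) : Fr := tofrac (rho (repr z).1) / tofrac (rho (projT1 (repr z).2)).
Lemma rho_den s : ~ P s -> tofrac (rho s) != 0.
by move=> Ps; rewrite tofrac_eq0; apply/eqP=> s0; apply/Ps/PE; rewrite s0 mcoeff0. Qed.
Lemma frE a s (Hs : denominator (~` P) s) : fr (lfrac a Hs) = tofrac (rho a) / tofrac (rho s).
have nd t: denominator (~` P) t -> tofrac (rho t) != 0 by move=> Ht; apply: rho_den; move: Ht; rewrite denominatorE.
rewrite /fr; have := reprK (lfrac a Hs); case: repr=> a' [s' Hs'] /= /lfrac_eq[u Hu E].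
apply/eqP; rewrite eqr_div ?nd // -!rmorphM tofrac_eq; apply/eqP; congr (rho _).
apply: rhoI; have u0: rho u != 0 by rewrite -tofrac_eq0 nd.
by apply: (mulfI u0); rewrite -!rmorphM E.
Qed.
Lemma fr_zmod : zmod_morphism fr.
move=> z w; have [a [s [Hs ->]]] := lfrac_ex z; have [b [t [Ht ->]]] := lfrac_ex w.
have nd u: denominator (~` P) u -> tofrac (rho u) != 0 by move=> Hu; apply: rho_den; move: Hu; rewrite denominatorE.
by rewrite lfracN lfracD !frE mulNr !(rmorphB, rmorphM) -[X in _ = _ X]mulNr addf_div ?nd // mulNr.
Qed.
Lemma fr_monoid : monoid_morphism fr.
split=> [|z w]; first by rewrite lfrac1 frE !rmorph1 divr1.
by have [a [s [Hs ->]]] := lfrac_ex z; have [b [t [Ht ->]]] := lfrac_ex w; rewrite lfracM !frE !rmorphM mulf_div.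
Qed.
HB.instance Definition _ := GRing.isZmodMorphism.Build _ _ fr fr_zmod.
HB.instance Definition _ := GRing.isMonoidMorphism.Build _ _ fr fr_monoid.
Lemma fr_lphi a : fr (lphi P a) = tofrac (rho a).
by rewrite frE !rmorph1 divr1. Qed.
Lemma fr_frac z : exists a s, ~ P s /\ tofrac (rho s) * fr z = tofrac (rho a).
by have [a [s [Ps E]]] := lphi_frac pP z; exists a, s; rewrite -!fr_lphi -rmorphM E. Qed.
Lemma fr_inj : injective fr.
move=> z w E; apply/eqP; rewrite -subr_eq0; have [a [s [Ps E']]] := lphi_frac pP (z - w).
have : fr (lphi P a) = 0 by rewrite -E' rmorphM rmorphB /= E subrr mulr0.
rewrite fr_lphi=> /eqP; rewrite tofrac_eq0 -(rmorph0 rho)=> /eqP/rhoI a0.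
by have [t ts] := lphi_unit pP Ps; rewrite -[z - w]mul1r -ts -mulrA E' a0 rmorph0 mulr0.
Qed.

(** Inverts [rho] on the Rees algebra and passes to the localization, so that elements of the local
    ring can be handled as polynomials. *)
Definition el (u : E) : R := lphi P (xget 0 [set z | rho z = u]).
Lemma elK u : Sg u -> fr (el u) = tofrac u.
by move=> Su; rewrite fr_lphi; congr tofrac; apply: xgetPex (rhoO Su). Qed.
Lemma el_eq u z : Sg u -> fr z = tofrac u -> z = el u.
by move=> Su zE; apply: fr_inj; rewrite elK. Qed.
Lemma J_el u : Sg u -> mi A x y u@_0%MM -> J (el u).
by move=> Su mu; apply/(lextP pP (lphi_ker pP))=> //; apply/PE; rewrite (xgetPex _ (rhoO Su)). Qed.
Lemma el_smod (I : set R) : smod setT (I : set R^o) -> smod Sg ([set u | Sg u /\ I (el u)] : set E^o).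
move=> sI; split=> [|u v [Su Iu] [Sv Iv]|u v Su [Sv Iv]].
- by split; [|rewrite -(el_eq (z := 0)) ?rmorph0].
- have Suv := srD sS Su Sv; split=> //.
 by rewrite -(el_eq Suv (z := el u + el v)); [|rewrite rmorphD /= !elK // tofracD].
- have Suv := srM sS Su Sv; split=> //.
 rewrite -(el_eq Suv (z := el u * el v)); last by rewrite rmorphM /= !elK // tofracM.
 exact: smodZ.
Qed.
Lemma J_generated : J = spn setT ([set` el x%:MP :: el y%:MP :: map el g] : set R^o).
set G : set R^o := [set` _]; have sJ: smod setT (J : set R^o) by apply/is_idealP; have [] := R_local.
have [Ax Ay] := (rlr_x rA, rlr_y rA).
have gS u: u \in g -> Sg u by move=> ug; apply: spn_gen; [|exact: mon_gen].
apply/seteqP; split; last first.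
 apply: (@spn_min R R^o)=> // z; rewrite /G=> /orP[/eqP->|/orP[/eqP->|/mapP[u ug ->]]]; apply: J_el.
 - exact: Sg_C.
 - by rewrite mcoeffC eqxx mulr1; exact: mi_gx.
 - exact: Sg_C.
 - by rewrite mcoeffC eqxx mulr1; exact: mi_gy.
 - exact: gS.
 - by rewrite (monn_const g1 (monn_gen ug)).
pose N := [set u | Sg u /\ spn setT G (el u)].
have sN: smod Sg (N : set E^o) by apply: el_smod.
have ND u v: N u -> N v -> N (u + v) by exact: (smodD sN).
have NM u v: Sg u -> N v -> N (u * v) by exact: (smodZ sN).
have NG u: Sg u -> el u \in el x%:MP :: el y%:MP :: map el g -> N u=> //.
move=> z [a [s [/PE ma Ps zE]]]; have [t ts] := lphi_unit pP Ps; rewrite -[z]mul1r -ts -mulrA zE.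
apply: (smodZ (@spn_smod R R^o _ G (@srT R)))=> //.
have aE: lphi P a = el (rho a) by apply: el_eq=> //; exact: fr_lphi.
suff [_]: N (rho a) by rewrite -aE.
have N0: N 0 by exact: (smod0 sN).
have [b [c [Ab Ac abc]]] := ma; rewrite -[rho a](subrK ((rho a)@_0%MM)%:MP); apply: (ND).
 elim: rhoS=> [|d w v Ad [n mw] _ IH]; first by rewrite mcoeff0 subrr.
 rewrite mcoeffD mpolyCD opprD addrACA; apply: (ND)=> //; case: n mw=> [|n] mw.
  by inversion mw; rewrite mcoeffZ mcoeff1 eqxx mulr1 -mul_mpolyC mulr1 subrr.
 rewrite mcoeffZ (monn_const g1 mw) mulr0 subr0; have [u [w' [ug mw' ->]]] := monn_inv mw.
 rewrite -mul_mpolyC mulrA mulrC mulrA; apply: (NM); last by apply: NG; [exact: gS|rewrite !inE map_f ?orbT].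
 by apply: (srM sS); [apply: Sg_monn (spn_gen (sr1 sA) mw')|exact: Sg_C].
rewrite abc mpolyCD !mpolyCM; apply: (ND); rewrite mulrC; apply: (NM); try exact: Sg_C.
 by apply: NG; [exact: Sg_C|].
by apply: NG; [exact: Sg_C|].
Qed.
Notation V := (pull fr).
Definition tf (u : E) : V := tofrac u.
Definition den : set E := [set t | exists2 s, ~ P s & rho s = t].
Notation B := (@fracmod r K R fr den (Bg A g)).
Notation Cr := (C (tf 1)).
Lemma Sg_Bg : Sg `<=` Bg A g.
by move=> u Su n; apply: (monn_Rb rA g1); exact: hc_spn. Qed.
Lemma den1 : den 1.
by exists 1; [have [] := pP|exact: rmorph1]. Qed.
Lemma denM s t : den s -> den t -> den (s * t).
by move=> [a Pa <-] [b Pb <-]; exists (a * b); [have [_ _ pr] := pP; move=> /pr[]|exact: rmorphM].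
Qed.
Lemma den_neq0 s : den s -> s != 0.
by move=> [a Pa <-]; rewrite -tofrac_eq0; exact: rho_den. Qed.
Lemma den_Sg s : den s -> Sg s. by move=> [a _ <-]. Qed.
Lemma den_Bg s v : den s -> Bg A g v -> Bg A g (s * v).
by move=> /den_Sg/Sg_Bg; exact: (BgM rA). Qed.
Lemma tfM z u v : fr z = tofrac u -> z *: tf v = tf (u * v).
by move=> zE; rewrite /tf tofracM -zE. Qed.
Lemma B_sub : smod setT B.
split=> [|u v [s [w [Ts Bw uE]]] [s' [w' [Ts' Bw' vE]]]|z v _ [s [w [Ts Bw vE]]]].
- by exists 1, 0; split; [exact: den1|exact: (Bg0 g rA)|rewrite mulr0].
- exists (s * s'), (s' * w + s * w'); split; [exact: denM|apply: (BgD rA); exact: den_Bg|].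
 have H (a b c d: Fr) : a * b * (c + d) = b * (a * c) + a * (b * d) by ring.
 by rewrite !(tofracD, tofracM) -uE -vE.
have [a [t [Pt tE]]] := fr_frac z; exists (rho t * s), (rho a * w); split.
- by apply: denM=> //; exists t.
- exact: (BgM rA (Sg_Bg (rhoS a))).
- by rewrite !tofracM -tE -vE mulrACA.
Qed.
Lemma B_tf w : Bg A g w -> B (tf w).
by move=> Bw; exists 1, w; split; rewrite ?mul1r //; exact: den1. Qed.
Lemma Cr_tf w : Sg w -> Cr (tf w).
by move=> Sw; exists (el w); rewrite (tfM _ (elK Sw)) mulr1. Qed.
(** In [s w = a] with a denominator [s], the part of degree [n] is the constant term of [s] times
    [w], and that constant term is a unit of [A]. *)
Lemma Cr_homog n w : Cr (tf w) -> w \is n.-homog -> spn A (monn g n) w.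
move=> [z zE] hw; have [a [s [Ps E]]] := fr_frac z; rewrite pullE /tf mulr1 in zE.
have {}E: rho s * w = rho a by apply/eqP; rewrite -tofrac_eq tofracM zE E.
have As := Sg_const (rhoS s); have us: ~ mi A x y (rho s)@_0%MM by move=> /PE.
have s0 := mi_neq0 rA us; have H: spn A (monn g n) ((rho s)@_0%MM *: w).
 have ->: (rho s)@_0%MM *: w = hc n (rho a); last exact: hc_spn.
 have [N uE] := hc_sum (rho s); rewrite -E [in RHS](uE N.+1 (leqnSn N)) big_ord_recl.
 rewrite hc0E mulrDl mul_mpolyC pihomogD mulr_suml (raddf_sum (hc n)) big1=> [|i _].
  by rewrite addr0 pihomog_dE //; exact: rpredZ.
 by apply: (@pihomog_ne0 _ _ _ (lift ord0 i + n)%N); [rewrite -[X in _ != X]add0n eqn_add2r|exact: (dhomogM (pihomogP _ _ _))].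
by rewrite -[w]scale1r -(mulVf s0) -scalerA; apply: smodZ=> //; exact: (rlr_unit rA).
Qed.
Lemma Rb1_fg : exists q : seq E, (forall w, w \in q -> Rb A g 1 w) /\ Rb A g 1 `<=` spn A [set` q].
have nX := fg_noeth (s := Xs r.+1 K) sA (rlr_noeth rA); apply: nX=> [|w Rw] //.
have mw := Rb_mcf rA fA (cof_mcf cg) g1 Rw; have [hw _] := Rw.
apply: spn_mono (mcf_spn sA hw mw)=> // v mv; have [u [w' [uX m0 ->]]] := monn_inv mv.
by inversion m0; rewrite mulr1.
Qed.
(** By [Rb_succ] the degrees from two on are products of [U], which lies in the Rees algebra, with
    lower degrees; degree zero is [A]. So degrees zero and one generate. *)
Lemma Bg_generated (q : seq E) : Rb A g 1 `<=` spn A [set` q] ->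
 Bg A g `<=` spn Sg ([set` (1 : E) :: q] : set E^o).
move=> Rq v Bv; have [M [c rg]] := reduction_exists rA infA fA cg.
have sG := @spn_smod _ E^o Sg [set` 1 :: q] sS.
have ZG a w: A a -> spn Sg ([set` 1 :: q] : set E^o) w -> spn Sg ([set` 1 :: q] : set E^o) (a *: w) by move=> Aa; rewrite -mul_mpolyC=> /(smodZ sG (Sg_C Aa)).
suff H n w: Rb A g n w -> spn Sg ([set` 1 :: q] : set E^o) w.
 have [N vE] := hc_sum v; rewrite (vE N (leqnn N)).
 by apply: (smod_sum (V := E^o))=> // i _; exact: H.
have H1 u: Rb A g 1 u -> spn Sg ([set` 1 :: q] : set E^o) u.
 move=> /Rq; elim=> [|a u' u'' Aa uq _ IH] //.
 apply: (smodD sG)=> //; apply: ZG=> //; apply: spn_gen=> //.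
 by rewrite /= inE uq orbT.
elim: n w=> [|[|n] IH] w; [|exact: H1|].
 move=> /(Rb0_const rA fA cg)[a Aa ->]; rewrite -[_%:MP]mulr1; apply: spn_mem; first exact: Sg_C.
 exact: mem_head.
move=> /(Rb_succ rA cg rg); have US u: u \in forms M -> Sg u by move=> /(redn_sub rg); exact: Sg_monn.
elim: forms US w=> [|u U IHU] US w /=; first by move=> ->.
move=> [b [w' [Rb' wU ->]]]; apply: (smodD sG); first by apply: IHU=> // u' uU; apply: US; rewrite inE uU orbT.
by apply: (smodZ sG); [exact: US|exact: IH].
Qed.
Lemma B_generated (q : seq E) : Rb A g 1 `<=` spn A [set` q] -> forall v, B v -> spn setT [set` map tf (1 :: q)] v.
move=> Rq v [s [w [[s0 Ps <-] Bw vE]]]; have sG := @spn_smod R V setT [set` map tf (1 :: q)] (@srT R).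
have [t ts] := lphi_unit pP Ps; have ->: v = t *: tf w.
 rewrite -[v]scale1r -ts -scalerA; congr (t *: _); rewrite -[_ v]/(fr (lphi P s0) * v) fr_lphi //.
apply: (smodZ sG); elim: (Bg_generated Rq Bw)=> [|d u w' Sd uq _ IH] //.
have ->: tf (d * u + w') = el d *: tf u + tf w' by rewrite (tfM _ (elK Sd)) /tf tofracD.
by apply: spn_cons=> //; exact: map_f.
Qed.
Lemma B_noeth : noethm setT B.
have [q [_ Rq]] := Rb1_fg; apply: (noethm_sub (B_generated Rq)); apply: fg_noeth=> //.
by apply/noethP; exact: R_noetherian.
Qed.
Lemma Cr_kill a : (forall w, Rb A g 1 w -> Cr (a *: tf w)) -> forall v, B v -> Cr (a *: v).
move=> H v Bv; have [q [qR Rq]] := Rb1_fg; have sC := C_sub (tf 1).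
elim: (B_generated Rq Bv)=> [|d u w _ uq _ IH]; first by rewrite scaler0.
rewrite scalerDr scalerA mulrC -scalerA; apply: smodD=> //; apply: smodZ=> //.
by move: uq; rewrite /= => /predU1P[->|/mapP[w' /qR Rw' ->]]; [exists a|exact: H].
Qed.
Lemma J_kill : (forall w, Rb A g 1 w -> [/\ Cr (tf (x *: w)), Cr (tf (y *: w)) & forall u, u \in g -> Cr (tf (u * w))]) ->
 forall a, J a -> forall v, B v -> Cr (a *: v).
move=> H a; rewrite J_generated; have sC := C_sub (tf 1); elim=> [|d z w _ zG _ IH] v Bv.
 by rewrite scale0r.
rewrite scalerDl -scalerA; apply: (smodD sC); last exact: IH.
apply: smodZ=> //; move: v Bv {IH}; apply: Cr_kill=> v /H[Hx Hy Hg].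
move: zG; rewrite /= => /orP[/eqP->|/orP[/eqP->|/mapP[u ug ->]]].
- by rewrite (tfM _ (elK (Sg_C (rlr_x rA)))) mul_mpolyC.
- by rewrite (tfM _ (elK (Sg_C (rlr_y rA)))) mul_mpolyC.
- by rewrite (tfM _ (elK _)); [exact: Hg|apply: spn_gen; [|exact: mon_gen]].
Qed.

Definition kill j : {rmorphism E -> E} := alg (fun i : 'I_r.+1=> if (i < j)%N then 0 else 'X_i).
Lemma kill_comp j v : kill j.+1 (kill j v) = kill j.+1 v.
apply: (@morph_ext _ _ (kill j.+1 \o kill j : {rmorphism E -> E}))=> [a w|a w|i] /=; rewrite ?algZ ?algX //.
by case: ltnP=> ij; rewrite ?rmorph0 ?algX // ltnW.
Qed.
Lemma kill_all v : kill r.+1 v = (v@_0%MM)%:MP.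
apply: (@morph_ext _ _ (kill r.+1) ((@mpolyC r.+1 K) \o mcoeff 0%MM : {rmorphism E -> E}))=> [a w|a w|i] /=; rewrite ?algZ ?algX ?ltn_ord //.
 by rewrite mcoeffZ mpolyCM mul_mpolyC.
by rewrite mcoeffX mnm1_eq0.
Qed.
(** The variables are set to zero one after the other, which gives kernels for [j = 0] to [r + 1];
    above them lie the elements with constant term in [x A], and [P] itself. Powers of [x] times the
    variables, as well as [x] and [y], make the inclusions strict. *)
Lemma R_chain : prime_chain R r.+3.
pose Q j : set S := if (j <= r.+1)%N then [set z | kill j (rho z) = 0] else
 if j == r.+2 then [set z | exists2 c, A c & (rho z)@_0%MM = x * c] else P.
have cA z: A (rho z)@_0%MM by exact: Sg_const.
have pX: prime_ideal [set z | exists2 c, A c & (rho z)@_0%MM = x * c].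
 split; [split| |].
 - by exists 0; [|rewrite rmorph0 mcoeff0 mulr0].
 - by move=> z w [c Ac zE] [d Ad wE]; exists (c + d); [|rewrite rmorphD mcoeffD zE wE mulrDr].
 - move=> z w [c Ac wE]; exists ((rho z)@_0%MM * c); first exact: srM.
  by rewrite rmorphM rmorphM /= wE mulrCA.
 - move=> [c Ac]; rewrite rmorph1 mcoeff1 eqxx=> cE; apply: (rlr_proper rA).
  by exists c, 0; rewrite mulr0 addr0.
 - by move=> z w [c Ac]; rewrite rmorphM rmorphM=> E; apply: (x_prime rA)=> //; exists c.
have XP: [set z | exists2 c, A c & (rho z)@_0%MM = x * c] `<=` P by move=> z [c Ac zE]; apply/PE; exists c, 0; rewrite mulr0 addr0.
have KX j z: (j <= r.+1)%N -> kill j (rho z) = 0 -> kill r.+1 (rho z) = 0.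
 move=> jr zj; suff /(_ (r.+1 - j)%N) : forall k, kill (k + j) (rho z) = 0 by rewrite subnK.
 by elim=> [//|k IH]; rewrite addSn -(kill_comp (k + j)) IH; exact: rmorph0.
have KX' j: (j <= r.+1)%N -> [set z | kill j (rho z) = 0] `<=` [set z | exists2 c, A c & (rho z)@_0%MM = x * c].
 move=> jr z /(KX _ _ jr)/eqP; rewrite kill_all mpolyC_eq0=> /eqP z0.
 by exists 0; [|rewrite mulr0].
apply: (loc_prime_chain pP (lphi_frac pP) (lphi_ker pP) (Q := Q))=> j jr.
 rewrite /Q; case: ifP=> jr1; last by case: ifP.
 split; last exact: subset_trans (KX' _ jr1) XP.
 split; [split| |]; rewrite /= ?rmorph0 ?rmorph1 //.
 - by move=> z w; rewrite !rmorphD /= => -> ->; rewrite addr0.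
 - by move=> z w; rewrite !rmorphM /= => ->; rewrite mulr0.
 - by apply/eqP; rewrite oner_eq0.
 - by move=> z w /eqP; rewrite !rmorphM mulf_eq0=> /orP[]/eqP; [left|right].
rewrite /Q; have [jr1|jr1] := leqP j.+1 r.+1.
 rewrite (ltnW jr1); split=> [z z0|H].
  by apply: (etrans (esym (kill_comp j (rho z)))); rewrite (z0 : kill j (rho z) = 0) rmorph0.
 have [k cx] := cof_x cg; have [z zE] := rhoO (Sg_monn (cx (Ordinal jr1))).
 have /eqP: kill j (rho z) = 0 by apply: H; rewrite /= zE algZ algX ltnSn scaler0.
 by rewrite zE algZ algX ltnn -mul_mpolyC mulf_eq0 mpolyC_eq0 expf_eq0 (negPf (rlr_x0 rA)) andbF -msupp_eq0 msuppX.
have [jE|jn] := eqVneq j r.+1.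
 rewrite jE leqnn eqxx; split; first exact: KX'.
 have [z zE] := rhoO (Sg_C (rlr_x rA))=> H; have /eqP: kill r.+1 (rho z) = 0.
  by apply: H; exists 1; [|rewrite zE mcoeffC eqxx].
 by rewrite kill_all zE mcoeffC eqxx mulr1 mpolyC_eq0 (negPf (rlr_x0 rA)).
have ->: j = r.+2 by lia.
have ->: (r.+3 == r.+2) = false by lia.
rewrite ltnn eqxx; split=> // H; have [z zE] := rhoO (Sg_C (rlr_y rA)); have [|c Ac yE] := H z.
 by apply/PE; rewrite zE mcoeffC eqxx mulr1; exact: mi_gy.
rewrite zE mcoeffC eqxx mulr1 in yE; have [|d Ad dE] := rlr_reg rA (sr1 sA) Ac; first by rewrite mulr1.
by apply: (rlr_proper rA); exists d, 0; rewrite mulr0 addr0.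
Qed.
Lemma elX u n : Sg u -> el (u ^+ n) = el u ^+ n.
by move=> Su; apply/esym/el_eq; [|rewrite rmorphXn /= elK // tofracXn]. Qed.
Lemma J_mi u : Sg u -> u@_0%MM = 0 -> J (el u).
by move=> Su u0; apply: J_el=> //; rewrite u0. Qed.
(** The index [i] is one with [c_i] not divisible by [a1]. Modulo the radical of these elements the
    relation leaves [c_i u_i = 0], where [u_i] is the form of index [i]. As [c_i] is a unit times
    [a2^k] modulo [a1] and [u_i] equals [a2], a power of [a2] vanishes. So [a2] and all forms are in
    the radical, and with them [g], of which they are a reduction. *)
Lemma system_of_parameters a1 a2 M c : rlr2 A a1 a2 -> (forall v, mi A x y v <-> mi A a1 a2 v) -> redn A x y g M c ->
 (exists N, spn A ([set` [seq c 0 i | i <- enum 'I_r.+2]] : set K^o) (a2 ^+ N)) ->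
 exists i, param J r.+3 (el a1%:MP :: el (rform M i - a2%:MP) :: [seq el (rform M (lift i j)) | j <- enum 'I_r.+1]).
move=> rA' miE rg [N cN]; have [Aa1 Aa2] := (rlr_x rA', rlr_y rA').
have [i ni]: exists i, ~ exists2 d, A d & c 0 i = a1 * d.
 apply: contrapT=> H; have sX: smod A ([set v | exists2 d, A d & v = a1 * d] : set K^o).
  split=> [|_ _ [d Ad ->] [e Ae ->]|b _ Ab [d Ad ->]]; first by exists 0; [|rewrite mulr0].
   by exists (d + e); [|rewrite mulrDr].
  by exists (b * d); [|rewrite mulrCA].
 have [|d Ad aE] := spn_min sX _ cN.
  by move=> _ /mapP[j _ ->]; apply: contrapT=> nj; apply: H; exists j.
 have [|e Ae E] := @rlr_reg_pow _ _ _ _ rA' N 1 d (sr1 sA) Ad; first by rewrite mulr1.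
 by apply: (rlr_proper rA'); exists e, 0; rewrite mulr0 addr0.
exists i; set L := _ :: _; pose Q : set R := spn setT ([set` L] : set R^o).
have SU j: Sg (rform M j) by apply/Sg_monn/(redn_sub rg)/map_f.
have U0 j: (rform M j)@_0%MM = 0 by apply: (dhomog_nemf_coeff (rowform_homog M j)); rewrite /= mdeg0.
have Sd: Sg (rform M i - a2%:MP) by apply: srB=> //; exact: Sg_C.
have [iJ _ _] := R_local; split; first by rewrite /= size_map size_enum_ord.
 move=> z; rewrite !inE=> /orP[/eqP->|/orP[/eqP->|/mapP[j _ ->]]].
 - by apply: J_el; [exact: Sg_C|rewrite mcoeffC eqxx mulr1; apply/miE; exact: mi_gx].
 - apply: J_el=> //; rewrite mcoeffB U0 mcoeffC eqxx mulr1 sub0r.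
  by apply: (idealN sA iM); apply/miE; exact: mi_gy.
 - exact: J_mi.
have sQ := radical_submod (@spn_smod R R^o _ ([set` L]) (@srT R)) : smod setT (radical Q : set R^o).
pose NQ := [set u | Sg u /\ radical Q (el u)]; have sN: smod Sg (NQ : set E^o) by exact: el_smod.
have NL u: Sg u -> el u \in L -> NQ u by move=> uL; split=> //; exists 1%N.
have NX u n: Sg u -> NQ (u ^+ n) -> NQ u by move=> Su [_ [k]]; rewrite elX // -exprM; split=> //; exists (n * k)%N.
have NM u v: Sg u -> NQ v -> NQ (u * v) by exact: (smodZ sN).
have NB u v: NQ u -> NQ v -> NQ (u - v) by exact: (smodB sS sN).
have Na1: NQ a1%:MP by apply: NL; [exact: Sg_C|].
have Nd: NQ (rform M i - a2%:MP) by apply: NL.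
have NU j: NQ (rform M (lift i j)) by apply: NL=> //; do 2!(apply/orP; right); apply/mapP; exists j.
have Ac j: A (c 0 j) by exact: redn_A rg j.
have NcU: NQ ((c 0 i)%:MP * rform M i).
 have : \sum_j (c 0 j)%:MP * rform M j = 0.
  rewrite /rform; under eq_bigr do rewrite mul_mpolyC scaler_sumr.
  rewrite exchange_big big1 // => k _ /=; under eq_bigr do rewrite scalerA.
  rewrite -scaler_suml; have /matrixP/(_ 0 k) := redn_cM rg; rewrite !mxE=> ->; exact: scale0r.
 rewrite (bigD1_ord i) //= => /eqP; rewrite addr_eq0=> /eqP ->; apply: (smodN sS sN).
 by apply: (smod_sum (V := E^o))=> // j _; apply: NM; [exact: Sg_C|].
have [k [u [d [Au mu Ad cE]]]] := rlr_yadic rA' (Ac i) ni.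
have u0 := mi_neq0 rA' mu; have Au': A u^-1 by exact: (rlr_unit rA').
have Na2: NQ a2%:MP.
 apply: (NX _ k.+1); first exact: Sg_C.
 have ->: a2%:MP ^+ k.+1 = u^-1%:MP * ((c 0 i)%:MP * rform M i - (c 0 i)%:MP * (rform M i - a2%:MP) - (d * a2)%:MP * a1%:MP).
  rewrite -mulrBr subKr cE -rmorphXn -!mpolyCM -mpolyCB -mpolyCM; congr _%:MP.
  by rewrite exprSr; field.
 apply: (NM); first exact: Sg_C; apply: (NB); [apply: NB=> //|]; apply: NM=> //; apply: Sg_C=> //.
have NUi: NQ (rform M i) by rewrite -[rform M i](subrK a2%:MP); exact: (smodD sN).
have NUa u': u' \in forms M -> NQ u' by move=> /mapP[j _ ->]; case: (unliftP i j)=> [j' ->|->].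
have Nmi a: A a -> mi A a1 a2 a -> NQ a%:MP.
 move=> _ [b [b' [Ab Ab' ->]]]; rewrite mpolyCD !mpolyCM; apply: (smodD sN); rewrite mulrC; apply: NM=> //; exact: Sg_C.
have Ng u': u' \in g -> NQ u'.
 move=> ug; have [n gn] := redn_red rg; apply: (NX _ n.+1); first by apply: spn_gen; [|exact: mon_gen].
 have mX: monn g n.+1 (u' ^+ n.+1) by elim: n.+1=> [|q]; [exact: monn_one|rewrite exprS; exact: monn_mul].
 elim: (gn _ (spn_gen (sr1 sA) mX))=> [|b w v Ab [u1 [w' [u1U mw ->]]] _ IH]; first exact: smod0 sN.
 apply: (smodD sN)=> //; rewrite -mul_mpolyC [u1 * _]mulrC mulrA; apply: (NM); last exact: NUa.
 by apply: (srM sS); [exact: Sg_C|apply: Sg_monn (spn_gen (sr1 sA) mw)].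
move=> a; rewrite J_generated; apply: (@spn_min R R^o)=> // {}a; rewrite /= !inE.
have [Ax Ay] := (rlr_x rA, rlr_y rA).
case/orP=> [/eqP->|/orP[/eqP->|/mapP[u' ug ->]]]; [have [] := Nmi x|have [] := Nmi y|by have [] := Ng u']=> //; apply/miE; [exact: mi_gx|exact: mi_gy].
Qed.
Lemma R_krull M c : redn A x y g M c -> krull_dim R r.+3.
move=> rg; have [i ps] := system_of_parameters rA (fun=> iff_refl _) rg (let: ex_intro N (conj _ h) := redn_xy rg in ex_intro _ N h).
have [ss sJ sR] := ps; split; first exact: R_chain.
by have := dimension_bound R_noetherian R_local sJ sR; rewrite ss.
Qed.
Lemma HV_R M c : redn A x y g M c ->
 HV (size [:: el x%:MP, el y%:MP & map el (forms M)]) B 2 [:: el x%:MP, el y%:MP & map el (forms M)].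
move=> rg; apply: (fracmod_HV den1 denM den_neq0 den_Bg (L := [:: x%:MP, y%:MP & forms M])).
- rewrite /= !elK; [|exact: Sg_C (rlr_y rA)|exact: Sg_C (rlr_x rA)]; congr [:: _, _ & _].
 by rewrite -map_comp; apply/eq_in_map=> u /(redn_sub rg)/Sg_monn; exact: elK.
- exact: (Bg0 g rA).
- exact: (Bg_exact rA fA cg rg).
Qed.
Lemma l_in_J M c : redn A x y g M c -> forall a, a \in [:: el x%:MP, el y%:MP & map el (forms M)] -> J a.
move=> rg a; rewrite J_generated=> /orP[/eqP->|/orP[/eqP->|/mapP[u uU ->]]].
- by apply: spn_gen=> //=.
- by apply: spn_gen=> //=.
rewrite -J_generated; have Su := Sg_monn (redn_sub rg uU); apply: J_mi=> //.
by apply: (dhomog_nemf_coeff (forms_homog uU)); rewrite /= mdeg0.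
Qed.
(** By [J_kill] it is enough to test the generators of [J] on the closure [L] of [N]: those from [m]
    carry [L] into [N], and those from [g] carry it into [L^2], hence into [N^2]. So [J B] lies in
    [R]. *)
Theorem buchsbaum_of_goodm : goodm A x y g -> buchsbaum_local R.
move=> [gm g2]; have [M [c rg]] := reduction_exists rA infA fA cg; have lR := R_local; have [iJ J1 Jc] := lR.
exists J, r.+3; split; first by split; [exact: R_noetherian|apply/islocal_local_ring=> //; exact: R_noetherian|exact: R_krull rg].
have sJ := proj1 (is_idealP J) iJ; have gS u: u \in g -> Sg u by move=> ug; apply: spn_gen; [|exact: mon_gen].
apply: (@buchsbaum_of_annihilated R J V (tf 1) B [:: el x%:MP, el y%:MP & map el (forms M)] r.+3)=> //.
- by move=> j; exact: islocal_unit.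
- by move=> a; case: (Jc a)=> [|[b]]; [left|right; exists b].
- by exists (el x%:MP :: el y%:MP :: map el g); exact: J_generated.
- by move=> a; rewrite pullE mulr1 -(rmorph0 fr)=> /fr_inj.
- exact: B_sub.
- exact: B_noeth.
- by apply/B_tf/Sg_Bg.
- by rewrite /= size_map size_map size_enum_ord.
- exact: (l_in_J rg).
- exact: HV_R rg.
move=> a b Ja; apply: J_kill Ja b=> w Rw; split.
- by apply/Cr_tf/Sg_monn/gm=> //; exact: mi_gx.
- by apply/Cr_tf/Sg_monn/gm=> //; exact: mi_gy.
move=> u ug; apply/Cr_tf/Sg_monn/g2; apply: (Rb_mul (n := 1) sA _ Rw).
by split; [exact: g1|apply: int_rees=> //; exact: gS].
Qed.
(** An exponent may always be raised, since a word splits off a generator of [N]; so finitely many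
    generators of the closure have a common exponent. *)
Lemma uniform_colon : (forall w, Rb A g 1 w -> exists2 l, (0 < l)%N & forall u, spn A (monn g l) u -> spn A (monn g l.+1) (w * u)) ->
 exists l, forall w u, Rb A g 1 w -> spn A (monn g l) u -> spn A (monn g l.+1) (w * u).
move=> H; have [q [qR Rq]] := Rb1_fg; pose G l w := forall u, spn A (monn g l) u -> spn A (monn g l.+1) (w * u).
have G1 l w: G l w -> G l.+1 w.
 move=> Gl u; elim=> [|d _ v Ad /monn_inv[u0 [u' [ug mu ->]]] _ IH]; first by rewrite mulr0.
 rewrite mulrDr; apply: spnD=> //; rewrite -scalerAr mulrCA; apply: smodZ=> //.
 by apply: (monn_spn_cat rA (n := 1)); [apply: spn_gen; [|exact: monn_gen]|apply/Gl/spn_gen].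
have Gk k l w: G l w -> G (k + l)%N w by elim: k=> [//|k IH] /IH; exact: G1.
have [l Gq]: exists l, forall w, w \in q -> G l w.
 elim: q qR {Rq} => [|w q IH] qR; first by exists 0%N.
 have [w' wq|l Gl] := IH; first by apply: qR; rewrite inE wq orbT.
 have [l' _ Gl'] := H w (qR w (mem_head _ _)); exists (l + l')%N=> w'.
 by rewrite inE=> /predU1P[->|/Gl]; [exact: Gk|rewrite addnC; exact: Gk].
exists l=> w u /Rq Sw Su; elim: Sw=> [|d w1 w2 Ad w1q _ IH]; first by rewrite mul0r.
by rewrite mulrDl -scalerAl; apply: spnD=> //; apply: smodZ=> //; exact: Gq.
Qed.
(** Each member of a parameter system kills [B / R] by [annihilated_of_buchsbaum], once [B / R] is
    known to have finite length. Suitable systems contain [x], [y] and the forms of [U]; by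
    [Cr_homog] their products with degree one elements fall into [N] and [N^2], and degree two of
    the closure is [U] times degree one. *)
Theorem goodm_of_buchsbaum : buchsbaum_local R ->
 (forall w, Rb A g 1 w -> exists2 l, (0 < l)%N & forall u, spn A (monn g l) u -> spn A (monn g l.+1) (w * u)) -> goodm A x y g.
move=> [m' [d' [[nR lm' [kd1 kd2]] [cst Bu]]]] /uniform_colon[l wl].
have [M [c rg]] := reduction_exists rA infA fA cg; have lR := R_local; have [iJ J1 Jc] := lR.
have [_ kR2] := R_krull rg; have /(islocal_local_ring nR)[im m1 mc] := lm'.
have mJ: m' = J by apply/seteqP; split; exact: islocal_sub.
have kmono n k: (k <= n)%N -> prime_chain R n -> prime_chain R k by move=> kn [Q [pQ sQ]]; exists Q; split=> i ik; [apply: pQ|apply: sQ]; exact: leq_trans kn.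
have dE: d' = r.+3.
 apply/eqP; rewrite eqn_leq; apply/andP; split; rewrite leqNgt; apply/negP=> lt.
  by apply: kR2; exact: kmono kd1.
 by apply: kd2; exact: kmono R_chain.
rewrite {m' lm' im m1 mc}mJ {d' kd1 kd2}dE in Bu; have sJ := proj1 (is_idealP J) iJ.
have gS u: u \in g -> Sg u by move=> ug; apply: spn_gen; [|exact: mon_gen].
have sC := C_sub (tf 1).
(* Some power of each generator of [J] kills [B / R]: for [x] and [y] because [N] has finite
   colength in the free module, for [u] in [g] because of the Ratliff-Rush exponent [l]; degree one
   is enough by [Cr_kill]. *)
have Cfin a: J a -> exists N, forall b, B b -> Cr (a ^+ N *: b).
 pose I0 : set R := [set a | forall b, B b -> Cr (a *: b)].
 have sI0: smod setT (I0 : set R^o).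
  split=> [b|a1 a2 I1 I2 b Bb|d a1 _ I1 b Bb]; first by rewrite scale0r.
   by rewrite scalerDl; apply: (smodD sC); [exact: I1|exact: I2].
  by rewrite -scalerA; apply: smodZ=> //; exact: I1.
 move: a; rewrite J_generated; apply: (@spn_min R R^o _ _ (radical I0)); first exact: radical_submod.
 have sc a: A a -> (exists k, forall i, spn A (monn g 1) (a ^+ k *: 'X_i)) -> radical I0 (el a%:MP).
  move=> Aa [k aX]; exists k; rewrite -elX; last exact: Sg_C.
  have Sak: Sg (a%:MP ^+ k) by apply: srX=> //; exact: Sg_C.
  apply: Cr_kill=> w Rw; rewrite (tfM _ (elK Sak)); apply: Cr_tf; rewrite -rmorphXn mul_mpolyC.
  have mw := Rb_mcf rA fA (cof_mcf cg) g1 Rw; have [hw _] := Rw; apply: (@Sg_monn 1).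
  elim: (mcf_spn sA hw mw)=> [|d _ v Ad /monn_inv[_ [w' [/mapP[i _ ->] m0 ->]]] _ IH] //.
  rewrite scalerDr scalerA mulrC -scalerA; apply: spnD=> //; apply: smodZ=> //.
  by inversion m0; rewrite mulr1.
 move=> a; rewrite /= => /orP[/eqP->|/orP[/eqP->|/mapP[u ug ->]]].
 - by apply: sc; [exact: rlr_x rA|exact: cof_x cg].
 - by apply: sc; [exact: rlr_y rA|exact: cof_y cg].
 exists l; rewrite -elX; last exact: gS.
 have mX: monn g l (u ^+ l) by elim: l {wl} => [|q]; [exact: monn_one|rewrite exprS; exact: monn_mul].
 have Sul: spn A (monn g l) (u ^+ l) by [].
 by apply: Cr_kill=> w Rw; rewrite (tfM _ (elK (Sg_monn Sul))) mulrC; apply/Cr_tf/Sg_monn/wl.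
have AN a t: param J r.+3 (a :: t) -> forall b, B b -> Cr (a *: b).
 move=> pt b Bb; refine (@annihilated_of_buchsbaum R J V (tf 1) B [:: el x%:MP, el y%:MP & map el (forms M)] r.+3 sJ
  _ _ J1 _ _ B_sub B_noeth _ _ _ (HV_R rg) _ Cfin cst a t isT Bu pt b Bb).
 - by move=> j; exact: islocal_unit.
 - by move=> a'; case: (Jc a')=> [|[b']]; [left|right; exists b'].
 - by exists (el x%:MP :: el y%:MP :: map el g); exact: J_generated.
 - by move=> a'; rewrite pullE mulr1 -(rmorph0 fr)=> /fr_inj.
 - by apply/B_tf/Sg_Bg.
 - by rewrite /= size_map size_map size_enum_ord.
 - exact: (l_in_J rg).
 - move=> a' n Ja; case: (Jc a')=> // -[b' ba]; case: J1; rewrite -(expr1n _ n) -ba exprMn; exact: idM.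
have AL s b: param J r.+3 s -> b \in s -> forall v, B v -> Cr (b *: v).
 move=> [ss sJ' sR] bs; have pe := perm_to_rem bs; apply: (AN b (rem b s)); split; first by rewrite -(perm_size pe).
  by move=> b'; rewrite -(perm_mem pe); exact: sJ'.
 suff ->: [set` b :: rem b s] = [set` s] by [].
 by apply/seteqP; split=> b' /=; rewrite (perm_mem pe).
(* One system contains [x] and the other, with the roles of [x] and [y] exchanged, contains [y]; the
   form missing from the first is recovered as [(u_i - y) + y]. *)
have redxy := redn_xy rg; have [N [xN yN]] := redxy.
have [i pi] := system_of_parameters rA (fun=> iff_refl _) rg (ex_intro _ N yN).
have [|i' pi'] := system_of_parameters (rlr2_sym rA) _ rg (ex_intro _ N xN); first by move=> v; rewrite mi_swap.
have SU j: Sg (rform M j) by apply/Sg_monn/(redn_sub rg)/map_f.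
have [Sx Sy]: Sg x%:MP /\ Sg y%:MP by split; apply: Sg_C; [exact: rlr_x rA|exact: rlr_y rA].
have Bw w: Rb A g 1 w -> B (tf w) by move=> Rw; apply/B_tf/(Rb_Bg rA Rw).
have Cx w: Rb A g 1 w -> Cr (tf (x *: w)) by move=> Rw; rewrite -mul_mpolyC -(tfM _ (elK Sx)); apply: (AL _ _ pi (mem_head _ _)); exact: Bw.
have Cy w: Rb A g 1 w -> Cr (tf (y *: w)) by move=> Rw; rewrite -mul_mpolyC -(tfM _ (elK Sy)); apply: (AL _ _ pi' (mem_head _ _)); exact: Bw.
have CU j w: Rb A g 1 w -> Cr (tf (rform M j * w)).
 move=> Rw; case: (unliftP i j)=> [j' ->|->].
  rewrite -(tfM _ (elK (SU _))); apply: (AL _ _ pi _ _ (Bw _ Rw)); rewrite !inE; do 2!(apply/orP; right)=> //.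
 have Sd: Sg (rform M i - y%:MP) by exact: srB.
 have ->: tf (rform M i * w) = tf ((rform M i - y%:MP) * w) + tf (y *: w) by rewrite -mul_mpolyC -tofracD mulrBl subrK.
 apply: (smodD sC); last exact: Cy.
 by rewrite -(tfM _ (elK Sd)); apply: (AL _ _ pi _ _ (Bw _ Rw)).
split=> [a w [b [b' [Ab Ab' ->]]] Rw|v Rv].
 have [hw _] := Rw; rewrite scalerDl ![_ b]mulrC ![_ b']mulrC -!scalerA.
 by apply: spnD; apply: smodZ=> //; apply: Cr_homog; [exact: Cx|exact: rpredZ|exact: Cy|exact: rpredZ].
have := Rb_succ rA cg rg Rv; have FU u: u \in forms M -> exists j, u = rform M j by move=> /mapP[j]; exists j.
elim: forms FU v {Rv} => [|u U IH] FU v /=; first by move=> ->.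
move=> [b [v' [Rb' vU ->]]]; apply: spnD; first by apply: IH=> // u' uU; apply: FU; rewrite inE uU orbT.
have [j ->] := FU u (mem_head _ _); have [hb _] := Rb'.
by apply: Cr_homog; [exact: CU|exact: (dhomogM (rowform_homog M j))].
Qed.
End ReesLocal.

(** * The theorem *)

Section Goodness.
Variables (A : comNzRingType) (m : set A) (K : fieldType) (io : {rmorphism A -> K}) (x y : A).
Hypotheses (ioI : injective io) (mE : m = [set v | exists b c, v = x * b + y * c]) (im : is_ideal m) (nA : noetherian A).
Notation AK := (range io).
Hypotheses (rA : rlr2 AK (io x) (io y)) (infA : infres AK (io x) (io y)) (fA : fracs AK).
Variables (F : lmodType A) (r : nat) (b : 'I_r.+1 -> F).
Hypotheses (bgen : forall v, exists a, v = comb b a) (bind : forall a, comb b a = 0 -> a = 0).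
Implicit Types (X : set F) (s : seq F).
Let sA := rlr_sub rA.
Notation gens s := [seq lin io bgen v | v <- s].
Notation cof s := (cofinite AK (io x) (io y) (gens s)).

Definition good_module X := exists s, [/\ X = spn setT [set` s], cof s & goodm AK (io x) (io y) (gens s)].
Lemma max_ideal_const X s z : X = spn setT [set` s] ->
 rees_max_ideal m z <-> mi AK (io x) (io y) (rho io bgen (z : rees_ring X))@_0%MM.
move=> XE; rewrite (max_idealP ioI bgen bind XE) //; split=> [[a ma ->]|]; first exact/(mi_io ioI mE).
move=> [_ [_ [[c _ <-] [d _ <-] ->]]]; exists (x * c + y * d); last by rewrite rmorphD !rmorphM.
by rewrite mE; exists c, d.
Qed.
Lemma good_conclusion X : good_module X -> rees_buchsbaum X m /\ ratliff_rush X = module_integral_closure X.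
move=> [s [XE cg gg]]; split.
 refine (@buchsbaum_of_goodm r K AK (io x) (io y) (gens s) rA infA fA cg _ (rhom io bgen bind X) (rees_max_ideal m) (@rho_inj _ _ _ _ _ _ ioI bgen bind X) _ _ (fun z=> max_ideal_const z XE) gg).
  exact: rho_spn.
 exact: rho_onto.
apply/seteqP; split=> v.
 move=> /(ratliff_rushP ioI bgen bind XE)[l l0 H]; apply/(integral_closureP ioI bgen bind XE).
 split; first exact: lin_homog.
 exists (words (gens s) l); split.
  have [u ug u0] := cofinite_neq0 rA cg; exists (u ^+ l); last exact: expf_neq0.
  by apply/wordsP; elim: l {l0 H} => [|l]; [exact: monn_one|rewrite exprS; exact: monn_mul].
 move=> e /wordsP me; apply: spn_mono (H e (spn_gen (sr1 sA) me))=> // w /monn_inv[u [w' [ug mw' ->]]].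
 by exists u, w'; split=> //; [exact: mon_gen|apply/wordsP].
move=> /(integral_closureP ioI bgen bind XE) Rv; apply/(ratliff_rushP ioI bgen bind XE); exists 1%N=> // u gu.
have [_ g2] := gg; apply: g2; apply: (Rb_mul sA Rv).
exact: (monn_Rb rA (cof_homog cg)).
Qed.
Lemma good_of_buchsbaum X s : X = spn setT [set` s] -> cof s -> rees_buchsbaum X m ->
 ratliff_rush X = module_integral_closure X -> good_module X.
move=> XE cg Xb Xc; exists s; split=> //.
apply: (@goodm_of_buchsbaum r K AK (io x) (io y) (gens s) rA infA fA cg _ (rhom io bgen bind X) (rees_max_ideal m) (@rho_inj _ _ _ _ _ _ ioI bgen bind X) _ _ (fun z=> max_ideal_const z XE) Xb).
- exact: rho_spn.
- exact: rho_onto.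
move=> w Rw; have [hw _] := Rw; have mw := Rb_mcf rA fA (cof_mcf cg) (cof_homog cg) Rw.
have [v vE] := lin_onto bgen bind hw mw; rewrite vE in Rw *.
by move/(integral_closureP ioI bgen bind XE): Rw; rewrite -Xc=> /(ratliff_rushP ioI bgen bind XE).
Qed.
Lemma ideal_pow_ideal (I : set A) n : is_ideal (ideal_pow I n).
by case: n=> [|n]; [|exact: span_submod]. Qed.
Lemma io_spn (t : seq A) a : spn setT ([set` t] : set A^o) a -> spn AK ([set` map io t] : set K^o) (io a).
elim=> [|d w v _ wt _ IH]; first by rewrite rmorph0.
by rewrite rmorphD rmorphM; apply: spn_cons=> //; exact: map_f.
Qed.

(* The coefficient of T^n in an equation of integral dependence of b T over A[I T] is an equation for b over I. *)
Lemma closed_ideal (I : set A) (t : seq A) : I = spn setT ([set` t] : set A^o) -> integrally_closed_ideal I ->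
 forall c, int AK [seq a *: ('X_ord_max : {mpoly K[r.+2]}) | a <- map io t] (c *: 'X_ord_max) ->
 spn AK ([set` map io t] : set K^o) c.
move=> IE [iI clI] c ic; set T := 'X_ord_max in ic; set g' := [seq _ | _ <- _] in ic.
have hT: T \is 1.-homog by rewrite dhomogX /= mdeg1.
have g'1 u: u \in g' -> u \is 1.-homog by move=> /mapP[a _ ->]; exact: rpredZ.
have mT: mcf AK T by exact: mcfX.
have g'A u: u \in g' -> mcf AK u by move=> /mapP[_ /mapP[a _ ->] ->] k; rewrite mcoeffZ; apply: srM.
have [c0 _ c0E]: AK c.
 have := Rb_mcf rA fA g'A g'1 (conj (rpredZ _ hT) ic) U_(ord_max)%MM.
 by rewrite mcoeffZ mcoeffXU eqxx mulr1.
rewrite -c0E; apply: io_spn; rewrite -IE; apply: clI.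
have wI k w: monn g' k w -> exists2 a, ideal_pow I k a & w = io a *: T ^+ k.
 elim=> [|n _ w' /mapP[_ /mapP[a ta ->] ->] _ [d Id ->]]; first by exists 1; rewrite ?rmorph1 ?scale1r.
 exists (a * d); last by rewrite exprS rmorphM -scalerAr -scalerAl scalerA mulrC.
 rewrite /= /ideal_mul /smul spanE; apply: spn_gen=> //; exists a, d; split=> //.
 by rewrite IE.
(* A word of length [k] in the generators is an element of [I^k] times [T^k], so only words of
   length [i] reach the monomial [T^i]. *)
have cI i u: spn AK (mon g') u -> exists a, ideal_pow I i a /\ u@_(U_(ord_max) *+ i)%MM = io a.
 have iIi := ideal_pow_ideal I i.
 elim=> [|_ w v [e _ <-] [k /wI[a Ia ->]] _ [d [Id vE]]]; first by exists 0; rewrite mcoeff0 rmorph0; split=> //; exact: id0.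
 rewrite mcoeffD !mcoeffZ vE mpolyXn mcoeffX; have [kE|nk] := eqVneq%MM%MM.
  have ki: k = i by have := congr1 mdeg kE; rewrite !mdegMn mdeg1 !mul1n.
  by rewrite mulr1; exists (e * a + d); split; [apply: idD=> //; apply: idM=> //; rewrite -ki|rewrite rmorphD rmorphM].
 by rewrite !mulr0 add0r; exists d.
have [p [mp Rp rp]] := int_minteg sA ic.
have p1: (1 < size p)%N.
 rewrite ltnNge; apply/negP=> sp; have pC := size1_polyC sp; move: mp rp.
 by rewrite pC monicE lead_coefC=> /eqP ->; rewrite /root hornerC oner_eq0.
pose n := (size p).-1; have sn: size p = n.+1 by rewrite prednK // (ltn_trans _ p1).
pose H i := cid (cI i p`_(n - i) (Rp (n - i)%N)); exists n, (fun i=> projT1 (H i)); split; first by rewrite -ltnS -sn.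
 by move=> i; have [] := projT2 (H i).
apply: ioI; rewrite rmorph0 rmorphD rmorph_sum rmorphXn.
have E := congr1 (mcoeff (U_(ord_max) *+ n)%MM) (eqP rp); rewrite horner_coef sn mcoeff0 in E.
rewrite -[RHS]E {E}.
have pw j u: (j <= n)%N -> (u * (c *: T) ^+ j)@_(U_(ord_max) *+ n)%MM = u@_(U_(ord_max) *+ (n - j))%MM * c ^+ j.
 move=> jn; rewrite exprZn -scalerAr mcoeffZ mpolyXn mulrC; congr (_ * _).
 have ->: (U_(ord_max) *+ n = U_(ord_max) *+ j + U_(ord_max) *+ (n - j) :> 'X_{1..r.+2})%MM by apply/mnmP=> q; rewrite mnmDE !mulmnE -mulnDr subnKC.
 exact: mcoeffMX.
rewrite raddf_sum big_ord_recr /= pw // subnn mulm0n -c0E addrC; congr (_ + _).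
 transitivity ((1 : {mpoly K[r.+2]})@_0%MM * io c0 ^+ n); first by rewrite mcoeff1 eqxx mul1r.
 by congr (mcoeff _ _ * _); rewrite -(monicP mp).
(* Integral dependence over [I] indexes the terms by the exponent of [I], the polynomial [p] by the
   power of [c]; the order is reversed. *)
rewrite big_add1 big_mkord (reindex_inj rev_ord_inj) /=; apply: eq_bigr=> i _.
have [_ E] := projT2 (H (n - i.+1).+1); rewrite rmorphM rmorphXn -E c0E pw; last exact: ltnW.
by rewrite subnSK // subKn // ltnW.
Qed.
Lemma good_smul (I : set A) X : integrally_closed_ideal I -> primary_to m I -> good_module X -> good_module (smul I X).
move=> cI [_ rI] [s [XE cg gg]]; have [iI _] := cI; have [t IE] := nA iI; rewrite /ideal_gen spanE in IE.
have pw a: m a -> exists k, spn AK ([set` map io t] : set K^o) (io a ^+ k) by rewrite -rI=> -[k]; exists k; rewrite -rmorphXn; apply: io_spn; rewrite -IE.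
have ix: exists k, spn AK ([set` map io t] : set K^o) (io x ^+ k) by apply: pw; rewrite mE; exists 1, 0; ring.
have iy: exists k, spn AK ([set` map io t] : set K^o) (io y ^+ k) by apply: pw; rewrite mE; exists 0, 1; ring.
have tA a: a \in map io t -> AK a by move=> /mapP[c _ ->].
have E: prodI (gens s) (map io t) = gens [seq a *: v | a <- t, v <- s] by rewrite /prodI map_allpairs allpairs_mapl allpairs_mapr; apply: eq_allpairs=> a v; rewrite linZ.
exists [seq a *: v | a <- t, v <- s]; rewrite -E; split.
- apply/seteqP; rewrite /smul spanE; split; apply: spn_min=> //.
  move=> _ [a [v [Ia Xv ->]]]; rewrite IE in Ia; rewrite XE in Xv.
  elim: Ia=> [|d a' c _ a't _ IH]; first by rewrite scale0r.
  rewrite scalerDl; apply: spnD=> //; rewrite -scalerA; apply: smodZ=> //.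
  elim: Xv=> [|d' v' w _ vs _ IHv]; first by rewrite scaler0.
  rewrite scalerDr scalerA mulrC -scalerA; apply: spn_cons=> //; apply/allpairsP; by exists (a', v').
 move=> _ /allpairsP[[a v] /= [at_ vs ->]]; apply: spn_gen=> //; exists a, v; split=> //.
  by rewrite IE.
 by rewrite XE.
- exact: prodI_cofinite.
- by apply: good_product=> //; exact: (closed_ideal IE).
Qed.
End Goodness.
Lemma smul_mulA (A : comNzRingType) (F : lmodType A) (I J : set A) (X : set F) :
 smul (ideal_mul I J) X = smul I (smul J X).
rewrite /ideal_mul /smul !spanE; apply/seteqP; split; apply: spn_min=> //.
 move=> _ [z [v [Iz Xv ->]]]; elim: Iz=> [|d _ w _ [a [c [Ia Jc ->]]] _ IH]; first by rewrite scale0r.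
 rewrite scalerDl; apply: spnD=> //; rewrite -scalerA; apply: smodZ=> //.
 apply: spn_gen=> //; exists a, (c *: v); rewrite scalerA; split=> //.
 by apply: spn_gen=> //; exists c, v.
move=> _ [a [z [Ia Xz ->]]]; elim: Xz=> [|d _ w _ [c [v [Jc Xv ->]]] _ IH]; first by rewrite scaler0.
have E: a *: (d *: (c *: v)) = d *: ((a * c) *: v) by rewrite !scalerA; congr (_ *: _); ring.
rewrite scalerDr; apply: spnD=> //; rewrite E; apply: spn_mem=> //; exists (a * c), v; split=> //.
by apply: spn_gen=> //; exists a, c.
Qed.
Theorem corollary5p4 (A : comNzRingType) (m : set A) (M : lmodType A)
    (Areg : regular_local m 2)
    (Ainf : infinite_residue_field m)
    (Mne0 : exists x : M, x <> 0)
    (Mfg : finitely_generated [set: M])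
    (Mtf : torsion_free M)
    (MBbm : rees_buchsbaum (bidual_image M) m)
    (Mcl : ratliff_rush (bidual_image M) =
      module_integral_closure (bidual_image M)) :
  (forall I : set A, integrally_closed_ideal I -> primary_to m I ->
     rees_buchsbaum (smul I (bidual_image M)) m /\
     ratliff_rush (smul I (bidual_image M)) =
      module_integral_closure (smul I (bidual_image M))) /\
  (forall l : nat, rees_buchsbaum (smul (ideal_pow m l) (bidual_image M)) m).
Proof.
have [[nA lA _] _] := Areg; have lm := proj2 (islocal_local_ring nA m) lA; have [im m1 mu] := lm.
have [x [y [mE dA x0 xy]]] := regular_domain Areg; have [K [io [ioI frac]]] := fraction_field dA.
have rA := io_rlr2 ioI mE nA lm x0 xy; have infA := io_infres ioI mE lm Ainf.
have fA : fracs (range io).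
  move=> k; have [a [s [s0 E]]] := frac k; exists (io s); split; [by []| |by rewrite E].
  by rewrite -(rmorph0 io) inj_eq.
have prin := io_principal ioI mE nA lm x0 xy.
have [s0 s0E] := Mfg; rewrite spanE in s0E; have gs v : spn setT [set` s0] v by rewrite -s0E.
have [r [b [bgen bind]]] := bidual_free nA lm dA mE x0 xy prin gs Mtf Mne0.
pose X := bidual_image M; pose s1 := [seq bidual_map v | v <- s0].
have X1 : X = spn setT [set` s1].
  have bD u v : bidual_map (u + v) = bidual_map u + bidual_map v by apply: dual_eq => h; exact: dualD.
  have bZ a v : bidual_map (a *: v) = a *: bidual_map v by apply: dual_eq => h; exact: dualZ.
  have b0 : bidual_map (0 : M) = 0 by apply: dual_eq; exact: dual0.
  apply/seteqP; split=> [_ [v _ <-]|v].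
    by elim: (gs v) => [|d u w _ us _]; [rewrite b0|rewrite bD bZ; apply: spn_cons => //; exact: map_f].
  elim=> [|d _ w _ /mapP[u us ->] _ [w' _ <-]]; first by exists 0.
  by exists (d *: u + w') => //; rewrite bD bZ.
have cg : cofinite (range io) (io x) (io y) [seq lin io bgen v | v <- s1].
  have pw a : a = x \/ a = y -> exists k, forall i, spn (range io) (monn [seq lin io bgen v | v <- s1] 1) (io a ^+ k *: 'X_i).
    move=> axy; have [k kX] := bidual_power nA lm prin gs Mtf axy; exists k => i.
    by rewrite -(lin_b io bgen bind) -rmorphXn -linZ //; apply/(lin_X ioI bgen bind X1)/kX.
  split; [exact: g_mcf|exact: g_homog|by apply: pw; left|by apply: pw; right].
have gX : good_module io x y bgen X by exact: good_of_buchsbaum cg MBbm Mcl.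
have concl Y : good_module io x y bgen Y -> rees_buchsbaum Y m /\ ratliff_rush Y = module_integral_closure Y.
  exact: good_conclusion.
split=> [I cI pI|l]; first by apply: concl; exact: (good_smul ioI mE).
have mX n a : m (a ^+ n) -> m a.
  by move=> ma; case: (mu a) => // -[c ca]; case: m1; rewrite -(expr1n _ n) -ca exprMn; exact: idM.
have pm : primary_to m m.
  split; last by apply/seteqP; split=> [a [n /mX]//|]; exists 1%N.
  split=> // a c mac; case: (mu a) => [|[d da]]; first by left.
  by right; exists 1%N; rewrite -[c]mul1r -da -mulrA; exact: idM.
have cm : integrally_closed_ideal m.
  split=> // a [n [c [n0 cI E]]]; apply: (mX n); have -> : a ^+ n = - \sum_(1 <= i < n.+1) c i * a ^+ (n - i).
    by apply/eqP; rewrite -addr_eq0 E.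
  apply: idN => //; rewrite big_seq_cond; apply: big_ind => [|u v|i]; [exact: id0|exact: idD|].
  rewrite mem_index_iota andbT => i1; apply: idMr; have := cI i i1; case: i i1 => // i _.
  rewrite /= /ideal_mul /smul spanE; apply: spn_min; first exact/is_idealP.
  by move=> _ [d [e [md _ ->]]]; exact: idMr.
(* The condition is carried from [m^l M] to [m^(l + 1) M] by multiplication with [m], itself
   integrally closed; so no integral closedness of [m^l] has to be shown. *)
apply: (proj1 (concl _ _)); elim: l => [|l]; last by rewrite smul_mulA; exact: (good_smul ioI mE).
have -> : smul (ideal_pow m 0) X = X => //; rewrite X1 /smul spanE; have sT := @srT A; apply/seteqP; split.
  by apply: spn_min => [|_ [a [v [_ Xv ->]]]] //.
by move=> v Xv; apply: spn_gen => //; exists 1, v; rewrite scale1r.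
Qed.
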